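(* Let $\rho\in(0,1)$ and let $T_n=(\gamma(i-j))_{i,j=1}^n$ be a sequence of positive semi-definite Toeplitz matrices such that either (i) $\gamma(h)=\dfrac{L_1(|h|)}{(1+|h|)^\rho}$ for all $h\in\mathbb Z$, or (ii) $T_n$ has spectral density $\varphi(x)=\dfrac{L_2(|x|^{-1})}{|x|^{1-\rho}}$ on $[-\pi,\pi]$, where $L_1,L_2$ are positive, locally bounded functions on $[0,\infty)$ which are slowly varying at $\infty$. Let $S_N(T)=\frac1NC_N^{1/2}ZT_nZ^*C_N^{1/2}$, where $C_N$ is an $N\times N$ deterministic positive semi-definite Hermitian matrix and $Z=(Z_{i,j})$ is an $N\times n$ matrix with i.i.d. entries. Assume that $\mathbb E Z_{i,j}=0$, $\mathbb E|Z_{i,j}|^2=1$, $\mathbb E|Z_{i,j}|^4<\infty$, that the spectral norm of $C_N$ is bounded in $N$, and that the empirical spectral distribution $\mu^{C_N}$ converges weakly, as $N\to\infty$, to a probability measure $\nu_C\ne\delta_0$. Then for any fixed $j\ge1$, as $N,n\to\infty$ with $N/n\to r\in(0,\infty)$, $$\frac{\lambda_j(S_N(T))}{\lambda_j(T_n)}\longrightarrow\int x\,\mathrm d\nu_C(x)\quad\text{in probability.}$$ Moreover, if the $Z_{i,j}$ are standard real or complex Gaussian, then for any fixed $j\ge1$, as $N,n\to\infty$ with $N/n\to r\in(0,\infty)$, $$\frac{\lambda_j(S_N(T))}{\lambda_j(T_n)}\longrightarrow\int x\,\mathrm d\nu_C(x)\quad\text{almost surely.}$$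
   Context: $\lambda_1(A)\ge\lambda_2(A)\ge\cdots$ are the eigenvalues of a Hermitian matrix $A$; the empirical spectral distribution of an $N\times N$ Hermitian $A$ is $\mu^A=\frac1N\sum_{i=1}^N\delta_{\lambda_i(A)}$. $N=N(n)$ with $N/n\to r$; $C_N$ and $Z$ may depend on $N,n$, the common law of the entries of $Z$ not depending on $N,n$. A Toeplitz matrix $(\gamma(k-l))_{k,l=1}^n$ has spectral density $\varphi$ on $[-\pi,\pi]$ if $\gamma(h)=\int_{-\pi}^{\pi}\varphi(x)e^{-\mathbf ihx}\,\mathrm dx$ for $h\in\mathbb Z$ (a factor $1/(2\pi)$ may be included; it is irrelevant here). A positive function $L$ is slowly varying at $\infty$ if $L(ax)/L(x)\to1$ as $x\to\infty$ for every $a>0$. All matrices $Z$ are defined on one probability space for almost sure statements.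
   Formalization: The slowly varying functions L_1, L_2 are also assumed measurable on [0,∞), as in Karamata's definition; without measurability the claim in case (i) fails for pathological L_1. *)

(* Defs.v *)
From HB Require Import structures.
From mathcomp Require Import all_boot all_order all_algebra.
From mathcomp Require Import all_classical all_reals all_analysis.
From mathcomp Require Import complex.

Set Implicit Arguments.
Unset Strict Implicit.
Unset Printing Implicit Defensive.

Import Order.TTheory GRing.Theory Num.Theory.
Import numFieldNormedType.Exports.

Local Open Scope classical_set_scope.
Local Open Scope ring_scope.
Local Open Scope complex_scope.
Local Open Scope sesquilinear_scope.

(* The modulus is stated over the complex numbers in the library; this is its
   value as a real number. *)
Definition cabs (R : realType) (z : R[i]) : R := complex.Re `|z|.

Definition psdmx (R : realType) n (A : 'M[R[i]]_n) : Prop :=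
  A \is hermsymmx /\ forall v : 'cV[R[i]]_n, 0 <= (v ^t* *m A *m v) 0 0.

(* The eigenvalues of a Hermitian matrix, with multiplicity, in nonincreasing
   order. They are real, so only real parts are kept; see [char_poly_eigvals]. *)
Definition eigvals (R : realType) n (A : 'M[R[i]]_n) : seq R :=
  sort >=%R [seq complex.Re (spectral_diag A 0 i) | i : 'I_n].

(* [eigval j A] is lambda_j(A), numbered from j = 1 (and 0 when j > n). *)
Definition eigval (R : realType) (j : nat) n (A : 'M[R[i]]_n) : R :=
  nth 0 (eigvals A) j.-1.

(* The positive semi-definite square root of a positive semi-definite A, by
   applying the square root to the eigenvalues in a spectral decomposition;
   see [sqrtmx_psd] and [sqrtmxK]. *)
Definition sqrtmx (R : realType) n (A : 'M[R[i]]_n) : 'M[R[i]]_n :=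
  invmx (spectralmx A) *m diag_mx (map_mx sqrtC (spectral_diag A))
    *m spectralmx A.

Lemma spectral_decomp (R : realType) n (A : 'M[R[i]]_n) : A \is hermsymmx ->
  A = (spectralmx A) ^t* *m diag_mx (spectral_diag A) *m spectralmx A.
Proof.
move=> /hermitian_normalmx/orthomx_spectralP {1}->.
by rewrite invmx_unitary ?spectral_unitarymx.
Qed.

Lemma char_poly_eigvals (R : realType) n (A : 'M[R[i]]_n) : A \is hermsymmx ->
  char_poly A = \prod_(x <- eigvals A) ('X - (x%:C)%:P).
Proof.
move=> hA; rewrite (perm_big _ (permEl (perm_sort _ _))) /= big_image /=.
under eq_bigr => i _.
  rewrite RRe_real; last exact: (mxOverP (hermitian_spectral_diag_real hA)).
  over.
have := hermitian_normalmx hA => /orthomx_spectralP {1}->.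
have uP := spectral_unit A.
set Q := spectralmx A in uP *; set D := spectral_diag A.
have -> : char_poly (invmx Q *m diag_mx D *m Q) = char_poly (diag_mx D).
  rewrite /char_poly /char_poly_mx.
  have uPX : map_mx (@polyC _) Q \in unitmx.
    by rewrite map_unitmx.
  have -> : 'X%:M - map_mx (@polyC _) (invmx Q *m diag_mx D *m Q) =
     invmx (map_mx (@polyC _) Q) *m ('X%:M - map_mx (@polyC _) (diag_mx D))
       *m map_mx (@polyC _) Q.
    rewrite mulmxBr mulmxBl !map_mxM map_invmx; congr (_ - _).
    by rewrite mul_mx_scalar -scalemxAl mulVmx // scalemx1.
  rewrite !det_mulmx mulrAC -det_mulmx mulVmx // det1 mul1r //.
rewrite char_poly_trig ?diag_mx_is_trig //.
by apply: eq_bigr => i _; rewrite mxE eqxx mulr1n.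
Qed.

Lemma psdmx_spectral_diag_ge0 (R : realType) n (A : 'M[R[i]]_n) (i : 'I_n) :
  psdmx A -> 0 <= spectral_diag A 0 i.
Proof.
move=> [hA pA].
have uP := spectral_unitarymx A.
have := pA ((spectralmx A) ^t* *m delta_mx i 0).
rewrite {2}(spectral_decomp hA) trmx_mul map_mxM trmxCK.
have PP : spectralmx A *m (spectralmx A) ^t* = 1%:M by apply/unitarymxP.
rewrite !mulmxA -(mulmxA _ (spectralmx A) (_ ^t*)) PP mulmx1.
rewrite -(mulmxA _ (spectralmx A) (_ ^t*)) PP mulmx1.
rewrite trmx_delta map_delta_mx -rowE -colE !mxE.
by rewrite eqxx mulr1n.
Qed.

Lemma sqrtmxK (R : realType) n (A : 'M[R[i]]_n) : psdmx A ->
  sqrtmx A *m sqrtmx A = A.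
Proof.
move=> [hA _]; rewrite /sqrtmx; have uP := spectral_unit A.
rewrite !mulmxA mulmxK // -(mulmxA (invmx _)) mulmx_diag.
rewrite [RHS](orthomx_spectralP (hermitian_normalmx hA)).
congr (_ *m diag_mx _ *m _).
by apply/rowP => i; rewrite !mxE -expr2 sqrtCK.
Qed.

Lemma sqrtmx_psd (R : realType) n (A : 'M[R[i]]_n) : psdmx A ->
  psdmx (sqrtmx A).
Proof.
move=> pA; have [hA _] := pA; rewrite /sqrtmx invmx_unitary ?spectral_unitarymx //.
set Q := spectralmx A; set D := map_mx sqrtC _.
have D0 i : 0 <= D 0 i.
  by rewrite mxE sqrtC_ge0; apply: psdmx_spectral_diag_ge0.
split.
  apply/is_hermitianmxP; rewrite expr0 scale1r !trmx_mul !map_mxM trmxCK.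
  rewrite mulmxA; congr (_ *m _ *m _); apply/matrixP => i j; rewrite !mxE.
  have [->|ij] := eqVneq i j; last by rewrite !mulr0n rmorph0.
  by rewrite !mulr1n; have := D0 j; rewrite mxE => /ger0_real/CrealP/esym.
move=> v; have -> : v ^t* *m (Q ^t* *m diag_mx D *m Q) *m v =
    (Q *m v) ^t* *m diag_mx D *m (Q *m v).
  by rewrite trmx_mul map_mxM !mulmxA.
rewrite mxE sumr_ge0 // => i _; rewrite mul_mx_diag !mxE.
have := D0 i; rewrite mxE => Di.
rewrite mulrAC mulr_ge0 // mulrC; exact: mul_conjC_ge0.
Qed.

Definition l2norm (R : realType) n (v : 'cV[R[i]]_n) : R :=
  Num.sqrt (\sum_i cabs (v i 0) ^+ 2).

Definition spectral_norm (R : realType) m n (A : 'M[R[i]]_(m, n)) : R :=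
  sup [set l2norm (A *m v) | v in [set v | l2norm v <= 1]].

(* The empirical spectral distribution, n^-1 \sum_(1 <= i <= n) \d_(lambda_i). *)
Definition esd (R : realType) n (A : 'M[R[i]]_n) :
    {measure set (measurableTypeR R) -> \bar R} :=
  mscale ((n%:R : R)^-1)%:nng
    (msum (fun i => dirac (eigval i.+1 A : measurableTypeR R)) n).

Definition weak_cvg (R : realType)
    (mu : nat -> {measure set (measurableTypeR R) -> \bar R})
    (nu : {measure set (measurableTypeR R) -> \bar R}) : Prop :=
  forall f : R -> R, continuous f -> (exists M, forall x, `|f x| <= M) ->
    (\int[mu n]_x (f x)%:E)%E @[n --> \oo] --> (\int[nu]_x (f x)%:E)%E.

Definition toeplitz (R : realType) (gamma : int -> R[i]) (n : nat) :
    'M[R[i]]_n :=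
  \matrix_(i < n, j < n) gamma (i%:Z - j%:Z).

Definition cintegral (R : realType) (D : set R) (f : R -> R[i]) : R[i] :=
  (\int[lebesgue_measure]_(x in D) complex.Re (f x))
    +i* (\int[lebesgue_measure]_(x in D) complex.Im (f x)).

Definition expi (R : realType) (t : R) : R[i] := cos t +i* sin t.

(* Integrability of phi is what makes the Fourier integrals meaningful (the
   library integral is total). *)
Definition has_spectral_density (R : realType) (gamma : int -> R[i])
    (phi : R -> R) : Prop :=
  lebesgue_measure.-integrable `[- pi, pi] (EFin \o phi) /\
  forall h : int, gamma h =
    cintegral `[- pi, pi] (fun x => (phi x)%:C * expi (- (h%:~R * x))).

(* Functions on [0, oo[ are total functions whose values on the negative
   half-line are irrelevant. Measurability is part of Karamata's notion of a
   slowly varying function: the uniform convergence theorem needs it. *)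
Definition slowly_varying (R : realType) (L : R -> R) : Prop :=
  [/\ measurable_fun (`[0, +oo[%classic : set R) L,
      forall x, 0 <= x -> 0 < L x
    & forall a, 0 < a -> L (a * x) / L x @[x --> +oo] --> (1 : R)].

Definition locally_bounded (R : realType) (L : R -> R) : Prop :=
  forall x : R, 0 <= x -> bounded_near (L : R -> R^o) (within `[0, +oo[ (nbhs x)).

Definition long_memory_autocov (R : realType) (rho : R) (gamma : int -> R[i])
    (L : R -> R) : Prop :=
  forall h : int,
    gamma h = (L `|h%:~R| / (1 + `|h%:~R|) `^ rho)%:C.

Definition long_memory_density (R : realType) (rho : R) (L : R -> R) : R -> R :=
  fun x => L (`|x|^-1) / `|x| `^ (1 - rho).

(* A complex random variable is handled through the real random vector formed by
   its real and imaginary parts. *)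
Definition reim (R : realType) (T : Type) (X : T -> R[i]) : T -> R * R :=
  fun w => (complex.Re (X w), complex.Im (X w)).

Section probability.
Context (R : realType) (d : measure_display) (T : measurableType d).
Context (P : probability T R).

Definition complex_rv (X : T -> R[i]) : Prop := measurable_fun setT (reim X).

Definition law (X : T -> R[i]) : set (R * R) -> \bar R :=
  pushforward P (reim X).

Definition same_law (X Y : T -> R[i]) : Prop :=
  forall A : set (R * R), measurable A -> law X A = law Y A.

Definition mutually_independent (I : finType) (X : I -> T -> R[i]) : Prop :=
  forall (J : {set I}) (A : I -> set (R * R)),
    (forall i, measurable (A i)) ->
    P (\bigcap_(i in [set` J]) (reim (X i) @^-1` A i)) =
    (\prod_(i in J) P (reim (X i) @^-1` A i))%E.

Definition cexp_eq0 (X : T -> R[i]) : Prop :=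
  ('E_P[fun w => complex.Re (X w)] = 0 /\ 'E_P[fun w => complex.Im (X w)] = 0)%E.

(* E|X|^k *)
Definition abs_moment (k : nat) (X : T -> R[i]) : \bar R :=
  ('E_P[fun w => (cabs (X w) ^+ k)%R])%E.

Definition std_real_gaussian (X : T -> R[i]) : Prop :=
  forall A : set (R * R), measurable A ->
    law X A = (normal_prob (0 : R) 1 \x (\d_(0%R : measurableTypeR R)))%E A.

(* Independent real and imaginary parts, each of variance 1/2. *)
Definition std_complex_gaussian (X : T -> R[i]) : Prop :=
  forall A : set (R * R), measurable A ->
    law X A = (normal_prob (0 : R) (Num.sqrt 2^-1)
               \x normal_prob (0 : R) (Num.sqrt 2^-1))%E A.

Definition cvg_in_prob (X : nat -> T -> R) (c : R) : Prop :=
  forall e : R, 0 < e -> P [set w | e <= `|X n w - c|] @[n --> \oo] --> 0%E.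

Definition cvg_as (X : nat -> T -> R) (c : R) : Prop :=
  {ae P, forall w, X n w @[n --> \oo] --> c}.

End probability.

Definition sample_cov (R : realType) N n (C : 'M[R[i]]_N)
    (Z : 'M[R[i]]_(N, n)) (T : 'M[R[i]]_n) : 'M[R[i]]_N :=
  N%:R^-1 *: (sqrtmx C *m Z *m T *m Z ^t* *m sqrtmx C).

(* Main.v *)
Require Import Defs.
From HB Require Import structures.
From mathcomp Require Import all_boot all_order all_algebra fingroup perm.
From mathcomp Require Import all_classical all_reals all_analysis.
From mathcomp Require Import measurable_realfun complex.
From mathcomp Require Import ring lra zify.

(** The sample covariance matrix is [B T B^*] with [B = C^(1/2) Z / sqrt N], where [T] is the
    Toeplitz matrix, and [c], the mean of the limit law of the spectrum of [C], is the limit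
    of [\tr C / N]. Long memory makes the spectrum of [T] spiked ([spiked]): on some scale
    [s n], growing at least like a power of [n], each fixed eigenvalue is bounded below, and
    the [K]-th one is arbitrarily small once [K] is large. So only finitely many eigenvectors
    of [T] matter, and on them [B^* B] is close to [c] times the identity by a law of large
    numbers. By the variational principle the [j]-th eigenvalue of [B T B^*] is then about [c]
    times that of [T].

    The spikes. For a regularly varying autocovariance ([spiked_long_memory_autocov]),
    indicators of well separated blocks give the lower bounds, and the upper bounds come from
    splitting the matrix into a band of small norm and a part of bounded Hilbert-Schmidt
    norm. For a singular density ([spiked_long_memory_density]) the same is done on the
    Fourier side: the test vectors are tents, whose trigonometric polynomials concentrate
    near the origin, and the density is split at a multiple of [1 / n]. Both rest on Potter's
    bounds ([potter]), which follow from the uniform convergence theorem of Karamata.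

    The finite part ([gram_off_rare]). The entries of [B^* B] on finitely many orthonormal
    vectors are quadratic forms in independent entries. Revealing the entries one at a time
    gives orthogonal increments, so the moment of order [2 p] of such a form is bounded
    ([quadratic_form_moment]), for [p = 1] by four moments of the entries and for [p = 2] by
    eight.

    The remainder ([tail_off_rare]). Let [T'] be [T] without its first [K] eigenvectors; it has
    norm at most [beta * s n]. The rows of [Z], mapped by the square root of [T'], are
    truncated at a squared norm [N l] with [l] a little below [s n], and the trace of a high
    power of the sum of their rank one matrices is estimated one factor at a time
    ([trace_pow_tail]): removing from the other factors the vector that the current factor
    has singled out costs [l] ([rank1_pow_le]), after which independence applies. A number of
    factors of order [ln n] bounds [Z T' Z^* / N] by [4 * beta * s n].

    Every failure probability is at most a negative power of [n], and for [p = 2] a summable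
    one ([ratio_off_rare]). This gives convergence in probability under four moments, and
    almost sure convergence, by the Borel-Cantelli lemma, for Gaussian entries. *)

Set Implicit Arguments.
Unset Strict Implicit.
Unset Printing Implicit Defensive.

Import Order.TTheory GRing.Theory Num.Theory.
Import numFieldNormedType.Exports.

Local Open Scope classical_set_scope.
Local Open Scope ring_scope.
Local Open Scope complex_scope.
Local Open Scope sesquilinear_scope.

(** * Quadratic forms and the spectral theorem *)

Section Quadratic.
Variable C : numClosedFieldType.
Implicit Types m n p : nat.

Lemma adjmxM m n p (A : 'M[C]_(m, n)) (B : 'M[C]_(n, p)) :
  (A *m B) ^t* = B ^t* *m A ^t*.
Proof. by rewrite trmx_mul map_mxM. Qed.

Lemma adjmxE m n (A : 'M[C]_(m, n)) i j : (A ^t*) i j = (A j i)^*%R.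
Proof. by rewrite !mxE. Qed.

Lemma adjmxD m n (A B : 'M[C]_(m, n)) : (A + B) ^t* = A ^t* + B ^t*.
Proof. by apply/matrixP => i j; rewrite !mxE rmorphD. Qed.

Lemma adjmxZ m n a (A : 'M[C]_(m, n)) : (a *: A) ^t* = a^*%R *: A ^t*.
Proof. by apply/matrixP => i j; rewrite !mxE rmorphM. Qed.

Lemma adjmx_hermP n (A : 'M[C]_n) : reflect (A ^t* = A) (A \is hermsymmx).
Proof.
apply: (iffP idP) => [/is_hermitianmxP|hA].
  by rewrite expr0 scale1r => /esym.
by apply/is_hermitianmxP; rewrite expr0 scale1r hA.
Qed.

Definition sqn n (v : 'cV[C]_n) : C := (v ^t* *m v) 0 0.

Definition qform n (A : 'M[C]_n) (v : 'cV[C]_n) : C := (v ^t* *m A *m v) 0 0.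

Lemma sqnE n (v : 'cV[C]_n) : sqn v = \sum_i `|v i 0| ^+ 2.
Proof. by rewrite /sqn mxE; apply: eq_bigr => i _; rewrite !mxE normCKC. Qed.

Lemma sqn_ge0 n (v : 'cV[C]_n) : 0 <= sqn v.
Proof. by rewrite sqnE sumr_ge0 // => i _; rewrite exprn_ge0. Qed.

Lemma sqn_eq0 n (v : 'cV[C]_n) : (sqn v == 0) = (v == 0).
Proof.
apply/eqP/eqP => [|->]; last by rewrite /sqn mulmx0 mxE.
rewrite sqnE => /eqP; rewrite psumr_eq0 => [|i _]; last by rewrite exprn_ge0.
move=> /allP h; apply/matrixP => i j; rewrite ord1 mxE.
by have := h i (mem_index_enum _); rewrite sqrf_eq0 normr_eq0 => /eqP.
Qed.

Lemma sqn_gt0 n (v : 'cV[C]_n) : (0 < sqn v) = (v != 0).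
Proof. by rewrite lt_def sqn_ge0 andbT sqn_eq0. Qed.

Lemma sqnZ n a (v : 'cV[C]_n) : sqn (a *: v) = `|a| ^+ 2 * sqn v.
Proof.
by rewrite !sqnE mulr_sumr; apply: eq_bigr => i _; rewrite mxE normrM exprMn.
Qed.

Lemma qformM n p (A : 'M[C]_n) (B : 'M[C]_(n, p)) (v : 'cV[C]_p) :
  qform A (B *m v) = qform (B ^t* *m A *m B) v.
Proof. by rewrite /qform adjmxM !mulmxA. Qed.

Lemma qform1 n (v : 'cV[C]_n) : qform 1%:M v = sqn v.
Proof. by rewrite /qform mulmx1. Qed.

Lemma sqnM n p (B : 'M[C]_(n, p)) (v : 'cV[C]_p) :
  sqn (B *m v) = qform (B ^t* *m B) v.
Proof. by rewrite -qform1 qformM mulmx1. Qed.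

Lemma qformD n (A B : 'M[C]_n) v : qform (A + B) v = qform A v + qform B v.
Proof. by rewrite /qform mulmxDr mulmxDl mxE. Qed.

Lemma qformZ n a (A : 'M[C]_n) v : qform (a *: A) v = a * qform A v.
Proof. by rewrite /qform -scalemxAr -scalemxAl mxE. Qed.

Lemma qform_diag n (d : 'rV[C]_n) (v : 'cV[C]_n) :
  qform (diag_mx d) v = \sum_i d 0 i * `|v i 0| ^+ 2.
Proof.
rewrite /qform mxE; apply: eq_bigr => i _; rewrite mul_mx_diag !mxE normCKC.
by rewrite mulrAC mulrC.
Qed.

Lemma sqn_unitary n (U : 'M[C]_n) v : U \is unitarymx -> sqn (U *m v) = sqn v.
Proof.
move=> hU; have hU' : U ^t* *m U = 1%:M.
  by rewrite -trmxC_unitary in hU; move/unitarymxP: hU; rewrite trmxCK.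
by rewrite sqnM hU' qform1.
Qed.

Lemma qform_real n (A : 'M[C]_n) v : A \is hermsymmx -> qform A v \is Num.real.
Proof.
move=> /adjmx_hermP hA; apply/CrealP; rewrite /qform.
have <- : ((v ^t* *m A *m v) ^t*) 0 0 = ((v ^t* *m A *m v) 0 0)^*%R.
  by rewrite adjmxE.
by rewrite !adjmxM trmxCK hA mulmxA.
Qed.

(** Dimension counting, for the subspaces met in variational principles. *)
Lemma exists_kernel m p (A : 'M[C]_(m, p)) : (m < p)%N ->
  exists2 a : 'cV[C]_p, a != 0 & A *m a = 0.
Proof.
move=> mp; have : kermx A^T != 0.
  rewrite -mxrank_eq0 mxrank_ker -lt0n subn_gt0.
  by rewrite mxrank_tr (leq_ltn_trans (rank_leq_row A)).
move=> /rowV0Pn [v /sub_kermxP vA v0]; exists v^T.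
  by apply: contraNneq v0 => /(congr1 trmx); rewrite trmxK trmx0 => ->.
by apply: trmx_inj; rewrite trmx_mul trmxK vA trmx0.
Qed.

Lemma qform_spectral n (A U : 'M[C]_n) d v :
  A = U ^t* *m diag_mx d *m U ->
  qform A v = \sum_i d 0 i * `|(U *m v) i 0| ^+ 2.
Proof. by move=> ->; rewrite -qformM qform_diag. Qed.

Lemma unitary_adjK n (U : 'M[C]_n) : U \is unitarymx -> U ^t* *m U = 1%:M.
Proof. by rewrite -trmxC_unitary => /unitarymxP; rewrite trmxCK. Qed.

Lemma spectral_pow n (U : 'M[C]_n) d m : U \is unitarymx ->
  (U ^t* *m diag_mx d *m U) ^+ m = U ^t* *m diag_mx (map_mx (fun z => z ^+ m) d) *m U.
Proof.
move=> hU; elim: m => [|m IH].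
  rewrite expr0; have -> : diag_mx (map_mx (fun z : C => z ^+ 0) d) = 1%:M.
    by apply/matrixP => i j; rewrite !mxE expr0.
  by rewrite mulmx1 unitary_adjK.
rewrite exprS IH -mulmxE !mulmxA -(mulmxA _ U); have /unitarymxP -> := hU.
rewrite mulmx1 -(mulmxA (U ^t*) (diag_mx d)) mulmx_diag.
by congr (_ *m diag_mx _ *m _); apply/rowP => i; rewrite !mxE exprS.
Qed.

Lemma spectral_shift n (U : 'M[C]_n) d s : U \is unitarymx ->
  U ^t* *m diag_mx d *m U + s%:M = U ^t* *m diag_mx (d + const_mx s) *m U.
Proof.
move=> hU; rewrite linearD /= mulmxDr mulmxDl; congr (_ + _).
have -> : diag_mx (const_mx s) = s%:M :> 'M[C]_n by rewrite diag_const_mx.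
by rewrite mul_mx_scalar -scalemxAl unitary_adjK // scalemx1.
Qed.

(** Chebyshev's association inequality for similarly ordered functions. *)
Lemma chebyshev_sum (K : numDomainType) (I : finType) (w f g : I -> K) :
  (forall i, 0 <= w i) -> (forall i j, 0 <= (f i - f j) * (g i - g j)) ->
  (\sum_i w i * f i) * (\sum_i w i * g i)
    <= (\sum_i w i) * (\sum_i w i * (f i * g i)).
Proof.
move=> w0 fg; rewrite -subr_ge0 -(@pmulrn_lge0 _ _ 2) //.
suff -> : ((\sum_i w i) * (\sum_i w i * (f i * g i)) -
   (\sum_i w i * f i) * (\sum_i w i * g i)) *+ 2 =
   \sum_i \sum_j w i * w j * ((f i - f j) * (g i - g j)).
  by apply: sumr_ge0 => i _; apply: sumr_ge0 => j _; rewrite mulr_ge0 // mulr_ge0.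
rewrite mulr2n {2}[(\sum_i w i) * _]mulrC {2}[(\sum_i w i * f i) * _]mulrC.
rewrite !mulr_suml -!sumrB -big_split /=; apply: eq_bigr => i _.
rewrite !mulr_sumr -!sumrB -big_split /=; apply: eq_bigr => j _.
by rewrite !mulrBl !mulrBr; ring.
Qed.

(** With [y] the coordinates of [x] in an eigenbasis of [A], all the quantities
    are sums of nondecreasing functions of the eigenvalues of [A] against the
    weights [|y_i|^2]; splitting off one factor [A + x x^*] at a time, the
    association inequality bounds the contribution of [x x^*] by that of [l]. *)
Lemma rank1_pow_le_spectral n (A U : 'M[C]_n) d (x : 'cV[C]_n) (l : C) m :
  U \is unitarymx -> A = U ^t* *m diag_mx d *m U -> (forall i, 0 <= d 0 i) ->
  sqn x <= l -> qform ((A + x *m x ^t*) ^+ m) x <= qform ((A + l%:M) ^+ m) x.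
Proof.
move=> hU AU d0 xl; have l0 : 0 <= l := le_trans (sqn_ge0 x) xl.
pose w i := `|(U *m x) i 0| ^+ 2.
have w0 i : 0 <= w i by rewrite exprn_ge0.
have AkE k : qform (A ^+ k) x = \sum_i w i * d 0 i ^+ k.
  rewrite {1}AU spectral_pow // (qform_spectral _ erefl).
  by apply: eq_bigr => i _; rewrite [map_mx _ _ _ _]mxE mulrC.
have A'E p : (A + l%:M) ^+ p =
    U ^t* *m diag_mx (map_mx (fun z => z ^+ p) (d + const_mx l)) *m U.
  by rewrite {1}AU spectral_shift // spectral_pow.
have A'kE k p : qform (A ^+ k * (A + l%:M) ^+ p) x =
    \sum_i w i * (d 0 i ^+ k * (d 0 i + l) ^+ p).
  rewrite A'E {1}AU spectral_pow // -mulmxE !mulmxA -(mulmxA _ U).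
  have /unitarymxP -> := hU; rewrite mulmx1 -(mulmxA (U ^t*) (diag_mx _)) mulmx_diag.
  rewrite (qform_spectral _ erefl); apply: eq_bigr => i _; rewrite mulrC.
  by congr (_ * _); rewrite !mxE.
suff H k : qform (A ^+ k * (A + x *m x ^t*) ^+ m) x <= qform (A ^+ k * (A + l%:M) ^+ m) x.
  by have := H 0%N; rewrite !expr0 !mul1r.
elim: m k => [|m IH] k; first by rewrite !expr0.
have -> : A ^+ k * (A + x *m x ^t*) ^+ m.+1 =
    A ^+ k.+1 * (A + x *m x ^t*) ^+ m + A ^+ k * (x *m x ^t*) * (A + x *m x ^t*) ^+ m.
  by rewrite [in LHS]exprS !mulrA [A ^+ k * _]mulrDr mulrDl -exprSr.
have -> : A ^+ k * (A + l%:M) ^+ m.+1 =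
    A ^+ k.+1 * (A + l%:M) ^+ m + l *: (A ^+ k * (A + l%:M) ^+ m).
  rewrite [in LHS]exprS !mulrA [A ^+ k * _]mulrDr mulrDl -exprSr; congr (_ + _).
  by rewrite -!mulmxE mul_mx_scalar -scalemxAl.
rewrite !qformD qformZ; apply: lerD => //.
have -> : qform (A ^+ k * (x *m x ^t*) * (A + x *m x ^t*) ^+ m) x =
    qform (A ^+ k) x * qform ((A + x *m x ^t*) ^+ m) x.
  rewrite /qform; set P := A ^+ k; set Q := _ ^+ m.
  have -> : x ^t* *m (P * (x *m x ^t*) * Q) *m x = (x ^t* *m P *m x) *m (x ^t* *m Q *m x).
    by rewrite -!mulmxE !mulmxA.
  by rewrite [LHS]mxE big_ord1.
have IH0 := IH 0%N; rewrite !expr0 !mul1r in IH0.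
apply: le_trans (ler_wpM2l _ IH0) _.
  by rewrite AkE sumr_ge0 // => i _; rewrite mulr_ge0 // exprn_ge0.
have A'1 : qform ((A + l%:M) ^+ m) x = \sum_i w i * (d 0 i + l) ^+ m.
  by have := A'kE 0%N m; rewrite expr0 mul1r => ->; under eq_bigr do rewrite expr0 mul1r.
rewrite A'1 AkE A'kE; apply: le_trans (chebyshev_sum w0 _) _.
  move=> i j.
  wlog ij : i j / d 0 j <= d 0 i => [hw|].
    have := real_leVge (ger0_real (d0 j)) (ger0_real (d0 i)).
    move=> /orP[/hw//|/hw]; rewrite -[X in _ -> 0 <= X * _]opprB.
    by rewrite -[X in _ -> 0 <= _ * X]opprB mulrNN.
  apply: mulr_ge0; rewrite subr_ge0; apply: lerXn2r;
    by rewrite ?nnegrE ?d0 ?addr_ge0 ?d0 ?lerD2r.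
apply: ler_wpM2r; last by rewrite -(sqn_unitary x hU) sqnE in xl.
by rewrite sumr_ge0 // => i _; rewrite !mulr_ge0 ?exprn_ge0 ?addr_ge0 ?d0.
Qed.

(** Expanding the square of [s x - M M^* x]. Lets [W^* W] and [W W^*] be bounded together. *)
Lemma adj_bound m n (M : 'M[C]_(m, n)) (s : C) : 0 < s ->
  (forall y, sqn (M *m y) <= s * sqn y) ->
  forall x, sqn (M ^t* *m x) <= s * sqn x.
Proof.
move=> s0 hM x; set y := M ^t* *m x.
have yE : (x ^t* *m (M *m y)) 0 0 = sqn y.
  by rewrite /sqn mulmxA /y adjmxM trmxCK.
have yE' : ((M *m y) ^t* *m x) 0 0 = sqn y by rewrite /sqn adjmxM -mulmxA.
have : 0 <= sqn (s *: x - M *m y) by apply: sqn_ge0.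
have -> : sqn (s *: x - M *m y) = s ^+ 2 * sqn x - s *+ 2 * sqn y + sqn (M *m y).
  have -> : (s *: x - M *m y) = s *: x + (-1) *: (M *m y) by rewrite scaleN1r.
  rewrite {1}/sqn adjmxD !adjmxZ mulmxDl !mulmxDr -!scalemxAl -!scalemxAr.
  have aE (A B : 'M[C]_1) : (A + B) 0 0 = A 0 0 + B 0 0 by rewrite mxE.
  have zE a (A : 'M[C]_1) : (a *: A) 0 0 = a * A 0 0 by rewrite mxE.
  rewrite !aE !zE yE yE' -/(sqn x) -/(sqn (M *m y)).
  by rewrite rmorphN1 (CrealP (gtr0_real s0)); ring.
move=> h; have := le_trans h (lerD (lexx _) (hM y)).
have -> : s ^+ 2 * sqn x - s *+ 2 * sqn y + s * sqn y = s * (s * sqn x - sqn y).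
  by ring.
by rewrite pmulr_rge0 // subr_ge0.
Qed.

End Quadratic.

Section SortedSpectrum.
Variable R : realType.
Local Notation C := R[i].

Lemma size_eigvals n (A : 'M[C]_n) : size (eigvals A) = n.
Proof. by rewrite size_sort size_map size_enum_ord. Qed.

Lemma eigval_oversize j n (A : 'M[C]_n) : (0 < j)%N -> (n < j)%N ->
  eigval j A = 0.
Proof.
by move=> j0 nj; rewrite /eigval nth_default // size_eigvals -ltnS prednK.
Qed.

Lemma eigval_noninc n (A : 'M[C]_n) i j : (i <= j < n)%N ->
  eigval j.+1 A <= eigval i.+1 A.
Proof.
move=> /andP[ij jn]; rewrite /eigval /=.
have st : sorted >=%R (eigvals A).
  by apply: sort_sorted => x y; exact: le_total.
by apply: (sorted_leq_nth ge_trans ge_refl 0 st) => //;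
  rewrite inE size_eigvals // (leq_ltn_trans ij).
Qed.

(** The spectral theorem with the eigenvalues listed in decreasing order, so that
    the [k]-th row of the unitary factor is attached to [eigval k.+1 A]. *)
Lemma sorted_spectral n (A : 'M[C]_n) : A \is hermsymmx ->
  exists2 U : 'M[C]_n, U \is unitarymx &
  A = U ^t* *m diag_mx (\row_k (eigval k.+1 A)%:C) *m U.
Proof.
move=> hA; pose t := [tuple complex.Re (spectral_diag A 0 i) | i < n].
have /tuple_permP[s es] : perm_eq (eigvals A) t.
  by rewrite perm_sort.
exists (row_perm s (spectralmx A)).
  apply/unitarymxP; rewrite row_permE adjmxM mulmxA -(mulmxA _ (spectralmx A)).
  have /unitarymxP -> := spectral_unitarymx A; rewrite mulmx1.
  rewrite tr_perm_mx map_perm_mx -perm_mxM.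
  by rewrite mulgV perm_mx1.
have dE k : (\row_k (eigval k.+1 A)%:C) 0 k = spectral_diag A 0 (s k).
  rewrite mxE /eigval es /= (nth_map k) ?size_enum_ord // nth_ord_enum.
  rewrite tnth_mktuple RRe_real //.
  exact: (mxOverP (hermitian_spectral_diag_real hA)).
rewrite {1}(spectral_decomp hA); apply/matrixP => i j; rewrite !mxE.
rewrite [RHS](reindex_inj (@perm_inj _ s^-1%g)) /=; apply: eq_bigr => k _.
by rewrite !mul_mx_diag mxE [in RHS]mxE dE !mxE permKV.
Qed.

End SortedSpectrum.

(** * Courant-Fischer principles and traces of powers *)

Section CourantFischer.
Variable R : realType.
Local Notation C := R[i].

Lemma qform_le_eigval n (A U : 'M[C]_n) p (x : 'cV[C]_n) : (p < n)%N ->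
  U \is unitarymx -> A = U ^t* *m diag_mx (\row_k (eigval k.+1 A)%:C) *m U ->
  (forall i : 'I_n, (i < p)%N -> (U *m x) i 0 = 0) ->
  qform A x <= (eigval p.+1 A)%:C * sqn x.
Proof.
move=> pn hU hA h0; rewrite (qform_spectral _ hA) -(sqn_unitary x hU) sqnE.
rewrite mulr_sumr ler_sum // => i _; rewrite [(\row__ _) 0 i]mxE.
have [ip|pi] := ltnP i p; first by rewrite h0 // normr0 expr0n !mulr0.
by rewrite ler_wpM2r ?exprn_ge0 // lecR eigval_noninc // pi ltn_ord.
Qed.

Lemma qform_ge_eigval n (A U : 'M[C]_n) p (x : 'cV[C]_n) : (p < n)%N ->
  U \is unitarymx -> A = U ^t* *m diag_mx (\row_k (eigval k.+1 A)%:C) *m U ->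
  (forall i : 'I_n, (p < i)%N -> (U *m x) i 0 = 0) ->
  (eigval p.+1 A)%:C * sqn x <= qform A x.
Proof.
move=> pn hU hA h0; rewrite (qform_spectral _ hA) -(sqn_unitary x hU) sqnE.
rewrite mulr_sumr ler_sum // => i _; rewrite [(\row__ _) 0 i]mxE.
have [ip|pi] := ltnP p i; first by rewrite h0 // normr0 expr0n !mulr0.
by rewrite ler_wpM2r ?exprn_ge0 // lecR eigval_noninc // pi pn.
Qed.

(** The subspace spanned by the columns of [V] has dimension [p + 1], so it meets
    the orthogonal of the first [p] eigenvectors. *)
Lemma eigval_ge_subspace n p (A : 'M[C]_n) (V : 'M[C]_(n, p.+1)) (t : R) :
  A \is hermsymmx -> (forall a : 'cV_p.+1, a != 0 -> V *m a != 0) ->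
  (forall a : 'cV_p.+1, t%:C * sqn (V *m a) <= qform A (V *m a)) -> t <= eigval p.+1 A.
Proof.
move=> hA Vinj hV; have [U hU AU] := sorted_spectral hA.
have pn : (p < n)%N.
  rewrite ltnNge; apply/negP => np.
  have [a a0 Va] := exists_kernel V np.
  by have := Vinj _ a0; rewrite Va eqxx.
have [a a0 Ma] := exists_kernel (rowsub (widen_ord (ltnW pn)) (U *m V)) (ltnSn p).
have := le_trans (hV a) (qform_le_eigval pn hU AU _).
rewrite ler_pM2r ?sqn_gt0 ?Vinj // lecR; apply => i ip.
have := congr1 (fun M : 'cV_p => M (Ordinal ip) 0) Ma.
rewrite mul_rowsub_mx mxE [RHS]mxE mulmxA => <-; congr ((_ *m _) _ _).
exact: val_inj.
Qed.

Lemma eigval_le_codim n p (A : 'M[C]_n) (W : 'M[C]_(p, n)) (t : R) :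
  A \is hermsymmx -> (p < n)%N ->
  (forall x : 'cV_n, W *m x = 0 -> qform A x <= t%:C * sqn x) -> eigval p.+1 A <= t.
Proof.
move=> hA pn hW; have [U hU AU] := sorted_spectral hA.
pose f (i : 'I_(n - p.+1)) := cast_ord (subnKC pn) (rshift p.+1 i).
have lt_pn : (p + (n - p.+1) < n)%N by rewrite -addSn subnKC.
have [x x0] := exists_kernel (col_mx W (rowsub f U)) lt_pn.
rewrite mul_col_mx -[RHS]vsubmxK !linear0 => /eq_col_mx[Wx Ux].
have := le_trans (qform_ge_eigval pn hU AU _) (hW x Wx).
rewrite ler_pM2r ?sqn_gt0 // lecR; apply => i pi.
have ip : (i - p.+1 < n - p.+1)%N by rewrite ltn_sub2r // (leq_ltn_trans pi).
have := congr1 (fun M : 'cV_(n - p.+1) => M (Ordinal ip) 0) Ux.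
rewrite mul_rowsub_mx mxE [RHS]mxE => <-; congr ((_ *m _) _ _).
by apply: val_inj; rewrite /= subnKC.
Qed.

Lemma eigval_perturb n (A B : 'M[C]_n) (t : R) p : (p < n)%N ->
  A \is hermsymmx -> B \is hermsymmx ->
  (forall v, qform A v <= qform B v + t%:C * sqn v) ->
  eigval p.+1 A <= eigval p.+1 B + t.
Proof.
move=> pn hA hB hAB; have [U hU BU] := sorted_spectral hB.
apply: (@eigval_le_codim _ _ _ (rowsub (widen_ord (ltnW pn)) U)) => // x Wx.
apply: le_trans (hAB x) _; rewrite rmorphD /= mulrDl lerD2r.
apply: (qform_le_eigval pn hU BU) => i ip.
have := congr1 (fun M : 'cV_p => M (Ordinal ip) 0) Wx.
rewrite mul_rowsub_mx mxE [RHS]mxE => <-; congr ((_ *m _) _ _).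
exact: val_inj.
Qed.

Lemma eigval_ge0 n (A : 'M[C]_n) j : psdmx A -> 0 <= eigval j A.
Proof.
move=> [hA pA].
suff h p : 0 <= eigval p.+1 A by case: j => [|j]; [exact: (h 0%N)|exact: h].
have [pn|np] := ltnP p n; last by rewrite eigval_oversize.
have [U hU AU] := sorted_spectral hA.
pose i := Ordinal pn; pose x : 'cV_n := U ^t* *m delta_mx i 0.
have Ux : U *m x = delta_mx i 0.
  by rewrite mulmxA; have /unitarymxP -> := hU; rewrite mul1mx.
have := pA x; rewrite -/(qform A x) (qform_spectral _ AU) (bigD1 i) //=.
rewrite big1 ?addr0 => [|k ki].
  by rewrite Ux !mxE !eqxx normr1 expr1n mulr1 ler0c.
by rewrite Ux !mxE (negPf ki) normr0 expr0n mulr0.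
Qed.

Lemma trace_pow n (A : 'M[C]_n) m : A \is hermsymmx ->
  \tr (A ^+ m) = (\sum_(k < n) eigval k.+1 A ^+ m)%:C.
Proof.
move=> /sorted_spectral[U hU AU]; rewrite {1}AU spectral_pow // mxtrace_mulC.
rewrite mulmxA; have /unitarymxP -> := hU; rewrite mul1mx mxtrace_diag.
by rewrite rmorph_sum; apply: eq_bigr => i _; rewrite !mxE rmorphXn.
Qed.

Lemma psdmxE n (A : 'M[C]_n) (U : 'M[C]_n) d : U \is unitarymx ->
  A = U ^t* *m diag_mx d *m U -> psdmx A -> forall i, 0 <= d 0 i.
Proof.
move=> hU AU [_ pA] i; have := pA (U ^t* *m delta_mx i (0 : 'I_1)).
rewrite -/(qform A _) (qform_spectral _ AU) mulmxA.
have /unitarymxP -> := hU; rewrite mul1mx (bigD1 i) //= big1 ?addr0 => [|k ki].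
  by rewrite !mxE !eqxx normr1 expr1n mulr1.
by rewrite !mxE (negPf ki) normr0 expr0n mulr0.
Qed.

(** The ordering of quadratic forms passes to the eigenvalues one by one, by the variational
    principle, hence to sums of their powers. *)
Lemma trace_pow_mono n (A B : 'M[C]_n) m : psdmx A -> B \is hermsymmx ->
  (forall v, qform A v <= qform B v) -> \tr (A ^+ m) <= \tr (B ^+ m).
Proof.
move=> pA hB AB; have hA := pA.1.
rewrite !trace_pow // lecR ler_sum // => k _.
have pB : psdmx B by split=> // v; apply: le_trans (pA.2 v) (AB v).
apply: lerXn2r; [exact: eigval_ge0 pA|exact: eigval_ge0 pB|].
rewrite -[leRHS]addr0; apply: eigval_perturb => // v.
by rewrite mul0r addr0.
Qed.

(** A psd matrix is dominated by any number whose power dominates the trace of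
    the corresponding power of the matrix. *)
Lemma qform_le_trace_pow n (A : 'M[C]_n) m (b : R) : (0 < m)%N -> 0 <= b ->
  psdmx A -> \tr (A ^+ m) <= (b ^+ m)%:C -> forall v, qform A v <= b%:C * sqn v.
Proof.
move=> m0 b0 pA; have [hA _] := pA; rewrite trace_pow // lecR => trA v.
have [U hU AU] := sorted_spectral hA.
rewrite (qform_spectral _ AU) -(sqn_unitary v hU) sqnE mulr_sumr ler_sum // => i _.
rewrite [(\row__ _) 0 i]mxE ler_wpM2r ?exprn_ge0 // lecR.
rewrite -(@ler_pXn2r _ m) ?nnegrE ?eigval_ge0 //; apply: le_trans trA.
rewrite (bigD1 i) //= lerDl sumr_ge0 // => k _.
by rewrite exprn_ge0 // eigval_ge0.
Qed.

Lemma psdmx_shift n (A : 'M[C]_n) s : psdmx A -> 0 <= s -> psdmx (A + s%:M).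
Proof.
move=> [/adjmx_hermP hA pA] s0; split.
  apply/adjmx_hermP; rewrite adjmxD hA tr_scalar_mx map_scalar_mx /=.
  by rewrite (CrealP (ger0_real s0)).
move=> v; rewrite -/(qform _ v) qformD -[s%:M]scalemx1 qformZ qform1.
by rewrite addr_ge0 ?pA // mulr_ge0 // sqn_ge0.
Qed.

Lemma psdmx_rank1 n (x : 'cV[C]_n) : psdmx (x *m x ^t*).
Proof.
split; first by apply/adjmx_hermP; rewrite adjmxM trmxCK.
move=> v; rewrite !mulmxA -mulmxA.
have -> : v ^t* *m x = (x ^t* *m v) ^t* by rewrite adjmxM trmxCK.
by rewrite -/(sqn _) sqn_ge0.
Qed.

Lemma psdmxD n (A B : 'M[C]_n) : psdmx A -> psdmx B -> psdmx (A + B).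
Proof.
move=> [/adjmx_hermP hA pA] [/adjmx_hermP hB pB]; split.
  by apply/adjmx_hermP; rewrite adjmxD hA hB.
by move=> v; rewrite -/(qform _ v) qformD addr_ge0 ?pA ?pB.
Qed.

Lemma psdmx0 n : psdmx (0 : 'M[C]_n).
Proof.
split; last by move=> v; rewrite mulmx0 mul0mx mxE.
by apply/adjmx_hermP; apply/matrixP => i j; rewrite !mxE rmorph0.
Qed.

Lemma psdmx_sum n (I : Type) (r : seq I) (P : pred I) (F : I -> 'M[C]_n) :
  (forall i, psdmx (F i)) -> psdmx (\sum_(i <- r | P i) F i).
Proof.
by move=> h; apply: big_ind => [||i _]; [exact: psdmx0|exact: psdmxD|exact: h].
Qed.

Lemma rank1_pow_le n (A : 'M[C]_n) (x : 'cV[C]_n) (l : C) m : psdmx A ->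
  sqn x <= l -> qform ((A + x *m x ^t*) ^+ m) x <= qform ((A + l%:M) ^+ m) x.
Proof.
move=> pA; have [U hU AU] := sorted_spectral pA.1.
exact: rank1_pow_le_spectral hU AU (psdmxE hU AU pA).
Qed.

(** One factor of the power is expanded into its summands; in the term of [y i] the
    contribution of [y i] to the other factors is replaced by [l], which frees them from
    [y i]. This decoupling is what independence will be applied to. *)
Lemma trace_pow_step n (I : finType) (y : I -> 'cV[C]_n) (s l : C) p :
  0 <= s -> (forall i, sqn (y i) <= l) ->
  forall S, S = \sum_i y i *m (y i) ^t* ->
  \tr ((S + s%:M) ^+ p.+1) <= s * \tr ((S + s%:M) ^+ p)
    + \sum_i qform ((\sum_(j | j != i) y j *m (y j) ^t* + (s + l)%:M) ^+ p) (y i).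
Proof.
move=> s0 yl S SE; rewrite exprS mulrDl raddfD /= addrC lerD //.
  by rewrite -mulmxE mul_scalar_mx linearZ.
rewrite {1}SE mulr_suml raddf_sum /= ler_sum // => i _.
rewrite -mulmxE -mulmxA mxtrace_mulC /mxtrace big_ord1 -/(qform _ _).
have -> : S + s%:M = \sum_(j | j != i) y j *m (y j) ^t* + s%:M + y i *m (y i) ^t*.
  by rewrite SE (bigD1 i) //= -addrA addrC.
rewrite [(s + l)%:M]raddfD /= addrA; apply: rank1_pow_le => //.
apply: psdmx_shift => //; apply: psdmx_sum => j; exact: psdmx_rank1.
Qed.

End CourantFischer.

(** * Comparing the spectra of [T] and of the sample covariance *)

Section Sandwich.
Variable R : realType.
Local Notation C := R[i].

Lemma sqrtmx_adj n (A : 'M[C]_n) : psdmx A -> (sqrtmx A) ^t* = sqrtmx A.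
Proof. by move=> /sqrtmx_psd [/adjmx_hermP]. Qed.

Lemma sqrtmx_adjK n (A : 'M[C]_n) : psdmx A ->
  (sqrtmx A) ^t* *m sqrtmx A = A.
Proof. by move=> pA; rewrite sqrtmx_adj // sqrtmxK. Qed.

Lemma adj_sample_cov N n (A : 'M[C]_N) (Z : 'M[C]_(N, n)) (T : 'M[C]_n) :
  psdmx A -> let B := sqrtmx A *m Z in
  sample_cov A Z T = N%:R^-1 *: (B *m T *m B ^t*).
Proof.
move=> pA B; rewrite /sample_cov /B adjmxM sqrtmx_adj //.
by move: (sqrtmx A) => Q; rewrite !mulmxA.
Qed.

Lemma psdmx_congr N n (B : 'M[C]_(N, n)) (T : 'M[C]_n) :
  psdmx T -> psdmx (B *m T *m B ^t*).
Proof.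
move=> [/adjmx_hermP hT pT]; split.
  by apply/adjmx_hermP; rewrite !adjmxM trmxCK hT mulmxA.
move=> v; rewrite -/(qform _ _) -[X in X *m T]trmxCK -qformM; exact: pT.
Qed.

Lemma psdmxZ n (a : C) (T : 'M[C]_n) : 0 <= a -> psdmx T -> psdmx (a *: T).
Proof.
move=> a0 [/adjmx_hermP hT pT]; split.
  by apply/adjmx_hermP; rewrite adjmxZ hT (CrealP (ger0_real a0)).
by move=> v; rewrite -/(qform _ _) qformZ mulr_ge0 //; exact: pT.
Qed.

Lemma sample_cov_psd N n (A : 'M[C]_N) (Z : 'M[C]_(N, n)) (T : 'M[C]_n) :
  psdmx A -> psdmx T -> psdmx (sample_cov A Z T).
Proof.
move=> pA pT; rewrite (adj_sample_cov _ _ pA); apply: psdmxZ.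
  by rewrite invr_ge0 ler0n.
exact: psdmx_congr.
Qed.

(** Expanding the square of [H a - h a]. *)
Lemma sq_le_of_ge n (H : 'M[C]_n) (h : C) : H \is hermsymmx -> 0 < h ->
  (forall b, h * sqn b <= qform H b) -> forall a, h * qform H a <= sqn (H *m a).
Proof.
move=> /adjmx_hermP hH h0 hb a.
have : 0 <= sqn (H *m a - h *: a) by apply: sqn_ge0.
have -> : sqn (H *m a - h *: a) = sqn (H *m a) - h *+ 2 * qform H a + h ^+ 2 * sqn a.
  have -> : H *m a - h *: a = H *m a + (- h) *: a by rewrite scaleNr.
  have aE (A B : 'M[C]_1) : (A + B) 0 0 = A 0 0 + B 0 0 by rewrite mxE.
  have zE b (A : 'M[C]_1) : (b *: A) 0 0 = b * A 0 0 by rewrite mxE.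
  rewrite {1}/sqn adjmxD adjmxZ mulmxDl !mulmxDr -!scalemxAl -!scalemxAr.
  rewrite !aE !zE rmorphN /= (CrealP (gtr0_real h0)).
  have -> : ((H *m a) ^t* *m a) 0 0 = qform H a by rewrite adjmxM hH.
  have -> : (a ^t* *m (H *m a)) 0 0 = qform H a by rewrite mulmxA.
  by rewrite -/(sqn a) -/(sqn (H *m a)); ring.
move=> h1; rewrite -subr_ge0; apply: le_trans h1 _.
rewrite -subr_ge0.
have -> : sqn (H *m a) - h * qform H a -
    (sqn (H *m a) - h *+ 2 * qform H a + h ^+ 2 * sqn a) =
    h * (qform H a - h * sqn a) by ring.
by rewrite pmulr_rge0 // subr_ge0.
Qed.

Section Deterministic.
Variables (N n K p : nat) (A : 'M[C]_N) (Z : 'M[C]_(N, n)) (T U : 'M[C]_n).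
Hypotheses (pA : psdmx A) (pT : psdmx T) (hU : U \is unitarymx).
Hypothesis TU : T = U ^t* *m diag_mx (\row_k (eigval k.+1 T)%:C) *m U.
Hypotheses (pK : (p < K)%N) (Kn : (K <= n)%N) (pN : (p < N)%N).

Let posC (x : R) : 0 < x -> 0 < x%:C :> C.
Proof. by move=> x0; rewrite -[0]/(0%:C) ltcR. Qed.

Let G := N%:R^-1 *: (Z ^t* *m A *m Z).
Let B := sqrtmx A *m Z.
Let N0 : 0 < (N%:R : C)^-1.
Proof. by rewrite invr_gt0 ltr0n (leq_ltn_trans _ pN). Qed.

Let topU q (qn : (q <= n)%N) := rowsub (widen_ord qn) U.

Lemma sqn_rowsub q (qn : (q <= n)%N) (v : 'cV[C]_n) :
  sqn (rowsub (widen_ord qn) v) = \sum_(i < n | (i < q)%N) `|v i 0| ^+ 2.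
Proof.
rewrite sqnE (big_ord_narrow qn) /=; apply: eq_bigr => i _; rewrite mxE.
by [].
Qed.

Let topU_unitary q (qn : (q <= n)%N) : topU qn *m (topU qn) ^t* = 1%:M.
Proof.
apply/matrixP => i j; have /unitarymxP/matrixP := hU.
move=> /(_ (widen_ord qn i) (widen_ord qn j)); rewrite !mxE => hij.
transitivity ((widen_ord qn i == widen_ord qn j)%:R : C); last by [].
by rewrite -hij; apply: eq_bigr => k _; rewrite !mxE.
Qed.

Let sqn_topU q (qn : (q <= n)%N) a : sqn ((topU qn) ^t* *m a) = sqn a.
Proof. by rewrite sqnM trmxCK topU_unitary qform1. Qed.

Let topU_supp q (qn : (q <= n)%N) (a : 'cV_q) (i : 'I_n) : (q <= i)%N ->
  (U *m ((topU qn) ^t* *m a)) i 0 = 0.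
Proof.
move=> qi; rewrite mulmxA mxE big1 // => j _.
have /unitarymxP/matrixP/(_ i (widen_ord qn j)) := hU.
rewrite !mxE; have -> : (i == widen_ord qn j) = false.
  by apply/eqP => /(congr1 val) /= ij; move: (ltn_ord j); rewrite -ij ltnNge qi.
move=> h; rewrite (_ : \sum_k _ = 0) ?mul0r // -[RHS]h.
by apply: eq_bigr => k _; rewrite !mxE.
Qed.

Let sqnB w : sqn (B *m w) = N%:R * qform G w.
Proof.
rewrite qformZ mulrA divff ?pnatr_eq0 -?lt0n ?(leq_ltn_trans _ pN) // mul1r.
by rewrite sqnM /B adjmxM mulmxA -(mulmxA _ _ (sqrtmx A)) sqrtmx_adjK.
Qed.

(** The images under [B] of the top eigenvectors of [T] span a test space on which the form
    of [B T B^*] is large as soon as [B^* B] is almost scalar on these eigenvectors. *)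
Lemma eigval_sample_cov_ge (c : R) : 0 < c ->
  (forall w : 'cV_n, (forall i : 'I_n, (K <= i)%N -> (U *m w) i 0 = 0) ->
     c%:C * sqn w <= qform G w) ->
  c * eigval p.+1 T <= eigval p.+1 (sample_cov A Z T).
Proof.
move=> c0 hG; have pn : (p.+1 <= n)%N by exact: leq_trans pK Kn.
have hG' (a : 'cV_p.+1) : c%:C * sqn a <= qform G ((topU pn) ^t* *m a).
  rewrite -(sqn_topU pn); apply: hG => i Ki; apply: topU_supp.
  exact: leq_trans pK Ki.
pose V := B *m (topU pn) ^t*.
have sqnV (a : 'cV_p.+1) : sqn (V *m a) = N%:R * qform G ((topU pn) ^t* *m a).
  by rewrite /V -mulmxA sqnB.
have cN : 0 < N%:R * c%:C :> C.
  by rewrite mulr_gt0 ?posC // -invr_gt0.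
have hV (a : 'cV_p.+1) : N%:R * c%:C * sqn a <= qform (V ^t* *m V) a.
  by rewrite -sqnM sqnV -mulrA ler_wpM2l ?ler0n.
apply: (@eigval_ge_subspace _ _ _ _ V).
- by have [] := sample_cov_psd Z pA pT.
- move=> a a0; rewrite -sqn_gt0 sqnM; apply: lt_le_trans (hV a).
  by rewrite mulr_gt0 // sqn_gt0.
move=> a; rewrite (adj_sample_cov _ _ pA) -/B qformZ.
have -> : qform (B *m T *m B ^t*) (V *m a) = qform T (B ^t* *m (V *m a)).
  by rewrite [RHS]qformM trmxCK.
rewrite (qform_spectral _ TU) -ler_pdivrMl // invrK.
have hH : V ^t* *m V \is hermsymmx by apply/adjmx_hermP; rewrite adjmxM trmxCK.
have := sq_le_of_ge hH cN hV a; rewrite -sqnM => h1.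
have l0 : 0 <= (eigval p.+1 T)%:C by rewrite ler0c eigval_ge0.
have -> : N%:R * ((c * eigval p.+1 T)%:C * sqn (V *m a)) =
    (eigval p.+1 T)%:C * (N%:R * c%:C * sqn (V *m a)) by rewrite rmorphM /=; ring.
apply: le_trans (ler_wpM2l l0 h1) _.
have -> : V ^t* *m V *m a = rowsub (widen_ord pn) (U *m (B ^t* *m (V *m a))).
  by rewrite -mul_rowsub_mx -/(topU pn) {1}/V adjmxM trmxCK !mulmxA.
rewrite sqn_rowsub mulr_sumr [leRHS](bigID (fun i : 'I_n => (i < p.+1)%N)) /=.
rewrite -[leLHS]addr0; apply: lerD.
  apply: ler_sum => i ip; rewrite [(\row__ _) 0 i]mxE ler_wpM2r ?exprn_ge0 //.
  by rewrite lecR eigval_noninc // -ltnS ip.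
apply: sumr_ge0 => i _; rewrite [(\row__ _) 0 i]mxE mulr_ge0 ?exprn_ge0 //.
by rewrite ler0c eigval_ge0.
Qed.

Let tailT := U ^t* *m diag_mx (\row_k (if (k < K)%N then 0 else (eigval k.+1 T)%:C)) *m U.

(** Orthogonality to the images of the first [p] eigenvectors removes their contribution.
    On what remains, the eigenvectors of index below [K] contribute at most the norm of
    [B^* B] there times the next eigenvalue, and the others go into [tau]. *)
Lemma eigval_sample_cov_le (c M tau : R) : 0 < c -> 0 <= tau ->
  (forall w : 'cV_n, (forall i : 'I_n, (K <= i)%N -> (U *m w) i 0 = 0) ->
     qform G w <= c%:C * sqn w) ->
  (forall x, qform A x <= M%:C * sqn x) ->
  (forall x, N%:R^-1 * qform (Z *m tailT *m Z ^t*) x <= tau%:C * sqn x) ->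
  eigval p.+1 (sample_cov A Z T) <= c * eigval p.+1 T + M * tau.
Proof.
move=> c0 tau0 hG hM htail; have pn : (p < n)%N by exact: leq_trans pK Kn.
have hS : sample_cov A Z T \is hermsymmx by have [] := sample_cov_psd Z pA pT.
apply: (@eigval_le_codim _ _ _ _ (rowsub (widen_ord (ltnW pn)) U *m B ^t*)) => //.
move=> x Wx; rewrite (adj_sample_cov _ _ pA) -/B qformZ.
have -> : qform (B *m T *m B ^t*) x = qform T (B ^t* *m x).
  by rewrite [RHS]qformM trmxCK.
set y := B ^t* *m x.
have Uy0 (i : 'I_n) : (i < p)%N -> (U *m y) i 0 = 0.
  move=> ip; have := congr1 (fun M : 'cV_p => M (Ordinal ip) 0) Wx.
  rewrite -mulmxA -/y mul_rowsub_mx mxE [RHS]mxE => <-; congr ((_ *m _) _ _).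
  exact: val_inj.
have Ksum : \sum_(i < n | (i < K)%N) `|(U *m y) i 0| ^+ 2 <= N%:R * c%:C * sqn x.
  rewrite -sqn_rowsub -mul_rowsub_mx -/(topU Kn) /y mulmxA.
  have -> : topU Kn *m B ^t* = (B *m (topU Kn) ^t*) ^t* by rewrite [RHS]adjmxM trmxCK.
  apply: adj_bound; first by rewrite mulr_gt0 ?posC // -invr_gt0.
  move=> a; rewrite -mulmxA sqnB -mulrA ler_wpM2l ?ler0n //.
  by rewrite -(sqn_topU Kn); apply: hG => i; exact: topU_supp.
have l0 : 0 <= (eigval p.+1 T)%:C by rewrite ler0c eigval_ge0.
have : qform T y <= (eigval p.+1 T)%:C * (N%:R * c%:C * sqn x) + qform tailT y.
  apply: le_trans (lerD (ler_wpM2l l0 Ksum) (lexx _)).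
  rewrite (qform_spectral _ TU) (qform_spectral _ erefl).
  rewrite (bigID (fun i : 'I_n => (i < K)%N)) /=; apply: lerD.
    rewrite mulr_sumr; apply: ler_sum => i iK; rewrite [(\row__ _) 0 i]mxE.
    have [ip|pi] := ltnP i p; first by rewrite Uy0 // normr0 expr0n !mulr0.
    by rewrite ler_wpM2r ?exprn_ge0 // lecR eigval_noninc // pi ltn_ord.
  rewrite [leRHS](bigID (fun i : 'I_n => (i < K)%N)) /= -[leLHS]add0r lerD //.
    by apply: sumr_ge0 => i iK; rewrite [(\row__ _) 0 i]mxE iK mul0r.
  by apply: ler_sum => i /negPf iK; rewrite ![(\row__ _) 0 i]mxE iK.
move=> h; apply: le_trans (ler_wpM2l (ltW N0) h) _.
rewrite mulrDr rmorphD /= mulrDl; apply: lerD.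
  rewrite le_eqVlt; apply/orP; left; apply/eqP.
  have N1 : N%:R^-1 * N%:R = 1 :> C by rewrite mulVf // -invr_eq0 gt_eqF.
  have -> : N%:R^-1 * ((eigval p.+1 T)%:C * (N%:R * c%:C * sqn x)) =
      N%:R^-1 * N%:R * (c%:C * (eigval p.+1 T)%:C * sqn x) by ring.
  by rewrite N1 mul1r rmorphM.
have -> : qform tailT y = qform (Z *m tailT *m Z ^t*) (sqrtmx A *m x).
  rewrite -[X in X *m tailT]trmxCK -[RHS]qformM /y /B adjmxM sqrtmx_adj //.
  by rewrite -(mulmxA _ (sqrtmx A)).
apply: le_trans (htail _) _; rewrite rmorphM /= [M%:C * _]mulrC -mulrA.
rewrite ler_wpM2l ?ler0c //; apply: le_trans (hM x).
by rewrite sqnM sqrtmx_adjK.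
Qed.

End Deterministic.
End Sandwich.

(** * Functions of independent entries *)

Section Independence.
Context {R : realType} {d : measure_display} {T : measurableType d}.
Context (P : probability T R) (I : finType) (X : I -> T -> R[i]).
Hypothesis mX : forall i, complex_rv (X i).
Hypothesis indX : mutually_independent P X.

Definition cylinder (J : {set I}) : set (set T) :=
  [set B | exists2 A : I -> set (R * R), (forall i, measurable (A i)) &
     B = \bigcap_(i in [set` J]) (reim (X i) @^-1` A i)].

Lemma cylinder_setI J : setI_closed (cylinder J).
Proof.
move=> _ _ [A mA ->] [B mB ->]; exists (fun i => A i `&` B i).
  by move=> i; apply: measurableI.
by rewrite -bigcapI.
Qed.

Lemma cylinderT J : cylinder J setT.
Proof.
exists (fun=> setT) => //; apply/esym; rewrite -subTset => w _ i _ //.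
Qed.

Lemma reim_measurable i (A : set (R * R)) : measurable A ->
  measurable (reim (X i) @^-1` A).
Proof. by move=> mA; rewrite -[X in measurable X]setTI; exact: mX. Qed.

Lemma cylinder_measurable J : cylinder J `<=` measurable.
Proof.
move=> _ [A mA ->]; apply: fin_bigcap_measurable => [|i _].
  exact: finite_finset.
exact: reim_measurable.
Qed.

Lemma sigma_cylinder_measurable J : <<s cylinder J >> `<=` measurable.
Proof.
by apply: smallest_sub; [exact: sigma_algebra_measurable|exact: cylinder_measurable].
Qed.

Lemma cylinder_indep (J J' : {set I}) A B : {in J, forall i, i \notin J'} -> cylinder J A ->
  cylinder J' B -> P (A `&` B) = (P A * P B)%E.
Proof.
move=> JJ' [A' mA ->] [B' mB ->].
pose D i := if i \in J then A' i else if i \in J' then B' i else setT.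
have DJ' i : i \in J' -> D i = B' i.
  by move=> iJ'; rewrite /D iJ'; case: ifP => // /JJ'; rewrite iJ'.
have -> : (\bigcap_(i in [set` J]) reim (X i) @^-1` A' i)
   `&` (\bigcap_(i in [set` J']) reim (X i) @^-1` B' i) =
   \bigcap_(i in [set` (J :|: J')]) reim (X i) @^-1` D i.
  apply/seteqP; split => w.
    move=> [h1 h2] i; rewrite /= inE => /orP[] iJ.
      by rewrite /D iJ; exact: h1.
    by rewrite DJ' //; exact: h2.
  move=> h; split => i iJ.
    by have := h i; rewrite /= inE (_ : i \in J) // /D (_ : i \in J = true) //; apply.
  by have := h i; rewrite /= inE (_ : i \in J' = true) // orbT DJ' //; apply.
rewrite !indX //; last first.
  by move=> i; rewrite /D; case: ifP => // _; case: ifP.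
rewrite (eq_bigl (fun i => i \in [predU J & J'])); last by move=> i; rewrite !inE.
rewrite bigU /=; last by rewrite disjoint_subset; apply/fintype.subsetP.
congr (_ * _)%E; apply: eq_bigr => i iJ.
  by rewrite /D iJ.
by rewrite DJ'.
Qed.

Let uniq_ext J (B : set T) (mB : measurable B) :
  (forall A, cylinder J A -> P (A `&` B) = (P A * P B)%E) ->
  forall A, <<s cylinder J >> A -> P (A `&` B) = (P A * P B)%E.
Proof.
move=> h A sA.
have PB : (0 <= fine (P B))%R by rewrite fine_ge0.
have := @g_sigma_algebra_measure_unique _ _ _ (cylinder J) (@cylinder_measurable J)
  (fun=> setT) (fun=> cylinderT J) _ (mrestr P mB) (mscale (NngNum PB) P)
  (@cylinder_setI J) _ _ A sA.
have sE D : mscale (NngNum PB) P D = (P B * P D)%E.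
  by rewrite -[in RHS](fineK (fin_num_measure P _ mB)).
move=> H; rewrite [RHS]muleC -sE; apply: H.
- by rewrite bigcup_const //; exists 0%N.
- move=> C cC; apply: etrans (h C cC) _; rewrite muleC; exact: (esym (sE C)).
- move=> _; apply: le_lt_trans (_ : 1 < +oo)%E; last by rewrite ltry.
  by apply: probability_le1; exact: measurableI.
Qed.

Lemma sigma_cylinder_indep (J J' : {set I}) A B : {in J, forall i, i \notin J'} ->
  <<s cylinder J >> A -> <<s cylinder J' >> B -> P (A `&` B) = (P A * P B)%E.
Proof.
move=> JJ' sA sB; have mB := sigma_cylinder_measurable sB.
apply: uniq_ext sA => // C cC.
rewrite setIC muleC; apply: uniq_ext sB; first exact: cylinder_measurable cC.
by move=> D cD; rewrite setIC muleC; apply: cylinder_indep cC cD.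
Qed.

(** Measurability for the sigma-algebra of the cylinders over [J]: independence then
    passes from cylinders to all such variables by Dynkin's theorem. *)
Definition depends (J : {set I}) (f : T -> R) : Prop :=
  measurable_fun setT (f : g_sigma_algebraType (cylinder J) -> R).

Lemma depends_measurable J f : depends J f -> measurable_fun setT f.
Proof.
move=> h _ Y mY; apply: sigma_cylinder_measurable; exact: h.
Qed.

Lemma cylinder_sub (J J' : {set I}) : J \subset J' -> cylinder J `<=` cylinder J'.
Proof.
move=> JJ' _ [A mA ->]; exists (fun i => if i \in J then A i else setT).
  by move=> i; case: ifP.
apply/seteqP; split => w h i /= iJ; first by case: ifPn => // iJ'; exact: h.
by have := h i (fintype.subsetP JJ' _ iJ); rewrite iJ.
Qed.

Lemma depends_sub (J J' : {set I}) f : J \subset J' -> depends J f -> depends J' f.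
Proof.
move=> JJ' h mT Y mY; have := h measurableT Y mY.
apply: sub_sigma_algebra2; exact: cylinder_sub.
Qed.

Lemma depends_reim (J : {set I}) i : i \in J ->
  measurable_fun setT (reim (X i) : g_sigma_algebraType (cylinder J) -> R * R).
Proof.
move=> iJ _ Y mY; apply: sub_sigma_algebra; rewrite setTI.
exists (fun j => if j == i then Y else setT); first by move=> j; case: ifP.
apply/seteqP; split => w /=; last by move=> /(_ i iJ); rewrite eqxx.
by move=> h j /= _; case: eqP => // ->.
Qed.

Lemma depends_Re (J : {set I}) i : i \in J -> depends J (fun w => complex.Re (X i w)).
Proof. by move=> /depends_reim /measurable_fun_pairP []. Qed.

Lemma depends_Im (J : {set I}) i : i \in J -> depends J (fun w => complex.Im (X i w)).
Proof. by move=> /depends_reim /measurable_fun_pairP []. Qed.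

Lemma dependsD J f g : depends J f -> depends J g -> depends J (fun w => f w + g w).
Proof. exact: measurable_funD. Qed.

Lemma dependsM J f g : depends J f -> depends J g -> depends J (fun w => f w * g w).
Proof. exact: measurable_funM. Qed.

Lemma depends_cst J c : depends J (fun=> c).
Proof. exact: measurable_cst. Qed.

Lemma dependsX J f n : depends J f -> depends J (fun w => f w ^+ n).
Proof. exact: measurable_funX. Qed.

End Independence.

Notation Pint P f := ((P).-integrable setT (EFin \o f)).

Section ExpectationProduct.
Context {R : realType} {d : measure_display} {T : measurableType d}.
Context (P : probability T R).

Lemma integral_indep_prod (f g : T -> R) :
  measurable_fun setT f -> measurable_fun setT g ->
  (forall A B, measurable A -> measurable B ->
    P ((f @^-1` A) `&` (g @^-1` B)) = (P (f @^-1` A) * P (g @^-1` B))%E) ->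
  Pint P f -> Pint P g ->
  Pint P (fun w => f w * g w) /\
  \int[P]_w (f w * g w) = (\int[P]_w f w) * (\int[P]_w g w).
Proof.
move=> mf mg fg intf intg.
pose F : {RV P >-> R} := mfun_Sub (mem_set mf).
pose G : {RV P >-> R} := mfun_Sub (mem_set mg).
have mfg : measurable_fun setT (fun w => (f w, g w)) by exact: measurable_fun_pair.
pose FG : {RV P >-> (R * R)%type} := mfun_Sub (mem_set mfg).
pose mu := distribution P F; pose nu := distribution P G.
have pE (A : set (R * R)) : measurable A ->
    distribution P FG A = (mu \x nu)%E A.
  move=> mA; apply/esym; by apply: product_measure_unique => // B C mB mC; exact: fg.
have mprod : measurable_fun setT (fun z : R * R => (z.1 * z.2)%:E).
  apply/measurable_EFinP; apply: measurable_funM; [exact: measurable_fst|exact: measurable_snd].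
have eqI (h : R * R -> \bar R) :
    (\int[distribution P FG]_z h z = \int[mu \x nu]_z h z)%E.
  by apply: eq_measure_integral => A mA _; exact: pE.
have intmu : mu.-integrable setT (EFin \o id).
  by apply: integrable_pushforward => //; exact/measurable_EFinP.
have intnu : nu.-integrable setT (EFin \o id).
  by apply: integrable_pushforward => //; exact/measurable_EFinP.
have intprod : (mu \x nu)%E.-integrable setT (fun z => (z.1 * z.2)%:E).
  apply/integrable12ltyP => //=.
  under eq_integral => x _.
    under eq_integral => y _ do rewrite normrM EFinM.
    rewrite ge0_integralZl //; last by apply/measurable_EFinP; exact: normr_measurable.
    over.
  rewrite ge0_integralZr //.
  - have /integrableP[_ h1] := intmu; have /integrableP[_ h2] := intnu.
    by apply: lte_mul_pinfty => //; [exact: integral_ge0|rewrite ge0_fin_numE //; exact: integral_ge0].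
  - by apply/measurable_EFinP; exact: normr_measurable.
  - exact: integral_ge0.
have intFG : (distribution P FG).-integrable setT (fun z => (z.1 * z.2)%:E).
  apply/integrableP; split => //; rewrite eqI.
  by have /integrableP[] := intprod.
have int1 : Pint P (fun w => f w * g w).
  apply/integrableP; split; first by apply/measurable_EFinP; exact: measurable_funM.
  have /integrableP[_] := intFG; rewrite ge0_integral_distribution //.
  by apply/measurableT_comp.
split=> //; rewrite /Rintegral.
have -> : (\int[P]_w (f w * g w)%:E = \int[distribution P FG]_z (z.1 * z.2)%:E)%E.
  by rewrite integral_distribution.
rewrite eqI -(integral12_prod_meas1 intprod) /fubini_F /=.
have -> : (\int[P]_w (f w)%:E = \int[mu]_z z%:E)%E.
  by rewrite integral_distribution //; exact/measurable_EFinP.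
have E2 : (\int[P]_w (g w)%:E = \int[nu]_z z%:E)%E.
  by rewrite integral_distribution //; exact/measurable_EFinP.
rewrite E2.
under eq_integral => x _.
  under eq_integral => y _ do rewrite EFinM.
  rewrite integralZl //.
  over.
have nufin : (\int[nu]_z z%:E)%E \is a fin_num by exact: integrable_fin_num.
rewrite -(fineK nufin) integralZr //= fineM //; exact: integrable_fin_num.
Qed.

Lemma depends_prod (I : finType) (X : I -> T -> R[i]) (J J' : {set I}) (f g : T -> R) :
  (forall i, complex_rv (X i)) -> mutually_independent P X ->
  {in J, forall i, i \notin J'} -> depends X J f -> depends X J' g ->
  Pint P f -> Pint P g ->
  Pint P (fun w => f w * g w) /\
  \int[P]_w (f w * g w) = (\int[P]_w f w) * (\int[P]_w g w).
Proof.
move=> mX indX JJ' Jf J'g; apply: integral_indep_prod.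
- exact: depends_measurable Jf.
- exact: depends_measurable J'g.
move=> A B mA mB; apply: (sigma_cylinder_indep mX indX JJ').
- by rewrite -[X in <<s _ >> X]setTI; exact: Jf.
- by rewrite -[X in <<s _ >> X]setTI; exact: J'g.
Qed.

End ExpectationProduct.

(** * Moments and orthogonality *)

Section Moments.
Context {R : realType} {d : measure_display} {T : measurableType d}.
Context (P : probability T R).
Implicit Types (f g : T -> R) (a b c : R).

Lemma PintD f g : Pint P f -> Pint P g -> Pint P (fun w => f w + g w).
Proof.
move=> hf hg; have := integrableD measurableT hf hg.
by apply: eq_integrable => // w _ /=; rewrite EFinD.
Qed.

Lemma PintZ c f : Pint P f -> Pint P (fun w => c * f w).
Proof.
move=> hf; have := integrableZl measurableT c hf.
by apply: eq_integrable => // w _ /=; rewrite EFinM.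
Qed.

Lemma Pint_cst c : Pint P (fun=> c).
Proof. exact: finite_measure_integrable_cst. Qed.

Lemma Pint_sum (J : Type) (s : seq J) (F : J -> T -> R) :
  (forall j, Pint P (F j)) -> Pint P (fun w => \sum_(j <- s) F j w).
Proof.
move=> hF; elim: s => [|j s IH].
  by under eq_fun do rewrite big_nil; exact: Pint_cst.
by under eq_fun do rewrite big_cons; exact: PintD.
Qed.

Lemma Rintegral_fsum (J : Type) (s : seq J) (F : J -> T -> R) :
  (forall j, Pint P (F j)) ->
  \int[P]_w (\sum_(j <- s) F j w) = \sum_(j <- s) \int[P]_w F j w.
Proof.
move=> hF; elim: s => [|j s IH].
  by under eq_Rintegral do rewrite big_nil; rewrite big_nil Rintegral_cst // mul0r.
under eq_Rintegral do rewrite big_cons.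
by rewrite big_cons RintegralD ?IH //; exact: Pint_sum.
Qed.

Lemma Pint_le f g : measurable_fun setT f -> (forall w, `|f w| <= g w) ->
  Pint P g -> Pint P f.
Proof.
move=> mf fg; apply: le_integrable => //; first exact/measurable_EFinP.
by move=> w _ /=; rewrite lee_fin (le_trans (fg w)) // ler_norm.
Qed.

Lemma Pint_bounded f c : measurable_fun setT f -> (forall w, `|f w| <= c) -> Pint P f.
Proof. by move=> mf fc; exact: Pint_le fc (Pint_cst c). Qed.

Lemma Pint_meas f : Pint P f -> measurable_fun setT f.
Proof. by move=> /integrableP[/measurable_EFinP]. Qed.

(** The moment of order [2 p] is compared with [a ^+ p], so that [a] scales like a variance:
    for [p] equal to 1 or 2 such bounds add up, to a constant, over orthogonal sums. *)
Definition moment_le (p : nat) f a : Prop :=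
  [/\ measurable_fun setT f, Pint P (fun w => f w ^+ p.*2), 0 <= a &
      \int[P]_w (f w ^+ p.*2) <= a ^+ p].

Lemma moment_le_ge p f a b : a <= b -> moment_le p f a -> moment_le p f b.
Proof.
move=> ab [mf intf a0 fa]; split=> //; first exact: le_trans ab.
by apply: le_trans fa _; rewrite lerXn2r ?nnegrE // (le_trans a0).
Qed.

Lemma moment_leZ p f a c : moment_le p f a -> moment_le p (fun w => c * f w) (c ^+ 2 * a).
Proof.
move=> [mf intf a0 fa].
have E w : (c * f w) ^+ p.*2 = c ^+ p.*2 * f w ^+ p.*2 by rewrite exprMn.
split; first exact: measurable_funM.
- by under eq_fun do rewrite E; exact: PintZ.
- by rewrite mulr_ge0 // sqr_ge0.
under eq_Rintegral do rewrite E; rewrite RintegralZl // exprMn -exprM mul2n.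
by rewrite ler_wpM2l // -mul2n exprM exprn_ge0 // sqr_ge0.
Qed.

Section OneTwo.
Variable p : nat.
Hypothesis p12 : (p = 1%N \/ p = 2%N).

Let pow_addr_le (x y : R) : (x + y) ^+ p.*2 <= 2 ^+ p.*2.-1 * (x ^+ p.*2 + y ^+ p.*2).
Proof.
case: p12 => -> /=.
  rewrite expr1 -subr_ge0 (_ : _ - _ = (x - y) ^+ 2) ?sqr_ge0 //; ring.
have h (u v : R) : (u + v) ^+ 2 <= 2 * (u ^+ 2 + v ^+ 2).
  rewrite -subr_ge0 (_ : _ - _ = (u - v) ^+ 2) ?sqr_ge0 //; ring.
have h1 : (x ^+ 2 + y ^+ 2) ^+ 2 <= 2 * (x ^+ 4 + y ^+ 4).
  by have := h (x ^+ 2) (y ^+ 2); rewrite -!exprM.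
rewrite [(x + y) ^+ 4](_ : _ = ((x + y) ^+ 2) ^+ 2); last by rewrite -exprM.
apply: (@le_trans _ _ ((2 * (x ^+ 2 + y ^+ 2)) ^+ 2)).
  by rewrite lerXn2r ?nnegrE ?sqr_ge0 // mulr_ge0 // addr_ge0 ?sqr_ge0.
have -> : 2 ^+ 3 = 8 :> R by ring.
by rewrite exprMn (_ : 2 ^+ 2 = 4 :> R); [lra|ring].
Qed.

Lemma moment_leD f g a b : moment_le p f a -> moment_le p g b ->
  moment_le p (fun w => f w + g w) (4 * (a + b)).
Proof.
move=> [mf intf a0 fa] [mg intg b0 gb].
have mfg : measurable_fun setT (fun w => f w + g w) by exact: measurable_funD.
have ints : Pint P (fun w => 2 ^+ p.*2.-1 * (f w ^+ p.*2 + g w ^+ p.*2)).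
  by apply: PintZ; exact: PintD.
have intfg : Pint P (fun w => (f w + g w) ^+ p.*2).
  apply: Pint_le ints; first exact: measurable_funX.
  move=> w; rewrite ger0_norm ?pow_addr_le //.
  by rewrite -mul2n exprM exprn_ge0 // sqr_ge0.
split=> //; first by rewrite mulr_ge0 // addr_ge0.
apply: (@le_trans _ _ (2 ^+ p.*2.-1 * (a ^+ p + b ^+ p))).
  apply: (@le_trans _ _ (\int[P]_w (2 ^+ p.*2.-1 * (f w ^+ p.*2 + g w ^+ p.*2)))).
    by apply: le_Rintegral => // w _; exact: pow_addr_le.
  rewrite RintegralZl //; last exact: PintD.
  by rewrite ler_wpM2l ?exprn_ge0 // RintegralD // lerD.
case: p12 => -> /=; first by rewrite !expr1; lra.
nra.
Qed.

Lemma moment_le_cross f g a b : moment_le p f a -> moment_le p g b ->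
  Pint P (fun w => f w ^+ p.*2.-1 * g w).
Proof.
move=> [mf intf a0 fa] [mg intg b0 gb].
have intD := PintD intf intg.
apply: Pint_le intD; first by apply: measurable_funM => //; exact: measurable_funX.
move=> w; have evn (h : R) : h ^+ p.*2 = `|h| ^+ p.*2.
  by rewrite -mul2n !exprM real_normK // num_real.
rewrite normrM normrX (evn (f w)) (evn (g w)).
move: `|f w| `|g w| (normr_ge0 (f w)) (normr_ge0 (g w)) => x y x0 y0.
have -> : x ^+ p.*2 = x ^+ p.*2.-1 * x by rewrite -exprSr prednK //; case: p12 => ->.
have -> : y ^+ p.*2 = y ^+ p.*2.-1 * y by rewrite -exprSr prednK //; case: p12 => ->.
have := exprn_ge0 p.*2.-1 x0; have := exprn_ge0 p.*2.-1 y0 => hy hx.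
have [xy|/ltW yx] := leP x y.
  apply: le_trans (_ : y ^+ p.*2.-1 * y <= _); last by rewrite lerDr mulr_ge0.
  by rewrite ler_wpM2r // lerXn2r ?nnegrE.
apply: le_trans (_ : x ^+ p.*2.-1 * x <= _); last by rewrite lerDl mulr_ge0.
by rewrite ler_wpM2l.
Qed.

Lemma moment_le_integrable f a : moment_le p f a -> Pint P f.
Proof.
move=> [mf intf a0 fa]; apply: Pint_le (PintD (Pint_cst 1) intf) => // w.
have -> : f w ^+ p.*2 = `|f w| ^+ p.*2.
  by rewrite -mul2n !exprM real_normK // num_real.
have [h|/ltW h] := leP `|f w| 1.
  by apply: le_trans h _; rewrite lerDl exprn_ge0.
apply: (@le_trans _ _ (`|f w| ^+ p.*2)); last by rewrite lerDr.
by rewrite -[leLHS]expr1 ler_weXn2l //; case: p12 => ->.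
Qed.

Lemma moment_le_pred f a : moment_le p f a -> Pint P (fun w => f w ^+ p.*2.-1).
Proof.
move=> [mf intf a0 fa]; apply: Pint_le (PintD (Pint_cst 1) intf).
  exact: measurable_funX.
move=> w; have -> : f w ^+ p.*2 = `|f w| ^+ p.*2.
  by rewrite -mul2n !exprM real_normK // num_real.
rewrite normrX; have [h|/ltW h] := leP `|f w| 1.
  by apply: (@le_trans _ _ 1); [exact: exprn_ile1|rewrite lerDl exprn_ge0].
apply: (@le_trans _ _ (`|f w| ^+ p.*2)); last by rewrite lerDr.
by rewrite ler_weXn2l // leq_pred.
Qed.

(** In the Hilbert norm ([p = 1]) this is Pythagoras. For [p = 2] the odd term
    [4 E f g^3] is absorbed in [E f^2 g^2] and [E g^4], and [E f^2 g^2 <= a b]. *)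
Lemma moment_le_orth f g a b : moment_le p f a -> moment_le p g b ->
  \int[P]_w (f w ^+ p.*2.-1 * g w) = 0 ->
  moment_le p (fun w => f w + g w) (a + 4 * b).
Proof.
move=> hf hg ortho; have [_ intfg _ _] := moment_leD hf hg.
have intc := moment_le_cross hf hg.
move: (hf) (hg) => [mf intf a0 fa] [mg intg b0 gb].
split=> //; [exact: measurable_funD|by rewrite addr_ge0 // mulr_ge0|].
have bound (u v c : R) : (forall x y : R, (x + y) ^+ p.*2 <=
    u * x ^+ p.*2 + v * y ^+ p.*2 + c * (x ^+ p.*2.-1 * y)) -> 0 <= u -> 0 <= v ->
    \int[P]_w ((f w + g w) ^+ p.*2) <= u * a ^+ p + v * b ^+ p.
  move=> h u0 v0.
  have i1 := PintD (PintZ u intf) (PintZ v intg).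
  have i2 := PintD i1 (PintZ c intc).
  apply: le_trans (le_Rintegral measurableT intfg i2 (fun w _ => h _ _)) _.
  rewrite RintegralD ?RintegralD ?RintegralZl ?ortho ?mulr0 ?addr0 //;
    try exact: PintZ.
  by rewrite lerD // ler_wpM2l.
case: (p12) => pE; rewrite pE in bound hf hg fa gb *; rewrite /= in bound fa gb *.
  rewrite !expr1 in bound *.
  have := bound 1 1 2; rewrite !mul1r => /(_ _ ler01 ler01) hb.
  apply: le_trans (hb _) _; first by move=> x y; rewrite le_eqVlt; apply/orP; left; apply/eqP; ring.
  by rewrite lerD2l ler_peMl // ler1n.
have b4 t : 0 < t -> \int[P]_w ((f w + g w) ^+ 4) <= (1 + 4 * t) * a ^+ 2 + (3 + 4 / t) * b ^+ 2.
  move=> t0; apply: (bound _ _ 4).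
  - move=> x y; rewrite -subr_ge0.
    have -> : (1 + 4 * t) * x ^+ 4 + (3 + 4 / t) * y ^+ 4 + 4 * (x ^+ 3 * y) - (x + y) ^+ 4 =
       4 * (t * x ^+ 2 - y ^+ 2) ^+ 2 / t + 2 * (x * y - y ^+ 2) ^+ 2.
      by field; rewrite gt_eqF.
    apply: addr_ge0; last by rewrite mulr_ge0 // sqr_ge0.
      by apply: divr_ge0; [rewrite mulr_ge0 // sqr_ge0|exact: ltW].
  - by rewrite addr_ge0 // mulr_ge0 // ltW.
  by rewrite addr_ge0 // mulr_ge0 // invr_ge0 ltW.
have [a00|an0] := eqVneq a 0.
  apply: le_trans (b4 4 _) _ => //; rewrite a00.
  have : 0 <= b ^+ 2 by exact: sqr_ge0.
  by rewrite !expr2; lra.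
have ap : 0 < a by rewrite lt_def an0.
have [b00|bn0] := eqVneq b 0.
  apply/ler_addgt0Pr => e e0.
  apply: le_trans (b4 (e / (4 * a ^+ 2)) _) _.
    by rewrite divr_gt0 // mulr_gt0 // exprn_gt0.
  rewrite b00 expr0n /= !mulr0 !addr0 mulrDl mul1r lerD2l.
  by rewrite le_eqVlt; apply/orP; left; apply/eqP; field.
have bp : 0 < b by rewrite lt_def bn0.
apply: le_trans (b4 (b / a) _) _; first by rewrite divr_gt0.
have -> : (1 + 4 * (b / a)) * a ^+ 2 + (3 + 4 / (b / a)) * b ^+ 2 =
   a ^+ 2 + 8 * (a * b) + 3 * b ^+ 2 by field; rewrite an0 bn0.
have : 0 <= b ^+ 2 by exact: sqr_ge0.
by rewrite !expr2; lra.
Qed.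

Lemma moment_le_prod (I : finType) (X : I -> T -> R[i]) (J J' : {set I}) f g a b :
  (forall i, complex_rv (X i)) -> mutually_independent P X ->
  {in J, forall i, i \notin J'} -> depends X J f -> depends X J' g ->
  moment_le p f a -> moment_le p g b -> moment_le p (fun w => f w * g w) (a * b).
Proof.
move=> mX indX JJ' Jf Jg [mf intf a0 fa] [mg intg b0 gb].
have [intfg E] := depends_prod mX indX JJ' (dependsX p.*2 Jf) (dependsX p.*2 Jg) intf intg.
split; first exact: measurable_funM.
- by under eq_fun do rewrite exprMn.
- exact: mulr_ge0.
under eq_Rintegral do rewrite exprMn; rewrite E exprMn.
have ev (h : T -> R) : 0 <= \int[P]_w (h w ^+ p.*2).
  by apply: Rintegral_ge0 => w _; rewrite -mul2n exprM exprn_ge0 // sqr_ge0.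
by apply: ler_pM.
Qed.

End OneTwo.

Lemma moment_le_tail p f a (t : R) : moment_le p f a -> 0 < t ->
  (P [set w | (t <= `|f w|)%R] <= (a ^+ p / t ^+ p.*2)%:E)%E.
Proof.
move=> [mf intf a0 fa] t0.
pose F : {RV P >-> R} := mfun_Sub (mem_set mf).
have mX : measurable_fun setT (fun x : R => x ^+ p.*2) by exact: exprn_measurable.
have := @markov _ _ _ P F (fun x => x ^+ p.*2) t t0 mX.
have -> : [set x | (t%:E <= `|(F x)%:E|)%E] = [set w | t <= `|f w|].
  by apply/seteqP; split => w /=; rewrite lee_fin.
move=> /(_ (fun r r0 => exprn_ge0 _ r0)) h.
have tp : 0 < t ^+ p.*2 by rewrite exprn_gt0.
rewrite EFinM lee_pdivlMr // muleC; apply: le_trans (h _) _.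
  by move=> x y x0 y0 xy; rewrite lerXn2r.
have -> : ('E_P[(((fun x : R => (x ^+ p.*2)%R) \o Num.Def.normr) \o F)])%E =
    (\int[P]_w (f w ^+ p.*2))%:E.
  rewrite unlock /= fineK; last exact: integrable_fin_num.
  apply: eq_integral => w _ /=; congr EFin.
  by rewrite -mul2n !exprM real_normK // num_real.
by rewrite lee_fin.
Qed.

End Moments.

(** * Concentration of quadratic forms *)

Section QuadraticForms.
Context {R : realType} {d : measure_display} {T : measurableType d}.
Context (P : probability T R) (I : finType) (X : I -> T -> R[i]) (p : nat) (kappa : R).
Hypothesis mX : forall i, complex_rv (X i).
Hypothesis indX : mutually_independent P X.
Hypothesis p12 : p = 1%N \/ p = 2%N.
Local Notation Re := complex.Re.
Local Notation Im := complex.Im.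
Hypothesis Re0 : forall i, \int[P]_w Re (X i w) = 0.
Hypothesis Im0 : forall i, \int[P]_w Im (X i w) = 0.
Hypothesis Sq0 : forall i, \int[P]_w (Re (X i w) ^+ 2 + Im (X i w) ^+ 2 - 1) = 0.
Hypothesis mRe : forall i, moment_le P p (fun w => Re (X i w)) kappa.
Hypothesis mIm : forall i, moment_le P p (fun w => Im (X i w)) kappa.
Hypothesis mSq : forall i,
  moment_le P p (fun w => Re (X i w) ^+ 2 + Im (X i w) ^+ 2 - 1) kappa.
Hypothesis kappa0 : 0 <= kappa.

Let lin (s : seq I) (a b : I -> R) w := \sum_(j <- s) (a j * Re (X j w) + b j * Im (X j w)).

Lemma depends_bigsum (J : {set I}) (K : eqType) (s : seq K) (F : K -> T -> R) :
  (forall j, j \in s -> depends X J (F j)) ->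
  depends X J (fun w => \sum_(j <- s) F j w).
Proof.
elim: s => [|j s IH] h.
  by under eq_fun do rewrite big_nil; exact: depends_cst.
under eq_fun do rewrite big_cons; apply: dependsD.
  by apply: h; rewrite mem_head.
by apply: IH => k ks; apply: h; rewrite inE ks orbT.
Qed.

Let lin_depends s a b : depends X [set j in s] (lin s a b).
Proof.
apply: depends_bigsum => j js; apply: dependsD; apply: dependsM;
  try exact: depends_cst; by [apply: depends_Re; rewrite inE|apply: depends_Im; rewrite inE].
Qed.

Let orth_prod (J J' : {set I}) f g : {in J, forall i, i \notin J'} ->
  depends X J f -> depends X J' g -> Pint P f -> Pint P g ->
  \int[P]_w g w = 0 -> \int[P]_w (f w * g w) = 0.
Proof.
by move=> JJ' Jf Jg intf intg g0; have [_ ->] := depends_prod mX indX JJ' Jf Jg intf intg;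
  rewrite g0 mulr0.
Qed.

Let notin1 (x : I) (s : seq I) : x \notin s ->
  {in [set j in s], forall i, i \notin ([set x]%SET : {set I})}.
Proof.
by move=> xs i; rewrite inE => si; rewrite finset.in_set1; apply: contraNneq xs => <-.
Qed.

Let single_depends x a b : depends X [set x] (fun w => a * Re (X x w) + b * Im (X x w)).
Proof.
apply: dependsD; apply: dependsM; try exact: depends_cst;
  by [apply: depends_Re; rewrite inE|apply: depends_Im; rewrite inE].
Qed.

Let single_moment x a b :
  moment_le P p (fun w => a * Re (X x w) + b * Im (X x w)) (4 * (a ^+ 2 + b ^+ 2) * kappa).
Proof.
have := moment_leD p12 (moment_leZ a (mRe x)) (moment_leZ b (mIm x)).
by rewrite -mulrDl mulrA.
Qed.

Let single_mean x a b : \int[P]_w (a * Re (X x w) + b * Im (X x w)) = 0.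
Proof.
have iR := moment_le_integrable p12 (mRe x); have iI := moment_le_integrable p12 (mIm x).
rewrite RintegralD // ?RintegralZl // ?Re0 ?Im0 ?mulr0 ?addr0 //; exact: PintZ.
Qed.

Let p12' : p = 1%N \/ p = 2%N := p12.

Lemma moment_le0 : moment_le P p (fun=> 0) 0.
Proof.
have E : (0 : R) ^+ p.*2 = 0 by case: p12' => ->; rewrite expr0n.
split=> //; rewrite E; first exact: Pint_cst.
by rewrite Rintegral_cst // mul0r exprn_ge0.
Qed.

(** Revealing the variables one at a time gives orthogonal increments. *)
Lemma linear_form_moment s a b : uniq s ->
  moment_le P p (lin s a b) (16 * kappa * \sum_(j <- s) (a j ^+ 2 + b j ^+ 2)).
Proof.
elim: s => [_|x s IH /= /andP[xs us]].
  rewrite big_nil mulr0 /lin; under eq_fun do rewrite big_nil.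
  exact: moment_le0.
rewrite big_cons /lin; under eq_fun do rewrite big_cons addrC.
have -> : 16 * kappa * (a x ^+ 2 + b x ^+ 2 + \sum_(j <- s) (a j ^+ 2 + b j ^+ 2)) =
   16 * kappa * (\sum_(j <- s) (a j ^+ 2 + b j ^+ 2)) +
     4 * (4 * (a x ^+ 2 + b x ^+ 2) * kappa) by ring.
have Ms := IH us; have Mx := single_moment x (a x) (b x).
apply: (moment_le_orth p12' Ms Mx).
apply: (@orth_prod _ _ (fun w => lin s a b w ^+ p.*2.-1) _ (notin1 xs)).
- by apply: dependsX; exact: lin_depends.
- exact: single_depends.
- exact: moment_le_pred Ms.
- exact: moment_le_integrable Mx.
exact: single_mean.
Qed.

Variable A : I -> I -> R[i].
Hypothesis hermA : forall i j, A j i = (A i j)^*%C.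

Let quad (s : seq I) w :=
  \sum_(i <- s) \sum_(j <- s) Re (A i j * ((X i w)^*%C * X j w))
    - \sum_(i <- s) Re (A i i).

Let sq (z : R[i]) : R := Re z ^+ 2 + Im z ^+ 2.

Let W1 s x w := lin s (fun j => Re (A x j)) (fun j => - Im (A x j)) w.
Let W2 s x w := lin s (fun j => Im (A x j)) (fun j => Re (A x j)) w.

Let ReE (z x y : R[i]) : Re (z * (x^*%C * y)) =
  Re x * (Re z * Re y + - Im z * Im y) + Im x * (Im z * Re y + Re z * Im y).
Proof. by case: z => a b; case: x => c e; case: y => f g /=; ring. Qed.

Let ReC (z x y : R[i]) : Re (z^*%C * (y^*%C * x)) = Re (z * (x^*%C * y)).
Proof. by case: z => a b; case: x => c e; case: y => f g /=; ring. Qed.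

Let quad_cons x s w : quad (x :: s) w = quad s w +
  (Re (A x x) * (Re (X x w) ^+ 2 + Im (X x w) ^+ 2 - 1)
   + 2 * (Re (X x w) * W1 s x w + Im (X x w) * W2 s x w)).
Proof.
rewrite /quad !big_cons.
under [X in _ + X - _]eq_bigr do rewrite big_cons.
rewrite big_split /=.
have -> : \sum_(i <- s) Re (A i x * ((X i w)^*%C * X x w)) =
   \sum_(j <- s) Re (A x j * ((X x w)^*%C * X j w)).
  by apply: eq_bigr => i _; rewrite -[RHS]ReC -hermA.
have -> : \sum_(j <- s) Re (A x j * ((X x w)^*%C * X j w)) =
   Re (X x w) * W1 s x w + Im (X x w) * W2 s x w.
  rewrite /W1 /W2 /lin !mulr_sumr -big_split /=.
  by apply: eq_bigr => j _; rewrite ReE.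
have -> : Re (A x x * ((X x w)^*%C * X x w)) = Re (A x x) * (Re (X x w) ^+ 2 + Im (X x w) ^+ 2).
  have ImA : Im (A x x) = 0.
    have := congr1 (@complex.Im R) (hermA x x); case: (A x x) => a b /= h.
    by apply/eqP; rewrite -[_ == _](mulrn_eq0 _ 2) mulr2n {1}h addNr.
  by rewrite ReE ImA; ring.
by ring.
Qed.

Let quad_depends s : depends X [set j in s] (quad s).
Proof.
apply: dependsD; last exact: depends_cst.
apply: depends_bigsum => i si; apply: depends_bigsum => j sj.
have E : (fun w => Re (A i j * ((X i w)^*%C * X j w))) = (fun w =>
    Re (X i w) * (Re (A i j) * Re (X j w) + - Im (A i j) * Im (X j w))
    + Im (X i w) * (Im (A i j) * Re (X j w) + Re (A i j) * Im (X j w))).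
  by apply/funext => w; rewrite ReE.
rewrite [X in depends _ _ X]E.
have hR k : k \in s -> depends X [set j in s] (fun w => Re (X k w)).
  by move=> ks; apply: depends_Re; rewrite inE.
have hI k : k \in s -> depends X [set j in s] (fun w => Im (X k w)).
  by move=> ks; apply: depends_Im; rewrite inE.
apply: dependsD; apply: dependsM; try exact: hR; try exact: hI;
 apply: dependsD; apply: dependsM; try exact: depends_cst; try exact: hR; exact: hI.
Qed.

(** The increments of a quadratic form when the variables are revealed one at a
    time are orthogonal to the past, so the bounds on their moments add up. *)
Lemma quadratic_form_moment s : uniq s ->
  moment_le P p (quad s) (4 * (4 * kappa + 64 * 32 * kappa ^+ 2) *
     \sum_(i <- s) \sum_(j <- s) sq (A i j)).
Proof.
set K0 := 4 * kappa + _; have sq0 z : 0 <= sq z by rewrite addr_ge0 ?sqr_ge0.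
have K00 : 0 <= K0.
  by apply: addr_ge0; apply: mulr_ge0; rewrite ?sqr_ge0 ?mulr_ge0 ?ler0n.
elim: s => [_|x s IH /= /andP[xs us]].
  rewrite big_nil mulr0 /quad; under eq_fun do rewrite !big_nil subr0.
  exact: moment_le0.
have Ms := IH us; set S := \sum_(j <- s) sq (A x j).
have S0 : 0 <= S by exact: sumr_ge0.
rewrite (funext (quad_cons x s)).
have mW1 : moment_le P p (W1 s x) (16 * kappa * S).
  have := linear_form_moment (fun j => Re (A x j)) (fun j => - Im (A x j)) us.
  by under eq_bigr do rewrite sqrrN.
have mW2 : moment_le P p (W2 s x) (16 * kappa * S).
  have := linear_form_moment (fun j => Im (A x j)) (fun j => Re (A x j)) us.
  by under eq_bigr do rewrite addrC.
have xs' : {in ([set x]%SET : {set I}), forall i, i \notin [set j in s]}.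
  by move=> i; rewrite finset.in_set1 => /eqP ->; rewrite inE.
have dR : depends X [set x] (fun w => Re (X x w)) by apply: depends_Re; rewrite inE.
have dI : depends X [set x] (fun w => Im (X x w)) by apply: depends_Im; rewrite inE.
have dQ : depends X [set x] (fun w => Re (X x w) ^+ 2 + Im (X x w) ^+ 2 - 1).
  by apply: dependsD; [apply: dependsD; exact: dependsX|exact: depends_cst].
have dW1 : depends X [set j in s] (W1 s x) by exact: lin_depends.
have dW2 : depends X [set j in s] (W2 s x) by exact: lin_depends.
have m1 := moment_le_prod mX indX xs' dR dW1 (mRe x) mW1.
have m2 := moment_le_prod mX indX xs' dI dW2 (mIm x) mW2.
have m3 := moment_leZ 2 (moment_leD p12 m1 m2).
have m4 := moment_leZ (Re (A x x)) (mSq x).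
have m5 := moment_leD p12 m4 m3.
have m5' := moment_le_ge _ m5; move/(_ (K0 * (sq (A x x) + S))) in m5'.
have {m5'} m6 := m5' _; rewrite !big_cons.
have := @moment_le_orth _ _ _ P p p12 _ _ _ _ Ms (m6 _) _.
move=> h; apply: moment_le_ge (h _ _).
- under [X in _ <= _ * (_ + X)]eq_bigr do rewrite big_cons.
  rewrite [X in _ <= _ * (_ + X)]big_split /= -/S.
  have S'0 : 0 <= \sum_(i <- s) sq (A i x) by exact: sumr_ge0.
  rewrite [4 * (K0 * _)]mulrA -mulrDr ler_wpM2l ?mulr_ge0 //.
  by lra.
- rewrite mulrDr /K0 /sq.
  have : 0 <= kappa * (Im (A x x)) ^+ 2 by rewrite mulr_ge0 // sqr_ge0.
  have : 0 <= kappa * S by rewrite mulr_ge0.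
  have : 0 <= kappa ^+ 2 * (Re (A x x) ^+ 2 + Im (A x x) ^+ 2).
    by rewrite mulr_ge0 ?sqr_ge0 // addr_ge0 ?sqr_ge0.
  by rewrite -/S; nra.
set Q := fun w => quad s w ^+ p.*2.-1.
have dQs : depends X [set j in s] Q by apply: dependsX; exact: quad_depends.
have iQ : Pint P Q by exact: moment_le_pred Ms.
have i1 := moment_le_cross p12 Ms mW1; have i2 := moment_le_cross p12 Ms mW2.
have ns := notin1 xs.
have dQW1 : depends X [set j in s] (fun w => Q w * W1 s x w).
  by exact: dependsM.
have dQW2 : depends X [set j in s] (fun w => Q w * W2 s x w).
  by exact: dependsM.
have iR := moment_le_integrable p12 (mRe x); have iI := moment_le_integrable p12 (mIm x).
have iS := moment_le_integrable p12 (mSq x).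
have [j1 e1] := depends_prod mX indX ns dQs dQ iQ iS.
have [j2 e2] := depends_prod mX indX ns dQW1 dR i1 iR.
have [j3 e3] := depends_prod mX indX ns dQW2 dI i2 iI.
rewrite Sq0 mulr0 in e1; rewrite Re0 mulr0 in e2; rewrite Im0 mulr0 in e3.
transitivity (\int[P]_w (Re (A x x) * (Q w * (Re (X x w) ^+ 2 + Im (X x w) ^+ 2 - 1)) +
   2 * (Q w * W1 s x w * Re (X x w) + Q w * W2 s x w * Im (X x w)))).
  by apply: eq_Rintegral => w _; rewrite /Q; ring.
rewrite RintegralD //; [|exact: PintZ|by apply: PintZ; exact: PintD].
rewrite !RintegralZl //; last exact: PintD.
by rewrite RintegralD // e1 e2 e3 addr0 !mulr0 addr0.
Qed.

End QuadraticForms.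

(** * A matrix Chernoff bound *)

Lemma psdmx_diag (R : realType) n (D : 'rV[R[i]]_n) :
  (forall i, 0 <= D 0 i) -> psdmx (diag_mx D).
Proof.
move=> D0; split.
  apply/adjmx_hermP/matrixP => i j; rewrite adjmxE !mxE eq_sym.
  have [->|ij] := eqVneq i j; last by rewrite !mulr0n rmorph0.
  by rewrite !mulr1n; have /ger0_real/CrealP := D0 j.
move=> v; rewrite -/(qform _ _) qform_diag sumr_ge0 // => i _.
by rewrite mulr_ge0 // exprn_ge0.
Qed.

Lemma markov_Rintegral (R : realType) d (T : measurableType d) (P : probability T R)
    (f : T -> R) (t : R) : Pint P f -> (forall w, 0 <= f w) -> 0 < t ->
  (P [set w | (t <= f w)%R] <= ((\int[P]_w f w) / t)%:E)%E.
Proof.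
move=> intf f0 t0; have mf := Pint_meas intf.
pose F : {RV P >-> R} := mfun_Sub (mem_set mf).
have mid : measurable_fun [set: R] (id : R -> R) by exact: measurable_id.
have := @markov _ _ _ P F id t t0 mid (fun _ h => h) (fun _ _ _ _ h => h).
have -> : [set x | (t%:E <= `|(F x)%:E|)%E] = [set w | t <= f w].
  by apply/seteqP; split => w /=; rewrite lee_fin ger0_norm.
move=> h; rewrite EFinM lee_pdivlMr // muleC; apply: le_trans h _.
rewrite unlock /Rintegral fineK; last exact: integrable_fin_num.
rewrite le_eqVlt; apply/orP; left; apply/eqP.
by apply: eq_integral => w _ /=; rewrite ger0_norm.
Qed.

Section BoundedMatrices.
Context {R : realType} {d : measure_display} {T : measurableType d}.
Context {I : finType} (X : I -> T -> R[i]).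
Local Notation C := R[i].
Local Notation Re := complex.Re.
Local Notation Im := complex.Im.

(** Boundedness makes every polynomial in such functions integrable. *)
Definition bounded_dep (J : {set I}) (f : T -> C) : Prop :=
  [/\ depends X J (fun w => Re (f w)), depends X J (fun w => Im (f w)) &
      exists c : R, forall w, `|Re (f w)| <= c /\ `|Im (f w)| <= c].

Lemma bounded_dep_cst J c : bounded_dep J (fun=> c).
Proof.
split; try exact: depends_cst.
by exists (`|Re c| + `|Im c|) => _; rewrite lerDl lerDr !normr_ge0.
Qed.

Lemma bounded_depD J f g : bounded_dep J f -> bounded_dep J g ->
  bounded_dep J (fun w => f w + g w).
Proof.
move=> [f1 f2 [c fc]] [g1 g2 [e ge]].
have E1 w : Re (f w + g w) = Re (f w) + Re (g w) by case: (f w); case: (g w).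
have E2 w : Im (f w + g w) = Im (f w) + Im (g w) by case: (f w); case: (g w).
split; [by rewrite (funext E1); exact: dependsD|by rewrite (funext E2); exact: dependsD|].
exists (c + e) => w; rewrite E1 E2; have [a1 a2] := fc w; have [b1 b2] := ge w.
by split; apply: le_trans (ler_normD _ _) _; exact: lerD.
Qed.

Lemma bounded_depM J f g : bounded_dep J f -> bounded_dep J g ->
  bounded_dep J (fun w => f w * g w).
Proof.
move=> [f1 f2 [c fc]] [g1 g2 [e ge]].
have E1 w : Re (f w * g w) = Re (f w) * Re (g w) + (-1) * (Im (f w) * Im (g w)).
  by case: (f w) => a b; case: (g w) => a' b' /=; ring.
have E2 w : Im (f w * g w) = Re (f w) * Im (g w) + Im (f w) * Re (g w).
  by case: (f w) => a b; case: (g w) => a' b' /=; ring.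
split.
- rewrite (funext E1); apply: dependsD; first exact: dependsM.
  by apply: dependsM; [exact: depends_cst|exact: dependsM].
- by rewrite (funext E2); apply: dependsD; exact: dependsM.
exists (c * e + c * e) => w; rewrite E1 E2; have [a1 a2] := fc w; have [b1 b2] := ge w.
by split; apply: le_trans (ler_normD _ _) _; rewrite ?mulN1r ?normrN !normrM;
  apply: lerD; apply: ler_pM.
Qed.

Lemma bounded_dep_conj J f : bounded_dep J f -> bounded_dep J (fun w => (f w)^*%C).
Proof.
move=> [f1 f2 [c fc]].
have E1 w : Re ((f w)^*%C) = Re (f w) by case: (f w).
have E2 w : Im ((f w)^*%C) = (-1) * Im (f w) by case: (f w) => a b /=; ring.
split; [by rewrite (funext E1)|rewrite (funext E2)|].
  by apply: dependsM => //; exact: depends_cst.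
by exists c => w; rewrite E1 E2 mulN1r normrN; exact: fc.
Qed.

Lemma bounded_dep_sum J (K : eqType) (s : seq K) (P : pred K) (F : K -> T -> C) :
  (forall k, P k -> bounded_dep J (F k)) ->
  bounded_dep J (fun w => \sum_(k <- s | P k) F k w).
Proof.
move=> h; elim: s => [|k s IH].
  by under eq_fun do rewrite big_nil; exact: bounded_dep_cst.
under eq_fun do rewrite big_cons; case: (boolP (P k)) => [Pk|_] //.
by apply: bounded_depD => //; exact: h.
Qed.

Definition bounded_mx (J : {set I}) m n (M : T -> 'M[C]_(m, n)) : Prop :=
  forall a b, bounded_dep J (fun w => M w a b).

Lemma bounded_mxM J m n q (M : T -> 'M[C]_(m, n)) (M' : T -> 'M[C]_(n, q)) :
  bounded_mx J M -> bounded_mx J M' -> bounded_mx J (fun w => M w *m M' w).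
Proof.
move=> h h' a b; under eq_fun do rewrite mxE.
by apply: bounded_dep_sum => k _; apply: bounded_depM.
Qed.

Lemma bounded_mxD J m n (M M' : T -> 'M[C]_(m, n)) :
  bounded_mx J M -> bounded_mx J M' -> bounded_mx J (fun w => M w + M' w).
Proof. by move=> h h' a b; under eq_fun do rewrite mxE; exact: bounded_depD. Qed.

Lemma bounded_mx_cst J m n (M : 'M[C]_(m, n)) : bounded_mx J (fun=> M).
Proof. by move=> a b; exact: bounded_dep_cst. Qed.

Lemma bounded_mxX J n (M : T -> 'M[C]_n) p :
  bounded_mx J M -> bounded_mx J (fun w => M w ^+ p).
Proof.
move=> h; elim: p => [|p IH]; first exact: bounded_mx_cst.
by under eq_fun do rewrite exprS -mulmxE; exact: bounded_mxM.
Qed.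

Lemma bounded_mx_adj J m n (M : T -> 'M[C]_(m, n)) :
  bounded_mx J M -> bounded_mx J (fun w => (M w) ^t*).
Proof. by move=> h a b; under eq_fun do rewrite adjmxE; exact: bounded_dep_conj. Qed.

Lemma bounded_mx_sum J m n (K : eqType) (s : seq K) (P : pred K) (F : K -> T -> 'M[C]_(m, n)) :
  (forall k, P k -> bounded_mx J (F k)) ->
  bounded_mx J (fun w => \sum_(k <- s | P k) F k w).
Proof.
move=> h a b; under eq_fun do rewrite summxE.
by apply: bounded_dep_sum => k Pk; exact: h.
Qed.

Lemma bounded_mx_trace J n (M : T -> 'M[C]_n) :
  bounded_mx J M -> bounded_dep J (fun w => \tr (M w)).
Proof. by move=> h; apply: bounded_dep_sum => k _. Qed.

Lemma bounded_dep_sub (J J' : {set I}) f : J \subset J' -> bounded_dep J f ->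
  bounded_dep J' f.
Proof.
by move=> JJ' [f1 f2 fc]; split=> //; [exact: depends_sub f1|exact: depends_sub f2].
Qed.

End BoundedMatrices.

(** The vectors [yo k] are independent, [y k] is a truncation of [yo k] bounded by [l], and the
    covariance of [yo k] is at most [sigma]. Truncation destroys the covariance, but only
    domination of [y k] by [yo k] in quadratic forms is used. *)
Section Chernoff.
Context {R : realType} {d : measure_display} {T : measurableType d}.
Context (P : probability T R) {I K : finType} (X : I -> T -> R[i]).
Local Notation C := R[i].
Local Notation Re := complex.Re.
Local Notation Im := complex.Im.
Hypothesis mX : forall i, complex_rv (X i).
Hypothesis indX : mutually_independent P X.
Variables (row : I -> K) (n : nat) (yo y : K -> T -> 'cV[C]_n) (l sigma : R).
Let own k : {set I} := [set i | row i == k].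
Let others k : {set I} := [set i | row i != k].
Hypothesis yoRe : forall k a b,
  depends X (own k) (fun w => Re ((yo k w a 0)^*%C * yo k w b 0)).
Hypothesis yoIm : forall k a b,
  depends X (own k) (fun w => Im ((yo k w a 0)^*%C * yo k w b 0)).
Hypothesis iyoRe : forall k a b, Pint P (fun w => Re ((yo k w a 0)^*%C * yo k w b 0)).
Hypothesis iyoIm : forall k a b, Pint P (fun w => Im ((yo k w a 0)^*%C * yo k w b 0)).
Hypothesis EyoRe0 : forall k a b, a != b ->
  \int[P]_w Re ((yo k w a 0)^*%C * yo k w b 0) = 0.
Hypothesis EyoIm0 : forall k a b, \int[P]_w Im ((yo k w a 0)^*%C * yo k w b 0) = 0.
Hypothesis Eyo : forall k a, \int[P]_w Re ((yo k w a 0)^*%C * yo k w a 0) <= sigma.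
Hypothesis yb : forall k, bounded_mx X (own k) (y k).
Hypothesis y_yo : forall k w, y k w = yo k w \/ y k w = 0.
Hypothesis yl : forall k w, sqn (y k w) <= l%:C.
Hypothesis l0 : 0 <= l.
Hypothesis sigma0 : 0 <= sigma.

Let dis k : {in others k, forall i, i \notin own k}.
Proof. by move=> i; rewrite !finset.inE. Qed.

Let bint J f : bounded_dep X J f -> Pint P (fun w => Re (f w)) /\ Pint P (fun w => Im (f w)).
Proof.
move=> [f1 f2 [c fc]]; split.
  by apply: (@Pint_bounded _ _ _ _ _ c) => [|w]; [exact: depends_measurable f1|have [] := fc w].
by apply: (@Pint_bounded _ _ _ _ _ c) => [|w]; [exact: depends_measurable f2|have [] := fc w].
Qed.

Let Re_le (z z' : C) : z <= z' -> Re z <= Re z'.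
Proof. by rewrite lecE => /andP[]. Qed.

Let ReD (z z' : C) : Re (z + z') = Re z + Re z'. Proof. by case: z; case: z'. Qed.

Let Re_sum (L : Type) (s : seq L) (F : L -> C) : Re (\sum_(k <- s) F k) = \sum_(k <- s) Re (F k).
Proof.
by elim: s => [|k s IH]; rewrite ?big_nil // !big_cons ReD IH.
Qed.

(** Given the other rows, the vector [yo k] enters only through its covariance. *)
Let row_bound k (V : T -> 'M[C]_n) : bounded_mx X (others k) V ->
  (forall w, psdmx (V w)) ->
  Pint P (fun w => Re (qform (V w) (yo k w))) /\
  \int[P]_w Re (qform (V w) (yo k w)) <= sigma * \int[P]_w Re (\tr (V w)).
Proof.
move=> bV pV.
pose F a b w := Re (V w a b) * Re ((yo k w a 0)^*%C * yo k w b 0) +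
   (-1) * (Im (V w a b) * Im ((yo k w a 0)^*%C * yo k w b 0)).
have FE w : Re (qform (V w) (yo k w)) = \sum_(b < n) \sum_(a < n) F a b w.
  rewrite /qform mxE Re_sum; apply: eq_bigr => b _.
  rewrite mxE mulr_suml Re_sum; apply: eq_bigr => a _; rewrite /F adjmxE.
  by case: (yo k w a 0) => u v; case: (V w a b) => u' v'; case: (yo k w b 0) => u2 v2 /=; ring.
have HF a b : Pint P (F a b) /\ \int[P]_w F a b w =
    (\int[P]_w Re (V w a b)) * (\int[P]_w Re ((yo k w a 0)^*%C * yo k w b 0)).
  have [v1 v2 _] := bV a b; have [i1 i2] := bint (bV a b).
  have [j1 e1] := depends_prod mX indX (@dis k) v1 (@yoRe k a b) i1 (@iyoRe k a b).
  have [j2 e2] := depends_prod mX indX (@dis k) v2 (@yoIm k a b) i2 (@iyoIm k a b).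
  rewrite EyoIm0 mulr0 in e2; split; first by apply: PintD => //; exact: PintZ.
  by rewrite RintegralD //; [rewrite e1 RintegralZl // e2 mulr0 addr0|exact: PintZ].
rewrite (funext FE).
have iF b : Pint P (fun w => \sum_(a < n) F a b w) by apply: Pint_sum => a; have [] := HF a b.
split; first exact: Pint_sum.
rewrite Rintegral_fsum //.
under eq_bigr => b _.
  rewrite Rintegral_fsum; last by move=> a; have [] := HF a b.
  rewrite (bigD1 b) //= big1 ?addr0; last first.
    by move=> a ab; have [_ ->] := HF a b; rewrite EyoRe0 // mulr0.
  rewrite (HF b b).2.
  over.
have -> : \int[P]_w Re (\tr (V w)) = \sum_(b < n) \int[P]_w Re (V w b b).
  under eq_Rintegral do rewrite Re_sum.
  by rewrite Rintegral_fsum // => b; have [] := bint (bV b b).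
rewrite mulr_sumr; apply: ler_sum => b _; rewrite mulrC.
apply: ler_wpM2r; last exact: Eyo.
apply: Rintegral_ge0 => w _.
have [_ /(_ (delta_mx b 0))] := pV w.
rewrite trmx_delta map_delta_mx -rowE -colE !mxE; exact: Re_le.
Qed.

Let S w := \sum_k y k w *m (y k w) ^t*.
Let S' k w := \sum_(j | j != k) y j w *m (y j w) ^t*.

Let psdS w : psdmx (S w).
Proof. by apply: psdmx_sum => k; exact: psdmx_rank1. Qed.

Let psdS' k w : psdmx (S' k w).
Proof. by apply: psdmx_sum => j; exact: psdmx_rank1. Qed.

Let ge0C (x : R) : 0 <= x -> 0 <= x%:C :> C. Proof. by rewrite ler0c. Qed.

Let psd_pow (V : 'M[C]_n) q : psdmx V -> psdmx (V ^+ q).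
Proof.
move=> pV; have [U hU VU] := sorted_spectral pV.1.
have d0 := psdmxE hU VU pV; set e := \row__ _ in VU d0.
rewrite VU (spectral_pow _ _ hU); set D := map_mx (fun z => z ^+ q) e.
have -> : U ^t* *m diag_mx D *m U = U ^t* *m diag_mx D *m (U ^t*) ^t* by rewrite trmxCK.
apply: psdmx_congr.
apply: psdmx_diag => i; rewrite [D 0 i]mxE exprn_ge0 //; exact: d0.
Qed.

Let bmx_sub (J J' : {set I}) m q (M : T -> 'M[C]_(m, q)) :
  J \subset J' -> bounded_mx X J M -> bounded_mx X J' M.
Proof. by move=> JJ' h a b; exact: bounded_dep_sub (h a b). Qed.

Let bS : bounded_mx X [set: I]%SET S.
Proof.
apply: bounded_mx_sum => k _; apply: bounded_mxM; last apply: bounded_mx_adj;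
  by apply: (bmx_sub _ (@yb k)); exact: finset.subsetT.
Qed.

Let bS' k : bounded_mx X (others k) (S' k).
Proof.
apply: bounded_mx_sum => j jk; have sub : own j \subset others k.
  by apply/fintype.subsetP => i; rewrite !finset.inE => /eqP ->.
by apply: bounded_mxM; last apply: bounded_mx_adj; exact: (bmx_sub _ (@yb j)).
Qed.

Let bp J (M : T -> 'M[C]_n) s q : bounded_mx X J M ->
  bounded_mx X J (fun w => (M w + (s : C)%:M) ^+ q).
Proof.
by move=> h; apply: bounded_mxX; apply: bounded_mxD => //; exact: bounded_mx_cst.
Qed.

Let F q s := \int[P]_w Re (\tr ((S w + (s%:C)%:M) ^+ q)).

Let iF q s : Pint P (fun w => Re (\tr ((S w + (s%:C)%:M) ^+ q))).
Proof. by have [] := bint (bounded_mx_trace (bp (s%:C) q bS)). Qed.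

Let herm_shift (M : 'M[C]_n) s : psdmx M -> 0 <= s -> M + (s%:C)%:M \is hermsymmx.
Proof. by move=> pM s0; have [] := psdmx_shift pM (ge0C s0). Qed.

Let qform_shift (M M' : 'M[C]_n) (s s' : R) : s <= s' ->
  (forall v, qform M v <= qform M' v) ->
  forall v, qform (M + (s%:C)%:M) v <= qform (M' + (s'%:C)%:M) v.
Proof.
move=> ss MM v; rewrite !qformD -[(s%:C)%:M]scalemx1 -[(s'%:C)%:M]scalemx1 !qformZ qform1.
by rewrite lerD // ler_wpM2r ?sqn_ge0 // lecR.
Qed.

Let step q s : 0 <= s -> F q.+1 s <= (s + #|K|%:R * sigma) * F q (s + l).
Proof.
move=> s0; have sl0 : 0 <= s + l by rewrite addr_ge0.
pose V k w := (S' k w + ((s + l)%:C)%:M) ^+ q.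
have bV k : bounded_mx X (others k) (V k) by exact: bp.
have pV k w : psdmx (V k w) by apply: psd_pow; apply: psdmx_shift => //; exact: ge0C.
have rb k := row_bound (bV k) (pV k).
have pt w : Re (\tr ((S w + (s%:C)%:M) ^+ q.+1)) <=
    s * Re (\tr ((S w + ((s + l)%:C)%:M) ^+ q)) + \sum_k Re (qform (V k w) (yo k w)).
  have h := trace_pow_step q (ge0C s0) (fun k => yl k w) (erefl (S w)).
  apply: le_trans (Re_le h) _; rewrite ReD Re_sum; apply: lerD.
    have -> (z : C) : Re (s%:C * z) = s * Re z by case: z => a b /=; rewrite mul0r subr0.
    rewrite ler_wpM2l //; apply: Re_le; apply: trace_pow_mono.
    - by apply: psdmx_shift => //; exact: ge0C.
    - exact: herm_shift.
    - by apply: qform_shift => //; rewrite lerDl.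
  apply: ler_sum => k _; apply: Re_le.
  have -> : s%:C + l%:C = (s + l)%:C :> C by rewrite rmorphD.
  have [->|->] := y_yo k w; first by [].
  rewrite {1}/qform mulmx0 mxE; have [_] := pV k w; exact.
have iV : Pint P (fun w => \sum_k Re (qform (V k w) (yo k w))).
  by apply: Pint_sum => k; have [] := rb k.
have is' := PintZ s (iF q (s + l)).
apply: le_trans (le_Rintegral measurableT (iF _ _) (PintD is' iV) (fun w _ => pt w)) _.
rewrite RintegralD // RintegralZl // -/(F q (s + l)) mulrDl lerD2l.
rewrite Rintegral_fsum; last by move=> k; have [] := rb k.
rewrite -mulrA -sum1_card natr_sum mulr_suml.
under [leRHS]eq_bigr do rewrite mul1r.
apply: ler_sum => k _; have [_ h] := rb k; apply: le_trans h _.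
apply: (ler_wpM2l sigma0).
apply: (le_Rintegral measurableT (bint (bounded_mx_trace (bV k))).1 (iF _ _)).
move=> w _; apply: Re_le; apply: trace_pow_mono.
- by apply: psdmx_shift => //; exact: ge0C.
- exact: herm_shift.
apply: qform_shift => [|v]; first exact: lexx.
rewrite /S (bigD1 k) //= qformD lerDr.
have [_] := psdmx_rank1 (y k w); exact.
Qed.

Let Fbound q s : 0 <= s -> F q s <= n%:R * (s + #|K|%:R * sigma + q%:R * l) ^+ q.
Proof.
have Ks : 0 <= #|K|%:R * sigma by rewrite mulr_ge0.
elim: q s => [|q IH] s s0.
  rewrite /F; under eq_Rintegral do rewrite expr0 mxtrace1.
  rewrite Rintegral_cst // [X in _ * fine X]probability_setT mulr1 expr0 mulr1.
  by have <- : (n%:R : R)%:C = n%:R :> C by rewrite rmorph_nat.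
have sl : 0 <= s + l by rewrite addr_ge0.
apply: le_trans (step q s0) _; have := IH _ sl.
have -> : s + l + #|K|%:R * sigma + q%:R * l = s + #|K|%:R * sigma + q.+1%:R * l.
  by rewrite -natr1; ring.
set B := s + _ + _ => h.
have sB : s + #|K|%:R * sigma <= B by rewrite /B lerDl mulr_ge0.
have s'0 : 0 <= s + #|K|%:R * sigma by rewrite addr_ge0.
apply: le_trans (ler_wpM2l s'0 h) _.
rewrite exprS mulrCA ler_wpM2l // ler_wpM2r // exprn_ge0 //.
exact: le_trans sB.
Qed.

(** A matrix Chernoff bound: each factor [S] in [E tr S^q] costs at most the norm of
    the mean plus [q] times the size of a summand. *)
Lemma trace_pow_tail q (b : R) : (0 < q)%N -> #|K|%:R * sigma + q%:R * l <= b -> 0 < b ->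
  exists2 B : set T, measurable B &
    (P B <= (n%:R * 2 ^- q)%:E)%E /\
    forall w, ~ B w -> forall v, qform (S w) v <= (2 * b)%:C * sqn v.
Proof.
move=> q0 hb b0; have Ks : 0 <= #|K|%:R * sigma by rewrite mulr_ge0.
pose f w := Re (\tr (S w ^+ q)).
have SE w : S w = S w + ((0 : R)%:C)%:M by rewrite raddf0 addr0.
have fE w : f w = Re (\tr ((S w + ((0 : R)%:C)%:M) ^+ q)) by rewrite -SE.
have intf : Pint P f by rewrite (funext fE).
have mf := Pint_meas intf.
have tr0 w : \tr (S w ^+ q) = (f w)%:C.
  by rewrite /f trace_pow; [|exact: (psdS w).1].
have f0 w : 0 <= f w.
  rewrite /f trace_pow; last exact: (psdS w).1.
  by rewrite /= sumr_ge0 // => i _; rewrite exprn_ge0 // eigval_ge0.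
have Ef : \int[P]_w f w <= n%:R * b ^+ q.
  have := Fbound q (lexx 0); rewrite /F add0r => h.
  rewrite (_ : \int[P]_w f w = \int[P]_w Re (\tr ((S w + ((0 : R)%:C)%:M) ^+ q))).
    apply: le_trans h _; rewrite ler_wpM2l // lerXn2r ?nnegrE ?(ltW b0) //.
    by rewrite addr_ge0 // mulr_ge0.
  by apply: eq_Rintegral => w _; rewrite fE.
exists [set w | (2 * b) ^+ q <= f w].
  by rewrite -[X in measurable X]setTI; exact: measurable_fun_le.
have b2 : 0 < (2 * b) ^+ q by rewrite exprn_gt0 // mulr_gt0.
split.
  apply: le_trans (markov_Rintegral intf f0 b2) _; rewrite lee_fin.
  rewrite exprMn invfM mulrA ler_pdivrMr ?exprn_gt0 //.
  by rewrite mulrAC ler_wpM2r // invr_ge0 exprn_ge0.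
move=> w; rewrite /= => /negP; rewrite -ltNge => fb v.
apply: (@qform_le_trace_pow _ _ _ q) => //; first by rewrite mulr_ge0 // ltW.
by rewrite tr0 lecR ltW.
Qed.

End Chernoff.

(** * Slowly varying functions *)

Section UniformConvergence.
Variable R : realType.
Notation mu := (@lebesgue_measure R).

Lemma lebesgue_measure_translate (a : R) (A : set R) : measurable A ->
  mu [set x | A (x + a)] = mu A.
Proof.
move=> mA; pose f : measurableTypeR R -> measurableTypeR R := fun x : R => x + a.
have mf : measurable_fun [set: measurableTypeR R] (f : measurableTypeR R -> measurableTypeR R).
  by apply: measurable_funD => //; exact: measurable_cst.
pose F : {mfun (measurableTypeR R) >-> (measurableTypeR R)} :=
  @mfun_Sub _ _ (measurableTypeR R) (measurableTypeR R) f (mem_set mf).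
have := @lebesgue_measure_unique R (pushforward mu F) _ A mA; move=> -> //.
move=> X [[b c] _ <-] /=; rewrite /pushforward.
have -> : f @^-1` `]b, c] = [set` `]b - a, c - a]].
  by apply/seteqP; split => x; rewrite /f /= !in_itv /= ltrBlDr lerBrDr.
rewrite !lebesgue_measure_itv /= !lte_fin ltrD2r; case: ifP => // _.
by rewrite -!EFinB; congr EFin; ring.
Qed.

Variable g : R -> R.
Hypothesis mg : measurable_fun setT g.
Hypothesis ginc : forall u, g (x + u) - g x @[x --> +oo] --> 0.

Let tame (e : R) (a : nat -> R) n : set R :=
  [set v | 0 <= v <= 2 /\ forall m, (n <= m)%N -> `|g (a m + v) - g (a m)| <= e].

Let m_tame e a n : measurable (tame e a n).
Proof.
have -> : tame e a n = `[0, 2]%classic `&`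
    \bigcap_(m in [set m | (n <= m)%N]) [set v | `|g (a m + v) - g (a m)| <= e].
  by apply/seteqP; split => v /=; rewrite in_itv /=.
apply: measurableI => //; apply: bigcap_measurable => [|m _]; first by exists n => /=.
rewrite -[X in measurable X]setTI; apply: measurable_fun_le => //.
apply: measurableT_comp => //; apply: measurable_funB => //.
by apply: measurableT_comp => //; apply: measurable_funD => //; exact: measurable_cst.
Qed.

Let tame_big e a : 0 < e -> (forall m : nat, m%:R <= a m) ->
  exists n, ((3 / 2)%:E < mu (tame e a n))%E.
Proof.
move=> e0 am; apply: contrapT => /forallNP h.
have cvgU : \bigcup_n tame e a n = `[0, 2]%classic.
  apply/seteqP; split => v /=; first by move=> [n _ []]; rewrite in_itv.
  rewrite in_itv /= => v02.
  have := ginc v; move=> /cvgrPdist_le /(_ e e0) [M [Mr hM]].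
  exists (Num.truncn M).+1 => //; split=> // m nm.
  have := hM (a m); rewrite /= sub0r normrN; apply.
  apply: lt_le_trans (am m); apply: lt_le_trans (_ : (Num.truncn M).+1%:R <= _).
    exact: truncnS_gt.
  by rewrite ler_nat.
have m02 : mu `[0, 2]%classic = 2%:E.
  by rewrite lebesgue_measure_itv /= lte_fin ltr0n /= oppr0 adde0.
have cv2 : mu (tame e a n) @[n --> \oo] --> 2%:E.
  rewrite -m02 -cvgU; apply: nondecreasing_cvg_mu.
  - by move=> i; exact: m_tame.
  - by apply: bigcup_measurable => i _; exact: m_tame.
  move=> n m nm; apply/subsetPset => v [v02 hv]; split=> // k mk; apply: hv.
  exact: leq_trans mk.
have : (2%:E <= (3 / 2)%:E :> \bar R)%E.
  rewrite -(cvg_lim _ cv2) //; apply: lime_le; first by apply/cvg_ex; exists 2%:E.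
  by apply: nearW => n; rewrite leNgt; apply/negP; exact: h.
by rewrite lee_fin; lra.
Qed.

(** Karamata's uniform convergence theorem: two subsets of measure more than [3/2]
    of an interval of length [3] intersect. *)
Lemma uniform_increment e : 0 < e ->
  exists X, forall x u, X <= x -> 0 <= u <= 1 -> `|g (x + u) - g x| <= e.
Proof.
move=> e0; apply: contrapT => /forallNP h.
have bad (n : nat) : exists z : R * R, [/\ n%:R <= z.1, 0 <= z.2 <= 1
    & e < `|g (z.1 + z.2) - g z.1|].
  apply: contrapT => hn; apply: (h n%:R) => x u nx u01.
  by rewrite leNgt; apply/negP => eg; apply: hn; exists (x, u).
have [z hz] := choice bad.
have e2 : 0 < e / 2 by rewrite divr_gt0.
have [n1 hn1] := @tame_big (e / 2) (fun m => (z m).1) e2 (fun m => let: And3 a _ _ := hz m in a).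
have zm m : m%:R <= (z m).1 + (z m).2.
  by have [a /andP[b _] _] := hz m; apply: le_trans a _; rewrite lerDl.
have [n2 hn2] := @tame_big (e / 2) (fun m => (z m).1 + (z m).2) e2 zm.
pose n := maxn n1 n2; have [_ u01 bn] := hz n.
pose U := tame (e / 2) (fun m => (z m).1) n1.
pose W := [set w | tame (e / 2) (fun m => (z m).1 + (z m).2) n2 (w + - (z n).2)].
have mW : mu W = mu (tame (e / 2) (fun m => (z m).1 + (z m).2) n2).
  by apply: lebesgue_measure_translate; exact: m_tame.
have msW : measurable W.
  have mf : measurable_fun setT (fun w : R => w + - (z n).2).
    by apply: measurable_funD => //; exact: measurable_cst.
  rewrite -[W]setTI; apply: mf => //; exact: m_tame.
have disj : U `&` W = set0.
  apply/eqP; apply/negP => /negP/set0P [w [[_ h1] [_ h2]]].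
  have := h1 n (leq_maxl _ _); have := h2 n (leq_maxr _ _).
  have -> : (z n).1 + (z n).2 + (w - (z n).2) = (z n).1 + w by ring.
  move=> a b; move: bn; rewrite ltNge => /negP; apply.
  have -> : g ((z n).1 + (z n).2) - g (z n).1 = (g ((z n).1 + w) - g (z n).1) -
     (g ((z n).1 + w) - g ((z n).1 + (z n).2)) by ring.
  apply: le_trans (ler_normB _ _) _; have -> : e = e / 2 + e / 2 by field.
  exact: lerD.
have UW3 : (mu (U `|` W) <= 3%:E)%E.
  have -> : (3%:E : \bar R) = mu `[0, 3]%classic.
    by rewrite lebesgue_measure_itv /= lte_fin ltr0n /= oppr0 adde0.
  apply: le_measure; rewrite ?inE //; first by apply: measurableU => //; exact: m_tame.
  move=> w [[/andP[w0 w2] _]|[/andP[w0 w2] _]] /=; rewrite in_itv /=; move/andP: u01 => [u0 u1].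
    by rewrite w0 /=; lra.
  by apply/andP; split; lra.
have : (3%:E < mu U + mu W)%E.
  rewrite mW; have -> : (3%:E : \bar R) = ((3 / 2)%:E + (3 / 2)%:E)%E.
    by rewrite -EFinD; congr EFin; field.
  exact: lteD.
move: UW3; rewrite measureU //; last exact: m_tame.
by move=> UW3; rewrite ltNge => /negP; apply; exact: UW3.
Qed.

Lemma potter_log e : 0 < e ->
  exists X, forall x t, X <= x -> 0 <= t -> `|g (x + t) - g x| <= e * (t + 1).
Proof.
move=> e0; have [X hX] := uniform_increment e0; exists X => x t Xx t0.
suff H (m : nat) : forall x t, X <= x -> 0 <= t <= m%:R -> `|g (x + t) - g x| <= e * m%:R.
  have tl := truncnS_gt t; apply: le_trans (H (Num.truncn t).+1 x t Xx _) _.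
    by rewrite t0 ltW.
  by rewrite ler_pM2l // -natr1 lerD2r truncn_le.
elim: m => [|m IH] {Xx}x {t0}t Xx /andP[t0 tm].
  have -> : t = 0 by apply/eqP; rewrite eq_le t0 tm.
  by rewrite addr0 subrr normr0 mulr0.
have [t1|t1] := leP t 1.
  apply: le_trans (hX x t Xx _) _; first by rewrite t0.
  by apply: ler_peMr; [exact: ltW|rewrite ler1n].
have -> : g (x + t) - g x = (g ((x + 1) + (t - 1)) - g (x + 1)) + (g (x + 1) - g x).
  have -> : x + 1 + (t - 1) = x + t by ring.
  by ring.
apply: le_trans (ler_normD _ _) _; rewrite -natr1 mulrDr mulr1; apply: lerD.
  apply: IH; first by apply: le_trans Xx _; rewrite lerDl.
  by rewrite -natr1 in tm; apply/andP; split; lra.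
by apply: hX => //; rewrite ler01 lexx.
Qed.

End UniformConvergence.

(** In logarithmic coordinates the increments of [L] over bounded steps are uniformly
    small, and chaining unit steps bounds its growth by any power. *)
Lemma potter (R : realType) (L : R -> R) (e : R) : slowly_varying L -> 0 < e ->
  exists2 X : R, 1 <= X & forall x y, X <= x -> x <= y ->
    L y <= expR e * (y / x) `^ e * L x /\ L x <= expR e * (y / x) `^ e * L y.
Proof.
move=> [mL L0 Linc] e0; pose g x := ln (L (expR x)).
have Le0 x : 0 < L (expR x) by apply: L0; exact: expR_ge0.
have mg : measurable_fun setT g.
  apply: measurableT_comp; first exact: measurable_ln.
  have := @measurable_comp _ _ _ _ _ _ _ L setT expR (measurable_itv `[0, +oo[) _ mL.
  apply; last exact: measurable_expR.
  by move=> _ [x _ <-] /=; rewrite in_itv /= expR_ge0.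
have ginc u : g (x + u) - g x @[x --> +oo] --> 0.
  have h : L (expR u * expR x) / L (expR x) @[x --> +oo] --> (1 : R).
    apply: (@cvg_comp _ _ _ expR (fun x => L (expR u * x) / L x)) (Linc _ (expR_gt0 u)).
    apply/cvgryPge => A; exists A; split=> [|x Ax]; first exact: num_real.
  by apply: le_trans (expR_ge1Dx x); rewrite ler_wpDl // ltW.
  have h2 : ln (L (expR u * expR x) / L (expR x)) @[x --> +oo] --> (0 : R).
    rewrite -ln1; apply: continuous_cvg h; exact: continuous_ln.
  apply: cvg_trans h2; apply: near_eq_cvg; near=> x.
  rewrite /g lnM ?posrE ?invr_gt0 // ?lnV ?posrE //.
    by rewrite expRD mulrC.
  by rewrite -expRD.
have [X hX] := potter_log mg ginc e0.
exists (Num.max 1 (expR X)) => [|x y]; first by rewrite le_max lexx.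
rewrite ge_max => /andP[x1 Xx] xy; have x0 : 0 < x by apply: lt_le_trans x1.
have y0 : 0 < y by apply: lt_le_trans xy.
have := hX (ln x) (ln y - ln x); rewrite subr_ge0 ler_ln ?posrE // xy.
have -> : X <= ln x by rewrite -(ler_expR X) lnK ?posrE.
have -> : ln x + (ln y - ln x) = ln y by ring.
move=> /(_ isT isT); rewrite /g !lnK ?posrE //.
have -> : expR e * (y / x) `^ e = expR (e * (ln y - ln x + 1)).
  rewrite /powR gt_eqF ?divr_gt0 // -expRD lnM ?posrE ?invr_gt0 // lnV ?posrE //.
  by congr expR; ring.
have Lx : 0 < L x by apply: L0; exact: ltW.
have Ly : 0 < L y by apply: L0; exact: ltW.
rewrite ler_norml => /andP[h1 h2].
have Ex : L x = expR (ln (L x)) by rewrite lnK.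
have Ey : L y = expR (ln (L y)) by rewrite lnK.
by split; [rewrite [leLHS]Ey Ex|rewrite [leLHS]Ex Ey]; rewrite -expRD ler_expR ?expRK; lra.
Unshelve. all: by end_near.
Qed.

(** * Eigenvalue sums and operator norms *)

Section EigenvalueSums.
Variable R : realType.
Local Notation C := R[i].

Lemma realcM (x y : R) : (x * y)%:C = x%:C * y%:C :> C.
Proof. exact: rmorphM. Qed.

Lemma realcD (x y : R) : (x + y)%:C = x%:C + y%:C :> C.
Proof. exact: rmorphD. Qed.

Lemma realcX (x : R) k : (x ^+ k)%:C = x%:C ^+ k :> C.
Proof. exact: rmorphXn. Qed.

Lemma realc_nat k : (k%:R : R)%:C = k%:R :> C.
Proof. exact: rmorph_nat. Qed.

Let eigenvec n (U : 'M[C]_n) (k : 'I_n) : 'cV[C]_n := U ^t* *m delta_mx k 0.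

Let sqn_eigenvec n (U : 'M[C]_n) k : U \is unitarymx -> sqn (eigenvec U k) = 1.
Proof.
move=> hU; rewrite sqn_unitary ?trmxC_unitary // sqnE (bigD1 k) //= big1 => [|i ik].
  by rewrite mxE !eqxx normr1 expr1n addr0.
by rewrite mxE (negPf ik) normr0 expr0n.
Qed.

Let qform_eigenvec n (A U : 'M[C]_n) k : U \is unitarymx ->
  A = U ^t* *m diag_mx (\row_k (eigval k.+1 A)%:C) *m U ->
  qform A (eigenvec U k) = (eigval k.+1 A)%:C.
Proof.
move=> hU AU; rewrite (qform_spectral _ AU) /eigenvec mulmxA.
have /unitarymxP -> := hU; rewrite mul1mx (bigD1 k) //= big1 => [|i ik].
  by rewrite [_ 0 k]mxE mxE !eqxx normr1 expr1n mulr1 addr0.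
by rewrite [delta_mx _ _ _ _]mxE (negPf ik) normr0 expr0n mulr0.
Qed.

Lemma sum_first n (q : nat) (c : C) : (q <= n)%N ->
  \sum_(k < n | (k < q)%N) c = c *+ q.
Proof. by move=> qn; rewrite (big_ord_narrow qn) sumr_const card_ord. Qed.

(** The sum of the first eigenvalues, of [A = B + F], evaluated on the
    eigenvectors of [A]. *)
Lemma eigval_sum_le n (A B F : 'M[C]_n) q (b : R) (f : C) : A \is hermsymmx -> (q < n)%N ->
  A = B + F -> (forall v, qform B v <= b%:C * sqn v) ->
  (forall U : 'M[C]_n, U \is unitarymx ->
     \sum_(k < n | (k <= q)%N) qform F (U ^t* *m delta_mx k 0) <= f) ->
  (eigval q.+1 A)%:C *+ q.+1 <= b%:C *+ q.+1 + f.
Proof.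
move=> hA qn AE hB hF; have [U hU AU] := sorted_spectral hA.
apply: (@le_trans _ _ (\sum_(k < n | (k <= q)%N) qform A (eigenvec U k))).
  rewrite -(sum_first _ qn); apply: ler_sum => k kq.
  by rewrite (qform_eigenvec _ hU AU) lecR eigval_noninc // qn andbT.
rewrite AE; under eq_bigr do rewrite qformD; rewrite big_split /=; apply: lerD; last exact: hF.
rewrite -(sum_first _ qn); apply: ler_sum => k kq.
by apply: le_trans (hB _) _; rewrite sqn_eigenvec // mulr1.
Qed.

(** Schur's test for a matrix with entries bounded by a Toeplitz kernel. *)
Lemma schur_test n (B : 'M[C]_n) (b : R) : B \is hermsymmx ->
  (forall i, \sum_j `|B i j| <= b%:C) -> forall v, qform B v <= b%:C * sqn v.
Proof.
move=> hB hb v; have hB' := hB; move/adjmx_hermP in hB'.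
have sym i j : `|B i j| = `|B j i|.
  have /matrixP/(_ i j) := hB'; rewrite adjmxE => <-; exact: norm_conjC.
have amgm (x y : C) : `|x| * `|y| *+ 2 <= `|x| ^+ 2 + `|y| ^+ 2.
  have : 0 <= (`|x| - `|y|) ^+ 2 by rewrite real_exprn_even_ge0 // rpredB ?normr_real.
  have -> : (`|x| - `|y|) ^+ 2 = `|x| ^+ 2 + `|y| ^+ 2 - `|x| * `|y| *+ 2 by ring.
  by rewrite subr_ge0.
have h1 : `|qform B v| <= \sum_i \sum_j `|B j i| * (`|v j 0| * `|v i 0|).
  rewrite /qform mxE; apply: le_trans (ler_norm_sum _ _ _) _.
  apply: ler_sum => i _; rewrite mxE mulr_suml; apply: le_trans (ler_norm_sum _ _ _) _.
  by apply: ler_sum => j _; rewrite adjmxE !normrM norm_conjC mulrAC mulrC mulrA.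
apply: le_trans (real_ler_norm (qform_real v hB)) _.
apply: le_trans h1 _; rewrite -(ler_pMn2r (n := 2)) // -sumrMnl.
apply: (@le_trans _ _ (\sum_i \sum_j (`|B j i| * `|v j 0| ^+ 2 + `|B i j| * `|v i 0| ^+ 2))).
  apply: ler_sum => i _; rewrite -sumrMnl; apply: ler_sum => j _.
  by rewrite -mulrnAr [`|B i j|]sym -mulrDr ler_wpM2l.
have bound : \sum_i \sum_j `|B i j| * `|v i 0| ^+ 2 <= b%:C * sqn v.
  rewrite sqnE mulr_sumr; apply: ler_sum => i _; rewrite -mulr_suml.
  by rewrite ler_wpM2r // exprn_ge0.
under eq_bigr do rewrite big_split /=.
rewrite big_split /= mulr2n; apply: lerD => //.
by rewrite exchange_big.
Qed.

(** The projection on the first eigenvectors has Hilbert-Schmidt norm the square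
    root of its rank. *)
Lemma sum_first_qform_le n (F U : 'M[C]_n) q (f t : R) : U \is unitarymx -> (q < n)%N ->
  0 < t -> (forall i j, `|F i j| <= f%:C) ->
  (\sum_(k < n | (k <= q)%N) qform F (U ^t* *m delta_mx k 0)) \is Num.real ->
  \sum_(k < n | (k <= q)%N) qform F (U ^t* *m delta_mx k 0) <=
    (t * (n%:R * f) ^+ 2 + q.+1%:R / t)%:C.
Proof.
move=> hU qn t0 hF hre.
pose Q i j : C := \sum_(k < n | (k <= q)%N) U k i * (U k j)^*%R.
have E : \sum_(k < n | (k <= q)%N) qform F (U ^t* *m delta_mx k 0) =
    \sum_j \sum_i F i j * Q i j.
  have qE k : qform F (U ^t* *m delta_mx k 0) = \sum_j \sum_i F i j * (U k i * (U k j)^*%R).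
    have eE i : (U ^t* *m delta_mx k 0 : 'cV_n) i 0 = (U k i)^*%R.
      by rewrite -colE mxE adjmxE.
    rewrite /qform mxE; apply: eq_bigr => j _; rewrite mxE mulr_suml.
    by apply: eq_bigr => i _; rewrite adjmxE !eE conjCK; ring.
  under eq_bigr do rewrite qE.
  rewrite exchange_big /=; apply: eq_bigr => j _; rewrite exchange_big /=.
  by apply: eq_bigr => i _; rewrite /Q mulr_sumr.
have sumQ : \sum_j \sum_i `|Q i j| ^+ 2 = q.+1%:R.
  have UU k k' : \sum_i U k i * (U k' i)^*%R = (k == k')%:R.
    have /unitarymxP/matrixP/(_ k k') := hU; rewrite !mxE => <-.
    by apply: eq_bigr => i _; rewrite !mxE.
  transitivity (\sum_(k < n | (k <= q)%N) \sum_(k' < n | (k' <= q)%N)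
      (\sum_i U k i * (U k' i)^*%R) * (\sum_j U k' j * (U k j)^*%R)).
    under eq_bigr => j _.
      under eq_bigr => i _.
        rewrite normCK /Q rmorph_sum mulr_suml.
        under eq_bigr => k _.
          rewrite mulr_sumr.
          under eq_bigr => k' _ do rewrite rmorphM /= conjCK.
          over.
        over.
      rewrite exchange_big /=.
      under eq_bigr => k _ do rewrite exchange_big /=.
      over.
    rewrite exchange_big /=; apply: eq_bigr => k _.
    rewrite exchange_big /=; apply: eq_bigr => k' _.
    rewrite mulr_sumr; apply: eq_bigr => j _; rewrite mulr_suml.
    by apply: eq_bigr => i _; ring.
  under eq_bigr => k kq.
    rewrite (bigD1 k) //= !UU eqxx mulr1 big1 ?addr0; last first.
      by move=> k' /andP[_ kk']; rewrite UU eq_sym (negPf kk') mul0r.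
    over.
  by rewrite (sum_first 1 qn).
have t0c : 0 <= t%:C :> C by rewrite ler0c ltW.
rewrite E in hre *; apply: le_trans (real_ler_norm hre) _.
apply: (@le_trans _ _ (\sum_(j < n) \sum_(i < n) (t%:C * f%:C ^+ 2 + t^-1%:C * `|Q i j| ^+ 2))).
  apply: le_trans (ler_norm_sum _ _ _) _; apply: ler_sum => j _.
  apply: le_trans (ler_norm_sum _ _ _) _; apply: ler_sum => i _.
  rewrite normrM; apply: (@le_trans _ _ (f%:C * `|Q i j|)); first by rewrite ler_wpM2r.
  set x := `|Q i j|; have xr : x \is Num.real by exact: normr_real.
  have f0 : 0 <= f%:C :> C by apply: le_trans (hF i j).
  have x0 : 0 <= x by exact: normr_ge0.
  have tt : t%:C * t^-1%:C = 1 :> C by rewrite -rmorphM /= divff ?gt_eqF.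
  have : 0 <= t^-1%:C * (t%:C * f%:C - x) ^+ 2.
    apply: mulr_ge0; first by rewrite ler0c invr_ge0 ltW.
    by rewrite real_exprn_even_ge0 // rpredB // rpredM ?ger0_real.
  have -> : t^-1%:C * (t%:C * f%:C - x) ^+ 2 =
      (t%:C * t^-1%:C) * (t%:C * f%:C ^+ 2) + t^-1%:C * x ^+ 2
        - (t%:C * t^-1%:C) * (f%:C * x) *+ 2 by ring.
  rewrite tt !mul1r subr_ge0; apply: le_trans.
  by rewrite mulr2n lerDl mulr_ge0.
under eq_bigr do rewrite big_split /=.
rewrite big_split /= !sumr_const !card_ord.
under eq_bigr do rewrite -mulr_sumr.
rewrite -mulr_sumr sumQ -[_ *+ n *+ n]mulr_natr -[_ *+ n]mulr_natr realcD !realcM !realc_nat.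
by rewrite le_eqVlt; apply/orP; left; apply/eqP; ring.
Qed.

(** Each off-diagonal term is absorbed, by [2 |x y| <= |x|^2 + |y|^2], in the diagonal. *)
Lemma diag_dominant j (G : 'M[C]_j) (g0 g1 : R) : G \is hermsymmx ->
  (forall b, g0%:C <= G b b) -> (forall b c, b != c -> `|G b c| <= g1%:C) -> 0 <= g1 ->
  forall a, (g0 - j%:R * g1)%:C * sqn a <= qform G a.
Proof.
move=> hG h0 h1 g10 a.
pose D : 'M[C]_j := \matrix_(b, c) if b == c then G b b - g0%:C else 0.
pose B : 'M[C]_j := \matrix_(b, c) if b == c then 0 else - G b c.
have /adjmx_hermP/matrixP hG' := hG.
have GE : G = D - B + g0%:C%:M.
  apply/matrixP => b c; rewrite !mxE; case: eqVneq => [->|_].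
    by rewrite subr0 mulr1n subrK.
  by rewrite add0r opprK mulr0n addr0.
have hB : B \is hermsymmx.
  apply/adjmx_hermP/matrixP => b c; rewrite adjmxE !mxE eq_sym.
  case: eqP => _; first by rewrite rmorph0.
  by rewrite rmorphN /=; have := hG' b c; rewrite adjmxE => ->.
have qB : qform B a <= (j%:R * g1)%:C * sqn a.
  apply: schur_test => // b.
  have -> : (j%:R * g1)%:C = \sum_(c < j) g1%:C :> C.
    by rewrite sumr_const card_ord rmorphM /= rmorph_nat mulr_natl.
  apply: ler_sum => c _; rewrite mxE; case: eqVneq => [_|bc].
    by rewrite normr0 ler0c.
  by rewrite normrN h1.
have qD : 0 <= qform D a.
  rewrite /qform mxE; apply: sumr_ge0 => c _; rewrite mxE mulr_suml (bigD1 c) //= big1.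
    rewrite addr0 [D c c]mxE eqxx adjmxE mulrAC; apply: mulr_ge0; last by rewrite subr_ge0.
    by rewrite mulrC mul_conjC_ge0.
  by move=> b bc; rewrite [D b c]mxE (negPf bc) mulr0 mul0r.
rewrite GE !qformD -[- B]scaleN1r qformZ mulN1r -[g0%:C%:M]scalemx1 qformZ qform1.
rewrite rmorphB /= mulrBl [leLHS]addrC lerD2r -[leLHS]add0r; exact: lerB.
Qed.

End EigenvalueSums.

(** * Regularly varying sequences *)

Section RealPowers.
Variable R : realType.
Implicit Types (x y e s : R).

Lemma powR_unbounded e (A : R) : 0 < e ->
  exists2 x0 : R, 0 < x0 & forall x, x0 <= x -> A <= x `^ e.
Proof.
move=> e0; have m1 : 0 < Num.max A 1 by rewrite lt_max ltr01 orbT.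
exists (Num.max A 1 `^ e^-1) => [|x xx]; first exact: powR_gt0.
apply: (@le_trans _ _ (Num.max A 1)); first by rewrite le_max lexx.
have -> : Num.max A 1 = (Num.max A 1 `^ e^-1) `^ e.
  by rewrite -powRrM mulVf ?gt_eqF // powRr1 // ltW.
apply: ge0_ler_powR => //; rewrite ?nnegrE ?powR_ge0 ?(ltW e0) //.
exact: le_trans (powR_ge0 _ _) xx.
Qed.

Lemma near_natS (x0 : R) : \forall n \near \oo, x0 <= n%:R.
Proof.
exists (Num.truncn x0).+1 => // n /= hn; apply: le_trans (ltW (truncnS_gt x0)) _.
by rewrite ler_nat.
Qed.

Lemma powR_natr_unbounded e (A : R) : 0 < e -> \forall n \near \oo, A <= n%:R `^ e.
Proof.
move=> e0; have [x0 _ h] := powR_unbounded A e0.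
by apply: filterS (near_natS x0) => n; exact: h.
Qed.

Lemma powR_bernoulli x s : 0 <= x -> 0 < s < 1 -> x `^ s <= 1 - s + s * x.
Proof.
move=> x0 /andP[s0 s1]; have s'0 : 0 < 1 - s by rewrite subr_gt0.
have := @conjugate_powR _ (x `^ s) 1 s^-1 (1 - s)^-1 (powR_ge0 _ _) ler01.
rewrite !invr_gt0 !invrK s0 s'0 mulr1 -powRrM mulfV ?gt_eqF // powRr1 // powR1 mul1r.
by move=> /(_ isT isT); rewrite addrC subrK => /(_ erefl); rewrite addrC [x * s]mulrC.
Qed.

Lemma power_sum s m : 0 < s < 1 ->
  \sum_(h < m) (h.+1%:R : R) `^ (- s) <= m%:R `^ (1 - s) / (1 - s).
Proof.
move=> /andP[s0 s1]; have s'0 : 0 < 1 - s by rewrite subr_gt0.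
elim: m => [|m IH].
  by rewrite big_ord0 divr_ge0 ?powR_ge0 // ltW.
rewrite big_ord_recr /=; apply: le_trans (lerD IH (lexx _)) _.
rewrite ler_pdivlMr // mulrDl divfK ?gt_eqF //.
set x : R := m.+1%:R; have x0 : 0 < x by rewrite ltr0n.
have -> : m%:R = x * (m%:R / x) :> R by rewrite mulrCA divff ?gt_eqF // mulr1.
rewrite powRM ?divr_ge0 ?(ltW x0) //.
have := @powR_bernoulli (m%:R / x) (1 - s); rewrite divr_ge0 ?(ltW x0) // s'0 ltrBlDr ltrDl s0.
move=> /(_ isT isT) h; have xs := powR_gt0 (1 - s) x0.
apply: le_trans (lerD (ler_wpM2l (ltW xs) h) (lexx _)) _.
have -> : x `^ (- s) = x `^ (1 - s) / x.
  rewrite -[in RHS](powR_inv1 (ltW x0)) -powRD ?(gt_eqF x0) ?implybT //.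
  by congr (_ `^ _); ring.
have -> : m%:R = x - 1 by rewrite /x -natr1 addrK.
rewrite le_eqVlt; apply/orP; left; apply/eqP.
by field; rewrite gt_eqF.
Qed.

(** An almost monotone positive sequence stays so when its first terms are
    taken into account. *)
Lemma almost_noninc_extend (f : nat -> R) (k0 : nat) (C : R) :
  (forall n, (0 < n)%N -> 0 < f n) -> 0 < C -> (0 < k0)%N ->
  (forall m n, (k0 <= m)%N -> (m <= n)%N -> f n <= C * f m) ->
  exists2 C' : R, 0 < C' & forall m n, (0 < m)%N -> (m <= n)%N -> f n <= C' * f m.
Proof.
move=> f0 C0 k00 h; pose S := \sum_(i < k0) f i.+1; pose W := \sum_(i < k0) (f i.+1)^-1.
have fS i : (0 < i <= k0)%N -> f i <= S.
  move=> /andP[i0 ik]; have lt : (i.-1 < k0)%N by rewrite prednK.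
  rewrite /S (bigD1 (Ordinal lt)) //= prednK // lerDl sumr_ge0 // => k _.
  by rewrite ltW // f0.
have fW i : (0 < i <= k0)%N -> 1 <= W * f i.
  move=> /andP[i0 ik]; have lt : (i.-1 < k0)%N by rewrite prednK.
  rewrite -ler_pdivrMr ?f0 // div1r /W (bigD1 (Ordinal lt)) //= prednK // lerDl.
  by rewrite sumr_ge0 // => k _; rewrite invr_ge0 ltW // f0.
have S0 : 0 < S by apply: lt_le_trans (fS k0 _); rewrite ?f0 // k00 leqnn.
have W0 : 0 <= W by rewrite sumr_ge0 // => k _; rewrite invr_ge0 ltW // f0.
have fB n : (0 < n)%N -> f n <= (1 + C) * S.
  move=> n0; have [nk|kn] := leqP n k0.
    apply: le_trans (fS n _) _; first by rewrite n0.
    by rewrite mulrDl mul1r lerDl mulr_ge0 // ltW.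
  apply: le_trans (h k0 n _ (ltnW kn)) _ => //; rewrite mulrDl mul1r ler_wpDl ?(ltW S0) //.
  by rewrite ler_wpM2l ?(ltW C0) // fS // k00 leqnn.
exists (C + (1 + C) * S * W) => [|m n m0 mn].
  by rewrite ltr_wpDr // !mulr_ge0 // ?addr_ge0 // ltW.
have fm := f0 m m0; have n0 : (0 < n)%N by exact: leq_trans mn.
have B0 : 0 <= (1 + C) * S by rewrite mulr_ge0 ?addr_ge0 // ltW.
have [mk|km] := leqP m k0.
  apply: le_trans (fB n n0) _; rewrite [leRHS]mulrDl ler_wpDl ?mulr_ge0 ?(ltW C0) ?(ltW fm) //.
  by rewrite -mulrA ler_peMr // fW // m0.
apply: le_trans (h m n (ltnW km) mn) _; rewrite [leRHS]mulrDl lerDl.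
by rewrite mulr_ge0 ?(ltW fm) // mulr_ge0.
Qed.

End RealPowers.

(** The two power bounds on the autocovariance that follow from Potter's. *)
Lemma regular_sequence (R : realType) (rho : R) (L : R -> R) (a : nat -> R) :
  0 < rho < 1 -> slowly_varying L ->
  (forall h : nat, a h = L h%:R / (1 + h%:R) `^ rho) ->
  exists s1 s2 C : R, [/\ 0 < s1, 0 < s2 < 1, 0 < C,
    forall m n, (0 < m)%N -> (m <= n)%N -> a n <= C * (m%:R / n%:R) `^ s1 * a m &
    forall m n, (0 < m)%N -> (m <= n)%N -> a m <= C * (n%:R / m%:R) `^ s2 * a n].
Proof.
move=> /andP[r0 r1] svL aE; have [_ Lpos _] := svL.
pose e := Num.min (rho / 2) ((1 - rho) / 2).
have e0 : 0 < e by rewrite lt_min !divr_gt0 // subr_gt0.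
have er : e <= rho / 2 by rewrite ge_min lexx.
have e1 : e <= (1 - rho) / 2 by rewrite ge_min lexx orbT.
pose s1 := rho - e; pose s2 := rho + e.
have s10 : 0 < s1 by rewrite /s1; lra.
have s20 : 0 < s2 < 1 by rewrite /s2; apply/andP; split; lra.
have [X X1 hX] := potter svL e0.
pose k0 := (Num.truncn X).+1.
have Xk m : (k0 <= m)%N -> X <= m%:R.
  by move=> km; apply: le_trans (ltW (truncnS_gt X)) _; rewrite ler_nat.
have a0 h : 0 < a h.
  by rewrite aE divr_gt0 ?Lpos // powR_gt0 // ltr_pwDl.
have nat0 m : (0 < m)%N -> 0 < (m%:R : R) by rewrite ltr0n.
have [C1 C10 h1] : exists2 C', 0 < C' & forall m n, (0 < m)%N -> (m <= n)%N ->
    n%:R `^ s1 * a n <= C' * (m%:R `^ s1 * a m).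
  apply: (@almost_noninc_extend _ (fun n => n%:R `^ s1 * a n) k0 (expR e * 2 `^ rho)) => //.
  - by move=> n n0; rewrite mulr_gt0 // powR_gt0 // nat0.
  - by rewrite mulr_gt0 ?expR_gt0 // powR_gt0.
  move=> m n km mn; have m0 : 0 < (m%:R : R) by apply: lt_le_trans (Xk m km); apply: lt_le_trans X1.
  have mn' : (m%:R : R) <= n%:R by rewrite ler_nat.
  have n0 : 0 < (n%:R : R) by apply: lt_le_trans mn'.
  have [hL _] := hX _ _ (Xk m km) mn'.
  rewrite !aE; set E := expR e in hL *.
  have m1 : 0 < (1 + m%:R : R) by rewrite addr_gt0.
  have n1 : 0 < (1 + n%:R : R) by rewrite addr_gt0.
  have q : (n%:R / m%:R) `^ rho <= 2 `^ rho * ((1 + n%:R) / (1 + m%:R)) `^ rho :> R.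
    rewrite -powRM ?divr_ge0 ?(ltW m1) ?(ltW n1) // ge0_ler_powR ?nnegrE ?(ltW r0) ?divr_ge0 ?mulr_ge0 ?(ltW m0) ?(ltW n0) ?divr_ge0 ?(ltW m1) ?(ltW n1) //.
    rewrite ler_pdivrMr // mulrAC mulrA ler_pdivlMr //.
    have : 1 <= (m%:R : R) by apply: le_trans (Xk m km).
    by move: (m%:R : R) (n%:R : R) m0 n0 => u v; nra.
  have pd (u v w : R) : 0 < u -> 0 < v -> (u / v) `^ w = u `^ w / v `^ w.
    by move=> u0 v0; rewrite powRM ?invr_ge0 ?ltW // -powR_inv1 ?(ltW v0) // powRAC powR_inv1 // powR_ge0.
  have e1r : n%:R `^ s1 * (n%:R / m%:R) `^ e = m%:R `^ s1 * (n%:R / m%:R) `^ rho :> R.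
    have -> : rho = s1 + e by rewrite /s1 subrK.
    rewrite powRD; last by rewrite (gt_eqF (divr_gt0 _ _)) ?implybT.
    by rewrite mulrA; congr (_ * _); rewrite pd // mulrC divfK // gt_eqF // powR_gt0.
  rewrite mulrA ler_pdivrMr ?powR_gt0 //.
  apply: le_trans (ler_wpM2l (powR_ge0 _ _) hL) _.
  have -> : n%:R `^ s1 * (E * (n%:R / m%:R) `^ e * L m%:R) =
     E * L m%:R * (n%:R `^ s1 * (n%:R / m%:R) `^ e) by ring.
  rewrite e1r; have -> : E * 2 `^ rho * (m%:R `^ s1 * (L m%:R / (1 + m%:R) `^ rho)) * (1 + n%:R) `^ rho =
     E * L m%:R * (m%:R `^ s1 * (2 `^ rho * ((1 + n%:R) / (1 + m%:R)) `^ rho)).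
    by rewrite (pd (1 + n%:R)) //; ring.
  by rewrite !ler_wpM2l ?powR_ge0 // mulr_ge0 ?expR_ge0 // ltW ?Lpos ?ltW.
have [C2 C20 h2] : exists2 C', 0 < C' & forall m n, (0 < m)%N -> (m <= n)%N ->
    (n%:R `^ s2 * a n)^-1 <= C' * (m%:R `^ s2 * a m)^-1.
  apply: (@almost_noninc_extend _ (fun n => (n%:R `^ s2 * a n)^-1) k0 (expR e)) => //.
  - by move=> n n0; rewrite invr_gt0 mulr_gt0 // powR_gt0 // nat0.
  - exact: expR_gt0.
  move=> m n km mn; have m0 : 0 < (m%:R : R) by apply: lt_le_trans (Xk m km); apply: lt_le_trans X1.
  have mn' : (m%:R : R) <= n%:R by rewrite ler_nat.
  have n0 : 0 < (n%:R : R) by apply: lt_le_trans mn'.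
  have [_ hL] := hX _ _ (Xk m km) mn'.
  rewrite ler_pdivlMr ?mulr_gt0 ?powR_gt0 // mulrC ler_pdivrMr ?mulr_gt0 ?powR_gt0 //.
  rewrite !aE; set E := expR e in hL *.
  have m1 : 0 < (1 + m%:R : R) by rewrite addr_gt0.
  have n1 : 0 < (1 + n%:R : R) by rewrite addr_gt0.
  have pd (u v w : R) : 0 < u -> 0 < v -> (u / v) `^ w = u `^ w / v `^ w.
    by move=> u0 v0; rewrite powRM ?invr_ge0 ?ltW // -powR_inv1 ?(ltW v0) // powRAC powR_inv1 // powR_ge0.
  have q : ((1 + n%:R) / (1 + m%:R)) `^ rho <= (n%:R / m%:R) `^ rho :> R.
    rewrite ge0_ler_powR ?nnegrE ?(ltW r0) ?divr_ge0 ?(ltW m1) ?(ltW n1) ?(ltW n0) ?(ltW m0) //.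
    rewrite ler_pdivrMr // mulrAC ler_pdivlMr //.
    by move: (m%:R : R) (n%:R : R) m0 n0 mn' => u v; nra.
  have e2r : m%:R `^ s2 * (n%:R / m%:R) `^ e * (n%:R / m%:R) `^ rho = n%:R `^ s2 :> R.
    rewrite -mulrA -powRD; last by rewrite (gt_eqF (divr_gt0 _ _)) ?implybT.
    by rewrite [e + rho]addrC -/s2 pd // mulrC divfK // gt_eqF // powR_gt0.
  apply: (@le_trans _ _ (m%:R `^ s2 * (E * (n%:R / m%:R) `^ e * L n%:R / (1 + m%:R) `^ rho))).
    by rewrite ler_wpM2l ?powR_ge0 // ler_wpM2r // invr_ge0 powR_ge0.
  rewrite -e2r.
  have -> : m%:R `^ s2 * (E * (n%:R / m%:R) `^ e * L n%:R / (1 + m%:R) `^ rho) =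
    E * L n%:R / (1 + n%:R) `^ rho * (m%:R `^ s2 * (n%:R / m%:R) `^ e * ((1 + n%:R) / (1 + m%:R)) `^ rho).
    by rewrite (pd (1 + n%:R)) //; field; rewrite !gt_eqF ?powR_gt0.
  have -> : E * (m%:R `^ s2 * (n%:R / m%:R) `^ e * (n%:R / m%:R) `^ rho * (L n%:R / (1 + n%:R) `^ rho)) =
    E * L n%:R / (1 + n%:R) `^ rho * (m%:R `^ s2 * (n%:R / m%:R) `^ e * (n%:R / m%:R) `^ rho) by ring.
  rewrite !ler_wpM2l ?mulr_ge0 ?powR_ge0 ?invr_ge0 ?expR_ge0 ?powR_ge0 //.
  by rewrite ltW // Lpos // ltW.
exists s1, s2, (C1 + C2); split=> //; first exact: addr_gt0.
  move=> m n m0 mn; have n0 : (0 < n)%N by exact: leq_trans mn.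
  have := h1 m n m0 mn; rewrite mulrC -ler_pdivlMr ?powR_gt0 ?nat0 // => h.
  apply: le_trans h _.
  have -> : (m%:R / n%:R) `^ s1 = m%:R `^ s1 / n%:R `^ s1.
    by rewrite powRM ?invr_ge0 // -powR_inv1 // powRAC powR_inv1 // powR_ge0.
  have -> : C1 * (m%:R `^ s1 * a m) / n%:R `^ s1 = C1 * (m%:R `^ s1 / n%:R `^ s1 * a m) by ring.
  rewrite -[leRHS]mulrA ler_wpM2r ?lerDl ?(ltW C20) //.
  by rewrite mulr_ge0 ?divr_ge0 ?powR_ge0 // ltW.
move=> m n m0 mn; have n0 : (0 < n)%N by exact: leq_trans mn.
have := h2 m n m0 mn.
have pm : 0 < m%:R `^ s2 * a m by apply: mulr_gt0 => //; apply: powR_gt0; rewrite ltr0n.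
have pn : 0 < n%:R `^ s2 * a n by apply: mulr_gt0 => //; apply: powR_gt0; rewrite ltr0n.
rewrite ler_pdivlMr // mulrC ler_pdivrMr // mulrC -ler_pdivlMr ?powR_gt0 ?nat0 // => h.
apply: le_trans h _.
have -> : (n%:R / m%:R) `^ s2 = n%:R `^ s2 / m%:R `^ s2.
  by rewrite powRM ?invr_ge0 // -powR_inv1 // powRAC powR_inv1 // powR_ge0.
have -> : C2 * (n%:R `^ s2 * a n) / m%:R `^ s2 = C2 * (n%:R `^ s2 / m%:R `^ s2 * a n) by ring.
rewrite -[leRHS]mulrA ler_wpM2r ?lerDr ?(ltW C10) //.
by rewrite mulr_ge0 ?divr_ge0 ?powR_ge0 // ltW.
Qed.

(** * Toeplitz matrices with regularly varying coefficients *)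

(** What the proof uses of the spectrum of the Toeplitz matrices: on some scale [s n]
    growing like a power of [n], every fixed eigenvalue is bounded below, and the
    [q]-th one is small for [q] large. *)
Definition spiked (R : realType) (gamma : int -> R[i]) : Prop :=
  exists (s : nat -> R) (e : R), [/\ 0 < e,
    forall p, exists2 c : R, 0 < c &
      \forall n \near \oo, c * s n <= eigval p.+1 (toeplitz gamma n),
    forall eps : R, 0 < eps -> exists q : nat,
      \forall n \near \oo, eigval q.+1 (toeplitz gamma n) <= eps * s n &
    \forall n \near \oo, n%:R `^ e <= s n].

Lemma sum_indic_itv (R : nzRingType) n x m : (x + m <= n)%N ->
  \sum_(i < n) ((x <= i < x + m)%N)%:R = m%:R :> R.
Proof.
move=> xmn; rewrite -(big_mkord xpredT (fun i => ((x <= i < x + m)%N)%:R : R)).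
rewrite (big_cat_nat (n := x)) //=; last exact: leq_trans (leq_addr _ _) xmn.
rewrite [X in _ + X](big_cat_nat (n := (x + m)%N)) //= ?leq_addr //.
rewrite big_nat_cond big1 ?add0r; last first.
  by move=> i /andP[/andP[_ ix] _]; rewrite leqNgt ix.
rewrite [X in _ + X]big_nat_cond [X in _ + X]big1 ?addr0; last first.
  by move=> i /andP[/andP[xi _] _]; rewrite [(i < _)%N]ltnNge xi andbF.
rewrite big_nat_cond (eq_bigr (fun=> 1)); last first.
  by move=> i /andP[/andP[a b] _]; rewrite a b.
by rewrite -big_nat_cond sumr_const_nat addKn.
Qed.

Lemma dist_lt x m i j : (x <= i < x + m)%N -> (x <= j < x + m)%N ->
  (`|i%:Z - j%:Z| < m)%N.
Proof. lia. Qed.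

Lemma dist_ge k i j : (i + k <= j)%N -> (k <= `|i%:Z - j%:Z|)%N.
Proof. lia. Qed.

Lemma dist_subl i h : (h <= i)%N -> `|i%:Z - (i - h)%N%:Z|%N = h.
Proof. lia. Qed.

Lemma dist_addl (i h : nat) : `|i%:Z - (h + i)%N%:Z|%N = h.
Proof. lia. Qed.

Lemma blocks_apart b c r m i j : (b < c)%N -> (i < b * (r.+1 * m) + m)%N ->
  (c * (r.+1 * m) <= j)%N -> (i + r * m <= j)%N.
Proof.
move=> bc hi hj; have : (b.+1 * (r.+1 * m) <= c * (r.+1 * m))%N.
  by rewrite leq_mul2r bc orbT.
by rewrite mulSn mulSn; lia.
Qed.

Lemma blocks_disjoint b c r m i : b <> c ->
  (b * (r.+1 * m) <= i < b * (r.+1 * m) + m)%N ->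
  (c * (r.+1 * m) <= i < c * (r.+1 * m) + m)%N -> False.
Proof.
move=> bc /andP[b1 b2] /andP[c1 c2]; have [lt|lt|//] := ltngtP b c.
  have := blocks_apart lt b2 c1; have := mulSn r m; nia.
have := blocks_apart lt c2 b1; have := mulSn r m; nia.
Qed.

Lemma blocks_fit p r n b : (b <= p)%N ->
  (b * (r.+1 * (n %/ (p.+1 * r.+1))) + n %/ (p.+1 * r.+1) <= n)%N.
Proof.
move=> bp; apply: leq_trans (leq_divM n (p.+1 * r.+1)); set m := (n %/ _)%N.
apply: (@leq_trans (b.+1 * (r.+1 * m))).
  by rewrite [(b.+1 * _)%N]mulSn [leqRHS]addnC leq_add2l leq_pmull.
by rewrite [leqRHS]mulnC -[leqRHS]mulnA leq_mul2r ltnS bp orbT.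
Qed.

Lemma divn_ceil2 n q : (0 < q)%N -> (q <= n)%N -> (n <= 2 * q * (n %/ q))%N.
Proof.
move=> q0 qn; have := ltn_ceil n q0; set m := (n %/ q)%N => h.
have m0 : (0 < m)%N by rewrite divn_gt0.
have : (q <= q * m)%N by rewrite leq_pmulr.
have : (m.+1 * q = q * m + q)%N by rewrite mulSn mulnC addnC.
have : (2 * q * m = q * m + q * m)%N by rewrite -mulnA mul2n addnn.
lia.
Qed.

Section LongMemoryAutocovariance.
Variables (R : realType) (gamma : int -> R[i]) (a : nat -> R) (s1 s2 C : R).
Local Notation Cx := R[i].
Hypothesis psdT : forall n, psdmx (toeplitz gamma n).
Hypothesis gammaE : forall h : int, gamma h = (a `|h|%N)%:C.
Hypothesis apos : forall h, 0 < a h.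
Hypotheses (s10 : 0 < s1) (s20 : 0 < s2) (s21 : s2 < 1) (C0 : 0 < C).
Hypothesis decr : forall m n, (0 < m)%N -> (m <= n)%N ->
  a n <= C * (m%:R / n%:R) `^ s1 * a m.
Hypothesis incr : forall m n, (0 < m)%N -> (m <= n)%N ->
  a m <= C * (n%:R / m%:R) `^ s2 * a n.

Let T n := toeplitz gamma n.
Let s n : R := n%:R * a n.
Let dist n (i j : 'I_n) : nat := `|i%:Z - j%:Z|%N.

Let TE n (i j : 'I_n) : T n i j = (a (dist i j))%:C.
Proof. by rewrite mxE gammaE. Qed.

Let distC n (i j : 'I_n) : dist i j = dist j i.
Proof. by rewrite /dist distnC. Qed.

Let decr' m n : (0 < m)%N -> (m <= n)%N -> a n <= C * a m.
Proof.
move=> m0 mn; have n0 : (0 < n)%N by exact: leq_trans mn.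
apply: le_trans (decr m0 mn) _; rewrite ler_wpM2r ?(ltW (apos _)) //.
rewrite ler_piMr ?(ltW C0) //.
have h : (m%:R / n%:R : R) <= 1 by rewrite ler_pdivrMr ?ltr0n // mul1r ler_nat.
rewrite [leRHS](_ : _ = 1 `^ s1); last by rewrite powR1.
by rewrite ge0_ler_powR ?nnegrE ?divr_ge0 // ltW.
Qed.

Let scale_large : exists2 e : R, 0 < e & \forall n \near \oo, n%:R `^ e <= s n.
Proof.
exists ((1 - s2) / 2); first by rewrite divr_gt0 // subr_gt0.
have e20 : 0 < (1 - s2) / 2 by rewrite divr_gt0 // subr_gt0.
near=> n; have n0 : (0 < n)%N by near: n; exists 1%N.
have nR : 0 < n%:R :> R by rewrite ltr0n.
have h : C / a 1%N <= n%:R `^ ((1 - s2) / 2).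
  by near: n; exact: powR_natr_unbounded.
have := incr (leqnn 1) n0; rewrite divr1 => h1.
have a1 := apos 1%N; have an := apos n.
set u := n%:R `^ ((1 - s2) / 2) in h *.
have u0 : 0 < u by exact: powR_gt0.
have nE : n%:R = n%:R `^ s2 * (u * u) :> R.
  rewrite /u -!powRD ?(gt_eqF nR) ?implybT //.
  have -> : s2 + ((1 - s2) / 2 + (1 - s2) / 2) = 1 by field.
  by rewrite powRr1 // ltW.
rewrite /s [X in X * a n]nE.
have w0 : 0 < n%:R `^ s2 :> R by exact: powR_gt0.
rewrite ler_pdivrMr // in h.
have -> : n%:R `^ s2 * (u * u) * a n = u * (u * (n%:R `^ s2 * a n)) by ring.
rewrite ler_peMr ?(ltW u0) //.
rewrite -(ler_pM2l C0) mulr1.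
apply: le_trans h _; rewrite mulrCA ler_pM2l //.
by move: h1; rewrite -mulrA.
Unshelve. all: by end_near.
Qed.

(** Indicators of [p + 1] blocks of length [m] separated by gaps of length [r m]: the
    form is nearly diagonal on their span, since the kernel has decayed by a
    factor [r^(- s1)] across a gap. *)
Let blocks_lower p : exists2 c : R, 0 < c & \forall n \near \oo, c * s n <= eigval p.+1 (T n).
Proof.
pose C2 := C + C * a 1%N / a 0%N.
have C20 : 0 < C2 by rewrite addr_gt0 // divr_gt0 // mulr_gt0.
have small m h : (0 < m)%N -> (h < m)%N -> a m <= C2 * a h.
  move=> m0; case: h => [_|h hm].
    apply: le_trans (decr' (leqnn 1) m0) _; rewrite /C2 mulrDl divfK ?gt_eqF //.
    by rewrite lerDr mulr_ge0 ?ltW.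
  apply: le_trans (decr' (ltn0Sn h) (ltnW hm)) _; rewrite /C2 mulrDl lerDl.
  by rewrite mulr_ge0 ?divr_ge0 ?mulr_ge0 ?ltW.
have [x0 x00 hx] := powR_unbounded (2 * C2 * (p.+1%:R * C)) s10.
have [r rp hr] : exists2 r : nat, (0 < r)%N & 2 * C2 * (p.+1%:R * C) <= r%:R `^ s1.
  by exists (Num.truncn x0).+1 => //; apply: hx; exact: ltW (truncnS_gt _).
exists ((2 * C2)^-1 / (2 * (p.+1 * r.+1)%:R * C)) => [|].
  by rewrite divr_gt0 ?invr_gt0 ?mulr_gt0 // ltr0n.
near=> n; have nq : (p.+1 * r.+1 <= n)%N by near: n; exists (p.+1 * r.+1)%N.
have [m [m0 mn nm pos]] : exists m, [/\ (0 < m)%N, (m <= n)%N,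
    (n <= 2 * (p.+1 * r.+1) * m)%N &
    forall b : 'I_p.+1, (b * (r.+1 * m) + m <= n)%N].
  exists (n %/ (p.+1 * r.+1))%N; split; rewrite ?divn_gt0 ?leq_div //.
    exact: divn_ceil2.
  by move=> b; apply: blocks_fit; rewrite -ltnS.
have mR : 0 < m%:R :> R by rewrite ltr0n.
pose V : 'M[Cx]_(n, p.+1) := \matrix_(i, b) ((b * (r.+1 * m) <= i < b * (r.+1 * m) + m)%N)%:R.
have Vreal i b : (V i b)^*%R = V i b by rewrite mxE conjC_nat.
have VV : V ^t* *m V = (m%:R)%:M.
  apply/matrixP => b c; rewrite !mxE.
  under eq_bigr do rewrite adjmxE Vreal !mxE -natrM mulnb.
  have [->|bc] := eqVneq b c.
    under eq_bigr do rewrite andbb.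
    by rewrite mulr1n; exact: (sum_indic_itv Cx (pos c)).
  rewrite mulr0n big1 // => i _; rewrite (_ : _ && _ = false) //.
  apply/negP => /andP[h1 h2]; apply: (blocks_disjoint _ h1 h2) => e.
  by move/eqP: bc; apply; exact: val_inj.
have sqnV (x : 'cV_p.+1) : sqn (V *m x) = m%:R * sqn x.
  by rewrite sqnM VV -[(m%:R)%:M]scalemx1 qformZ qform1.
have hT : T n \is hermsymmx by have [] := psdT n.
pose G := V ^t* *m T n *m V.
have hG : G \is hermsymmx.
  by apply/adjmx_hermP; rewrite !adjmxM trmxCK; have /adjmx_hermP -> := hT; rewrite mulmxA.
have GE b c : G b c = (\sum_(i < n) \sum_(j < n)
    ((b * (r.+1 * m) <= i < b * (r.+1 * m) + m)%N)%:R * ((c * (r.+1 * m) <= j < c * (r.+1 * m) + m)%N)%:R * a (dist i j))%:C.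
  rewrite mxE exchange_big rmorph_sum /=; apply: eq_bigr => j _.
  rewrite mxE mulr_suml rmorph_sum /=; apply: eq_bigr => i _.
  rewrite adjmxE Vreal TE !realcM !realc_nat ![V _ _]mxE.
  by rewrite mulrAC.
pose cnt (b : 'I_p.+1) (i : 'I_n) : R := ((b * (r.+1 * m) <= i < b * (r.+1 * m) + m)%N)%:R.
have cnt0 b i : 0 <= cnt b i by exact: ler0n.
have cntsum b : \sum_i cnt b i = m%:R by exact: sum_indic_itv (pos b).
have mm z b c : \sum_(i < n) \sum_(j < n) cnt b i * cnt c j * z = m%:R ^+ 2 * z.
  under eq_bigr => i _.
    under eq_bigr do rewrite mulrAC.
    rewrite -mulr_sumr cntsum mulrAC.
    over.
  by rewrite -!mulr_suml cntsum expr2 mulrAC.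
pose g0 : R := m%:R ^+ 2 * (a m / C2).
pose g1 : R := m%:R ^+ 2 * (C / r%:R `^ s1 * a m).
have r0 : 0 < (r%:R : R) by rewrite ltr0n.
have G0 b : g0%:C <= G b b.
  rewrite GE lecR /g0 -(mm _ b b); apply: ler_sum => i _; apply: ler_sum => j _.
  have [|] := boolP (cnt b i * cnt b j == 0) => [/eqP ->|nz]; first by rewrite !mul0r.
  rewrite ler_wpM2l ?mulr_ge0 // ler_pdivrMr // mulrC; apply: small => //.
  move: nz; rewrite mulf_eq0 negb_or /cnt !pnatr_eq0 !eqb0 !negbK => /andP[h1 h2].
  exact: dist_lt h1 h2.
have G1 b c : b != c -> `|G b c| <= g1%:C.
  move=> bc; rewrite GE ger0_norm; last first.
    by rewrite ler0c; apply: sumr_ge0 => i _; apply: sumr_ge0 => j _; rewrite mulr_ge0 ?(ltW (apos _)) // mulr_ge0.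
  rewrite lecR /g1 -(mm _ b c); apply: ler_sum => i _; apply: ler_sum => j _.
  have [|] := boolP (cnt b i * cnt c j == 0) => [/eqP ->|nz]; first by rewrite !mul0r.
  rewrite ler_wpM2l ?mulr_ge0 //.
  move: nz; rewrite mulf_eq0 negb_or /cnt !pnatr_eq0 !eqb0 !negbK => /andP[/andP[h1 h2] /andP[h3 h4]].
  have far : (r * m <= dist i j)%N.
    have bc' : (b : nat) <> c by move=> e; move/eqP: bc; apply; exact: val_inj.
    have [lt|lt|//] := ltngtP (b : nat) (c : nat).
      by apply: dist_ge; exact: blocks_apart lt h2 h3.
    by rewrite distC; apply: dist_ge; exact: blocks_apart lt h4 h1.
  have md : (m <= dist i j)%N by apply: leq_trans far; rewrite leq_pmull.
  apply: le_trans (decr m0 md) _; rewrite ler_wpM2r ?(ltW (apos _)) // ler_wpM2l ?(ltW C0) //.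
  have -> : (r%:R `^ s1)^-1 = r%:R^-1 `^ s1 :> R.
    by rewrite -powR_inv1 ?powR_ge0 // powRAC powR_inv1.
  rewrite ge0_ler_powR ?nnegrE ?(ltW s10) ?divr_ge0 ?invr_ge0 //.
  have dR : 0 < (dist i j)%:R :> R by rewrite ltr0n (leq_trans m0).
  by rewrite ler_pdivrMr // mulrC ler_pdivlMr // -natrM mulnC ler_nat.
have g10 : 0 <= g1 by rewrite !mulr_ge0 ?invr_ge0 ?powR_ge0 ?exprn_ge0 // ltW.
have GG := diag_dominant hG G0 G1 g10.
have dom : (2 * C2)^-1 * (m%:R * a m) * m%:R <= g0 - p.+1%:R * g1.
  have rs0 : 0 < r%:R `^ s1 :> R by exact: powR_gt0.
  have key : p.+1%:R * C / r%:R `^ s1 <= (2 * C2)^-1.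
    have C22 : 0 < 2 * C2 :> R by rewrite mulr_gt0.
    by rewrite ler_pdivrMr // ler_pdivlMl //.
  have am : 0 <= m%:R ^+ 2 * a m by rewrite mulr_ge0 ?exprn_ge0 // ltW.
  have -> : g0 - p.+1%:R * g1 = m%:R ^+ 2 * a m * (C2^-1 - p.+1%:R * C / r%:R `^ s1).
    by rewrite /g0 /g1; ring.
  have -> : (2 * C2)^-1 * (m%:R * a m) * m%:R = m%:R ^+ 2 * a m * (2 * C2)^-1 by ring.
  rewrite ler_wpM2l //; have -> : C2^-1 = (2 * C2)^-1 + (2 * C2)^-1 by field; rewrite gt_eqF.
  by rewrite lerBrDr lerD2l.
apply: (@le_trans _ _ ((2 * C2)^-1 * (m%:R * a m))); last first.
  apply: (@eigval_ge_subspace _ _ _ _ V) => // [x x0'|x].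
    by rewrite -sqn_gt0 sqnV mulr_gt0 ?ltr0n // sqn_gt0.
  rewrite sqnV qformM -/G; apply: le_trans (GG x).
  rewrite mulrA -(@realc_nat R m) -realcM ler_wpM2r ?sqn_ge0 // lecR.
  exact: dom.
rewrite -[leLHS]mulrA; apply: ler_wpM2l; first by rewrite invr_ge0 mulr_ge0 // ltW.
have qR : 0 < (p.+1 * r.+1)%:R :> R by rewrite ltr0n.
rewrite mulrC ler_pdivrMr ?mulr_gt0 // /s.
have h1 : n%:R <= 2 * (p.+1 * r.+1)%:R * m%:R :> R.
  by rewrite -!natrM ler_nat.
have h2 : a n <= C * a m by exact: decr'.
have -> : m%:R * a m * (2 * (p.+1 * r.+1)%:R * C) = (2 * (p.+1 * r.+1)%:R * m%:R) * (C * a m) by ring.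
by apply: ler_pM; rewrite ?ler0n ?(ltW (apos _)).
Unshelve. all: by end_near.
Qed.

(** The part of the kernel within distance [n / r] of the diagonal has small norm,
    and the rest has bounded Hilbert-Schmidt norm, both on the scale [s n]. *)
Let near_far_upper eps : 0 < eps -> exists q : nat,
  \forall n \near \oo, eigval q.+1 (T n) <= eps * s n.
Proof.
move=> eps0.
have s20' : 0 < 1 - s2 by rewrite subr_gt0.
pose B0 := 2 * C ^+ 2 / (1 - s2).
have B00 : 0 < B0 by rewrite divr_gt0 // mulr_gt0 // exprn_gt0.
have [x0 x00 hx] := powR_unbounded (B0 * (4 / eps)) s20'.
have [r rp hr] : exists2 r : nat, (0 < r)%N & B0 * (4 / eps) <= r%:R `^ (1 - s2).
  by exists (Num.truncn x0).+1 => //; apply: hx; exact: ltW (truncnS_gt _).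
have r0 : 0 < (r%:R : R) by rewrite ltr0n.
pose Cr := C ^+ 2 * (2 * r%:R) `^ s2.
have Cr0 : 0 < Cr by rewrite mulr_gt0 ?exprn_gt0 ?powR_gt0 // mulr_gt0.
have [q qE] : exists q : nat, 16 * Cr ^+ 2 / eps ^+ 2 <= q.+1%:R.
  by eexists; exact: ltW (truncnS_gt _).
exists q; have [e e0 hs] := scale_large.
near=> n; have nr : (r <= n)%N by near: n; exists r.
have nq : (q < n)%N by near: n; exists q.+1.
have [m [m0 mn nm mrn]] : exists m, [/\ (0 < m)%N, (m <= n)%N, (n <= 2 * r * m)%N &
    (m * r <= n)%N].
  by exists (n %/ r)%N; rewrite divn_gt0 // leq_div leq_divM nr; split=> //; exact: divn_ceil2.
have mR : 0 < m%:R :> R by rewrite ltr0n.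
have nR : 0 < n%:R :> R by rewrite ltr0n (leq_trans m0).
have sn : 8 * a 0%N / eps <= s n.
  apply: (@le_trans _ _ (n%:R `^ e)); last by near: n.
  by near: n; exact: powR_natr_unbounded.
have s0 : 0 < s n by rewrite mulr_gt0.
have hT : T n \is hermsymmx by have [] := psdT n.
pose B : 'M[Cx]_n := \matrix_(i, j) if (dist i j < m)%N then T n i j else 0.
pose F : 'M[Cx]_n := \matrix_(i, j) if (dist i j < m)%N then 0 else T n i j.
have TBF : T n = B + F.
  by apply/matrixP => i j; rewrite [RHS]mxE [B i j]mxE [F i j]mxE; case: ifP; rewrite ?addr0 ?add0r.
have symT i j : (T n i j)^*%R = T n j i.
  by have /adjmx_hermP/matrixP/(_ j i) := hT; rewrite adjmxE.
have hB : B \is hermsymmx.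
  apply/adjmx_hermP/matrixP => i j; rewrite adjmxE [B j i]mxE [B i j]mxE distC.
  by case: ifP => _; rewrite ?rmorph0 // symT.
have hF : F \is hermsymmx.
  apply/adjmx_hermP/matrixP => i j; rewrite adjmxE [F j i]mxE [F i j]mxE distC.
  by case: ifP => _; rewrite ?rmorph0 // symT.
have nrm : n%:R / m%:R <= 2 * r%:R :> R.
  by rewrite ler_pdivrMr // -!natrM ler_nat.
pose f := C ^+ 2 * (2 * r%:R) `^ s2 * a n.
have Ff i j : `|F i j| <= f%:C.
  rewrite mxE; case: ltnP => [_|md].
    by rewrite normr0 ler0c !mulr_ge0 ?exprn_ge0 ?powR_ge0 // ltW.
  rewrite TE ger0_norm ?ler0c ?(ltW (apos _)) // lecR.
  apply: le_trans (decr' m0 md) _; rewrite /f expr2 -!mulrA ler_wpM2l ?(ltW C0) // mulrA.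
  apply: le_trans (incr m0 mn) _; rewrite ler_wpM2r ?(ltW (apos _)) // ler_wpM2l ?(ltW C0) //.
  by rewrite ge0_ler_powR ?nnegrE ?(ltW s20) ?divr_ge0 ?mulr_ge0.
pose b := 2 * a 0%N + B0 / r%:R `^ (1 - s2) * s n.
have Bb i : \sum_j `|B i j| <= b%:C.
  pose bnd (h : nat) : R := if (h < m)%N then a h else 0.
  have bnd0 h : 0 <= bnd h by rewrite /bnd; case: ifP => // _; exact: ltW.
  have -> : \sum_j `|B i j| = (\sum_(j < n) bnd (dist i j))%:C.
    rewrite rmorph_sum /=; apply: eq_bigr => j _; rewrite mxE /bnd; case: ifP => _.
      by rewrite TE ger0_norm // ler0c ltW.
    by rewrite normr0.
  rewrite lecR; apply: (@le_trans _ _ (2 * \sum_(h < m) a h)).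
    rewrite -(big_mkord xpredT (fun j => bnd `|i%:Z - j%:Z|%N)).
    rewrite (big_cat_nat (n := i)) //=; last by rewrite ltnW.
    have bsum k : \sum_(0 <= h < k) bnd h <= \sum_(h < m) a h.
      rewrite -(big_mkord xpredT a); have [km|mk] := leqP k m.
        rewrite [leRHS](big_cat_nat (n := k)) //= -[leLHS]addr0; apply: lerD.
          rewrite big_nat_cond [leRHS]big_nat_cond; apply: ler_sum => h /andP[/andP[_ hk] _].
          by rewrite /bnd (leq_trans hk).
        by rewrite sumr_ge0 // => h _; exact: ltW.
      rewrite (big_cat_nat (n := m)) //=; last exact: ltnW.
      rewrite [X in _ + X]big_nat_cond [X in _ + X]big1 ?addr0; last first.
        by move=> h /andP[/andP[mh _] _]; rewrite /bnd ltnNge mh.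
      rewrite big_nat_cond [leRHS]big_nat_cond; apply: ler_sum => h /andP[/andP[_ hk] _].
      by rewrite /bnd hk.
    rewrite mulr_natl mulr2n; apply: lerD.
      apply: le_trans (bsum i.+1); rewrite big_nat_rev /= add0n big_nat_recl // -[leLHS]add0r.
      apply: lerD => //; rewrite le_eqVlt; apply/orP; left; apply/eqP.
      rewrite big_nat_cond [RHS]big_nat_cond; apply: eq_bigr => h /andP[/andP[_ hi] _].
      by rewrite dist_subl.
    apply: le_trans (bsum (n - i)%N); rewrite -{1}[nat_of_ord i]add0n big_addn.
    rewrite le_eqVlt; apply/orP; left; apply/eqP; apply: eq_bigr => h _; congr bnd; exact: dist_addl.
  have -> : b = 2 * (a 0%N + C ^+ 2 / (1 - s2) / r%:R `^ (1 - s2) * s n).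
    by rewrite /b /B0; ring.
  rewrite ler_pM2l // -(prednK m0) big_ord_recl /= lerD2l.
  apply: (@le_trans _ _ (\sum_(h < m) (C * (m%:R / h.+1%:R) `^ s2 * a m))).
    pose Fm (h : nat) : R := C * (m%:R / h.+1%:R) `^ s2 * a m.
    have -> : \sum_(h < m) C * (m%:R / h.+1%:R) `^ s2 * a m = \sum_(h < m.-1.+1) Fm h.
      by rewrite prednK.
    rewrite big_ord_recr /= -[leLHS]addr0; apply: lerD; last first.
      by rewrite !mulr_ge0 ?powR_ge0 // ltW.
    apply: ler_sum => h _; rewrite /bump /= add1n; apply: incr => //.
    exact: leq_trans (ltn_ord h) (leq_pred m).
  have hE h : C * (m%:R / h.+1%:R) `^ s2 * a m = C * a m * m%:R `^ s2 * (h.+1%:R : R) `^ (- s2).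
    rewrite powRM ?invr_ge0 // -powR_inv1 // -powRrM mulN1r; ring.
  under eq_bigr do rewrite hE.
  rewrite -mulr_sumr.
  have ps := @power_sum R s2 m; rewrite s20 s21 in ps; have {ps} ps := ps isT.
  apply: le_trans (ler_wpM2l _ ps) _; first by rewrite !mulr_ge0 ?powR_ge0 // ltW.
  have -> : C * a m * m%:R `^ s2 * (m%:R `^ (1 - s2) / (1 - s2)) =
     C / (1 - s2) * (m%:R * a m).
    have -> : m%:R * a m = m%:R `^ s2 * m%:R `^ (1 - s2) * a m.
      rewrite -powRD ?(gt_eqF mR) ?implybT // (_ : s2 + (1 - s2) = 1) ?powRr1 ?ltW //; ring.
    by ring.
  have -> : C ^+ 2 / (1 - s2) / r%:R `^ (1 - s2) * s n = C / (1 - s2) * (C / r%:R `^ (1 - s2) * s n) by ring.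
  rewrite ler_wpM2l ?divr_ge0 ?(ltW C0) ?(ltW s20') //.
  apply: le_trans (ler_wpM2l (ltW mR) (incr m0 mn)) _.
  have -> : m%:R * (C * (n%:R / m%:R) `^ s2 * a n) =
     C * (m%:R / n%:R) `^ (1 - s2) * s n.
    have mn1 : m%:R = n%:R * (m%:R / n%:R) :> R by rewrite mulrCA divff ?mulr1 // gt_eqF.
    have mnp : 0 < m%:R / n%:R :> R by rewrite divr_gt0.
    rewrite {1}mn1 powRB ?(gt_eqF mnp) ?implybT // powRr1 ?(ltW mnp) // /s.
    rewrite -[n%:R / m%:R]invf_div; have -> : (m%:R / n%:R)^-1 `^ s2 = ((m%:R / n%:R) `^ s2)^-1 :> R.
      by rewrite -powR_inv1 ?(ltW mnp) // powRAC powR_inv1 // powR_ge0.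
    by ring.
  rewrite ler_wpM2r ?(ltW s0) // ler_wpM2l ?(ltW C0) //.
  have -> : (r%:R `^ (1 - s2))^-1 = r%:R^-1 `^ (1 - s2) :> R.
    by rewrite -powR_inv1 ?powR_ge0 // powRAC powR_inv1.
  rewrite ge0_ler_powR ?nnegrE ?(ltW s20') ?divr_ge0 ?invr_ge0 //.
  by rewrite ler_pdivrMr // mulrC ler_pdivlMr // -natrM ler_nat.
pose t := 4 / (eps * s n).
have t0 : 0 < t by rewrite divr_gt0 // mulr_gt0.
have Fsum (U : 'M[Cx]_n) : U \is unitarymx ->
    \sum_(k < n | (k <= q)%N) qform F (U ^t* *m delta_mx k 0) <= (t * (n%:R * f) ^+ 2 + q.+1%:R / t)%:C.
  move=> hU; apply: sum_first_qform_le => //; apply: rpred_sum => k _; exact: qform_real.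
have := eigval_sum_le hT nq TBF (schur_test hB Bb) Fsum.
rewrite -[(eigval _ _)%:C *+ _]mulr_natr -[b%:C *+ _]mulr_natr -(@realc_nat R q.+1).
rewrite -!realcM -realcD lecR => h.
have qR : 0 < q.+1%:R :> R by rewrite ltr0n.
rewrite -(ler_pM2r qR); apply: le_trans h _.
have hb : b <= eps / 2 * s n.
  rewrite /b; have -> : eps / 2 * s n = eps / 4 * s n + eps / 4 * s n by field.
  apply: lerD.
    move: sn; rewrite ler_pdivrMr // => sn; lra.
  rewrite ler_wpM2r ?(ltW s0) // ler_pdivrMr ?powR_gt0 //.
  move: hr; rewrite -ler_pdivlMr ?divr_gt0 // => hr.
  apply: le_trans hr _; rewrite le_eqVlt; apply/orP; left; apply/eqP; field.
  by rewrite gt_eqF.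
have ht : q.+1%:R / t = q.+1%:R * (eps / 4 * s n).
  by rewrite /t; field; rewrite !gt_eqF.
have hf : t * (n%:R * f) ^+ 2 <= q.+1%:R * (eps / 4 * s n).
  have -> : n%:R * f = Cr * s n by rewrite /f /Cr /s; ring.
  have -> : t * (Cr * s n) ^+ 2 = 16 * Cr ^+ 2 / eps ^+ 2 * (eps / 4 * s n).
    by rewrite /t; field; rewrite !gt_eqF.
  by rewrite ler_wpM2r // mulr_ge0 ?divr_ge0 // ltW.
rewrite ht; apply: le_trans (lerD (ler_wpM2r (ltW qR) hb) (lerD hf (lexx _))) _.
rewrite le_eqVlt; apply/orP; left; apply/eqP; field.
Unshelve. all: by end_near.
Qed.

(** The decay of [a] makes the form nearly diagonal on separated blocks; its slowness makes the
    sum of the kernel near the diagonal small. *)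
Lemma spiked_autocov : spiked gamma.
Proof.
have [e e0 he] := scale_large.
by exists s, e; split.
Qed.

End LongMemoryAutocovariance.

Lemma spiked_long_memory_autocov (R : realType) rho (gamma : int -> R[i]) (L : R -> R) :
  0 < rho < 1 -> (forall n, psdmx (toeplitz gamma n)) -> slowly_varying L ->
  long_memory_autocov rho gamma L -> spiked gamma.
Proof.
move=> hrho psdT svL hgamma; have [_ L0 _] := svL.
pose a (h : nat) : R := L h%:R / (1 + h%:R) `^ rho.
have [s1 [s2 [C [s10 /andP[s20 s21] C0 decr incr]]]] := @regular_sequence R rho L a hrho svL (fun=> erefl).
apply: (@spiked_autocov R gamma a s1 s2 C) => // h.
  by rewrite hgamma /a -intr_norm -abszE.
by rewrite /a divr_gt0 ?powR_gt0 ?L0 // ltr_wpDr.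
Qed.

(** * Toeplitz forms on the Fourier side *)

Section TrigonometricForms.
Variable R : realType.
Local Notation Cx := R[i].
Local Notation mu := (@lebesgue_measure R).
Local Notation I := (`[- pi, pi]%classic : set (measurableTypeR R)).
Implicit Types (psi : R -> R) (f g : R -> Cx).

Let mI : measurable I. Proof. exact: measurable_itv. Qed.

Let cint f := mu.-integrable I (EFin \o (fun x => complex.Re (f x))) /\
              mu.-integrable I (EFin \o (fun x => complex.Im (f x))).

Let intD (f g : R -> R) : mu.-integrable I (EFin \o f) -> mu.-integrable I (EFin \o g) ->
  mu.-integrable I (EFin \o (fun x => f x + g x)).
Proof. by move=> hf hg; have := integrableD mI hf hg; apply: eq_integrable. Qed.

Let intZ (a : R) (f : R -> R) : mu.-integrable I (EFin \o f) ->
  mu.-integrable I (EFin \o (fun x => a * f x)).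
Proof. by move=> hf; have := integrableZl mI a hf; apply: eq_integrable. Qed.

Let cintegralD f g : cint f -> cint g -> cint (fun x => f x + g x) /\
  cintegral I (fun x => f x + g x) = cintegral I f + cintegral I g.
Proof.
move=> [f1 f2] [g1 g2]; have re x : complex.Re (f x + g x) = complex.Re (f x) + complex.Re (g x).
  exact: raddfD.
have im x : complex.Im (f x + g x) = complex.Im (f x) + complex.Im (g x).
  exact: raddfD.
split.
  by rewrite /cint (funext re) (funext im); split; exact: intD.
rewrite /cintegral (funext re) (funext im).
by rewrite !RintegralD.
Qed.

Let cintegralZ (a : Cx) f : cint f -> cint (fun x => a * f x) /\
  cintegral I (fun x => a * f x) = a * cintegral I f.
Proof.
move=> [f1 f2]; case: a => a b.
have re x : complex.Re ((a +i* b) * f x) = a * complex.Re (f x) + (- b) * complex.Im (f x).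
  by case: (f x) => u v /=; rewrite mulNr.
have im x : complex.Im ((a +i* b) * f x) = a * complex.Im (f x) + b * complex.Re (f x).
  by case: (f x) => u v /=.
split.
  by rewrite /cint (funext re) (funext im); split; apply: intD; exact: intZ.
rewrite /cintegral (funext re) (funext im).
rewrite !RintegralD ?RintegralZl //; try exact: intZ.
by apply/eqP; rewrite eq_complex /= mulNr !eqxx.
Qed.

Let cintegral_sum (J : Type) (s : seq J) (F : J -> R -> Cx) : (forall j, cint (F j)) ->
  cint (fun x => \sum_(j <- s) F j x) /\
  cintegral I (fun x => \sum_(j <- s) F j x) = \sum_(j <- s) cintegral I (F j).
Proof.
move=> hF; elim: s => [|j s [IH1 IH2]].
  rewrite (funext (fun x => big_nil _ _ _ _)) big_nil; split.
    by split; exact: integrable0.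
  by rewrite /cintegral !Rintegral_cst // !mul0r.
by rewrite (funext (fun x => big_cons _ _ _ _ _ _)) big_cons -IH2; exact: cintegralD.
Qed.

Definition normsq (z : Cx) : R := complex.Re z ^+ 2 + complex.Im z ^+ 2.

Lemma normsqE z : (normsq z)%:C = z^*%R * z.
Proof. by case: z => a b; apply/eqP; rewrite eq_complex /normsq /=; apply/andP; split; apply/eqP; ring. Qed.

Lemma normsqM z w : normsq (z * w) = normsq z * normsq w.
Proof. by case: z w => [a b] [c e]; rewrite /normsq /=; ring. Qed.

Lemma normsq_ge0 z : 0 <= normsq z.
Proof. by rewrite addr_ge0 // sqr_ge0. Qed.

Lemma expiD s t : expi (s + t) = expi s * expi t :> Cx.
Proof. by apply/eqP; rewrite eq_complex /= cosD sinD; apply/andP; split; apply/eqP; ring. Qed.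

Lemma expiN t : expi (- t) = (expi t)^*%R :> Cx.
Proof. by rewrite /expi cosN sinN. Qed.

Definition trig_poly n (c : 'cV[Cx]_n) (x : R) : Cx := \sum_(l < n) c l 0 * expi (l%:R * x).

Lemma trig_poly_sq n (c : 'cV[Cx]_n) x : (normsq (trig_poly c x))%:C =
  \sum_(k < n) \sum_(l < n) (c k 0)^*%R * c l 0 * expi (- ((k%:Z - l%:Z)%:~R * x)).
Proof.
rewrite normsqE rmorph_sum /= mulr_suml; apply: eq_bigr => k _.
rewrite mulr_sumr; apply: eq_bigr => l _.
have -> : - ((k%:Z - l%:Z)%:~R * x) = - (k%:R * x) + l%:R * x.
  by rewrite rmorphB /= -!pmulrn; ring.
by rewrite expiD expiN rmorphM /=; ring.
Qed.

Lemma measurable_trig_cos (a : R) : measurable_fun I (fun x => cos (a * x)).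
Proof.
apply: measurable_funTS; apply: continuous_measurable_fun => x.
by apply: continuous_comp; [exact: mulrl_continuous|exact: continuous_cos].
Qed.

Lemma measurable_trig_sin (a : R) : measurable_fun I (fun x => sin (a * x)).
Proof.
apply: measurable_funTS; apply: continuous_measurable_fun => x.
by apply: continuous_comp; [exact: mulrl_continuous|exact: continuous_sin].
Qed.

Let int_bounded psi (h : R -> R) : mu.-integrable I (EFin \o psi) ->
  measurable_fun I h -> (forall x, `|h x| <= 1) -> mu.-integrable I (EFin \o (fun x => psi x * h x)).
Proof.
move=> hpsi mh h1; have := @integrableMl _ _ _ mu I mI (EFin \o psi) h hpsi mh.
move=> H; apply: (eq_integrable mI) (H _) => //.
exists 1; split=> // M M1 x _ /=; exact: le_trans (h1 x) (ltW M1).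
Qed.

Let cint_expi psi (a : R) : mu.-integrable I (EFin \o psi) ->
  cint (fun x => (psi x)%:C * expi (- (a * x))).
Proof.
move=> hpsi; split.
  have re x : complex.Re ((psi x)%:C * expi (- (a * x))) = psi x * cos (- a * x).
    by rewrite /= mul0r subr0 mulNr.
  by rewrite (funext re); apply: int_bounded => //; [exact: measurable_trig_cos|move=> x; exact: cos_max].
have im x : complex.Im ((psi x)%:C * expi (- (a * x))) = psi x * sin (- a * x).
  by rewrite /= mul0r addr0 mulNr.
by rewrite (funext im); apply: int_bounded => //; [exact: measurable_trig_sin|move=> x; exact: sin_max].
Qed.

(** Under the Fourier integral the double sum of the form is a square. *)
Lemma toeplitz_form (gamma : int -> Cx) psi n (c : 'cV[Cx]_n) :
  has_spectral_density gamma psi ->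
  mu.-integrable I (EFin \o (fun x => psi x * normsq (trig_poly c x))) /\
  qform (toeplitz gamma n) c = (\int[mu]_(x in I) (psi x * normsq (trig_poly c x)))%:C.
Proof.
move=> [hpsi hg].
pose F (k l : 'I_n) x : Cx := (c k 0)^*%R * c l 0 * ((psi x)%:C * expi (- ((k%:Z - l%:Z)%:~R * x))).
have FE k l : cint (F k l) /\ cintegral I (F k l) = (c k 0)^*%R * c l 0 * gamma (k%:Z - l%:Z).
  by rewrite hg; apply: cintegralZ; exact: cint_expi.
have G k := cintegral_sum (index_enum 'I_n) (fun l => (FE k l).1).
have [[H1 _] H2] := cintegral_sum (index_enum 'I_n) (fun k => (G k).1).
have E x : \sum_(k < n) \sum_(l < n) F k l x = (psi x * normsq (trig_poly c x))%:C.
  rewrite realcM trig_poly_sq mulr_sumr; apply: eq_bigr => k _.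
  by rewrite mulr_sumr; apply: eq_bigr => l _; rewrite /F; ring.
split.
  apply: eq_integrable H1 => // x _ /=; congr EFin.
  by have -> : \sum_(k < n) \sum_(l < n) F k l x = (psi x * normsq (trig_poly c x))%:C by [].
have -> : qform (toeplitz gamma n) c = \sum_(k < n) \sum_(l < n) cintegral I (F k l).
  rewrite /qform mxE exchange_big /=; apply: eq_bigr => l _.
  rewrite mxE mulr_suml; apply: eq_bigr => k _.
  by rewrite (FE k l).2 adjmxE [(toeplitz _ _) _ _]mxE; ring.
rewrite (eq_bigr _ (fun k _ => esym (G k).2)) -H2 (_ : (fun x => _) = (fun x => (psi x * normsq (trig_poly c x))%:C)) ?(funext E) // /cintegral.
by rewrite /= Rintegral_cst // mul0r.
Qed.

End TrigonometricForms.

Section Parseval.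
Variable R : realType.
Local Notation Cx := R[i].
Local Notation mu := (@lebesgue_measure R).
Local Notation I := (`[- pi, pi]%classic : set (measurableTypeR R)).
Implicit Types (phi : R -> R).

Let mI : measurable I. Proof. exact: measurable_itv. Qed.

Let piNpi : - pi < pi :> R. Proof. by rewrite gtrN ?pi_gt0. Qed.

Lemma mu_period : fine (mu I) = 2 * pi.
Proof. by rewrite lebesgue_measure_itv /= lte_fin piNpi -EFinB /= opprK mulr_natl mulr2n. Qed.

Lemma integrable_period_cst (c : R) : mu.-integrable I (EFin \o cst c).
Proof.
apply: measurable_bounded_integrable => //.
  have : (mu I < +oo)%E by rewrite lebesgue_measure_itv /= lte_fin piNpi -EFinB ltry.
  by [].
exists `|c|; split; first exact: num_real.
by move=> M cM x _ /=; exact: ltW.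
Qed.

Let FTC (f F : R -> R) : continuous f -> (forall x : R, is_derive x 1 F (f x)) ->
  \int[mu]_(x in I) f x = F pi - F (- pi).
Proof.
move=> cf dF; have cF : continuous F.
  by move=> x; apply/differentiable_continuous/derivable1_diffP; have [] := dF x.
rewrite /Rintegral (@continuous_FTC2 _ _ F) //.
- by apply: continuous_subspaceT => x; exact: cf.
- split.
  + by move=> x _; have [] := dF x.
  + by apply: cvg_at_right_filter; exact: cF.
  + by apply: cvg_at_left_filter; exact: cF.
- by move=> x _; rewrite derive1E; have [] := dF x.
Qed.

Lemma integral_cos_period (h : int) : h != 0 -> \int[mu]_(x in I) cos (h%:~R * x) = 0 :> R.
Proof.
move=> h0; have hR : h%:~R != 0 :> R by rewrite intr_eq0.
have cf : continuous (fun x : R => cos (h%:~R * x)).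
  by move=> x; apply: continuous_comp; [exact: mulrl_continuous|exact: continuous_cos].
have dF (x : R) : is_derive x 1 (fun x => h%:~R^-1 * sin (h%:~R * x)) (cos (h%:~R * x)).
  by apply: is_derive_eq; rewrite /GRing.scale /=; field.
rewrite (FTC cf dF); have npi k : sin (k%:R * pi) = 0 :> R.
  have := alternatingn (@sinDpi R) k 0; rewrite add0r sin0 mulr0 mulr_natl; exact.
have zpi : sin (h%:~R * pi) = 0 :> R.
  by case: (h) => k; rewrite ?NegzE -?pmulrn ?npi // rmorphN /= -pmulrn mulNr sinN npi oppr0.
by rewrite mulrN sinN zpi oppr0 mulr0 subrr.
Qed.

Lemma integral_sin_period (h : int) : \int[mu]_(x in I) sin (h%:~R * x) = 0 :> R.
Proof.
have [->|h0] := eqVneq h 0.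
  by under eq_Rintegral do rewrite mul0r sin0; rewrite Rintegral_cst // mul0r.
have hR : h%:~R != 0 :> R by rewrite intr_eq0.
have cf : continuous (fun x : R => sin (h%:~R * x)).
  by move=> x; apply: continuous_comp; [exact: mulrl_continuous|exact: continuous_sin].
have dF (x : R) : is_derive x 1 (fun x => - h%:~R^-1 * cos (h%:~R * x)) (sin (h%:~R * x)).
  by apply: is_derive_eq; rewrite /GRing.scale /=; field.
by rewrite (FTC cf dF) mulrN cosN subrr.
Qed.

(** Parseval is the form of [toeplitz_form] for the identity matrix. *)
Lemma flat_spectral_density :
  has_spectral_density (fun h => (if h == 0 then 2 * pi else 0 : R)%:C) (cst 1).
Proof.
split=> [|h]; first exact: integrable_period_cst.
rewrite /cintegral.
have re x : complex.Re ((cst (1 : R) x)%:C * expi (- (h%:~R * x))) = cos (h%:~R * x).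
  by rewrite /= mul1r mul0r subr0 cosN.
have im x : complex.Im ((cst (1 : R) x)%:C * expi (- (h%:~R * x))) = sin ((- h)%:~R * x).
  by rewrite /= mul1r mul0r addr0 rmorphN mulNr.
rewrite (funext re) (funext im) integral_sin_period; have [->|h0] := eqVneq h 0.
  by under eq_Rintegral do rewrite mul0r cos0; rewrite Rintegral_cst // mul1r mu_period.
by rewrite integral_cos_period.
Qed.

Lemma parseval n (c : 'cV[Cx]_n) :
  mu.-integrable I (EFin \o (fun x => normsq (trig_poly c x))) /\
  (\int[mu]_(x in I) normsq (trig_poly c x))%:C = (2 * pi)%:C * sqn c.
Proof.
have [H1 H2] := toeplitz_form c flat_spectral_density.
have E : (fun x => cst 1 x * normsq (trig_poly c x)) = (fun x => normsq (trig_poly c x)).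
  by apply: funext => x; rewrite mul1r.
rewrite E in H1 H2; split=> //; rewrite -H2 -qform1 -qformZ; congr qform.
apply/matrixP => i j; rewrite !mxE subr_eq0 eqz_nat.
have -> : (nat_of_ord i == j) = (i == j) by [].
by case: ifP => _; rewrite ?mulr1 ?mulr0.
Qed.

(** The origin is a null set, where a long memory density is not the expected one. *)
Lemma le_Rintegral_off0 (f g : R -> R) : mu.-integrable I (EFin \o f) ->
  mu.-integrable I (EFin \o g) -> (forall x, - pi <= x <= pi -> x != 0 -> f x <= g x) ->
  \int[mu]_(x in I) f x <= \int[mu]_(x in I) g x.
Proof.
move=> intf intg fg; pose I' : set (measurableTypeR R) := I `\ 0.
have I0 : I = I' `|` [set 0].
  by rewrite setUC /I' setDUK // => x /= ->; rewrite in_itv /= oppr_le0 pi_ge0.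
have mI' : measurable I' by exact: measurableD.
have off0 h : mu.-integrable I (EFin \o h) ->
    \int[mu]_(x in I) h x = \int[mu]_(x in I') h x.
  move=> hh; rewrite {1}I0 Rintegral_setU -?I0 ?Rintegral_set1 ?addr0 //.
  by rewrite disj_set2E; apply/eqP; rewrite /I' setDKI.
have sI : I' `<=` I by exact: subDsetl.
rewrite !off0 //; apply: le_Rintegral => //; [exact: integrableS intf|exact: integrableS intg|].
by move=> x [/= xI x0]; apply: fg; [move: xI; rewrite in_itv|apply/eqP].
Qed.

Lemma toeplitz_form_le (gamma : int -> Cx) phi (S : R) n (c : 'cV[Cx]_n) :
  has_spectral_density gamma phi -> (forall x, - pi <= x <= pi -> x != 0 -> phi x <= S) ->
  qform (toeplitz gamma n) c <= (S * (2 * pi))%:C * sqn c.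
Proof.
move=> hphi hS; have [H1 ->] := toeplitz_form c hphi; have [H2 H3] := parseval c.
rewrite realcM -mulrA -H3 -realcM lecR -RintegralZl //.
apply: le_Rintegral_off0 => //.
  by have := integrableZl mI S H2; apply: eq_integrable.
by move=> x xI x0; rewrite ler_wpM2r ?normsq_ge0 // hS.
Qed.

(** The discrete gradient; it multiplies trigonometric polynomials by [1 - e^(i x)]. *)
Definition diffmx n : 'M[Cx]_(n.+1, n) :=
  \matrix_(l, k) ((l == k :> nat)%:R - (l == k.+1 :> nat)%:R).

Lemma trig_poly_diffmx n (c : 'cV[Cx]_n) x :
  trig_poly (diffmx n *m c) x = (1 - expi x) * trig_poly c x.
Proof.
rewrite /trig_poly; under eq_bigr do rewrite mxE mulr_suml.
rewrite exchange_big mulr_sumr /=; apply: eq_bigr => k _.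
have kn := ltn_ord k; have k1 : (k < n.+1)%N by exact: ltnW.
have k2 : (k.+1 < n.+1)%N by [].
under eq_bigr => l _ do rewrite mxE !mulrBl.
rewrite sumrB (bigD1 (Ordinal k1)) //= eqxx big1 ?addr0; last first.
  by move=> l; rewrite -val_eqE /= => /negPf ->; rewrite !mul0r.
rewrite (bigD1 (Ordinal k2)) //= eqxx big1 ?addr0; last first.
  by move=> l; rewrite -val_eqE /= => /negPf ->; rewrite !mul0r.
have -> : k.+1%:R * x = k%:R * x + x by rewrite -addn1 natrD; ring.
by rewrite expiD -[true%:R]/(1 : Cx); ring.
Qed.

(** A trigonometric minorant of the density turns, through Parseval, into a comparison of
    the Toeplitz form with the norms of a vector and of its discrete gradient. *)
Lemma toeplitz_form_ge (gamma : int -> Cx) phi (a b : R) n (c : 'cV[Cx]_n) :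
  has_spectral_density gamma phi ->
  (forall x, - pi <= x <= pi -> x != 0 -> a - b * normsq (1 - expi x) <= phi x) ->
  (2 * pi)%:C * (a%:C * sqn c - b%:C * sqn (diffmx n *m c)) <= qform (toeplitz gamma n) c.
Proof.
move=> hphi hab; have [H1 ->] := toeplitz_form c hphi; have [H2 H3] := parseval c.
have [H4 H5] := parseval (diffmx n *m c).
have H2' : mu.-integrable I (EFin \o (fun x => a * normsq (trig_poly c x))).
  by have := integrableZl mI a H2; apply: eq_integrable.
have H4' : mu.-integrable I (EFin \o (fun x => b * normsq (trig_poly (diffmx n *m c) x))).
  by have := integrableZl mI b H4; apply: eq_integrable.
rewrite mulrBr ![(2 * pi)%:C * (_ * _)]mulrCA -H3 -H5 -!realcM -rmorphB /= lecR.
rewrite -!RintegralZl // -RintegralB //; apply: le_Rintegral_off0 => //.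
  by have := integrableB mI H2' H4'; apply: eq_integrable.
move=> x xI x0; rewrite trig_poly_diffmx normsqM mulrA -mulrBl.
by rewrite ler_wpM2r ?normsq_ge0 // hab.
Qed.

End Parseval.

(** * Toeplitz matrices with a singular spectral density *)

Section DisjointSupports.
Variable R : realType.
Local Notation Cx := R[i].

Lemma sqn_disjoint n m (V : 'M[Cx]_(n, m)) (x : 'cV[Cx]_m) :
  (forall l b c, b != c -> V l b * V l c = 0) ->
  sqn (V *m x) = \sum_b (\sum_l `|V l b| ^+ 2) * `|x b 0| ^+ 2.
Proof.
move=> hV; rewrite sqnE; under [RHS]eq_bigr do rewrite mulr_suml.
rewrite exchange_big /=; apply: eq_bigr => l _; rewrite mxE.
have [[b Vb]|h] := pselect (exists b, V l b != 0); last first.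
  have V0 b : V l b = 0 by apply: contrapT => hb; apply: h; exists b; apply/eqP.
  rewrite big1 => [|b _]; last by rewrite V0 mul0r.
  by rewrite big1 => [|b _]; rewrite ?V0 normr0 expr0n ?mul0r.
have V0 c : c != b -> V l c = 0.
  move=> cb; have /eqP := hV l c b cb; rewrite mulf_eq0 (negPf Vb) orbF.
  by move/eqP.
rewrite (bigD1 b) //= big1 => [|c cb]; last by rewrite V0 ?mul0r.
rewrite (bigD1 b) //= big1 => [|c cb]; last by rewrite V0 // normr0 expr0n mul0r.
by rewrite !addr0 normrM exprMn.
Qed.

(** On consecutive blocks of length [4 q], tents of height [2 q] and slopes [1] and [-1]: the
    gradient is smaller than the function by a factor of order [q]. *)
Definition tent (q b l : nat) : nat := minn (l - 4 * q * b) (4 * q * b + 4 * q - l).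

Lemma tent_out q b l : ~~ (4 * q * b < l < 4 * q * b + 4 * q)%N -> tent q b l = 0%N.
Proof. by rewrite /tent; move: (4 * q * b)%N => x; lia. Qed.

Lemma tent_slope q b l : (tent q b l.+1 <= tent q b l + 1)%N /\ (tent q b l <= tent q b l.+1 + 1)%N.
Proof. by rewrite /tent; move: (4 * q * b)%N => x; lia. Qed.

Lemma tent_mid q b l : (4 * q * b + q <= l < 4 * q * b + q + 2 * q)%N -> (q <= tent q b l)%N.
Proof. by rewrite /tent; move: (4 * q * b)%N => x; lia. Qed.

Lemma tent_block q b c l : b <> c -> (4 * q * b <= l < 4 * q * b + 4 * q)%N ->
  (4 * q * c <= l < 4 * q * c + 4 * q)%N -> False.
Proof.
move=> bc /andP[b1 b2] /andP[c1 c2].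
have h x y : (4 * q * x <= l)%N -> (l < 4 * q * y + 4 * q)%N -> (x <= y)%N.
  move=> h1 h2; rewrite leqNgt; apply/negP => yx.
  have : (4 * q * y.+1 <= 4 * q * x)%N by rewrite leq_mul2l yx orbT.
  rewrite mulnS; lia.
by apply: bc; apply/eqP; rewrite eqn_leq (h _ _ b1 c2) (h _ _ c1 b2).
Qed.

Lemma block_end q b p n : (b <= p)%N -> (4 * q * p.+1 <= n)%N -> (4 * q * b + 4 * q <= n)%N.
Proof.
move=> bp; apply: leq_trans; rewrite -mulnSr; exact: leq_mul.
Qed.

Definition tentmx q n p : 'M[Cx]_(n, p.+1) := \matrix_(l, b) (tent q b l)%:R.

Lemma diff_tentmx q n p l b : (4 * q * p.+1 <= n)%N ->
  (diffmx R n *m tentmx q n p) l b = (tent q b l)%:R - (if nat_of_ord l is l'.+1 then tent q b l' else 0%N)%:R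
  :> Cx.
Proof.
move=> qn; have bn := block_end (ltn_ord b : (b <= p)%N) qn.
have sumE (k : nat) : (k <= n)%N -> \sum_(j < n) (k == j :> nat)%:R * (tent q b j)%:R = (tent q b k)%:R :> Cx.
  move=> kn; have [lt|ge] := ltnP k n; last first.
    rewrite big1 => [|j _]; first by rewrite tent_out // negb_and orbC -leqNgt (leq_trans bn).
    by rewrite gtn_eqF ?mul0r // (leq_trans (ltn_ord j)).
  rewrite (bigD1 (Ordinal lt)) //= eqxx mul1r big1 ?addr0 // => j; rewrite -val_eqE /= eq_sym.
  by move=> /negPf ->; rewrite mul0r.
rewrite mxE; under eq_bigr do rewrite !mxE mulrBl.
rewrite sumrB sumE -1?ltnS //; congr (_ - _).
case: l => -[|l] hl /=; first by rewrite big1 // => j _; rewrite mul0r.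
by rewrite -(sumE l) //; last exact: ltnW.
Qed.

Lemma sqn_tentmx q n p (x : 'cV[Cx]_p.+1) : (4 * q * p.+1 <= n)%N ->
  (2 * q ^ 3)%:R * sqn x <= sqn (tentmx q n p *m x).
Proof.
move=> qn; rewrite sqn_disjoint => [|l b c bc]; last first.
  rewrite !mxE -natrM; apply/eqP; rewrite pnatr_eq0 muln_eq0.
  have [/(tent_out (q := q)) ->//|hb] := boolP (~~ (4 * q * b < l < 4 * q * b + 4 * q)%N).
  have [/(tent_out (q := q)) ->//|hc] := boolP (~~ (4 * q * c < l < 4 * q * c + 4 * q)%N).
    by rewrite orbT.
  rewrite !negbK in hb hc; case/andP: hb => b1 b2; case/andP: hc => c1 c2.
  exfalso; apply: (@tent_block q b c l); rewrite ?(ltnW b1) ?(ltnW c1) //.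
  by move=> e; move/eqP: bc; apply; exact: val_inj.
rewrite sqnE mulr_sumr; apply: ler_sum => b _; rewrite ler_wpM2r ?exprn_ge0 //.
have bn := block_end (ltn_ord b : (b <= p)%N) qn.
apply: (@le_trans _ _ (\sum_(l < n) ((4 * q * b + q <= l < 4 * q * b + q + 2 * q)%N)%:R * (q%:R ^+ 2))).
  rewrite -mulr_suml sum_indic_itv; last by move: bn; move: (4 * q * b)%N => y; lia.
  by rewrite -natrX -natrM ler_nat [(q ^ 3)%N]expnS mulnA.
apply: ler_sum => l _; rewrite mxE.
have [h|_] := boolP (4 * q * b + q <= l < _)%N; last by rewrite mul0r exprn_ge0.
by rewrite mul1r normr_nat -!natrX ler_nat leq_exp2r // tent_mid.
Qed.

Lemma sqn_diff_tentmx q n p (x : 'cV[Cx]_p.+1) : (4 * q * p.+1 <= n)%N ->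
  sqn (diffmx R n *m (tentmx q n p *m x)) <= (4 * q)%:R * sqn x.
Proof.
move=> qn; pose J (b : 'I_p.+1) (l : nat) := (4 * q * b + 1 <= l < 4 * q * b + 1 + 4 * q)%N.
have D0 (l : 'I_n.+1) b : ~~ J b l -> (diffmx R n *m tentmx q n p) l b = 0.
  rewrite diff_tentmx // /J => hJ; case: l hJ => -[|l] hl /= hJ.
    by rewrite tent_out ?subrr //.
  by rewrite !tent_out ?subrr //; move: hJ; move: (4 * q * b)%N => y; lia.
have D1 l b : `|(diffmx R n *m tentmx q n p) l b| ^+ 2 <= 1.
  rewrite diff_tentmx //; apply: exprn_ile1; rewrite ?normr_ge0 //.
  case: l => -[|l] hl /=.
    by rewrite tent_out ?subrr ?normr0 ?ler01.
  have [h1 h2] := tent_slope q b l; rewrite real_ler_distl ?rpredB ?realn //; apply/andP; split.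
    by rewrite lerBlDr -[1]/(1%:R) -natrD ler_nat.
  by rewrite -[1]/(1%:R) -natrD ler_nat.
rewrite mulmxA sqn_disjoint => [|l b c bc]; last first.
  have [/D0 ->|hb] := boolP (~~ J b l); first by rewrite mul0r.
  have [/D0 ->|hc] := boolP (~~ J c l); first by rewrite mulr0.
  rewrite !negbK in hb hc; case/andP: hb => b1 b2; case/andP: hc => c1 c2.
  exfalso; apply: (@tent_block q b c l.-1).
  - by move=> e; move/eqP: bc; apply; exact: val_inj.
  - by move: b1 b2; move: (4 * q * b)%N => y; lia.
  - by move: c1 c2; move: (4 * q * c)%N => y; lia.
rewrite sqnE mulr_sumr; apply: ler_sum => b _; rewrite ler_wpM2r ?exprn_ge0 //.
have bn := block_end (ltn_ord b : (b <= p)%N) qn.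
rewrite -(@sum_indic_itv Cx n.+1 (4 * q * b + 1)); last by move: bn; move: (4 * q * b)%N => y; lia.
apply: ler_sum => l _; have [hJ|hJ] := boolP (4 * q * b + 1 <= l < _)%N; first exact: D1.
by rewrite D0 ?normr0 ?expr0n.
Qed.

End DisjointSupports.

Section SpectralDensity.
Variables (R : realType) (gamma : int -> R[i]) (phi : R -> R).
Local Notation Cx := R[i].
Local Notation mu := (@lebesgue_measure R).
Local Notation I := (`[- pi, pi]%classic : set (measurableTypeR R)).
Hypothesis psdT : forall n, psdmx (toeplitz gamma n).
Hypothesis density : has_spectral_density gamma phi.
Hypothesis phi0 : forall x, 0 <= phi x.

Let mI : measurable I. Proof. exact: measurable_itv. Qed.

(** Blocks of tents are orthogonal, of large norm and small increments. *)
Lemma density_eigval_ge n p q (a b : R) : 0 <= a -> 0 <= b -> (0 < q)%N ->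
  (4 * q * p.+1 <= n)%N -> b * 4 <= a * q%:R ^+ 2 ->
  (forall x, - pi <= x <= pi -> x != 0 -> a - b * normsq (1 - expi x) <= phi x) ->
  pi * a <= eigval p.+1 (toeplitz gamma n).
Proof.
move=> a0 b0 q0 qn ab hphi; have hT : toeplitz gamma n \is hermsymmx by have [] := psdT n.
have q3 : 0 < (2 * q ^ 3)%:R :> Cx by rewrite ltr0n muln_gt0 expn_gt0 q0.
apply: (@eigval_ge_subspace _ _ _ _ (tentmx R q n p)) => // [x x0|x].
  rewrite -sqn_gt0; apply: lt_le_trans (sqn_tentmx _ qn).
  by rewrite mulr_gt0 // sqn_gt0.
apply: le_trans (toeplitz_form_ge _ density hphi).
have h1 := sqn_tentmx x qn; have h2 := sqn_diff_tentmx x qn.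
set X := sqn (tentmx R q n p *m x) in h1 *; set D := sqn (diffmx _ _ *m _) in h2 *.
have h3 : b%:C * D <= (a / 2)%:C * X.
  apply: (@le_trans _ _ (b%:C * ((4 * q)%:R * sqn x))); first by rewrite ler_wpM2l // ler0c.
  apply: (@le_trans _ _ ((a / 2)%:C * ((2 * q ^ 3)%:R * sqn x))); last first.
    by rewrite ler_wpM2l // ler0c divr_ge0.
  rewrite !mulrA ler_wpM2r ?sqn_ge0 // -!realc_nat -!realcM lecR.
  have -> : a / 2 * (2 * q ^ 3)%:R = a * q%:R ^+ 2 * q%:R.
    by rewrite natrM natrX; field.
  by rewrite natrM mulrA ler_wpM2r.
have -> : (pi * a)%:C * X = (2 * pi)%:C * ((a / 2)%:C * X).
  by rewrite mulrA -realcM; congr (_%:C * _); field.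
rewrite ler_wpM2l ?ler0c ?mulr_ge0 ?pi_ge0 // lerBrDr.
apply: le_trans (lerD (lexx _) h3) _; rewrite -mulrDl -realcD.
by rewrite (_ : a / 2 + a / 2 = a) //; field.
Qed.

(** Splitting the density splits the matrix into a part bounded in norm
    and a part bounded entrywise. *)
Lemma density_eigval_le n q (w : R -> R) (S f t : R) : (q < n)%N -> 0 < t ->
  measurable_fun I w -> (forall x, 0 <= w x <= 1) ->
  (forall x, - pi <= x <= pi -> x != 0 -> phi x * (1 - w x) <= S) ->
  \int[mu]_(x in I) (phi x * w x) <= f ->
  q.+1%:R * eigval q.+1 (toeplitz gamma n) <=
    q.+1%:R * (S * (2 * pi)) + (t * (n%:R * (2 * f)) ^+ 2 + q.+1%:R / t).
Proof.
move=> qn t0 mw w01 hS hf; have [intphi gammaE] := density.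
have hT : toeplitz gamma n \is hermsymmx by have [] := psdT n.
have intw (h : R -> R) : measurable_fun I h -> (forall x, `|h x| <= 1) ->
    mu.-integrable I (EFin \o (fun x => phi x * h x)).
  move=> mh h1; have := @integrableMl _ _ _ mu I mI (EFin \o phi) h intphi mh.
  move=> H; apply: (eq_integrable mI) (H _) => //.
  exists 1; split=> // M M1 x _ /=; exact: le_trans (h1 x) (ltW M1).
have int1 := intw _ mw (fun x => _); have {}int1 : mu.-integrable I (EFin \o (fun x => phi x * w x)).
  by apply: int1 => x; have /andP[w0 w1] := w01 x; rewrite ger0_norm.
have int2 : mu.-integrable I (EFin \o (fun x => phi x * (1 - w x))).
  apply: intw => [|x]; first exact: measurable_funB.
  by have /andP[w0 w1] := w01 x; rewrite ger0_norm ?subr_ge0 // lerBlDr lerDl.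
pose G (psi : R -> R) (h : int) : Cx := cintegral I (fun x => (psi x)%:C * expi (- (h%:~R * x))).
pose B := toeplitz (G (fun x => phi x * (1 - w x))) n.
pose F := toeplitz (G (fun x => phi x * w x)) n.
have dB : has_spectral_density (G (fun x => phi x * (1 - w x))) (fun x => phi x * (1 - w x)) by split.
have dF : has_spectral_density (G (fun x => phi x * w x)) (fun x => phi x * w x) by split.
have reE psi x h : complex.Re ((psi x)%:C * expi (- (h%:~R * x))) = psi x * cos (h%:~R * x).
  by rewrite /= mul0r subr0 cosN.
have imE psi x h : complex.Im ((psi x)%:C * expi (- (h%:~R * x))) = psi x * - sin (h%:~R * x).
  by rewrite /= mul0r addr0 sinN.
have intcs psi (a : R) : mu.-integrable I (EFin \o psi) ->
    mu.-integrable I (EFin \o (fun x => psi x * cos (a * x))) /\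
    mu.-integrable I (EFin \o (fun x => psi x * - sin (a * x))).
  move=> hpsi; split.
    have := @integrableMl _ _ _ mu I mI (EFin \o psi) (fun x => cos (a * x)) hpsi (measurable_trig_cos a).
    move=> H; apply: (eq_integrable mI) (H _) => //.
    exists 1; split=> // M M1 x _ /=; exact: le_trans (cos_max _) (ltW M1).
  have := @integrableMl _ _ _ mu I mI (EFin \o psi) (fun x => - sin (a * x)) hpsi.
  move=> H; apply: (eq_integrable mI) (H _ _) => //.
    by apply: measurableT_comp => //; exact: measurable_trig_sin.
  exists 1; split=> // M M1 x _ /=; rewrite normrN; exact: le_trans (sin_max _) (ltW M1).
have GE psi h : cintegral I (fun x => (psi x)%:C * expi (- (h%:~R * x))) =
    (\int[mu]_(x in I) (psi x * cos (h%:~R * x))) +i*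
    (\int[mu]_(x in I) (psi x * - sin (h%:~R * x))).
  by rewrite /cintegral; congr (_ +i* _); apply: eq_Rintegral => x _; rewrite ?reE ?imE.
have TBF : toeplitz gamma n = B + F.
  apply/matrixP => i j; rewrite !mxE gammaE /G; set h := (_ - _ : int).
  rewrite (GE phi) (GE (fun x => phi x * (1 - w x))) (GE (fun x => phi x * w x)).
  have [c1 s1] := intcs _ h%:~R int1; have [c2 s2] := intcs _ h%:~R int2.
  apply/eqP; rewrite eq_complex /= -!RintegralD //; apply/andP; split; apply/eqP.
    by apply: eq_Rintegral => x _; ring.
  by apply: eq_Rintegral => x _; ring.
have Fij i j : `|F i j| <= (2 * f)%:C.
  rewrite !mxE /G (GE (fun x => phi x * w x)); set h := (_ - _ : int).
  have bnd (g : R -> R) : (forall x, `|g x| <= 1) ->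
      mu.-integrable I (EFin \o (fun x => phi x * w x * g x)) ->
      `|\int[mu]_(x in I) (phi x * w x * g x)| <= f.
    move=> g1 ig; apply: le_trans (le_normr_Rintegral mI ig) _.
    apply: le_trans hf; apply: le_Rintegral => //.
      by have := integrable_norm ig; apply: eq_integrable.
    move=> x _; have /andP[w0 _] := w01 x; have p0 := phi0 x.
    by rewrite normrM ger0_norm ?mulr_ge0 // ler_piMr ?mulr_ge0.
  have [c1 s1] := intcs _ h%:~R int1.
  set u := \int[mu]_(x in I) _; set v := \int[mu]_(x in I) _.
  apply: (@le_trans _ _ (`|u| + `|v|)%:C).
    rewrite normc_def lecR /=.
    have uv0 : 0 <= `|u| + `|v| by rewrite addr_ge0.
    rewrite -[leRHS](ger0_norm uv0) -sqrtr_sqr ler_wsqrtr // sqrrD !real_normK ?num_real //.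
    by rewrite addrAC lerDl mulrn_wge0 // mulr_ge0.
  rewrite lecR mulr_natl mulr2n.
  apply: lerD; apply: bnd => // x; rewrite ?normrN; [exact: cos_max|exact: sin_max].
have Bv v : qform B v <= (S * (2 * pi))%:C * sqn v by exact: toeplitz_form_le dB hS.
have Fsum (U : 'M[Cx]_n) : U \is unitarymx ->
    \sum_(k < n | (k <= q)%N) qform F (U ^t* *m delta_mx k 0) <=
      (t * (n%:R * (2 * f)) ^+ 2 + q.+1%:R / t)%:C.
  move=> hU; apply: sum_first_qform_le => //; apply: rpred_sum => k _.
  by rewrite (toeplitz_form _ dF).2 complex_real.
have := eigval_sum_le hT qn TBF Bv Fsum.
rewrite -[(eigval _ _)%:C *+ _]mulr_natl -[(S * _)%:C *+ _]mulr_natl -(@realc_nat R q.+1).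
by rewrite -!realcM -realcD lecR.
Qed.

End SpectralDensity.

Lemma powR_invl (R : realType) (x z : R) : 0 <= x -> x^-1 `^ z = (x `^ z)^-1.
Proof. by move=> x0; rewrite -powR_inv1 // powRAC powR_inv1 // powR_ge0. Qed.

Lemma powR_expn (R : realType) (x z : R) j : 0 <= x -> (x ^+ j) `^ z = (x `^ z) ^+ j.
Proof.
move=> x0; have xz0 := powR_ge0 x z.
by rewrite -(powR_mulrn j x0) -(powR_mulrn j xz0) powRAC.
Qed.

Lemma normsq_expi_ge (R : realType) (x : R) : - pi <= x <= pi ->
  x ^+ 2 / 8 <= normsq (1 - expi x).
Proof.
move=> hx; have -> : normsq (1 - expi x) = 4 * sin (x / 2) ^+ 2.
  rewrite /normsq /= sub0r sqrrN.
  have -> : x = (x / 2) *+ 2 by rewrite -mulr_natr divfK.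
  have -> : x / 2 *+ 2 / 2 = x / 2 by rewrite -mulr_natr mulfK.
  rewrite cos_mulr2n sin_mulr2n; have := cos2Dsin2 (x / 2).
  set u := cos _; set v := sin _ => h; have uE : u ^+ 2 = 1 - v ^+ 2 by rewrite -h addrK.
  by have -> : (u * v *+ 2) ^+ 2 = u ^+ 2 * v ^+ 2 * 4; [ring|rewrite uE; ring].
have [y [y0 yp yE sE]] : exists y : R, [/\ 0 <= y, y <= pi / 2, x ^+ 2 = 4 * y ^+ 2 &
    sin (x / 2) ^+ 2 = sin y ^+ 2].
  exists `|x / 2|; split => //.
  - rewrite normrM [`|2^-1|]gtr0_norm ?invr_gt0 // ler_wpM2r ?invr_ge0 //.
    by rewrite ler_norml.
  - by rewrite real_normK ?num_real //; field.
  - have [x0|x0] := leP 0 (x / 2); first by rewrite ger0_norm.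
    by rewrite ltr0_norm // sinN sqrrN.
rewrite sE yE; have -> : 4 * y ^+ 2 / 8 = y ^+ 2 / 2 by field.
have yp2 : y <= 2 by apply: le_trans yp _; exact: ltW (pihalf_lt2 R).
suff : y ^+ 2 / 8 <= sin y ^+ 2 by lra.
have cy0 : 0 <= cos y by apply: cos_ge0_pihalf; rewrite yp andbT (le_trans _ y0) // oppr_le0 divr_ge0 // pi_ge0.
have [c12|c12] := leP (1 / 2) (cos y).
  have : y / 2 <= sin y.
    move: y0; rewrite le_eqVlt => /predU1P[<-|y0]; first by rewrite sin0 mul0r.
    have cs : {within `[0, y], continuous (@sin R)}.
      by apply: continuous_subspaceT => z; exact: continuous_sin.
    have [z /itvP zI] := @MVT _ (@sin R) (@cos R) 0 y y0 (fun z _ => is_derive_sin z) cs.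
    rewrite sin0 !subr0 => ->; rewrite mulrC ler_wpM2r ?(ltW y0) //.
    have ypi : y <= pi by apply: le_trans yp _; rewrite ler_pdivrMr // ler_peMr ?pi_ge0 // ler1n.
    have zy : cos y <= cos z.
      have z0 : 0 <= z by rewrite ltW // zI.
      have zy : z < y by rewrite zI.
      have zI' : z \in `[0, pi] by rewrite in_itv /= z0 (le_trans (ltW zy)).
      have yI' : y \in `[0, pi] by rewrite in_itv /= (ltW y0).
      by apply: ltW; rewrite ltr_cos.
    by apply: le_trans zy; rewrite -div1r.
  move=> h; have hy : 0 <= y / 2 by rewrite divr_ge0.
  have : (y / 2) ^+ 2 <= sin y ^+ 2 by rewrite ler_sqr ?nnegrE // (le_trans hy h).
  by have := sqr_ge0 y; lra.
have := cos2Dsin2 y; have : cos y ^+ 2 <= (1 / 2) ^+ 2 by rewrite ler_sqr ?nnegrE ?divr_ge0 // ltW.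
have : y ^+ 2 <= 2 ^+ 2 by rewrite ler_sqr ?nnegrE.
lra.
Qed.

Section LongMemoryDensity.
Variables (R : realType) (rho : R) (gamma : int -> R[i]) (L : R -> R).
Local Notation mu := (@lebesgue_measure R).
Local Notation I := (`[- pi, pi]%classic : set (measurableTypeR R)).
Hypothesis hrho : 0 < rho < 1.
Hypothesis psdT : forall n, psdmx (toeplitz gamma n).
Hypothesis lbL : locally_bounded L.
Hypothesis svL : slowly_varying L.
Let phi := long_memory_density rho L.
Hypothesis density : has_spectral_density gamma phi.

Let sigma := 1 - rho.
Let psi (y : R) : R := L y * y `^ sigma.
Let s n : R := psi n%:R.

Let sigma01 : 0 < sigma < 1.
Proof. by move: hrho => /andP[h0 h1]; rewrite /sigma; apply/andP; split; lra. Qed.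

Let L0 y : 0 <= y -> 0 < L y. Proof. by move=> y0; have [_ h _] := svL; exact: h. Qed.

Let psi_gt0 y : 0 < y -> 0 < psi y.
Proof. by move=> y0; rewrite mulr_gt0 ?L0 ?powR_gt0 // ltW. Qed.

Let phiE x : x != 0 -> phi x = psi `|x|^-1.
Proof.
move=> x0; rewrite /phi /long_memory_density /psi -/sigma; congr (_ * _).
by rewrite powR_invl.
Qed.

Let phi0 x : 0 <= phi x.
Proof. by rewrite /phi /long_memory_density divr_ge0 ?powR_ge0 // ltW // L0 // invr_ge0. Qed.

(** The exponent [sigma] leaves room on both sides for the error in Potter's bounds for [L]. *)
Let regular : exists k t E X : R, [/\ 0 < k, 0 < t < 1, 1 <= E, 1 <= X &
  forall x y, X <= x -> x <= y ->
    psi y <= E * (y / x) `^ t * psi x /\ psi x <= E * (x / y) `^ k * psi y].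
Proof.
have /andP[sg0 sg1] := sigma01.
pose e := Num.min (sigma / 2) ((1 - sigma) / 2).
have e0 : 0 < e by rewrite lt_min !divr_gt0 // subr_gt0.
have es : e <= sigma / 2 by rewrite ge_min lexx.
have e1 : e <= (1 - sigma) / 2 by rewrite ge_min lexx orbT.
have [X X1 hX] := potter svL e0.
exists (sigma - e), (sigma + e), (expR e), X; split=> //.
- lra.
- by apply/andP; split; lra.
- by rewrite -expR0 ler_expR ltW.
move=> x y Xx xy; have [h1 h2] := hX x y Xx xy.
have x0 : 0 < x by rewrite (lt_le_trans _ Xx) // (lt_le_trans ltr01).
have y0 : 0 < y by exact: lt_le_trans xy.
have yx0 : 0 < y / x by rewrite divr_gt0.
have yE : y `^ sigma = (y / x) `^ sigma * x `^ sigma.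
  by rewrite -powRM ?(ltW yx0) ?(ltW x0) // divfK // gt_eqF.
split; rewrite /psi.
  apply: le_trans (ler_wpM2r (powR_ge0 _ _) h1) _.
  rewrite yE [_ `^ (sigma + e)]powRD ?(gt_eqF yx0) ?implybT //.
  by rewrite le_eqVlt; apply/orP; left; apply/eqP; ring.
apply: le_trans (ler_wpM2r (powR_ge0 _ _) h2) _.
rewrite yE -[x / y]invf_div [_ `^ (sigma - e)]powRB ?invr_eq0 ?(gt_eqF yx0) ?implybT //.
have inv z : (y / x)^-1 `^ z = ((y / x) `^ z)^-1.
  by rewrite powR_invl // ltW.
rewrite !inv invrK.
have p0 : (y / x) `^ sigma != 0 by rewrite gt_eqF // powR_gt0.
by rewrite le_eqVlt; apply/orP; left; apply/eqP; field.
Qed.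

Let bounded_below X : exists K, forall y, 0 <= y -> y <= X -> psi y <= K.
Proof.
have /andP[sg0 sg1] := sigma01.
have [|M [Mr hM]] := (@compact_near_coveringP _ `[0, X]%classic).1 (@segment_compact _ 0 X)
    _ (pinfty_nbhs R) (fun M y => 0 <= y -> L y <= M) _.
  move=> x /=; rewrite in_itv /= => /andP[x0 _].
  have [M0 [M0r h]] := lbL x0.
  have := h (M0 + 1); rewrite ltrDl ltr01 => /(_ isT) hx.
  exists ([set y : R | 0 <= y -> `|L y| <= M0 + 1], [set M | M0 + 1 < M]) => /=.
    split; last by exists (M0 + 1); split; rewrite ?realD // num_real.
    move: hx; rewrite /within /=; apply: filterS => y hy y0; apply: hy => /=.
    by rewrite in_itv /= y0.
  move=> [y M] /= [h1 h2] y0; apply: le_trans (ler_norm _) _.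
  by apply: le_trans (h1 y0) _; exact: ltW.
have hM1 : M < M + 1 by rewrite ltrDl.
exists ((M + 1) * X `^ sigma) => y y0 yX; have X0 := le_trans y0 yX.
have := hM (M + 1) hM1 y; rewrite /= in_itv /= y0 yX => /(_ isT isT) Ly.
apply: ler_pM => //; rewrite ?powR_ge0 ?(ltW (L0 y0)) //.
by rewrite ge0_ler_powR ?nnegrE // ltW.
Qed.

Let scale_large : exists2 e : R, 0 < e & \forall n \near \oo, n%:R `^ e <= s n.
Proof.
have [k [t [E [X [k0 _ E1 X1 hX]]]]] := regular.
have X0 : 0 < X := lt_le_trans ltr01 X1.
have E0 : 0 < E := lt_le_trans ltr01 E1.
exists (k / 2); first by rewrite divr_gt0.
have k2 : 0 < k / 2 by rewrite divr_gt0.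
near=> n; have Xn : X <= n%:R by near: n; exact: near_natS.
have n0 : 0 < n%:R :> R := lt_le_trans X0 Xn.
have [_ h] := hX X n%:R (lexx _) Xn.
have : E * X `^ k / psi X <= n%:R `^ (k / 2) by near: n; exact: powR_natr_unbounded.
rewrite ler_pdivrMr ?psi_gt0 // => h1.
set u := n%:R `^ (k / 2) in h1 *; have u0 : 0 < u by exact: powR_gt0.
have kE : n%:R `^ k = u * u.
  by rewrite /u -powRD ?(gt_eqF n0) ?implybT //; congr (_ `^ _); field.
have XnE : (X / n%:R) `^ k = X `^ k / (u * u).
  by rewrite powRM ?(ltW X0) ?invr_ge0 // -kE powR_invl.
have Ek : 0 < E * X `^ k by rewrite mulr_gt0 ?powR_gt0.
rewrite XnE in h; rewrite /s -(ler_pM2l Ek).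
have h2 : psi X * (u * u) <= E * X `^ k * psi n%:R.
  rewrite -ler_pdivlMr ?mulr_gt0 //; apply: le_trans h _.
  by rewrite le_eqVlt; apply/orP; left; apply/eqP; ring.
apply: le_trans (ler_wpM2r (ltW u0) h1) _; apply: le_trans h2.
by rewrite le_eqVlt; apply/orP; left; apply/eqP; ring.
Unshelve. all: by end_near.
Qed.

(** Away from [M / n] the density is small on the scale [s n]. *)
Let density_far eta : 0 < eta -> exists2 M : R, 1 <= M & \forall n \near \oo,
  forall x, x != 0 -> M / n%:R < `|x| -> phi x <= eta * s n.
Proof.
move=> eta0; have [k [t [E [X [k0 _ E1 X1 hX]]]]] := regular.
have X0 : 0 < X := lt_le_trans ltr01 X1.
have E0 : 0 < E := lt_le_trans ltr01 E1.
have [M0 M00 hM] := powR_unbounded (E / eta) k0.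
pose M := Num.max M0 1; have M1 : 1 <= M by rewrite le_max lexx orbT.
have M0' : 0 < M := lt_le_trans ltr01 M1.
have hM' : E / eta <= M `^ k by apply: hM; rewrite le_max lexx.
have [K hK] := bounded_below X; have [e e0 se] := scale_large.
exists M => //; near=> n.
have nK : K / eta <= n%:R `^ e by near: n; exact: powR_natr_unbounded.
have ns : n%:R `^ e <= s n by near: n.
have n0 : 0 < n%:R :> R by rewrite ltr0n; near: n; exists 1%N.
move=> x x0 xM; rewrite phiE //; set y := `|x|^-1.
have ax : 0 < `|x| by rewrite normr_gt0.
have y0 : 0 < y by rewrite invr_gt0.
have yn : y <= n%:R / M.
  by rewrite -[n%:R / M]invf_div lef_pV2 ?posrE ?divr_gt0 // ltW.
have [Xy|yX] := leP X y; last first.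
  apply: le_trans (hK y (ltW y0) (ltW yX)) _; rewrite mulrC -ler_pdivrMr //.
  exact: le_trans nK ns.
have yn' : y <= n%:R by apply: le_trans yn _; rewrite ler_pdivrMr // ler_peMr ?(ltW n0).
have [_ h] := hX y n%:R Xy yn'; apply: le_trans h _.
rewrite ler_wpM2r ?(ltW (psi_gt0 n0)) //.
have h : (y / n%:R) `^ k <= (M `^ k)^-1.
  have -> : (M `^ k)^-1 = M^-1 `^ k.
    by rewrite powR_invl // ltW.
  rewrite ge0_ler_powR ?nnegrE ?(ltW k0) ?divr_ge0 ?invr_ge0 ?(ltW y0) ?(ltW M0') //.
  by rewrite ler_pdivrMr // mulrC.
apply: le_trans (ler_wpM2l (ltW E0) h) _.
by rewrite ler_pdivrMr ?powR_gt0 // mulrC -ler_pdivrMr.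
Unshelve. all: by end_near.
Qed.

Let intphi : mu.-integrable I (EFin \o phi). Proof. by have [] := density. Qed.
Let mI : measurable I. Proof. exact: measurable_itv. Qed.

Let window (v : R) (x : R) : R := \1_(`[- v, v]%classic : set (measurableTypeR R)) x.

Let window01 v x : 0 <= window v x <= 1.
Proof. by rewrite /window indicE; case: (_ \in _); rewrite ler01 lexx. Qed.

Let mwindow v (D : set (measurableTypeR R)) : measurable_fun D (window v).
Proof. exact: measurable_indic. Qed.

Let windowE v x : window v x = (`|x| <= v)%R%:R.
Proof.
rewrite /window indicE; congr ((_ : bool)%:R).
by apply/idP/idP => [/set_mem|h]; [|apply: mem_set]; rewrite /= in_itv /= -ler_norml.
Qed.

Let int_window (h : R -> R) v : mu.-integrable I (EFin \o h) ->
  mu.-integrable I (EFin \o (fun x => h x * window v x)).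
Proof.
move=> hh; have := @integrableMl _ _ _ mu I mI (EFin \o h) (window v) hh (@mwindow v _).
move=> H; apply: (eq_integrable mI) (H _) => //.
exists 1; split=> // M M1 x _ /=; have /andP[w0 w1] := window01 v x.
by rewrite ger0_norm // (le_trans w1) // ltW.
Qed.

Let integral_window v : 0 <= v -> \int[mu]_(x in I) window v x <= 2 * v.
Proof.
move=> v0; rewrite /Rintegral (@integral_indic _ _ _ mu I mI) //.
have h : (mu (`[(- v)%R, v]%classic `&` I) <= (2 * v)%:E)%E.
  apply: (@le_trans _ _ (mu `[- v, v]%classic)).
    by apply: le_measure; rewrite ?inE //; exact: measurableI.
  rewrite lebesgue_measure_itv /= lte_fin; case: ifP => _; last by rewrite lee_fin mulr_ge0.
  by rewrite -EFinB lee_fin opprK mulr_natl mulr2n.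
rewrite -lee_fin fineK //; rewrite ge0_fin_numE //; exact: le_lt_trans h (ltry _).
Qed.

Let vanishing_window u : 0 < u -> forall e, 0 < e ->
  exists k : nat, \int[mu]_(x in I) (phi x * window (u / 2 ^+ k) x) <= e.
Proof.
move=> u0 e e0.
have int1 : mu.-integrable [set: measurableTypeR R] (EFin \o (phi \_ I)).
  have := (@integrable_mkcond _ _ _ mu I (EFin \o phi) mI).1 intphi.
  by apply: eq_integrable => // x _ /=; rewrite /patch; case: ifP.
have [dl [dl0 hd]] := integral_normr_continuous int1 e0.
have [k hk] : exists k : nat, 2 * u / dl < k.+1%:R by eexists; exact: truncnS_gt.
exists k.+1; set v := u / _.
have v0 : 0 < v by rewrite divr_gt0 // exprn_gt0.
have mA : measurable (`[- v, v]%classic : set (measurableTypeR R)) by exact: measurable_itv.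
have muA : mu `[- v, v]%classic = (2 * v)%:E.
  by rewrite lebesgue_measure_itv /= lte_fin gtrN // -EFinB opprK mulr_natl mulr2n.
have vd : 2 * v < dl.
  rewrite /v mulrA ltr_pdivrMr ?exprn_gt0 // -ltr_pdivrMl // mulrC; apply: lt_le_trans hk _.
  by rewrite -natrX ler_nat; apply: ltnW; exact: ltn_expl.
have hA : (mu `[(- v)%R, v]%classic < dl%:E)%E by rewrite muA lte_fin.
have h := hd _ mA hA.
apply: le_trans (ltW h); rewrite Rintegral_mkcond [leRHS]Rintegral_mkcond.
rewrite le_eqVlt; apply/orP; left; apply/eqP; apply: eq_Rintegral => x _.
rewrite /patch windowE.
have -> : (x \in (`[- v, v]%classic : set (measurableTypeR R))) = (`|x| <= v).
  by apply/idP/idP => [/set_mem|hx]; [|apply: mem_set]; rewrite /= in_itv /= -ler_norml.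
case: ifP => _; case: ifP => _; rewrite ?mulr1 ?mulr0 ?normr0 //.
by rewrite ger0_norm.
Qed.

(** The mass of the density near the origin, by dyadic shells. *)
Let density_near M : 1 <= M -> exists2 K : R, 0 < K & \forall n \near \oo,
  \int[mu]_(x in I) (phi x * window (M / n%:R) x) <= K * s n / n%:R.
Proof.
move=> M1; have [k [t [E [X [k0 /andP[t0 t1] E1 X1 hX]]]]] := regular.
have X0 : 0 < X := lt_le_trans ltr01 X1.
have E0 : 0 < E := lt_le_trans ltr01 E1.
have M0 : 0 < M := lt_le_trans ltr01 M1.
pose th : R := 2 `^ t / 2; pose H : R := 2 `^ t.
have H0 : 0 < H by exact: powR_gt0.
have th0 : 0 < th by rewrite divr_gt0.
have th1 : th < 1.
  have h : 1 < 2 `^ (1 - t) :> R.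
    have t10 : 0 < 1 - t by rewrite subr_gt0.
    have := gt0_ltr_powR t10 (_ : 1 \in Num.nneg) (_ : 2 \in Num.nneg) (_ : 1 < 2 :> R).
    by rewrite powR1 !nnegrE ltr1n; apply.
  have e2 : 2 = H * 2 `^ (1 - t) :> R.
    by rewrite /H -powRD ?gt_eqF ?implybT // (_ : t + (1 - t) = 1) ?powRr1 //; ring.
  by rewrite ltr_pdivrMr // mul1r -/H [ltRHS]e2 ltr_pMr.
exists (E ^+ 2 * H * 2 * M / (1 - th)).
  by rewrite divr_gt0 ?subr_gt0 // !mulr_gt0 // exprn_gt0.
near=> n; have Xn : X * M <= n%:R by near: n; exact: near_natS.
have n0 : 0 < n%:R :> R by apply: lt_le_trans Xn; rewrite mulr_gt0.
have [u uE] : exists u : R, u = M / n%:R by eexists.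
have u0 : 0 < u by rewrite uE divr_gt0.
have [n' n'E] : exists n' : R, n' = n%:R / M by eexists.
have n'0 : 0 < n' by rewrite n'E divr_gt0.
have n'u : n' = u^-1 by rewrite n'E uE invf_div.
have Xn' : X <= n' by rewrite n'E ler_pdivlMr.
have n'n : n' <= n%:R by rewrite n'E ler_pdivrMr // ler_peMr ?(ltW n0).
have psin' : psi n' <= E * s n.
  have [_ h] := hX n' n%:R Xn' n'n; apply: le_trans h _.
  rewrite ler_wpM2r ?(ltW (psi_gt0 n0)) // ler_piMr ?(ltW E0) //.
  rewrite [leRHS](_ : _ = 1 `^ k); last by rewrite powR1.
  have n'n1 : n' / n%:R <= 1 by rewrite ler_pdivrMr // mul1r.
  apply: ge0_ler_powR => //.
  - exact: ltW.
  - by rewrite nnegrE divr_ge0 // ltW.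
  - by rewrite nnegrE.
have bound x v : x != 0 -> 0 < v -> v < `|x| -> `|x| <= u -> phi x <= E ^+ 2 * (u / v) `^ t * s n.
  move=> x0 v0 vx xu; have ax : 0 < `|x| by rewrite normr_gt0.
  have yn : n' <= `|x|^-1 by rewrite n'u lef_pV2.
  rewrite phiE //; have [h _] := hX n' `|x|^-1 Xn' yn; apply: le_trans h _.
  have h : (`|x|^-1 / n') `^ t <= (u / v) `^ t.
    rewrite n'u invrK mulrC ge0_ler_powR ?nnegrE ?(ltW t0) ?divr_ge0 ?(ltW u0) ?(ltW ax) ?(ltW v0) //.
    by rewrite ler_pM2l // lef_pV2 ?posrE // ltW.
  apply: (@le_trans _ _ (E * (u / v) `^ t * (E * s n))).
    apply: ler_pM => //.
    - by apply: mulr_ge0; [exact: ltW|exact: powR_ge0].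
    - exact: ltW (psi_gt0 n'0).
    - by rewrite ler_wpM2l // ltW.
  by rewrite le_eqVlt; apply/orP; left; apply/eqP; ring.
pose J i := \int[mu]_(x in I) (phi x * window (u / 2 ^+ i) x).
pose Q := E ^+ 2 * H * s n * (2 * u).
have s0 : 0 < s n by exact: psi_gt0.
have Q0 : 0 < Q.
  by rewrite /Q; move: (s n) s0 => z z0; rewrite !mulr_gt0 // exprn_gt0.
have step i : J i <= J i.+1 + Q * th ^+ i.
  have v0 : 0 < u / 2 ^+ i by rewrite divr_gt0 // exprn_gt0.
  pose c := E ^+ 2 * (H * H ^+ i) * s n.
  have c0 : 0 <= c.
    by rewrite /c; move: (s n) s0 => z z0; rewrite !mulr_ge0 ?exprn_ge0 ?(ltW E0) ?(ltW H0) ?(ltW z0).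
  have intc : mu.-integrable I (EFin \o (fun x => c * window (u / 2 ^+ i) x)).
    by have := int_window (u / 2 ^+ i) (integrable_period_cst c); apply: eq_integrable.
  have int1 := int_window (u / 2 ^+ i.+1) intphi.
  apply: (@le_trans _ _ (\int[mu]_(x in I) (phi x * window (u / 2 ^+ i.+1) x + c * window (u / 2 ^+ i) x))).
    apply: le_Rintegral_off0; first exact: int_window.
      by have := integrableD mI int1 intc; apply: eq_integrable.
    move=> x _ x0; rewrite !windowE; have [xv|vx] := leP `|x| (u / 2 ^+ i); last first.
      by rewrite !mulr0 addr0 mulr_ge0.
    have [xv'|vx'] := leP `|x| (u / 2 ^+ i.+1); first by rewrite !mulr1 lerDl.
    rewrite !mulr1 mulr0 add0r; apply: le_trans (bound x (u / 2 ^+ i.+1) x0 _ vx' _) _.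
    - by rewrite divr_gt0 // exprn_gt0.
    - apply: le_trans xv _; rewrite ler_pdivrMr ?exprn_gt0 // ler_peMr ?(ltW u0) //.
      by rewrite exprn_ege1 // ler1n.
    rewrite /c; have -> : u / (u / 2 ^+ i.+1) = 2 ^+ i.+1 by rewrite invf_div mulrCA divff ?mulr1 // gt_eqF.
    by rewrite powR_expn // -exprS.
  rewrite RintegralD // lerD2l.
  have intw : mu.-integrable I (EFin \o window (u / 2 ^+ i)).
    have := int_window (u / 2 ^+ i) (integrable_period_cst 1); apply: eq_integrable => // x _ /=.
    by rewrite mul1r.
  rewrite RintegralZl //; apply: le_trans (ler_wpM2l c0 (integral_window (ltW v0))) _.
  rewrite /c /Q /th expr_div_n le_eqVlt; apply/orP; left; apply/eqP; rewrite -/H; field.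
  by rewrite expf_neq0.
have geo i : J 0%N <= J i + Q / (1 - th) * (1 - th ^+ i).
  elim: i => [|i IH]; first by rewrite expr0 subrr mulr0 addr0.
  apply: le_trans IH _; apply: le_trans (lerD (step i) (lexx _)) _.
  rewrite -addrA lerD2l le_eqVlt; apply/orP; left; apply/eqP; rewrite exprS; field.
  by rewrite gt_eqF // subr_gt0.
have QE : E ^+ 2 * H * 2 * M / (1 - th) * s n / n%:R = Q / (1 - th).
  by rewrite /Q uE; ring.
rewrite QE; apply/ler_addgt0Pr => e e0.
have [i hi] := vanishing_window u0 e0.
have J0 : \int[mu]_(x in I) (phi x * window (M / n%:R) x) = J 0%N by rewrite /J expr0 divr1 uE.
rewrite J0; apply: le_trans (geo i) _; rewrite addrC; apply: lerD => //.
rewrite ler_piMr ?divr_ge0 ?(ltW Q0) ?subr_ge0 ?(ltW th1) //.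
by rewrite lerBlDr lerDl exprn_ge0 // ltW.
Unshelve. all: by end_near.
Qed.

(** Near the origin the density is at least of order [s n]; comparing with a trigonometric
    polynomial makes this an inequality between Toeplitz forms. *)
Let density_low B : 0 < B -> exists2 c : R, 0 < c & \forall n \near \oo,
  forall x, - pi <= x <= pi -> x != 0 ->
    c * s n - c * s n * (B * n%:R ^+ 2) * normsq (1 - expi x) <= phi x.
Proof.
move=> B0; have [k [t [E [X [k0 /andP[t0 t1] E1 X1 hX]]]]] := regular.
have X0 : 0 < X := lt_le_trans ltr01 X1.
have E0 : 0 < E := lt_le_trans ltr01 E1.
have [A [A1 BA]] : exists A : R, 1 <= A /\ 8 <= B * A ^+ 2.
  exists (Num.max 1 (8 / B)); have h : 1 <= Num.max 1 (8 / B) by rewrite le_max lexx.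
  split=> //; rewrite -ler_pdivrMl // mulrC.
  apply: (@le_trans _ _ (Num.max 1 (8 / B))); first by rewrite le_max lexx orbT.
  by rewrite expr2 ler_peMr // (le_trans ler01).
have A0 : 0 < A := lt_le_trans ltr01 A1.
have At0 : 0 < A `^ t by exact: powR_gt0.
exists (E ^+ 2 * A `^ t)^-1; first by rewrite invr_gt0 mulr_gt0 // exprn_gt0.
near=> n; have Xn : X * A <= n%:R by near: n; exact: near_natS.
have n0 : 0 < n%:R :> R by apply: lt_le_trans Xn; rewrite mulr_gt0.
have s0 : 0 < s n by exact: psi_gt0.
have [c [cE c0]] : exists c : R, c = (E ^+ 2 * A `^ t)^-1 * s n /\ 0 < c.
  by eexists; split; first reflexivity; rewrite mulr_gt0 // invr_gt0 mulr_gt0 // exprn_gt0.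
rewrite -cE => x xI x0; set z := normsq _.
have z0 : 0 <= z by exact: normsq_ge0.
have [big|small] := leP 1 (B * n%:R ^+ 2 * z).
  apply: le_trans (phi0 x); rewrite -mulrA subr_le0 -{1}[c]mulr1 ler_wpM2l // ltW //.
have ax : 0 < `|x| by rewrite normr_gt0.
have nx : n%:R * `|x| < A.
  rewrite -ltr_sqr ?nnegrE ?mulr_ge0 ?(ltW A0) //.
  rewrite exprMn real_normK ?num_real //.
  have h8 := normsq_expi_ge xI; rewrite -/z in h8.
  have h9 : B * n%:R ^+ 2 * (x ^+ 2 / 8) < 1.
    apply: le_lt_trans small; apply: ler_wpM2l h8.
    by rewrite mulr_ge0 ?exprn_ge0 ?(ltW B0).
  have h10 : B * (n%:R ^+ 2 * x ^+ 2) < B * A ^+ 2 by lra.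
  by rewrite ltr_pM2l in h10.
pose y := `|x|^-1.
have [n' n'E] : exists n' : R, n' = n%:R / A by eexists.
have n'0 : 0 < n' by rewrite n'E divr_gt0.
have n'y : n' <= y.
  by rewrite n'E /y ler_pdivrMr // mulrC ler_pdivlMr // ltW.
have Xn' : X <= n' by rewrite n'E ler_pdivlMr.
have n'n : n' <= n%:R by rewrite n'E ler_pdivrMr // ler_peMr ?(ltW n0).
rewrite phiE // -/y; apply: (@le_trans _ _ c).
  by rewrite lerBlDr lerDl !mulr_ge0 ?exprn_ge0 // ?(ltW c0) ?(ltW B0).
have [_ h1] := hX n' y Xn' n'y; have [h2 _] := hX n' n%:R Xn' n'n.
have y0 : 0 < y by rewrite invr_gt0.
have h3 : psi n' <= E * psi y.
  apply: le_trans h1 _; rewrite ler_wpM2r ?(ltW (psi_gt0 y0)) // ler_piMr ?(ltW E0) //.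
  rewrite [leRHS](_ : _ = 1 `^ k); last by rewrite powR1.
  have n'y1 : n' / y <= 1 by rewrite ler_pdivrMr // mul1r.
  apply: ge0_ler_powR => //; [exact: ltW| |by rewrite nnegrE].
  by rewrite nnegrE divr_ge0 // ltW.
have nn' : n%:R / n' = A by rewrite n'E invf_div mulrCA divff ?mulr1 // gt_eqF.
rewrite nn' in h2; rewrite cE ler_pdivrMl ?mulr_gt0 ?exprn_gt0 //.
apply: le_trans h2 _; apply: (@le_trans _ _ (E * A `^ t * (E * psi y))).
  by rewrite ler_wpM2l // mulr_ge0 // ltW.
by rewrite le_eqVlt; apply/orP; left; apply/eqP; ring.
Unshelve. all: by end_near.
Qed.

Lemma spiked_long_memory_density : spiked gamma.
Proof.
have [e0 e00 he] := scale_large; exists s, e0; split=> // [p|eps eps0].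
  have B0 : 0 < (256 * p.+1%:R ^+ 2)^-1 :> R by rewrite invr_gt0 mulr_gt0 // exprn_gt0.
  have [c c0 hc] := density_low B0; exists (pi * c); first by rewrite mulr_gt0 // pi_gt0.
  near=> n; have pn : (4 * p.+1 <= n)%N by near: n; exists (4 * p.+1)%N.
  have n0 : (0 < n)%N by apply: leq_trans pn.
  have [q [q0 qn nq]] : exists q, [/\ (0 < q)%N, (4 * q * p.+1 <= n)%N & (n <= 8 * p.+1 * q)%N].
    exists (n %/ (4 * p.+1))%N; split; first by rewrite divn_gt0.
      by rewrite -mulnA [(_ %/ _ * _)%N]mulnC mulnA mulnC leq_divM.
    by have := divn_ceil2 (isT : 0 < 4 * p.+1)%N pn; rewrite mulnA.
  have s0 : 0 < s n by apply: psi_gt0; rewrite ltr0n.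
  have hcn : forall x, - pi <= x <= pi -> x != 0 ->
      c * s n - c * s n * ((256 * p.+1%:R ^+ 2)^-1 * n%:R ^+ 2) * normsq (1 - expi x) <= phi x.
    by near: n.
  rewrite -[pi * c * _]mulrA; apply: (density_eigval_ge psdT density _ _ q0 qn _ hcn) => //.
  - by rewrite mulr_ge0 // ltW.
  - move: (s n) s0 (_^-1) B0 => z z0 B1 B10.
    by rewrite !mulr_ge0 ?exprn_ge0 ?(ltW c0) ?(ltW z0) ?(ltW B10).
  have nqR : n%:R <= 8 * p.+1%:R * q%:R :> R by rewrite -!natrM ler_nat.
  have h : n%:R ^+ 2 <= (8 * p.+1%:R * q%:R) ^+ 2 :> R by rewrite lerXn2r ?nnegrE ?mulr_ge0.
  have p0 : 0 < p.+1%:R ^+ 2 :> R by rewrite exprn_gt0.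
  have key : (256 * p.+1%:R ^+ 2)^-1 * n%:R ^+ 2 * 4 <= q%:R ^+ 2 :> R.
    rewrite -mulrA ler_pdivrMl ?mulr_gt0 //; have h4 : (0 : R) <= 4 by [].
    apply: le_trans (ler_wpM2r h4 h) _.
    by rewrite le_eqVlt; apply/orP; left; apply/eqP; ring.
  move: (s n) s0 => z z0; rewrite -[c * z * _ * 4]mulrA; apply: ler_wpM2l key.
  by apply: mulr_ge0; exact: ltW.
pose eta := eps / (4 * pi).
have pi0 := @pi_gt0 R.
have eta0 : 0 < eta by rewrite divr_gt0 // mulr_gt0.
have [M M1 hM] := density_far eta0; have [K K0 hK] := density_near M1.
have [q qE] : exists q : nat, 64 * K ^+ 2 / eps ^+ 2 <= q.+1%:R.
  by eexists; exact: ltW (truncnS_gt _).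
exists q; near=> n; have n0 : (0 < n)%N by near: n; exists 1%N.
have nR : 0 < n%:R :> R by rewrite ltr0n.
have nq : (q < n)%N by near: n; exists q.+1.
have s0 : 0 < s n by apply: psi_gt0; rewrite ltr0n.
have t0 : 0 < 4 / (eps * s n) by rewrite divr_gt0 // mulr_gt0.
have far : forall x, x != 0 -> M / n%:R < `|x| -> phi x <= eta * s n by near: n.
have nr : \int[mu]_(x in I) (phi x * window (M / n%:R) x) <= K * s n / n%:R by near: n.
have hS x : - pi <= x <= pi -> x != 0 -> phi x * (1 - window (M / n%:R) x) <= eta * s n.
  move=> _ x0; rewrite windowE; have [h|h] := leP `|x| (M / n%:R).
    by rewrite subrr mulr0; apply: mulr_ge0; exact: ltW.
  by rewrite subr0 mulr1; exact: far.
have H := density_eigval_le psdT density phi0 nq t0 (@mwindow _ I) (window01 _) hS nr.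
have qR : 0 < q.+1%:R :> R by rewrite ltr0n.
rewrite -(ler_pM2l qR); apply: le_trans H _.
move: (s n) s0 => z z0.
have -> : n%:R * (2 * (K * z / n%:R)) = 2 * K * z by field; rewrite gt_eqF.
have pin : pi != 0 :> R by rewrite gt_eqF.
have -> : eta * z * (2 * pi) = eps * z / 2.
  by rewrite /eta; move: pi pin => P P0; field.
have -> : 4 / (eps * z) * (2 * K * z) ^+ 2 = 64 * K ^+ 2 / eps ^+ 2 * (eps * z / 4).
  by field; rewrite !gt_eqF.
have -> : q.+1%:R / (4 / (eps * z)) = q.+1%:R * (eps * z / 4) by field; rewrite !gt_eqF.
have z1 : 0 <= eps * z / 4 by rewrite divr_ge0 // mulr_ge0 // ltW.
apply: le_trans (lerD (lexx _) (lerD (ler_wpM2r z1 qE) (lexx _))) _.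
rewrite le_eqVlt; apply/orP; left; apply/eqP; field.
Unshelve. all: by end_near.
Qed.

End LongMemoryDensity.

(** * Measurability of eigenvalues *)

Lemma normc_le_add (R : realType) (u v : R) : `|u +i* v| <= (`|u| + `|v|)%:C.
Proof.
rewrite normc_def lecR /=; have uv0 : 0 <= `|u| + `|v| by rewrite addr_ge0.
rewrite -[leRHS](ger0_norm uv0) -sqrtr_sqr ler_wsqrtr // sqrrD !real_normK ?num_real //.
by rewrite addrAC lerDl mulrn_wge0 // mulr_ge0.
Qed.

Section MeasurableEigenvalues.
Variables (R : realType) (d : measure_display) (T : measurableType d).
Local Notation Cx := R[i].
Implicit Types f g : T -> Cx.

Definition cmeasurable f : Prop :=
  measurable_fun setT (fun w => complex.Re (f w)) /\ measurable_fun setT (fun w => complex.Im (f w)).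

Lemma cmeasurable_cst (c : Cx) : cmeasurable (fun=> c).
Proof. by split; exact: measurable_cst. Qed.

Lemma cmeasurableD f g : cmeasurable f -> cmeasurable g -> cmeasurable (fun w => f w + g w).
Proof.
move=> [f1 f2] [g1 g2].
have E1 w : complex.Re (f w + g w) = complex.Re (f w) + complex.Re (g w) by exact: raddfD.
have E2 w : complex.Im (f w + g w) = complex.Im (f w) + complex.Im (g w) by exact: raddfD.
by rewrite /cmeasurable (funext E1) (funext E2); split; exact: measurable_funD.
Qed.

Lemma cmeasurableM f g : cmeasurable f -> cmeasurable g -> cmeasurable (fun w => f w * g w).
Proof.
move=> [f1 f2] [g1 g2].
have E1 w : complex.Re (f w * g w) = complex.Re (f w) * complex.Re (g w) - complex.Im (f w) * complex.Im (g w).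
  by case: (f w) (g w) => a b [u v].
have E2 w : complex.Im (f w * g w) = complex.Re (f w) * complex.Im (g w) + complex.Im (f w) * complex.Re (g w).
  by case: (f w) (g w) => a b [u v].
rewrite /cmeasurable (funext E1) (funext E2); split.
  by apply: measurable_funB; exact: measurable_funM.
by apply: measurable_funD; exact: measurable_funM.
Qed.

Lemma cmeasurable_conj f : cmeasurable f -> cmeasurable (fun w => (f w)^*%R).
Proof.
move=> [f1 f2].
have E1 w : complex.Re ((f w)^*%R) = complex.Re (f w) by case: (f w).
have E2 w : complex.Im ((f w)^*%R) = - complex.Im (f w) by case: (f w).
rewrite /cmeasurable (funext E1) (funext E2); split=> //.
by apply: measurableT_comp f2.
Qed.

Lemma cmeasurable_sum (J : Type) (s : seq J) (F : J -> T -> Cx) :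
  (forall j, cmeasurable (F j)) -> cmeasurable (fun w => \sum_(j <- s) F j w).
Proof.
move=> hF; elim: s => [|j s IH].
  by under eq_fun do rewrite big_nil; exact: cmeasurable_cst.
by under eq_fun do rewrite big_cons; exact: cmeasurableD.
Qed.

Lemma cmeasurable_mulmx m n p (A : T -> 'M[Cx]_(m, n)) (B : T -> 'M[Cx]_(n, p)) :
  (forall i j, cmeasurable (fun w => A w i j)) -> (forall i j, cmeasurable (fun w => B w i j)) ->
  forall i j, cmeasurable (fun w => (A w *m B w) i j).
Proof.
move=> hA hB i j; under eq_fun do rewrite mxE.
by apply: cmeasurable_sum => k; exact: cmeasurableM.
Qed.

Let ratmx n (q : 'M[rat]_n * 'M[rat]_n) : 'M[Cx]_n :=
  let M := \matrix_(i, j) (ratr (q.1 i j) +i* ratr (q.2 i j)) in (2^-1 : Cx) *: (M + M ^t*).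

Let ratmx_herm n q : @ratmx n q \is hermsymmx.
Proof.
apply/adjmx_hermP; rewrite /ratmx adjmxZ adjmxD trmxCK addrC; congr (_ *: _).
by rewrite fmorphV rmorph_nat.
Qed.

Let ratmxE n q i j : complex.Re (@ratmx n q i j) = (ratr (q.1 i j) + ratr (q.1 j i)) / 2 /\
  complex.Im (@ratmx n q i j) = (ratr (q.2 i j) - ratr (q.2 j i)) / 2.
Proof.
have h2 : (2^-1 : Cx) = (2^-1 : R)%:C by rewrite fmorphV rmorph_nat.
have -> : ratmx q i j = (2^-1 : R)%:C * ((ratr (q.1 i j) +i* ratr (q.2 i j)) +
    (ratr (q.1 j i) +i* ratr (q.2 j i))^*%R).
  by rewrite /ratmx h2 !mxE.
by rewrite /= !mul0r subr0 addr0 mulrC [X in _ /\ X = _]mulrC.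
Qed.

Let close (a : R) (z w : Cx) := `|complex.Re z - complex.Re w| <= a /\ `|complex.Im z - complex.Im w| <= a.

Let close_norm a z w : close a z w -> `|z - w| <= (2 * a)%:C.
Proof.
case: z w => [x y] [x' y'] [/= h1 h2]; apply: le_trans (normc_le_add (x - x') (y - y')) _.
by rewrite lecR mulr_natl mulr2n lerD.
Qed.

Let close_eigval n p (A B : 'M[Cx]_n) (e : R) : (p < n)%N -> 0 <= e ->
  A \is hermsymmx -> B \is hermsymmx ->
  (forall i j, close (e / (2 * n%:R)) (A i j) (B i j)) -> eigval p.+1 A <= eigval p.+1 B + e.
Proof.
move=> pn e0 hA hB hAB; have n0 : 0 < n%:R :> R by rewrite ltr0n (leq_ltn_trans _ pn).
apply: eigval_perturb => // v; have -> : A = B + (A - B) by rewrite addrC subrK.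
rewrite qformD lerD2l; apply: schur_test => [|i].
  move/adjmx_hermP in hA; move/adjmx_hermP in hB; apply/adjmx_hermP.
  by rewrite -scaleN1r adjmxD adjmxZ rmorphN1 hA hB.
apply: (@le_trans _ _ (\sum_(j < n) (e / n%:R)%:C)).
  apply: ler_sum => j _; rewrite mxE [(- B) i j]mxE; apply: le_trans (close_norm (hAB i j)) _.
  by rewrite lecR le_eqVlt; apply/orP; left; apply/eqP; field; rewrite gt_eqF.
rewrite sumr_const card_ord -[leLHS]mulr_natr -(@realc_nat R n) -realcM lecR divfK //.
by rewrite gt_eqF.
Qed.

(** Eigenvalues are continuous, hence limits over countably many rational matrices. *)
Lemma measurable_eigval n (S : T -> 'M[Cx]_n) p : (forall w, S w \is hermsymmx) ->
  (forall i j, cmeasurable (fun w => S w i j)) ->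
  measurable_fun setT (fun w => eigval p.+1 (S w)).
Proof.
move=> hS mS; have [np|pn] := leqP n p.
  have -> : (fun w => eigval p.+1 (S w)) = cst 0 by apply: funext => w; rewrite eigval_oversize.
  exact: measurable_cst.
have n0 : 0 < n%:R :> R by rewrite ltr0n (leq_ltn_trans _ pn).
apply: (measurability (@RGenOInfty.G R)) => [|_ [_ [t ->] <-]].
  exact: RGenOInfty.measurableE.
rewrite setTI; pose near (q : 'M[rat]_n * 'M[rat]_n * rat) : set T :=
  [set w | [/\ 0 < ratr q.2 :> R, t + ratr q.2 < eigval p.+1 (ratmx q.1) &
     forall i j, close (ratr q.2 / (2 * n%:R)) (ratmx q.1 i j) (S w i j)]].
have -> : (fun w => eigval p.+1 (S w)) @^-1` `]t, +oo[%classic = \bigcup_q near q.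
  apply/seteqP; split => w /=; last first.
    move=> [[q dl] _ [/= dl0 h1 h2]]; rewrite in_itv /= andbT.
    have h3 := close_eigval pn (ltW dl0) (ratmx_herm q) (hS w) h2.
    by rewrite -(ltrD2r (ratr dl)); exact: lt_le_trans h3.
  rewrite in_itv /= andbT => tw.
  have [dl] : exists dl : rat, ratr dl \in `]0, ((eigval p.+1 (S w) - t) / 2)[.
    by have [dl hdl] := @rat_in_itvoo R 0 ((eigval p.+1 (S w) - t) / 2)
      ltac:(by rewrite divr_gt0 // subr_gt0); exists dl.
  rewrite in_itv /= => /andP[dl0 dl1]; pose eta := ratr dl / (2 * n%:R) : R.
  have eta0 : 0 < eta by rewrite divr_gt0 // mulr_gt0.
  have approx (x : R) : exists z : rat, `|ratr z - x| <= eta.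
    have [z] := @rat_in_itvoo R (x - eta) (x + eta) ltac:(lra).
    by rewrite in_itv /= => /andP[z1 z2]; exists z; rewrite ler_norml; apply/andP; split; lra.
  have [A hA] : exists A : 'M[rat]_n, forall i j, `|ratr (A i j) - complex.Re (S w i j)| <= eta.
    exists (\matrix_(i, j) xget 0 [set z : rat | `|ratr z - complex.Re (S w i j)| <= eta]) => i j.
    by rewrite mxE; case: xgetP => // h; have [z hz] := approx (complex.Re (S w i j)); case: (h z).
  have [B hB] : exists B : 'M[rat]_n, forall i j, `|ratr (B i j) - complex.Im (S w i j)| <= eta.
    exists (\matrix_(i, j) xget 0 [set z : rat | `|ratr z - complex.Im (S w i j)| <= eta]) => i j.
    by rewrite mxE; case: xgetP => // h; have [z hz] := approx (complex.Im (S w i j)); case: (h z).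
  have sym i j : S w j i = (S w i j)^*%R.
    by have /adjmx_hermP/matrixP/(_ j i) := hS w; rewrite adjmxE.
  have cl i j : close eta (ratmx (A, B) i j) (S w i j).
    rewrite /close; have [-> ->] := ratmxE (A, B) i j; rewrite /=.
    have := hA i j; have := hA j i; have := hB i j; have := hB j i.
    rewrite (sym i j); case: (S w i j) => x y /=; rewrite !ler_norml.
    move=> /andP[? ?] /andP[? ?] /andP[? ?] /andP[? ?].
    by split; apply/andP; split; lra.
  exists ((A, B), dl) => //; split=> //=.
  have cl' i j : close (ratr dl / (2 * n%:R)) (S w i j) (ratmx (A, B) i j).
    by have [h1 h2] := cl i j; split; rewrite distrC.
  have := close_eigval pn (ltW dl0) (hS w) (ratmx_herm (A, B)) cl'; lra.
apply: countable_bigcupT_measurable => [|q]; first exact: countableP.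
have [h|h] := pselect (0 < ratr q.2 :> R /\ t + ratr q.2 < eigval p.+1 (ratmx q.1)); last first.
  have -> : near q = set0 by apply/seteqP; split => w //= [h1 h2 _]; apply: h.
  exact: measurable0.
have -> : near q = \bigcap_(ij in [set: 'I_n * 'I_n])
   [set w | close (ratr q.2 / (2 * n%:R)) (ratmx q.1 ij.1 ij.2) (S w ij.1 ij.2)].
  apply/seteqP; split => w /=; first by move=> [_ _ hw] ij _; exact: hw.
  by move=> hw; split; [exact: h.1|exact: h.2|move=> i j; exact: (hw (i, j))].
apply: fin_bigcap_measurable => [|ij _]; first exact: finite_finset.
have [m1 m2] := mS ij.1 ij.2; rewrite /close; apply: measurableI.
  rewrite -[X in measurable X]setTI; apply: measurable_fun_le => //.
  by apply: measurableT_comp => //; exact: measurable_funB.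
rewrite -[X in measurable X]setTI; apply: measurable_fun_le => //.
by apply: measurableT_comp => //; exact: measurable_funB.
Qed.

(** The matrix is polynomial in the entries of [Z]. *)
Lemma measurable_eigval_sample_cov N n (C : 'M[Cx]_N) (Z : T -> 'M[Cx]_(N, n)) (A : 'M[Cx]_n) p :
  psdmx C -> psdmx A -> (forall i j, cmeasurable (fun w => Z w i j)) ->
  measurable_fun setT (fun w => eigval p.+1 (sample_cov C (Z w) A)).
Proof.
move=> pC pA mZ; apply: measurable_eigval => [w|i j].
  by have [] := sample_cov_psd (Z w) pC pA.
rewrite /sample_cov; under eq_fun do rewrite mxE.
apply: cmeasurableM; first exact: cmeasurable_cst.
have cstm m k (B : 'M[Cx]_(m, k)) a b : cmeasurable (fun=> B a b) by exact: cmeasurable_cst.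
have m1 := cmeasurable_mulmx (cstm _ _ (sqrtmx C)) mZ.
have m2 := cmeasurable_mulmx m1 (cstm _ _ A).
have m3 k l : cmeasurable (fun w => (Z w ^t*) k l).
  by under eq_fun do rewrite adjmxE; exact: cmeasurable_conj.
exact: (cmeasurable_mulmx (cmeasurable_mulmx m2 m3) (cstm _ _ (sqrtmx C))).
Qed.

End MeasurableEigenvalues.

(** * The limit of the mean eigenvalue *)

Section SpectralNorm.
Variable R : realType.
Local Notation Cx := R[i].

Lemma cabsE (z : Cx) : `|z| = (cabs z)%:C.
Proof. by rewrite /cabs normc_def. Qed.

Lemma l2norm_sqn n (v : 'cV[Cx]_n) : (l2norm v ^+ 2)%:C = sqn v.
Proof.
rewrite sqr_sqrtr; last by apply: sumr_ge0 => i _; exact: sqr_ge0.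
by rewrite sqnE rmorph_sum /=; apply: eq_bigr => i _; rewrite realcX -cabsE.
Qed.

Lemma eigval_le_spectral_norm n (A : 'M[Cx]_n) p : psdmx A -> (p < n)%N ->
  eigval p.+1 A <= spectral_norm A.
Proof.
move=> pA pn; have [hA _] := pA; have [U hU AU] := sorted_spectral hA.
have lam0 k : 0 <= eigval k A by exact: eigval_ge0.
have sqnA v : sqn (A *m v) = \sum_(k < n) ((eigval k.+1 A) ^+ 2)%:C * `|(U *m v) k 0| ^+ 2.
  have /adjmx_hermP hA' := hA.
  rewrite sqnM hA' -[A *m A](_ : A ^+ 2 = _) // {1}AU spectral_pow //.
  rewrite (qform_spectral _ (erefl _)); apply: eq_bigr => k _.
  by rewrite mxE [(\row__ _) 0 k]mxE realcX.
pose S := [set l2norm (A *m v) | v in [set v : 'cV[Cx]_n | l2norm v <= 1]].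
have l2ge0 k (v : 'cV[Cx]_k) : 0 <= l2norm v by exact: sqrtr_ge0.
have ub v : l2norm v <= 1 -> l2norm (A *m v) <= eigval 1 A.
  move=> v1; rewrite -ler_sqr ?nnegrE // -lecR l2norm_sqn sqnA.
  apply: (@le_trans _ _ (\sum_(k < n) ((eigval 1 A) ^+ 2)%:C * `|(U *m v) k 0| ^+ 2)).
    apply: ler_sum => k _; rewrite ler_wpM2r ?exprn_ge0 // lecR ler_sqr ?nnegrE //.
    by apply: eigval_noninc => /=.
  rewrite -mulr_sumr -sqnE sqn_unitary // -l2norm_sqn -realcM lecR ler_piMr ?sqr_ge0 //.
  by rewrite -(expr1n _ 2) ler_sqr ?nnegrE.
pose u : 'cV[Cx]_n := U ^t* *m delta_mx (Ordinal pn) 0.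
have Uu k : `|(U *m u) k 0| ^+ 2 = (k == Ordinal pn)%:R.
  rewrite /u mulmxA; have /unitarymxP -> := hU; rewrite mul1mx mxE andbT.
  by case: eqP; rewrite ?normr1 ?expr1n ?normr0 ?expr0n.
have u1 : l2norm u = 1.
  apply/eqP; rewrite -(@eqrXn2 _ 2) //.
  apply/eqP/(@complexI R); rewrite l2norm_sqn -(sqn_unitary u hU) sqnE.
  rewrite (bigD1 (Ordinal pn)) //= Uu eqxx big1 => [|k kp]; last by rewrite Uu (negPf kp).
  by rewrite addr0 expr1n.
have Au : l2norm (A *m u) = eigval p.+1 A.
  apply/eqP; rewrite -(@eqrXn2 _ 2) //.
  apply/eqP/(@complexI R); rewrite l2norm_sqn sqnA.
  rewrite (bigD1 (Ordinal pn)) //= Uu eqxx big1 => [|k kp]; last by rewrite Uu (negPf kp) mulr0.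
  by rewrite addr0 mulr1.
rewrite -Au; apply: ub_le_sup; last by exists u => //=; rewrite u1.
by exists (eigval 1 A) => _ [v /= v1 <-]; exact: ub.
Qed.

Lemma qform_le_bound n (A : 'M[Cx]_n) (M : R) : psdmx A ->
  (forall p, (p < n)%N -> eigval p.+1 A <= M) -> forall x, qform A x <= M%:C * sqn x.
Proof.
move=> [hA _] hM x; have [U hU AU] := sorted_spectral hA.
rewrite (qform_spectral x AU) -(sqn_unitary x hU) sqnE mulr_sumr.
apply: ler_sum => k _; rewrite ler_wpM2r ?exprn_ge0 //.
by rewrite [(\row__ _) 0 k]mxE lecR hM.
Qed.

End SpectralNorm.

Section LimitTrace.
Variable R : realType.
Local Notation RR := (measurableTypeR R).
Variables (N : nat -> nat) (C : forall n, 'M[R[i]]_(N n)) (nu : probability RR R) (M : R).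
Hypothesis M0 : 0 <= M.
Hypothesis eigC : forall n k, 0 <= eigval k (C n).
Hypothesis eigM : forall n k, (k < N n)%N -> eigval k.+1 (C n) <= M.
Hypothesis hnu : weak_cvg (fun n => esd (C n)) nu.

Lemma integral_esd n (A : 'M[R[i]]_n) (f : R -> R) : continuous f -> (forall x, 0 <= f x) ->
  (\int[esd A]_x (f x)%:E)%E = (n%:R^-1 * \sum_(k < n) f (eigval k.+1 A))%:E.
Proof.
move=> cf f0; have mf : measurable_fun [set: RR] (EFin \o f : RR -> \bar R).
  by apply/measurable_EFinP; exact: continuous_measurable_fun.
have f0' (x : RR) : [set: RR] x -> (0 <= (EFin \o f) x)%E by move=> _; rewrite /= lee_fin.
rewrite /esd ge0_integral_mscale //= EFinM -sumEFin; congr (_ * _)%E.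
rewrite ge0_integral_measure_sum //; apply: eq_bigr => k _.
by rewrite integral_dirac // diracT mul1e.
Qed.

Let clamp (x : R) : R := Num.max 0 (Num.min x M).

Let clamp_ge0 x : 0 <= clamp x. Proof. by rewrite /clamp le_max lexx. Qed.
Let clamp_le x : clamp x <= M. Proof. by rewrite /clamp ge_max M0 ge_min lexx orbT. Qed.
Let clamp_id x : 0 <= x <= M -> clamp x = x.
Proof. by move=> /andP[x0 xM]; rewrite /clamp min_l // max_r. Qed.

Let cclamp : continuous clamp.
Proof.
move=> x; apply: (@continuous_max _ _ (cst 0) (fun x => Num.min x M)); first exact: cst_continuous.
by apply: (@continuous_min _ _ id (cst M)); [|exact: cst_continuous].
Qed.

Let excess (x : R) : R := Num.min 1 `|x - clamp x|.

Let cexcess : continuous excess.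
Proof.
move=> x; apply: (@continuous_min _ _ (cst 1) (fun x => `|x - clamp x|)); first exact: cst_continuous.
by apply: continuous_comp; [apply: continuousB => //; exact: cclamp|exact: norm_continuous].
Qed.

Let excess_ge0 x : 0 <= excess x. Proof. by rewrite /excess le_min ler01 normr_ge0. Qed.

Let clampE n k : (k < N n)%N -> clamp (eigval k.+1 (C n)) = eigval k.+1 (C n).
Proof. by move=> kn; rewrite clamp_id // eigC eigM. Qed.

Let excess0 : ae_eq nu setT (EFin \o excess) (cst 0%E).
Proof.
have mex : measurable_fun [set: RR] (EFin \o excess : RR -> \bar R).
  by apply/measurable_EFinP; exact: continuous_measurable_fun.
apply/(ae_eq_integral_abs nu measurableT mex).
have bex : exists B, forall x, `|excess x| <= B.
  by exists 1 => x; rewrite ger0_norm // /excess ge_min lexx.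
have := hnu cexcess bex.
have -> : (fun n => \int[esd (C n)]_x (excess x)%:E)%E = cst 0%E.
  apply: funext => n; rewrite integral_esd // big1 ?mulr0 // => k _.
  by rewrite /excess clampE // subrr normr0 min_r // ler01.
move=> h; have E := cvg_unique (@ereal_hausdorff R) h (cvg_cst (0%E : \bar R)).
rewrite -[RHS]E; apply: eq_integral => x _.
by rewrite /= ger0_norm.
Qed.

Let ae_clamp : ae_eq nu setT (EFin \o clamp) (EFin \o (id : R -> R)).
Proof.
apply: filterS excess0 => x /= h /h /eqP; rewrite eqe /excess => /eqP.
rewrite /Num.min; case: ifP => _; first by move=> /eqP; rewrite oner_eq0.
by move=> /eqP; rewrite normr_eq0 subr_eq0 => /eqP <-.
Qed.

Let mclamp : measurable_fun [set: RR] (EFin \o clamp : RR -> \bar R).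
Proof. by apply/measurable_EFinP; exact: continuous_measurable_fun. Qed.

Let mid : measurable_fun [set: RR] (EFin \o (id : R -> R) : RR -> \bar R).
Proof. exact/measurable_EFinP. Qed.

Let int_clamp : (\int[nu]_x (clamp x)%:E = (\int[nu]_x x)%:E)%E.
Proof.
have E : (\int[nu]_x (clamp x)%:E = \int[nu]_x (x%:E))%E.
  by apply: ae_eq_integral.
rewrite /Rintegral -E fineK //.
have h : (\int[nu]_x (clamp x)%:E <= M%:E)%E.
  apply: (@le_trans _ _ (\int[nu]_x (cst M%:E x))%E).
    by apply: ge0_le_integral => //; move=> x _; rewrite lee_fin.
  have -> : (\int[nu]_x cst M%:E x = M%:E * nu setT)%E by exact: integral_cst.
  by rewrite probability_setT mule1.
rewrite ge0_fin_numE; first exact: le_lt_trans h (ltry _).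
by apply: integral_ge0 => x _; rewrite lee_fin.
Qed.

(** Weak convergence tests bounded functions only. All the spectra lie between [0] and [M], so
    [clamp] replaces the identity, and integrating [excess] shows that the limit law charges
    nothing outside these bounds. *)
Lemma mean_eigval_cvg : (N n)%:R^-1 * \sum_(k < N n) eigval k.+1 (C n) @[n --> \oo]
  --> (\int[nu]_x x : R).
Proof.
have bcl : exists B, forall x, `|clamp x| <= B.
  by exists M => x; rewrite ger0_norm.
have := hnu cclamp bcl; rewrite int_clamp => h.
have E : (fun n => \int[esd (C n)]_x (clamp x)%:E)%E =
    EFin \o (fun n => (N n)%:R^-1 * \sum_(k < N n) eigval k.+1 (C n)).
  apply: funext => n; rewrite integral_esd //=; congr (_ * _)%:E.
  by apply: eq_bigr => k _; exact: clampE.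
by rewrite E in h; move/fine_cvgP: h => [_].
Qed.

(** A nonnegative variable of mean zero vanishes almost surely, which is excluded. *)
Lemma limit_mean_gt0 :
  ~ (forall A : set RR, measurable A -> nu A = dirac (0 : R) A) -> 0 < \int[nu]_x x :> R.
Proof.
move=> nu0; have c0 : 0 <= \int[nu]_x x :> R.
  by rewrite -lee_fin -int_clamp; apply: integral_ge0 => x _; rewrite lee_fin.
rewrite lt_neqAle c0 andbT; apply/eqP => c0'; apply: nu0 => A mA.
have h0 : ae_eq nu setT (EFin \o clamp) (cst 0%E).
  apply/(ae_eq_integral_abs nu measurableT mclamp).
  rewrite -[RHS]/(0%:E) [in RHS]c0' -int_clamp; apply: eq_integral => x _.
  by rewrite /= ger0_norm.
have ae0 : {ae nu, forall x : RR, x = 0}.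
  apply: filterS2 h0 ae_clamp => x /= h1 h2; have := h1 I; rewrite h2 //.
  by case.
have nu0c : nu [set~ (0 : RR)] = 0%E.
  by apply: measure_negligible => //; apply: measurableC.
have small (B : set RR) : measurable B -> ~ B (0 : R) -> nu B = 0%E.
  move=> mB B0; apply/eqP; rewrite eq_le measure_ge0 andbT -nu0c.
  by apply: le_measure; rewrite ?inE //; [exact: measurableC|move=> x Bx x0; apply: B0; rewrite -x0].
rewrite diracE; have [A0|A0] := boolP ((0 : RR) \in A).
  have := probability_setC nu (measurableC mA); rewrite setCK => ->.
  rewrite small ?sube0 //; first exact: measurableC.
  by apply; exact: set_mem.
by rewrite small // => A0'; move/negP: A0; apply; exact: mem_set.
Qed.

End LimitTrace.

(** * Equality of laws and Gaussian moments *)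

Section Laws.
Variables (R : realType) (d : measure_display) (T : measurableType d) (P : probability T R).
Local Notation Cx := R[i].
Local Notation RR := (measurableTypeR R).
Implicit Types X Y : T -> Cx.

Lemma cabs_sqr (z : Cx) : cabs z ^+ 2 = complex.Re z ^+ 2 + complex.Im z ^+ 2.
Proof. by rewrite /cabs normc_def /= sqr_sqrtr // addr_ge0 // sqr_ge0. Qed.

Lemma cabs_ge0 (z : Cx) : 0 <= cabs z.
Proof. by rewrite /cabs normc_def /= sqrtr_ge0. Qed.

Lemma complex_rv_cmeasurable X : complex_rv X -> cmeasurable X.
Proof. by move=> /measurable_fun_pairP[]. Qed.

Lemma law_integral X (f : R * R -> R) : complex_rv X ->
  measurable_fun setT f -> (forall x, 0 <= f x) ->
  (\int[P]_w (f (reim X w))%:E = \int[pushforward P (reim X)]_x (f x)%:E)%E.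
Proof.
move=> mX mf f0; rewrite ge0_integral_pushforward //.
  exact/measurable_EFinP.
by move=> x _; rewrite lee_fin.
Qed.

Lemma same_law_integral X Y (f : R * R -> R) : complex_rv X -> complex_rv Y ->
  same_law P X Y -> measurable_fun setT f -> (forall x, 0 <= f x) ->
  (\int[P]_w (f (reim X w))%:E = \int[P]_w (f (reim Y w))%:E)%E.
Proof.
move=> mX mY XY mf f0; rewrite !law_integral //.
pose FX : {mfun T >-> (R * R)%type} := @mfun_Sub _ _ T (R * R)%type (reim X) (mem_set mX).
pose FY : {mfun T >-> (R * R)%type} := @mfun_Sub _ _ T (R * R)%type (reim Y) (mem_set mY).
apply: (@eq_measure_integral _ _ _ setT (pushforward P FY) (pushforward P FX)) => A mA _.
exact: XY.
Qed.

Lemma measurable_cabsX k : measurable_fun setT (fun x : R * R => cabs (x.1 +i* x.2) ^+ k).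
Proof.
apply: measurable_funX; rewrite /cabs.
have -> : (fun x : R * R => complex.Re `|x.1 +i* x.2|) = (fun x => Num.sqrt (x.1 ^+ 2 + x.2 ^+ 2)).
  by apply: funext => x; rewrite normc_def.
apply: measurableT_comp => //; first by apply: continuous_measurable_fun; exact: sqrt_continuous.
by apply: measurable_funD; apply: measurable_funX; [exact: measurable_fst|exact: measurable_snd].
Qed.

Lemma abs_momentE k X : abs_moment P k X =
  (\int[P]_w (cabs ((reim X w).1 +i* (reim X w).2) ^+ k)%:E)%E.
Proof.
rewrite /abs_moment unlock; apply: eq_integral => w _ /=.
by case: (X w).
Qed.

Lemma same_law_abs_moment k X Y : complex_rv X -> complex_rv Y -> same_law P X Y ->
  abs_moment P k X = abs_moment P k Y.
Proof.
move=> mX mY XY; rewrite !abs_momentE.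
apply: (same_law_integral mX mY XY (measurable_cabsX k)) => x.
by rewrite exprn_ge0 // cabs_ge0.
Qed.

End Laws.

Section GaussianMoments.
Variable R : realType.
Local Notation RR := (measurableTypeR R).
Local Notation mu := (@lebesgue_measure R).

Let expR_quartic (y : R) : 0 <= y -> (1 + y / 4) ^+ 4 <= expR y.
Proof.
move=> y0; have -> : y = 4 * (y / 4) by field.
rewrite expRM_natl -[4 * (y / 4) / 4](_ : y / 4 = _); last by field.
by rewrite lerXn2r ?nnegrE ?expR_ge0 ?addr_ge0 ?divr_ge0 // expR_ge1Dx.
Qed.

Let pdf_bound (s : R) : 0 < s -> exists2 C : R, 0 <= C & forall x,
  (`|x| + 1) ^+ 8 * normal_pdf 0 s x <= C * normal_pdf 0 (Num.sqrt 2 * s) x.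
Proof.
move=> s0; have s20 : 0 < Num.sqrt 2 * s :> R by rewrite mulr_gt0 // sqrtr_gt0.
rewrite !normal_pdfE ?gt_eqF //.
pose K : R := 32 * s ^+ 2 + 2; have K0 : 0 <= K by rewrite addr_ge0 // mulr_ge0 // sqr_ge0.
have p0 := normal_peak_gt0 (lt0r_neq0 s0); have p1 := normal_peak_gt0 (lt0r_neq0 s20).
exists (K ^+ 4 * normal_peak s / normal_peak (Num.sqrt 2 * s)).
  by rewrite divr_ge0 ?mulr_ge0 ?exprn_ge0 // ltW.
move=> x; have nf t : normal_fun 0 t x = expR (- (x ^+ 2 / (t ^+ 2 * 2))).
  by rewrite /normal_fun subr0 mulNr mulr_natr.
rewrite !nf [(Num.sqrt 2 * s) ^+ 2]exprMn sqr_sqrtr //.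
pose y := x ^+ 2 / (4 * s ^+ 2).
have s2 : 0 < s ^+ 2 by rewrite exprn_gt0.
have y0 : 0 <= y by rewrite divr_ge0 ?sqr_ge0 // mulr_ge0 // ltW.
have -> : x ^+ 2 / (s ^+ 2 * 2) = y + y by rewrite /y; field; rewrite gt_eqF.
have -> : x ^+ 2 / (2 * s ^+ 2 * 2) = y by rewrite /y; field; rewrite gt_eqF.
have h : (`|x| + 1) ^+ 8 <= K ^+ 4 * expR y.
  have h1 : (`|x| + 1) ^+ 2 <= K * (1 + y / 4).
    have -> : K * (1 + y / 4) = 2 * x ^+ 2 + 2 + 32 * s ^+ 2 + y / 2.
      by rewrite /K /y; field; rewrite gt_eqF.
    have := sqr_ge0 (`|x| - 1); rewrite sqrrB sqrrD real_normK ?num_real //.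
    by move: s2 y0; lra.
  have -> : (`|x| + 1) ^+ 8 = ((`|x| + 1) ^+ 2) ^+ 4 by rewrite -exprM.
  apply: le_trans (_ : (K * (1 + y / 4)) ^+ 4 <= _).
    by rewrite lerXn2r ?nnegrE ?sqr_ge0 // mulr_ge0 // addr_ge0 // divr_ge0.
  by rewrite exprMn ler_wpM2l ?exprn_ge0 // expR_quartic.
have -> : K ^+ 4 * normal_peak s / normal_peak (Num.sqrt 2 * s) *
   (normal_peak (Num.sqrt 2 * s) * expR (- y)) = normal_peak s * (K ^+ 4 * expR (- y)).
  by field; rewrite gt_eqF.
rewrite mulrCA ler_wpM2l ?(ltW p0) // opprD expRD mulrA ler_wpM2r ?expR_ge0 //.
apply: le_trans (ler_wpM2r (expR_ge0 _) h) _.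
by rewrite -mulrA -expRD subrr expR0 mulr1.
Qed.

(** On each unit shell the eighth power is bounded, and the mass of the shell is
    dominated by that of a wider Gaussian. *)
Lemma normal_moment8 (s : R) : 0 < s ->
  (\int[normal_prob 0 s]_x (x ^+ 8)%:E < +oo)%E.
Proof.
move=> s0; have [C C0 hC] := pdf_bound s0.
pose F (k : nat) : set RR := [set x | Num.truncn `|x| = k].
have FE k : F k = (fun x : RR => `|x|) @^-1` `[k%:R, k.+1%:R[%classic.
  apply/seteqP; split => x /=; rewrite in_itv /=.
    by move=> <-; exact: truncn_itv.
  exact: truncn_def.
have mF k : measurable (F k).
  have mn : measurable_fun [set: RR] ((fun x => `|x|) : RR -> RR).
    by apply: continuous_measurable_fun; exact: norm_continuous.
  by rewrite FE -[X in measurable X]setTI; apply: mn => //; exact: measurable_itv.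
have FT : \bigcup_k F k = setT by apply/seteqP; split => // x _; exists (Num.truncn `|x|).
have tF : trivIset setT F by apply/trivIsetP => i j _ _ ij; apply/seteqP; split => x //= [hi hj]; move/eqP: ij; apply; rewrite -hi -hj.
have m8 : measurable_fun [set: RR] (fun x : RR => (x ^+ 8)%:E).
  by apply/measurable_EFinP; apply: measurable_funX.
have E1 : (\int[normal_prob 0 s]_x (x ^+ 8)%:E =
    \sum_(k <oo) \int[normal_prob 0 s]_(x in F k) (x ^+ 8)%:E)%E.
  rewrite -FT; apply: ge0_integral_bigcup; rewrite ?FT // => x _.
  by rewrite lee_fin (exprn_even_ge0 _ (isT : ~~ odd 8)).
have mpdf t : measurable_fun [set: RR] (fun x : RR => (normal_pdf 0 t x)%:E).
  by apply/measurable_EFinP; exact: measurable_normal_pdf.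
have pdf0 t x : (0 <= (normal_pdf 0 t x)%:E :> \bar R)%E by rewrite lee_fin normal_pdf_ge0.
have Fx k x : F k x -> (`|x| < k.+1%:R) /\ (k%:R <= `|x|).
  by rewrite FE /= in_itv /= => /andP[].
have step k : (\int[normal_prob 0 s]_(x in F k) (x ^+ 8)%:E <=
    C%:E * \int[mu]_(x in F k) (normal_pdf 0 (Num.sqrt 2 * s) x)%:E)%E.
  apply: (@le_trans _ _ (\int[normal_prob 0 s]_(x in F k) (cst (k.+1%:R ^+ 8)%:E x))%E).
    apply: ge0_le_integral => //.
    - by move=> x _; rewrite lee_fin (exprn_even_ge0 _ (isT : ~~ odd 8)).
    - exact: measurable_funS m8.
    - move=> x /Fx[h _]; rewrite lee_fin.
      have -> : x ^+ 8 = `|x| ^+ 8 by rewrite -normrX ger0_norm // (exprn_even_ge0 _ (isT : ~~ odd 8)).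
      by rewrite lerXn2r ?nnegrE // ltW.
  have -> : (\int[normal_prob 0 s]_(x in F k) (cst (k.+1%:R ^+ 8)%:E x) =
      (k.+1%:R ^+ 8)%:E * \int[mu]_(x in F k) (normal_pdf 0 s x)%:E)%E by exact: integral_cst.
  have Zl (c t : R) : 0 <= c -> (c%:E * \int[mu]_(x in F k) (normal_pdf 0 t x)%:E =
      \int[mu]_(x in F k) (c%:E * (normal_pdf 0 t x)%:E))%E.
    by move=> c0; rewrite ge0_integralZl //; exact: measurable_funS (mpdf t).
  rewrite !Zl ?exprn_ge0 //.
  apply: ge0_le_integral => //.
  - by move=> x _; rewrite mule_ge0 // lee_fin exprn_ge0.
  - by apply: measurable_funeM; exact: measurable_funS (mpdf _).
  - by apply: measurable_funeM; exact: measurable_funS (mpdf _).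
  - move=> x /Fx[_ h]; rewrite -!EFinM lee_fin; apply: le_trans (hC x).
    by rewrite ler_wpM2r ?normal_pdf_ge0 // lerXn2r ?nnegrE ?addr_ge0 // -natr1 lerD2r.
rewrite E1; apply: (@le_lt_trans _ _ (C%:E * 1)%E); last by rewrite mule1 ltry.
rewrite -(integral_normal_pdf 0 (Num.sqrt 2 * s)) -FT ge0_integral_bigcup ?FT //.
rewrite -nneseriesZl //; last by move=> k _; apply: integral_ge0 => x _.
apply: lee_nneseries => k _; last exact: step.
by move=> _; apply: integral_ge0 => x _; rewrite lee_fin (exprn_even_ge0 _ (isT : ~~ odd 8)).
Qed.

End GaussianMoments.

Section GaussianEntries.
Variables (R : realType) (d : measure_display) (T : measurableType d) (P : probability T R).
Local Notation RR := (measurableTypeR R).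

Let moment8 (f : T -> R) (m : {measure set RR -> \bar R}) : measurable_fun setT f ->
  (forall A : set RR, measurable A -> P (f @^-1` A) = m A) ->
  (\int[m]_x (x ^+ 8)%:E < +oo)%E -> (\int[P]_w (f w ^+ 8)%:E < +oo)%E.
Proof.
move=> mf fm; pose F : {mfun T >-> RR} := @mfun_Sub _ _ T RR f (mem_set mf).
have <- : (\int[pushforward P F]_x (x ^+ 8)%:E = \int[m]_x (x ^+ 8)%:E)%E.
  by apply: eq_measure_integral => A mA _; rewrite -fm.
rewrite ge0_integral_pushforward //.
  by apply/measurable_EFinP; apply: measurable_funX.
by move=> x _; rewrite lee_fin (exprn_even_ge0 _ (isT : ~~ odd 8)).
Qed.

Let product_moment8 (X : T -> R[i]) (m1 m2 : probability RR R) : complex_rv X ->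
  (forall A : set (R * R), measurable A -> law P X A = (m1 \x m2)%E A) ->
  (\int[m1]_x (x ^+ 8)%:E < +oo)%E -> (\int[m2]_x (x ^+ 8)%:E < +oo)%E ->
  (abs_moment P 8 X < +oo)%E.
Proof.
move=> mX XE f1 f2; have [mr mi] := complex_rv_cmeasurable mX.
have Re8 : (\int[P]_w (complex.Re (X w) ^+ 8)%:E < +oo)%E.
  apply: (moment8 mr _ f1) => A mA.
  have := XE (A `*` setT) (measurableX mA measurableT).
  have -> : ((m1 \x m2) (A `*` setT) = m1 A)%E.
    have E : ((m1 \x m2) (A `*` setT) = m1 A * m2 setT)%E by exact: product_measure1E.
    by rewrite E probability_setT mule1.
  move=> E1; apply: (etrans _ E1); rewrite /law /pushforward; congr (P _).
  by apply/seteqP; split => w //=; case.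
have Im8 : (\int[P]_w (complex.Im (X w) ^+ 8)%:E < +oo)%E.
  apply: (moment8 mi _ f2) => A mA.
  have := XE (setT `*` A) (measurableX measurableT mA).
  have -> : ((m1 \x m2) (setT `*` A) = m2 A)%E.
    have E : ((m1 \x m2) (setT `*` A) = m1 setT * m2 A)%E by exact: product_measure1E.
    by rewrite E probability_setT mul1e.
  move=> E1; apply: (etrans _ E1); rewrite /law /pushforward; congr (P _).
  by apply/seteqP; split => w //=; case.
have e8 (x : R) : 0 <= x ^+ 8 by rewrite (exprn_even_ge0 _ (isT : ~~ odd 8)).
have m8 (f : T -> R) : measurable_fun setT f -> measurable_fun setT (fun w => (f w ^+ 8)%:E).
  by move=> mf; apply/measurable_EFinP; exact: measurable_funX.
rewrite /abs_moment unlock.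
apply: (@le_lt_trans _ _ (\int[P]_w (8%:E * ((complex.Re (X w) ^+ 8)%:E + (complex.Im (X w) ^+ 8)%:E)))%E).
  apply: ge0_le_integral => //.
  - by move=> w _; rewrite lee_fin exprn_ge0 // cabs_ge0.
  - have h := measurableT_comp (@measurable_cabsX R 8) mX.
    apply/measurable_EFinP; apply: eq_measurable_fun h => w _ /=; by case: (X w).
  - by apply: measurable_funeM; apply: emeasurable_funD; exact: m8.
  - move=> w _; rewrite -EFinD -EFinM lee_fin.
    have -> : cabs (X w) ^+ 8 = (cabs (X w) ^+ 2) ^+ 4 by rewrite -exprM.
    rewrite cabs_sqr; set u := complex.Re _; set v := complex.Im _.
    have -> : u ^+ 8 = (u ^+ 2) ^+ 4 by rewrite -exprM.
    have -> : v ^+ 8 = (v ^+ 2) ^+ 4 by rewrite -exprM.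
    move: (u ^+ 2) (v ^+ 2) (sqr_ge0 u) (sqr_ge0 v) => a b a0 b0.
    have h (x y : R) : (x + y) ^+ 2 <= 2 * (x ^+ 2 + y ^+ 2) by have := sqr_ge0 (x - y); lra.
    have h1 := h a b; have h2 := h (a ^+ 2) (b ^+ 2).
    have h3 : ((a + b) ^+ 2) ^+ 2 <= (2 * (a ^+ 2 + b ^+ 2)) ^+ 2.
      by rewrite ler_sqr ?nnegrE ?sqr_ge0 // mulr_ge0 // addr_ge0 // sqr_ge0.
    have E4 (x : R) : x ^+ 4 = (x ^+ 2) ^+ 2 by rewrite -exprM.
    by rewrite !E4; move: h2 h3; rewrite exprMn; lra.
rewrite ge0_integralZl //; last 2 first.
- by apply: emeasurable_funD; exact: m8.
- by move=> w _; rewrite adde_ge0 ?lee_fin.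
rewrite ge0_integralD //; try (by move=> w _; rewrite lee_fin); try exact: m8.
by rewrite lte_mul_pinfty // ?lee_fin // lte_add_pinfty.
Qed.

Lemma gaussian_abs_moment8 (X : T -> R[i]) : complex_rv X ->
  std_real_gaussian P X \/ std_complex_gaussian P X -> (abs_moment P 8 X < +oo)%E.
Proof.
move=> mX [h|h]; apply: (product_moment8 mX h).
- exact: normal_moment8.
- by rewrite integral_dirac // ?diracT ?mul1e ?expr0n ?ltry //; apply/measurable_EFinP; exact: measurable_funX.
- by apply: normal_moment8; rewrite sqrtr_gt0 invr_gt0.
- by apply: normal_moment8; rewrite sqrtr_gt0 invr_gt0.
Qed.

End GaussianEntries.

(** * Rare events and forms in the entries *)

Section RareEvents.
Variables (R : realType) (d : measure_display) (T : measurableType d) (P : probability T R).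

(** [Q] holds off a measurable event of probability at most [x]; this spares proofs of
    measurability for [Q] itself. *)
Definition off_rare (Q : T -> Prop) (x : R) : Prop :=
  exists2 B : set T, measurable B & (P B <= x%:E)%E /\ forall w, ~ B w -> Q w.

Lemma off_rare_imp (Q Q' : T -> Prop) x : off_rare Q x -> (forall w, Q w -> Q' w) ->
  off_rare Q' x.
Proof. by move=> [B mB [PB hB]] QQ'; exists B => //; split=> // w /hB /QQ'. Qed.

Lemma off_rare_le (Q : T -> Prop) x y : x <= y -> off_rare Q x -> off_rare Q y.
Proof. by move=> xy [B mB [PB hB]]; exists B => //; split=> //; apply: le_trans PB _; rewrite lee_fin. Qed.

Lemma off_rare_and (Q Q' : T -> Prop) x y : off_rare Q x -> off_rare Q' y ->
  off_rare (fun w => Q w /\ Q' w) (x + y).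
Proof.
move=> [B mB [PB hB]] [B' mB' [PB' hB']]; exists (B `|` B'); first exact: measurableU.
split; first by apply: le_trans (measureU2 _ _ _) _ => //; rewrite EFinD leeD.
by move=> w /not_orP[/hB ? /hB' ?].
Qed.

Lemma off_rare_all (J : eqType) (s : seq J) (Q : J -> T -> Prop) x :
  (forall j, j \in s -> off_rare (Q j) x) ->
  off_rare (fun w => forall j, j \in s -> Q j w) ((size s)%:R * x).
Proof.
elim: s => [_|j s IH h].
  by exists set0 => //; split=> [|w _ j]; rewrite ?measure0 ?mul0r // in_nil.
have h1 : off_rare (Q j) x by apply: h; rewrite mem_head.
have h2 : off_rare (fun w => forall j, j \in s -> Q j w) ((size s)%:R * x).
  by apply: IH => k ks; apply: h; rewrite in_cons ks orbT.
have -> : (size (j :: s))%:R * x = x + (size s)%:R * x by rewrite /= -natr1; ring.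
apply: off_rare_imp (off_rare_and h1 h2) _ => w [a b] k; rewrite in_cons => /predU1P[->//|].
exact: b.
Qed.

Lemma moment_off_rare p f a t : moment_le P p f a -> 0 < t ->
  off_rare (fun w => `|f w| < t) (a ^+ p / t ^+ p.*2).
Proof.
move=> hf t0; exists [set w | t <= `|f w|].
  have [mf _ _ _] := hf; rewrite -[X in measurable X]setTI; apply: measurable_fun_le => //.
  exact: measurableT_comp.
split; first exact: moment_le_tail.
by move=> w /= /negP; rewrite -ltNge.
Qed.

End RareEvents.

Section Frobenius.
Variable R : realType.
Local Notation Cx := R[i].

Definition frob m n (A : 'M[Cx]_(m, n)) : R := \sum_i \sum_j normsq (A i j).

Lemma normsq_norm (z : Cx) : (normsq z)%:C = `|z| ^+ 2.
Proof. by rewrite normsqE normCKC. Qed.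

Lemma frob_ge0 m n (A : 'M[Cx]_(m, n)) : 0 <= frob A.
Proof. by apply: sumr_ge0 => i _; apply: sumr_ge0 => j _; exact: normsq_ge0. Qed.

Lemma frob_trace m n (A : 'M[Cx]_(m, n)) : (frob A)%:C = \tr (A ^t* *m A).
Proof.
rewrite /frob exchange_big rmorph_sum /=; apply: eq_bigr => j _.
by rewrite rmorph_sum /= mxE; apply: eq_bigr => i _; rewrite normsqE adjmxE.
Qed.

Lemma frob_spectral n (U : 'M[Cx]_n) (e : 'I_n -> R) : U \is unitarymx ->
  frob (U ^t* *m diag_mx (\row_k (e k)%:C) *m U) = \sum_k e k ^+ 2.
Proof.
move=> hU; apply: (@complexI R); rewrite frob_trace.
have hD : (diag_mx (\row_k (e k)%:C) : 'M[Cx]_n) ^t* = diag_mx (\row_k (e k)%:C).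
  apply/matrixP => i j; rewrite adjmxE !mxE eq_sym; case: eqP => [->|_].
    by rewrite !mulr1n; apply/eqP; rewrite eq_complex /= oppr0 !eqxx.
  by rewrite !mulr0n rmorph0.
have hA : (U ^t* *m diag_mx (\row_k (e k)%:C) *m U) ^t* = U ^t* *m diag_mx (\row_k (e k)%:C) *m U.
  by rewrite !adjmxM trmxCK hD mulmxA.
rewrite hA -[X in \tr X](_ : (U ^t* *m diag_mx (\row_k (e k)%:C) *m U) ^+ 2 = _) //.
rewrite spectral_pow // mxtrace_mulC mulmxA; have /unitarymxP -> := hU.
rewrite mul1mx mxtrace_diag rmorph_sum /=; apply: eq_bigr => k _.
by rewrite mxE [(\row__ _) 0 k]mxE realcX.
Qed.

End Frobenius.

Section KroneckerForms.
Variables (R : realType) (d : measure_display) (T : measurableType d) (P : probability T R).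
Variables (N n : nat) (Z : T -> 'M[R[i]]_(N, n)) (p : nat) (kappa : R).
Local Notation Cx := R[i].
Local Notation Re := complex.Re.
Local Notation Im := complex.Im.
Let X (ij : 'I_N * 'I_n) w := Z w ij.1 ij.2.
Hypothesis mX : forall ij, complex_rv (X ij).
Hypothesis indX : mutually_independent P X.
Hypothesis p12 : p = 1%N \/ p = 2%N.
Hypothesis Re0 : forall ij, \int[P]_w Re (X ij w) = 0.
Hypothesis Im0 : forall ij, \int[P]_w Im (X ij w) = 0.
Hypothesis Sq0 : forall ij, \int[P]_w (Re (X ij w) ^+ 2 + Im (X ij w) ^+ 2 - 1) = 0.
Hypothesis mRe : forall ij, moment_le P p (fun w => Re (X ij w)) kappa.
Hypothesis mIm : forall ij, moment_le P p (fun w => Im (X ij w)) kappa.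
Hypothesis mSq : forall ij,
  moment_le P p (fun w => Re (X ij w) ^+ 2 + Im (X ij w) ^+ 2 - 1) kappa.
Hypothesis kappa0 : 0 <= kappa.

(** What matters is that it depends on [kappa] only, and not on the dimensions. *)
Definition kron_const : R := 4 * (4 * kappa + 64 * 32 * kappa ^+ 2).

Let Re_sum (L : Type) (s : seq L) (F : L -> Cx) : Re (\sum_(k <- s) F k) = \sum_(k <- s) Re (F k).
Proof.
elim: s => [|k s IH]; rewrite ?big_nil // !big_cons -IH; exact: raddfD.
Qed.

(** Quadratic forms in all the entries whose coefficient matrix is a Kronecker product;
    both the compressions of [Z^* C Z] and the norms of the rows of [Z] are of this kind. *)
Lemma kron_moment (A : 'M[Cx]_N) (B : 'M[Cx]_n) : A \is hermsymmx -> B \is hermsymmx ->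
  moment_le P p (fun w => Re (\sum_(ik : 'I_N * 'I_n) \sum_(jl : 'I_N * 'I_n)
      A ik.1 jl.1 * B ik.2 jl.2 * ((Z w ik.1 ik.2)^*%C * Z w jl.1 jl.2)) - Re (\tr A * \tr B))
    (kron_const * (frob A * frob B)).
Proof.
move=> /adjmx_hermP/matrixP hA /adjmx_hermP/matrixP hB.
pose D (ik jl : 'I_N * 'I_n) : Cx := A ik.1 jl.1 * B ik.2 jl.2.
have hD ik jl : D jl ik = (D ik jl)^*%C.
  rewrite /D; have := hA jl.1 ik.1; have := hB jl.2 ik.2; rewrite !adjmxE => <- <-.
  by rewrite rmorphM.
have := quadratic_form_moment mX indX p12 Re0 Im0 Sq0 mRe mIm mSq kappa0 hD
  (index_enum_uniq ('I_N * 'I_n)%type).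
have -> : \sum_i \sum_j (Re (D i j) ^+ 2 + Im (D i j) ^+ 2) = frob A * frob B.
  transitivity (\sum_(ik : 'I_N * 'I_n) \sum_(jl : 'I_N * 'I_n)
      normsq (A ik.1 jl.1) * normsq (B ik.2 jl.2)).
    by apply: eq_bigr => ik _; apply: eq_bigr => jl _; rewrite -normsqM.
  rewrite -(pair_bigA _ (fun i k => \sum_(jl : 'I_N * 'I_n) normsq (A i jl.1) * normsq (B k jl.2))) /=.
  rewrite /frob mulr_suml; apply: eq_bigr => i _.
  rewrite mulr_sumr; apply: eq_bigr => k _.
  rewrite -(pair_bigA _ (fun j l => normsq (A i j) * normsq (B k l))) /= mulr_suml.
  by apply: eq_bigr => j _; rewrite mulr_sumr.
rewrite -/kron_const; congr (moment_le _ _ _ _); apply: funext => w; congr (_ - _).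
  by rewrite Re_sum; apply: eq_bigr => ik _; rewrite Re_sum.
rewrite -Re_sum; congr Re; rewrite /mxtrace mulr_suml.
rewrite -(pair_bigA _ (fun i k => A i i * B k k)) /=.
by apply: eq_bigr => i _; rewrite mulr_sumr.
Qed.

Lemma kron_const_ge0 : 0 <= kron_const.
Proof. by rewrite mulr_ge0 // addr_ge0 // mulr_ge0 // sqr_ge0. Qed.

(** The quadratic form of [Z^* C Z] concentrates around [\tr C] times the squared norm. *)
Lemma gram_form_moment (A : 'M[Cx]_N) (u : 'cV[Cx]_n) : A \is hermsymmx ->
  moment_le P p (fun w => Re (qform ((Z w) ^t* *m A *m Z w) u) - Re (\tr A * sqn u))
    (kron_const * (frob A * Re (sqn u) ^+ 2)).
Proof.
move=> hA; pose B : 'M[Cx]_n := \matrix_(k, l) ((u k 0)^*%R * u l 0).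
have hB : B \is hermsymmx.
  by apply/adjmx_hermP/matrixP => k l; rewrite adjmxE !mxE rmorphM /= conjCK mulrC.
have trB : \tr B = sqn u.
  by rewrite sqnE; apply: eq_bigr => k _; rewrite mxE normCKC.
have fB : frob B = Re (sqn u) ^+ 2.
  have -> : sqn u = (\sum_k normsq (u k 0))%:C.
    by rewrite sqnE rmorph_sum /=; apply: eq_bigr => k _; rewrite normsq_norm.
  rewrite /= expr2 mulr_suml; apply: eq_bigr => k _; rewrite mulr_sumr; apply: eq_bigr => l _.
  rewrite mxE normsqM; congr (_ * _); apply: (@complexI R).
  by rewrite !normsq_norm norm_conjC.
have := kron_moment hA hB; rewrite trB fB; congr (moment_le _ _ _ _); apply: funext => w.
congr (Re _ - _); rewrite -qformM /qform mxE.
rewrite -(pair_bigA _ (fun i k => \sum_(jl : 'I_N * 'I_n) A i jl.1 * B k jl.2 * ((Z w i k)^*%C * Z w jl.1 jl.2))) /=.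
under [RHS]eq_bigr do rewrite mxE mulr_suml.
rewrite [RHS]exchange_big /=; apply: eq_bigr => i _.
rewrite adjmxE mxE rmorph_sum /=.
under eq_bigr => k _ do rewrite -(pair_bigA _ (fun j l => A i j * B k l * ((Z w i k)^*%C * Z w j l))) /=.
rewrite exchange_big /=; apply: eq_bigr => j _.
rewrite mxE !mulr_suml; apply: eq_bigr => k _; rewrite mulr_sumr; apply: eq_bigr => l _.
by rewrite mxE rmorphM /=; ring.
Qed.

(** The Kronecker product of [delta_mx i i] with the transpose of [B]. *)
Lemma row_form_moment (B : 'M[Cx]_n) (i : 'I_N) : B \is hermsymmx ->
  moment_le P p (fun w => Re (qform B ((Z w) ^t* *m delta_mx i 0)) - Re (\tr B))
    (kron_const * frob B).
Proof.
move=> hB; have hA : (delta_mx i i : 'M[Cx]_N) \is hermsymmx.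
  by apply/adjmx_hermP/matrixP => k l; rewrite adjmxE !mxE rmorph_nat andbC.
have hBT : B^T \is hermsymmx.
  apply/adjmx_hermP/matrixP => k l; rewrite adjmxE !mxE.
  by have /adjmx_hermP/matrixP/(_ l k) := hB; rewrite adjmxE.
have := kron_moment hA hBT.
have -> : frob (delta_mx i i : 'M[Cx]_N) = 1.
  have d0 k l : (k == i) && (l == i) = false -> normsq ((delta_mx i i : 'M[Cx]_N) k l) = 0.
    by move=> kl; rewrite mxE kl /normsq /= expr0n addr0.
  have row0 k : k != i -> \sum_l normsq ((delta_mx i i : 'M[Cx]_N) k l) = 0.
    by move=> ki; rewrite big1 // => l _; rewrite d0 // (negPf ki).
  have col0 l : l != i -> normsq ((delta_mx i i : 'M[Cx]_N) i l) = 0.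
    by move=> li; rewrite d0 // (negPf li) andbF.
  rewrite /frob (bigD1 i) //= (eq_bigr _ row0) big1_eq addr0.
  rewrite (bigD1 i) //= (eq_bigr _ col0) big1_eq addr0.
  by rewrite mxE !eqxx /normsq /= expr1n expr0n addr0.
have -> : frob B^T = frob B.
  by rewrite /frob exchange_big /=; apply: eq_bigr => k _; apply: eq_bigr => l _; rewrite mxE.
have -> : \tr (delta_mx i i : 'M[Cx]_N) = 1.
  rewrite /mxtrace (bigD1 i) //= big1 => [|k ki]; first by rewrite mxE !eqxx addr0.
  by rewrite mxE (negPf ki).
rewrite mxtrace_tr !mul1r; congr (moment_le _ _ _ _); apply: funext => w; congr (Re _ - _).
rewrite (_ : qform B _ = \sum_k \sum_l Z w i k * B k l * (Z w i l)^*%R); last first.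
  rewrite /qform mxE exchange_big /=; apply: eq_bigr => l _; rewrite mxE mulr_suml.
  have zE (k : 'I_n) : ((Z w) ^t* *m (delta_mx i 0 : 'cV_N)) k 0 = (Z w i k)^*%R.
    by rewrite -colE mxE adjmxE.
  by apply: eq_bigr => k _; rewrite zE adjmxE zE conjCK.
rewrite -(pair_bigA _ (fun j l => \sum_(jl : 'I_N * 'I_n) (delta_mx i i : 'M[Cx]_N) j jl.1 * B^T l jl.2 * ((Z w j l)^*%C * Z w jl.1 jl.2))) /=.
rewrite (bigD1 i) //= [X in _ + X]big1 ?addr0; last first.
  move=> j ji; rewrite big1 // => l _; rewrite big1 // => jl _.
  by rewrite mxE (negPf ji) !mul0r.
rewrite [RHS]exchange_big /=; apply: eq_bigr => l _.
rewrite -(pair_bigA _ (fun j k => (delta_mx i i : 'M[Cx]_N) i j * B^T l k * ((Z w i l)^*%C * Z w j k))) /=.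
rewrite (bigD1 i) //= [X in _ + X]big1 ?addr0; last first.
  by move=> j ji; rewrite big1 // => k _; rewrite mxE (negPf ji) andbF !mul0r.
by apply: eq_bigr => k _; rewrite !mxE !eqxx mul1r; ring.
Qed.

End KroneckerForms.

(** * The bulk of the spectrum *)

Section ComplexExpectation.
Variables (R : realType) (d : measure_display) (T : measurableType d) (P : probability T R).
Local Notation Cx := R[i].
Local Notation Re := complex.Re.
Local Notation Im := complex.Im.
Implicit Types f g : T -> Cx.

Definition CPint f : Prop := Pint P (fun w => Re (f w)) /\ Pint P (fun w => Im (f w)).
Definition cexpect f : Cx := (\int[P]_w Re (f w)) +i* (\int[P]_w Im (f w)).

Lemma cexpectD f g : CPint f -> CPint g ->
  CPint (fun w => f w + g w) /\ cexpect (fun w => f w + g w) = cexpect f + cexpect g.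
Proof.
move=> [f1 f2] [g1 g2]; have re w : Re (f w + g w) = Re (f w) + Re (g w) by exact: raddfD.
have im w : Im (f w + g w) = Im (f w) + Im (g w) by exact: raddfD.
rewrite /CPint /cexpect (funext re) (funext im); split; first by split; exact: PintD.
by rewrite !RintegralD.
Qed.

Lemma cexpectZ (a : Cx) f : CPint f ->
  CPint (fun w => a * f w) /\ cexpect (fun w => a * f w) = a * cexpect f.
Proof.
move=> [f1 f2]; case: a => a b.
have re w : Re ((a +i* b) * f w) = a * Re (f w) + (- b) * Im (f w).
  by case: (f w) => u v /=; rewrite mulNr.
have im w : Im ((a +i* b) * f w) = a * Im (f w) + b * Re (f w) by case: (f w).
rewrite /CPint /cexpect (funext re) (funext im); split.
  by split; apply: PintD; exact: PintZ.
rewrite !RintegralD ?RintegralZl //; try exact: PintZ.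
by apply/eqP; rewrite eq_complex /= mulNr !eqxx.
Qed.

Lemma cexpect_sum (J : Type) (s : seq J) (F : J -> T -> Cx) : (forall j, CPint (F j)) ->
  CPint (fun w => \sum_(j <- s) F j w) /\
  cexpect (fun w => \sum_(j <- s) F j w) = \sum_(j <- s) cexpect (F j).
Proof.
move=> hF; elim: s => [|j s [IH1 IH2]].
  rewrite (funext (fun w => big_nil _ _ _ _)) big_nil; split; first by split; exact: Pint_cst.
  by rewrite /cexpect !Rintegral_cst // !mul0r.
by rewrite (funext (fun w => big_cons _ _ _ _ _ _)) big_cons -IH2; exact: cexpectD.
Qed.

Variables (I : finType) (X : I -> T -> Cx).

Definition cdepends (J : {set I}) f : Prop :=
  depends X J (fun w => Re (f w)) /\ depends X J (fun w => Im (f w)).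

Lemma cdependsD J f g : cdepends J f -> cdepends J g -> cdepends J (fun w => f w + g w).
Proof.
move=> [f1 f2] [g1 g2]; have re w : Re (f w + g w) = Re (f w) + Re (g w) by exact: raddfD.
have im w : Im (f w + g w) = Im (f w) + Im (g w) by exact: raddfD.
by rewrite /cdepends (funext re) (funext im); split; exact: dependsD.
Qed.

Lemma cdepends_cst J c : cdepends J (fun=> c).
Proof. by split; exact: depends_cst. Qed.

Lemma cdependsM J f g : cdepends J f -> cdepends J g -> cdepends J (fun w => f w * g w).
Proof.
move=> [f1 f2] [g1 g2].
have re w : Re (f w * g w) = Re (f w) * Re (g w) + (-1) * (Im (f w) * Im (g w)).
  by case: (f w) (g w) => a b [u v] /=; ring.
have im w : Im (f w * g w) = Re (f w) * Im (g w) + Im (f w) * Re (g w).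
  by case: (f w) (g w) => a b [u v].
have c1 : depends X J (fun=> -1) by exact: depends_cst.
rewrite /cdepends (funext re) (funext im); split.
  by apply: dependsD; [exact: dependsM|apply: dependsM => //; exact: dependsM].
by apply: dependsD; exact: dependsM.
Qed.

Lemma cdepends_conj J f : cdepends J f -> cdepends J (fun w => (f w)^*%C).
Proof.
move=> [f1 f2]; have re w : Re ((f w)^*%C) = Re (f w) by case: (f w).
have im w : Im ((f w)^*%C) = -1 * Im (f w) by case: (f w) => a b /=; ring.
rewrite /cdepends (funext re) (funext im); split=> //.
by apply: dependsM => //; exact: depends_cst.
Qed.

Lemma cdepends_sum J (L : Type) (s : seq L) (F : L -> T -> Cx) :
  (forall j, cdepends J (F j)) -> cdepends J (fun w => \sum_(j <- s) F j w).
Proof.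
move=> hF; elim: s => [|j s IH].
  by rewrite (funext (fun w => big_nil _ _ _ _)); exact: cdepends_cst.
by rewrite (funext (fun w => big_cons _ _ _ _ _ _)); exact: cdependsD.
Qed.

End ComplexExpectation.

Section SampleRows.
Variables (R : realType) (d : measure_display) (T : measurableType d) (P : probability T R).
Variables (N n : nat) (Z : T -> 'M[R[i]]_(N, n)) (p : nat) (kappa : R).
Local Notation Cx := R[i].
Local Notation Re := complex.Re.
Local Notation Im := complex.Im.
Let X (ij : 'I_N * 'I_n) w := Z w ij.1 ij.2.
Hypothesis mX : forall ij, complex_rv (X ij).
Hypothesis indX : mutually_independent P X.
Hypothesis p12 : p = 1%N \/ p = 2%N.
Hypothesis Re0 : forall ij, \int[P]_w Re (X ij w) = 0.
Hypothesis Im0 : forall ij, \int[P]_w Im (X ij w) = 0.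
Hypothesis Sq0 : forall ij, \int[P]_w (Re (X ij w) ^+ 2 + Im (X ij w) ^+ 2 - 1) = 0.
Hypothesis mRe : forall ij, moment_le P p (fun w => Re (X ij w)) kappa.
Hypothesis mIm : forall ij, moment_le P p (fun w => Im (X ij w)) kappa.
Hypothesis mSq : forall ij,
  moment_le P p (fun w => Re (X ij w) ^+ 2 + Im (X ij w) ^+ 2 - 1) kappa.
Hypothesis kappa0 : 0 <= kappa.

Let cov i (k l : 'I_n) : CPint P (fun w => Z w i k * (Z w i l)^*%C) /\
  cexpect P (fun w => Z w i k * (Z w i l)^*%C) = (k == l)%:R.
Proof.
have iRe ij := moment_le_integrable p12 (mRe ij); have iIm ij := moment_le_integrable p12 (mIm ij).
have re w : Re (Z w i k * (Z w i l)^*%C) = Re (X (i, k) w) * Re (X (i, l) w) + Im (X (i, k) w) * Im (X (i, l) w).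
  by rewrite /X /=; case: (Z w i k) (Z w i l) => a b [u v] /=; ring.
have im w : Im (Z w i k * (Z w i l)^*%C) = Im (X (i, k) w) * Re (X (i, l) w) + (-1) * (Re (X (i, k) w) * Im (X (i, l) w)).
  by rewrite /X /=; case: (Z w i k) (Z w i l) => a b [u v] /=; ring.
rewrite /CPint /cexpect (funext re) (funext im); have [->|kl] := eqVneq k l.
  have sq w : Re (X (i, l) w) * Re (X (i, l) w) + Im (X (i, l) w) * Im (X (i, l) w) =
      (Re (X (i, l) w) ^+ 2 + Im (X (i, l) w) ^+ 2 - 1) + 1 by ring.
  have z w : Im (X (i, l) w) * Re (X (i, l) w) + (-1) * (Re (X (i, l) w) * Im (X (i, l) w)) = 0 by ring.
  have iS := moment_le_integrable p12 (mSq (i, l)); have i1 := Pint_cst P 1.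
  rewrite (funext sq) (funext z); split; first by split; [exact: PintD|exact: Pint_cst].
  have cst1 (a : R) : \int[P]_w a = a.
    have -> : \int[P]_w a = a * fine (P setT) by exact: Rintegral_cst.
    by rewrite probability_setT mulr1.
  rewrite RintegralD // Sq0 !cst1 add0r.
  by apply/eqP; rewrite eq_complex /= !eqxx.
have dis : {in [set (i, k)]%SET, forall x : 'I_N * 'I_n, x \notin [set (i, l)]%SET}.
  by move=> x; rewrite !finset.in_set1 => /eqP ->; rewrite xpair_eqE eqxx.
have dRe x : depends X [set x]%SET (fun w => Re (X x w)) by apply: depends_Re; rewrite finset.in_set1.
have dIm x : depends X [set x]%SET (fun w => Im (X x w)) by apply: depends_Im; rewrite finset.in_set1.
have [a1 a2] := depends_prod mX indX dis (dRe _) (dRe _) (iRe _) (iRe _).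
have [b1 b2] := depends_prod mX indX dis (dIm _) (dIm _) (iIm _) (iIm _).
have [c1 c2] := depends_prod mX indX dis (dIm _) (dRe _) (iIm _) (iRe _).
have [e1 e2] := depends_prod mX indX dis (dRe _) (dIm _) (iRe _) (iIm _).
have e1' := PintZ (-1) e1.
split; first by split; exact: PintD.
rewrite !RintegralD // RintegralZl // a2 b2 c2 e2 !Re0 !Im0.
by apply/eqP; rewrite eq_complex /= !mul0r !mulr0 !addr0 !eqxx.
Qed.

Variables (W : 'M[Cx]_n) (g : 'I_n -> R) (Lam l b : R) (q : nat).
Hypothesis WW : W *m W ^t* = diag_mx (\row_k (g k)%:C).
Hypothesis g0 : forall k, 0 <= g k <= Lam.
Hypotheses (N0 : (0 < N)%N) (n0 : (0 < n)%N) (l0 : 0 < l) (q0 : (0 < q)%N) (b0 : 0 < b).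
Hypothesis trW : \sum_k g k <= N%:R * l / 2.
Hypothesis Lamb : Lam + q%:R * l <= b.

Let c : R := (Num.sqrt N%:R)^-1.
Let c2 : c ^+ 2 = N%:R^-1.
Proof. by rewrite exprVn sqr_sqrtr. Qed.

Let Y w : 'M[Cx]_(n, N) := c%:C *: (W *m (Z w) ^t*).
Let yo i w : 'cV[Cx]_n := col i (Y w).
Let y i w : 'cV[Cx]_n := if Re (sqn (yo i w)) <= l then yo i w else 0.

Let yoE i w a : yo i w a 0 = \sum_k c%:C * W a k * (Z w i k)^*%C.
Proof. by rewrite !mxE mulr_sumr; apply: eq_bigr => k _; rewrite adjmxE mulrA. Qed.

Let own i : {set 'I_N * 'I_n} := [set x | x.1 == i]%SET.

Let dep_entry i k : cdepends X (own i) (fun w => Z w i k).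
Proof.
have h : (i, k) \in own i by rewrite finset.inE.
by split; [exact: (depends_Re h)|exact: (depends_Im h)].
Qed.

Let dep_yo i a : cdepends X (own i) (fun w => yo i w a 0).
Proof.
rewrite (funext (fun w => yoE i w a)); apply: cdepends_sum => k.
by apply: cdependsM; [exact: cdepends_cst|apply: cdepends_conj; exact: dep_entry].
Qed.

Let dep_yoyo i a b' : cdepends X (own i) (fun w => (yo i w a 0)^*%C * yo i w b' 0).
Proof. by apply: cdependsM; [apply: cdepends_conj|]; exact: dep_yo. Qed.

Let cov_yo i a b' : CPint P (fun w => (yo i w a 0)^*%C * yo i w b' 0) /\
  cexpect P (fun w => (yo i w a 0)^*%C * yo i w b' 0) = (N%:R^-1 * g a *+ (a == b'))%:C.
Proof.
pose F (k m : 'I_n) w : Cx := (c%:C * c%:C * ((W a k)^*%R * W b' m)) * (Z w i k * (Z w i m)^*%C).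
have E w : (yo i w a 0)^*%C * yo i w b' 0 = \sum_k \sum_m F k m w.
  rewrite !yoE rmorph_sum /= mulr_suml; apply: eq_bigr => k _.
  rewrite mulr_sumr; apply: eq_bigr => m _; rewrite !rmorphM /= conjcK.
  by rewrite oppr0 -[c +i* 0]/(c%:C) /F; ring.
have FE k m := cexpectZ (c%:C * c%:C * ((W a k)^*%R * W b' m)) (cov i k m).1.
have G k := cexpect_sum (index_enum 'I_n) (fun m => (FE k m).1).
have [H1 H2] := cexpect_sum (index_enum 'I_n) (fun k => (G k).1).
rewrite (funext E); split; first exact: H1.
rewrite H2; transitivity (\sum_k c%:C * c%:C * ((W a k)^*%R * W b' k)).
  apply: eq_bigr => k _; rewrite (G k).2 (bigD1 k) //= big1 ?addr0 => [|m mk].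
    by rewrite (FE k k).2 (cov i k k).2 eqxx mulr1.
  by rewrite (FE k m).2 (cov i k m).2 eq_sym (negPf mk) mulr0.
rewrite -mulr_sumr -realcM -expr2 c2; have /matrixP/(_ b' a) := WW; rewrite !mxE => WWba.
have -> : \sum_k (W a k)^*%R * W b' k = (g a)%:C *+ (a == b').
  transitivity (\sum_k W b' k * (W ^t*) k a).
    by apply: eq_bigr => k _; rewrite adjmxE mulrC.
  by rewrite WWba eq_sym; case: eqP => [->|].
by case: eqP => _; rewrite ?mulr1n ?mulr0n -?realcM ?mulr0 ?mulr1n.
Qed.

Let ReE f (z : Cx) : cexpect P f = z -> \int[P]_w Re (f w) = Re z.
Proof. by move=> <-. Qed.

Let ImE f (z : Cx) : cexpect P f = z -> \int[P]_w Im (f w) = Im z.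
Proof. by move=> <-. Qed.

Let y_bounded i : bounded_mx X (own i) (y i).
Proof.
move=> a j; rewrite ord1.
have cond : measurable_fun setT ((fun w => Re (sqn (yo i w)) <= l) :
    g_sigma_algebraType (cylinder X (own i)) -> bool).
  apply: measurable_fun_ler; last exact: measurable_cst.
  have h : cdepends X (own i) (fun w => sqn (yo i w)).
    have E w : sqn (yo i w) = \sum_k (yo i w k 0)^*%C * yo i w k 0.
      by rewrite sqnE; apply: eq_bigr => k _; rewrite normCKC.
    by rewrite (funext E); apply: cdepends_sum => k; exact: dep_yoyo.
  exact: h.1.
have [d1 d2] := dep_yo i a.
have re w : Re (y i w a 0) = if Re (sqn (yo i w)) <= l then Re (yo i w a 0) else 0.
  by rewrite /y; case: ifP; rewrite ?mxE.
have im w : Im (y i w a 0) = if Re (sqn (yo i w)) <= l then Im (yo i w a 0) else 0.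
  by rewrite /y; case: ifP; rewrite ?mxE.
split.
- by rewrite (funext re); apply: measurable_fun_ifT => //; exact: measurable_cst.
- by rewrite (funext im); apply: measurable_fun_ifT => //; exact: measurable_cst.
exists (1 + l) => w; have l1 : 0 <= 1 + l by rewrite addr_ge0 // ltW.
rewrite re im; case: ifP => [h|_]; last by rewrite normr0.
have h2 : Re (yo i w a 0) ^+ 2 + Im (yo i w a 0) ^+ 2 <= l.
  apply: le_trans h; have -> : sqn (yo i w) = (\sum_k normsq (yo i w k 0))%:C.
    by rewrite sqnE rmorph_sum /=; apply: eq_bigr => k _; rewrite normsq_norm.
  rewrite /= (bigD1 a) //= lerDl; apply: sumr_ge0 => k _; exact: normsq_ge0.
have sm (x z : R) : x ^+ 2 + z ^+ 2 <= l -> `|x| <= 1 + l.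
  move=> hx; have := sqr_ge0 (`|x| - 1); have := sqr_ge0 z; have := real_normK (num_real x).
  rewrite sqrrB => -> ? ?; have := normr_ge0 x; lra.
by split; [exact: sm h2|apply: sm; rewrite addrC; exact: h2].
Qed.

(** The Gram matrix of the rows, truncated, obeys a Chernoff bound; truncation is rarely
    felt because the squared norms of the rows concentrate. *)
Lemma tail_off_rare : off_rare P
  (fun w => forall x, N%:R^-1 * qform (Z w *m (W ^t* *m W) *m (Z w) ^t*) x <= (2 * b)%:C * sqn x)
  (n%:R / 2 ^+ q + N%:R * ((kron_const kappa * frob (W ^t* *m W)) ^+ p / (N%:R * l / 2) ^+ p.*2)).
Proof.
have NR : 0 < N%:R :> R by rewrite ltr0n.
have Lam0 : 0 <= Lam by have /andP[h1 h2] := g0 (Ordinal n0); exact: le_trans h1 h2.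
have sg0 : 0 <= N%:R^-1 * Lam by rewrite mulr_ge0 ?invr_ge0.
have yl i w : sqn (y i w) <= l%:C.
  rewrite /y; case: ifP => [h|_]; last by rewrite /sqn mulmx0 mxE ler0c ltW.
  have : sqn (yo i w) \is Num.real by exact/ger0_real/sqn_ge0.
  by move=> /RRe_real hre; rewrite -hre lecR.
have y_yo i w : y i w = yo i w \/ y i w = 0 by rewrite /y; case: ifP; [left|right].
have trunc := trace_pow_tail mX indX (row := fst) (yo := yo) (y := y) (l := l) (sigma := N%:R^-1 * Lam)
  (fun i a b' => (dep_yoyo i a b').1) (fun i a b' => (dep_yoyo i a b').2)
  (fun i a b' => (cov_yo i a b').1.1) (fun i a b' => (cov_yo i a b').1.2).
have {}trunc : off_rare P (fun w => forall v, qform (\sum_i y i w *m (y i w) ^t*) v <= (2 * b)%:C * sqn v)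
    (n%:R / 2 ^+ q).
  apply: trunc => //; last 2 first.
  - exact: ltW.
  - by rewrite card_ord mulVKf ?gt_eqF.
  - by move=> i a b' ab; rewrite (ReE (cov_yo i a b').2) /= (negPf ab).
  - by move=> i a b'; rewrite (ImE (cov_yo i a b').2).
  - move=> i a; rewrite (ReE (cov_yo i a a).2) /= eqxx mulr1n ler_wpM2l ?invr_ge0 //.
    by have /andP[] := g0 a.
have hWW : W ^t* *m W \is hermsymmx by apply/adjmx_hermP; rewrite adjmxM trmxCK.
have trWW : Re (\tr (W ^t* *m W)) = \sum_k g k.
  rewrite mxtrace_mulC WW mxtrace_diag -[RHS]/(Re (\sum_k g k)%:C) rmorph_sum; congr Re.
  by apply: eq_bigr => k _; rewrite mxE.
have t0 : 0 < N%:R * l / 2 by rewrite divr_gt0 // mulr_gt0.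
have rows := @off_rare_all _ _ _ P _ (enum 'I_N) _ _ (fun i _ =>
  moment_off_rare (row_form_moment mX indX p12 Re0 Im0 Sq0 mRe mIm mSq kappa0 i hWW) t0).
rewrite size_enum_ord in rows; apply: off_rare_imp (off_rare_and trunc rows) _ => w [h1 h2].
have good i : y i w = yo i w.
  rewrite /y ifT //; have -> : yo i w = c%:C *: (W *m ((Z w) ^t* *m delta_mx i 0)).
    by rewrite /yo /Y colE -scalemxAl mulmxA.
  rewrite sqnZ sqnM normc_def /= expr0n addr0 sqrtr_sqr -realcX real_normK ?num_real // c2.
  have := h2 i (mem_enum _ i); rewrite trWW ltr_norml => /andP[_ h3].
  have -> (z : Cx) (a : R) : Re (a%:C * z) = a * Re z by case: z => u v /=; rewrite mul0r subr0.
  rewrite ler_pdivrMl //; move: h3 trW; lra.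
have YY : \sum_i y i w *m (y i w) ^t* = Y w *m (Y w) ^t*.
  apply/matrixP => a b'; rewrite summxE mxE; apply: eq_bigr => i _.
  by rewrite good mxE big_ord1 !adjmxE /yo [col _ _ a _]mxE [col _ _ b' _]mxE.
move=> x; have b2 : 0 < (2 * b)%:C :> Cx by rewrite -[0]/(0%:C) ltcR mulr_gt0.
have Yb v : sqn ((Y w) ^t* *m v) <= (2 * b)%:C * sqn v.
  by rewrite sqnM trmxCK -YY; exact: h1.
have := adj_bound b2 Yb x; rewrite trmxCK; apply: le_trans.
rewrite /Y -scalemxAl sqnZ normc_def /= expr0n addr0 sqrtr_sqr -realcX real_normK ?num_real // c2.
rewrite sqnM !adjmxM trmxCK !mulmxA -(@realc_nat R N) -fmorphV.
by rewrite lexx.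
Qed.

End SampleRows.

(** * Sample covariance matrices of a fixed size *)

Section DeltaForms.
Variable R : realType.
Local Notation Cx := R[i].

Lemma adjmx_real_scalar n (x : R) : ((x%:C)%:M : 'M[Cx]_n) ^t* = (x%:C)%:M.
Proof.
rewrite tr_scalar_mx map_scalar_mx; congr (_%:M).
by apply/eqP; rewrite eq_complex /= oppr0 !eqxx.
Qed.

Lemma scale_window (N : nat) (x y : R) (Q s : Cx) : (0 < N)%N ->
  - (y * N%:R)%:C * s <= Q - (N%:R * x)%:C * s <= (y * N%:R)%:C * s ->
  (x - y)%:C * s <= N%:R^-1 * Q <= (x + y)%:C * s.
Proof.
move=> N0; have NR : 0 < (N%:R : Cx) by rewrite ltr0n.
rewrite lerBrDr lerBlDr !realcM realc_nat rmorphB realcD => /andP[q1 q2].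
apply/andP; split; [rewrite ler_pdivlMl //; apply: le_trans q1|rewrite ler_pdivrMl //; apply: le_trans q2 _].
  by rewrite le_eqVlt; apply/orP; left; apply/eqP; ring.
by rewrite le_eqVlt; apply/orP; left; apply/eqP; ring.
Qed.

Lemma qform_entries n (A : 'M[Cx]_n) v :
  qform A v = \sum_k \sum_l (v k 0)^*%R * A k l * v l 0.
Proof.
rewrite /qform mxE exchange_big /=; apply: eq_bigr => l _.
by rewrite mxE mulr_suml; apply: eq_bigr => k _; rewrite adjmxE.
Qed.

Lemma qform_delta2 n (A : 'M[Cx]_n) (k l : 'I_n) (a : Cx) :
  qform A (delta_mx k 0 + a *: delta_mx l 0) =
    A k k + a^*%R * a * A l l + a * A k l + a^*%R * A l k.
Proof.
have dd i j : ((delta_mx i 0 : 'cV[Cx]_n) ^t* *m A *m (delta_mx j 0 : 'cV[Cx]_n)) 0 0 = A i j.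
  by rewrite trmx_delta map_delta_mx -rowE -colE !mxE.
rewrite /qform adjmxD adjmxZ mulmxDl !mulmxDr !mulmxDl.
have add0 (Y Y' : 'M[Cx]_1) : (Y + Y') 0 0 = Y 0 0 + Y' 0 0 by rewrite mxE.
have sc x (Y : 'M[Cx]_1) : (x *: Y) 0 0 = x * Y 0 0 by rewrite mxE.
rewrite -!scalemxAl -!scalemxAr !add0 !sc !dd.
by move: (A k k) (A l l) (A k l) (A l k) => a1 a2 a3 a4; ring.
Qed.

Lemma qform_restrict n K (G : 'M[Cx]_n) (t : R) (v : 'cV[Cx]_n) : G \is hermsymmx ->
  (forall k l : 'I_n, (k < K)%N -> (l < K)%N -> `|G k l| <= t%:C) -> 0 <= t -> (K <= n)%N ->
  (forall i : 'I_n, (K <= i)%N -> v i 0 = 0) ->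
  - (K%:R * t)%:C * sqn v <= qform G v <= (K%:R * t)%:C * sqn v.
Proof.
move=> hG hGt t0 Kn hv.
have herm (s : Cx) : s^*%R = s ->
    ((\matrix_(k, l) (if (k < K)%N && (l < K)%N then s * G k l else 0)) : 'M[Cx]_n) \is hermsymmx.
  move=> hs; apply/adjmx_hermP/matrixP => k l; rewrite adjmxE !mxE andbC.
  case: ifP => _; last by rewrite rmorph0.
  by have /adjmx_hermP/matrixP/(_ k l) := hG; rewrite adjmxE rmorphM /= hs => ->.
have bnd (s : Cx) : s^*%R = s -> `|s| = 1 -> s * qform G v <= (K%:R * t)%:C * sqn v.
  move=> hs s1; set B : 'M[Cx]_n := \matrix_(k, l) (if (k < K)%N && (l < K)%N then s * G k l else 0).
  have -> : s * qform G v = qform B v.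
    rewrite !qform_entries mulr_sumr; apply: eq_bigr => k _; rewrite mulr_sumr.
    apply: eq_bigr => l _; rewrite [B k l]mxE.
    have [kK|Kk] := ltnP k K; last by rewrite hv // rmorph0 !mul0r mulr0.
    have [lK|Kl] := ltnP l K; last by rewrite (hv l) // !mulr0.
    by rewrite /=; ring.
  apply: schur_test => [|k]; first exact: herm.
  apply: (@le_trans _ _ (\sum_(l < n | (l < K)%N) t%:C)); last first.
    by rewrite sum_first // -[leLHS]mulr_natl -(@realc_nat R K) -realcM.
  rewrite [leRHS]big_mkcond /=; apply: ler_sum => l _; rewrite mxE.
  have [kK|_] := ltnP k K; have [lK|_] := ltnP l K; rewrite /= ?normr0 ?ler0c //.
  by rewrite normrM s1 mul1r hGt.
apply/andP; split.
  have := bnd (-1); rewrite rmorphN1 normrN1 => /(_ erefl erefl).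
  by rewrite mulN1r mulNr lerNl.
by have := bnd 1; rewrite rmorph1 normr1 mul1r; apply.
Qed.

End DeltaForms.

Section FixedSize.
Variables (R : realType) (d : measure_display) (T : measurableType d) (P : probability T R).
Variables (N n : nat) (Z : T -> 'M[R[i]]_(N, n)) (p : nat) (kappa : R).
Local Notation Cx := R[i].
Local Notation Re := complex.Re.
Local Notation Im := complex.Im.
Let X (ij : 'I_N * 'I_n) w := Z w ij.1 ij.2.
Hypothesis mX : forall ij, complex_rv (X ij).
Hypothesis indX : mutually_independent P X.
Hypothesis p12 : p = 1%N \/ p = 2%N.
Hypothesis Re0 : forall ij, \int[P]_w Re (X ij w) = 0.
Hypothesis Im0 : forall ij, \int[P]_w Im (X ij w) = 0.
Hypothesis Sq0 : forall ij, \int[P]_w (Re (X ij w) ^+ 2 + Im (X ij w) ^+ 2 - 1) = 0.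
Hypothesis mRe : forall ij, moment_le P p (fun w => Re (X ij w)) kappa.
Hypothesis mIm : forall ij, moment_le P p (fun w => Im (X ij w)) kappa.
Hypothesis mSq : forall ij,
  moment_le P p (fun w => Re (X ij w) ^+ 2 + Im (X ij w) ^+ 2 - 1) kappa.
Hypothesis kappa0 : 0 <= kappa.

Variables (C : 'M[Cx]_N) (M : R) (K : nat).
Hypotheses (pC : psdmx C) (eigM : forall k, (k < N)%N -> eigval k.+1 C <= M).
Hypotheses (M0 : 0 <= M) (N0 : (0 < N)%N) (K0 : (0 < K)%N) (Kn : (K <= n)%N).

Let ct : R := N%:R^-1 * \sum_(k < N) eigval k.+1 C.
Let NR : 0 < N%:R :> R. Proof. by rewrite ltr0n. Qed.

Let trC : \tr C = (N%:R * ct)%:C.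
Proof. by rewrite -[C]expr1 trace_pow ?pC.1 // /ct mulVKf ?gt_eqF //; congr (_%:C); apply: eq_bigr => k _; rewrite expr1. Qed.

Let frobC : frob C <= N%:R * M ^+ 2.
Proof.
have [U hU CU] := sorted_spectral pC.1; rewrite CU frob_spectral //.
apply: (@le_trans _ _ (\sum_(k < N) M ^+ 2)); last by rewrite sumr_const card_ord mulr_natl.
by apply: ler_sum => k _; rewrite ler_sqr ?nnegrE ?eigval_ge0 // eigM.
Qed.

(** On a fixed number of coordinates the form of [Z^* C Z / N] is almost scalar: its
    entries are recovered by polarization from finitely many quadratic forms. *)
Lemma gram_off_rare (U : 'M[Cx]_n) (dlt : R) : U \is unitarymx -> 0 < dlt -> off_rare P
  (fun w => forall v, (forall i : 'I_n, (K <= i)%N -> (U *m v) i 0 = 0) ->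
     (ct - dlt)%:C * sqn v <= qform (N%:R^-1 *: ((Z w) ^t* *m C *m Z w)) v <= (ct + dlt)%:C * sqn v)
  ((3 * K ^ 2)%:R * ((kron_const kappa * (N%:R * M ^+ 2 * 16)) ^+ p / (dlt * N%:R / (3 * K%:R)) ^+ p.*2)).
Proof.
move=> hU dlt0; have KR : 0 < K%:R :> R by rewrite ltr0n.
pose eta := dlt * N%:R / (3 * K%:R); have eta0 : 0 < eta by rewrite divr_gt0 ?mulr_gt0.
have hC := pC.1; have hU' : U ^t* \is unitarymx by rewrite trmxC_unitary.
pose al (m : option bool) : Cx := if m is Some m' then (if m' then 'i else 1) else 0.
pose wd (k : 'I_K) : 'I_n := widen_ord Kn k.
pose e (x : 'I_K * 'I_K * option bool) : 'cV[Cx]_n := delta_mx (wd x.1.1) 0 + al x.2 *: delta_mx (wd x.1.2) 0.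
pose G w : 'M[Cx]_n := U *m ((Z w) ^t* *m C *m Z w) *m U ^t* - (N%:R * ct)%:C%:M.
have qG w v : qform (G w) v = qform ((Z w) ^t* *m C *m Z w) (U ^t* *m v) - (N%:R * ct)%:C * sqn v.
  rewrite /G qformD -[- _%:M]scaleN1r qformZ mulN1r -[(_)%:C%:M]scalemx1 qformZ qform1.
  by rewrite qformM trmxCK.
have herm w : G w \is hermsymmx.
  apply/adjmx_hermP; rewrite /G -scaleN1r adjmxD adjmxZ rmorphN1 !adjmxM !trmxCK.
  have /adjmx_hermP -> := hC; rewrite !mulmxA; congr (_ + _); congr (_ *: _).
  exact: adjmx_real_scalar.
have e4 x : Re (sqn (U ^t* *m e x)) ^+ 2 <= 16.
  rewrite sqn_unitary // -qform1 qform_delta2 !mxE !eqxx.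
  have -> : (16 : R) = 4 ^+ 2 by ring.
  have k01 : (wd x.1.2 == wd x.1.1) = (wd x.1.1 == wd x.1.2) by rewrite eq_sym.
  rewrite k01 /al; case: x.2 => [[]|]; case: (_ == _);
    rewrite /= ?mulr1n ?mulr0n ?mulr0 ?mul0r ?mulr1 ?mul1r ?addr0 ?add0r ?subr0 ?oppr0;
    rewrite ler_sqr ?nnegrE; by lra.
have mom x : moment_le P p (fun w => Re (qform (G w) (e x)))
    (kron_const kappa * (N%:R * M ^+ 2 * 16)).
  have := gram_form_moment mX indX p12 Re0 Im0 Sq0 mRe mIm mSq kappa0 (U ^t* *m e x) hC.
  have -> : (fun w => Re (qform ((Z w) ^t* *m C *m Z w) (U ^t* *m e x)) -
      Re (\tr C * sqn (U ^t* *m e x))) = (fun w => Re (qform (G w) (e x))).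
    apply: funext => w; rewrite qG trC sqn_unitary //.
    by case: (qform _ _) ((_)%:C * _) => [a1 a2] [b1 b2].
  apply: moment_le_ge; rewrite ler_wpM2l ?kron_const_ge0 //.
  by apply: ler_pM; rewrite ?frob_ge0 ?sqr_ge0.
have key := @off_rare_all _ _ _ P _ (enum {: 'I_K * 'I_K * option bool}) _ _
  (fun x _ => moment_off_rare (mom x) eta0).
rewrite -cardE !card_prod !card_ord card_option card_bool in key.
rewrite (_ : (K * K * 3)%N = (3 * K ^ 2)%N) in key; last by rewrite mulnC expnS expn1.
apply: off_rare_imp key _ => w h v hv.
have Gbnd (k l : 'I_n) : (k < K)%N -> (l < K)%N -> `|G w k l| <= (3 * eta)%:C.
  move=> kK lK; pose k' := Ordinal kK; pose l' := Ordinal lK.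
  have wk : wd k' = k by exact: val_inj.
  have wl : wd l' = l by exact: val_inj.
  have := h (k', k', None) (mem_enum _ _); have := h (l', l', None) (mem_enum _ _).
  have := h (k', l', Some false) (mem_enum _ _); have := h (k', l', Some true) (mem_enum _ _).
  rewrite /e /al [(k', l', _).1]/= [(k', k', _).1]/= [(l', l', _).1]/= wk wl !qform_delta2.
  have sym : G w l k = (G w k l)^*%R.
    by have /adjmx_hermP/matrixP/(_ l k) := herm w; rewrite adjmxE.
  rewrite sym; move: (G w k k) (G w l l) (G w k l) => [a1 a2] [b1 b2] [c1 c2] /=.
  rewrite !ltr_norml => /andP[? ?] /andP[? ?] /andP[? ?] /andP[? ?].
  apply: le_trans (normc_le_add c1 c2) _; rewrite lecR.
  have c1b : `|c1| <= 3 / 2 * eta by rewrite ler_norml; apply/andP; split; lra.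
  have c2b : `|c2| <= 3 / 2 * eta by rewrite ler_norml; apply/andP; split; lra.
  lra.
have e30 : 0 <= 3 * eta by rewrite mulr_ge0 // ltW.
have := qform_restrict (herm w) Gbnd e30 Kn hv.
have -> : K%:R * (3 * eta) = dlt * N%:R by rewrite /eta; field; rewrite gt_eqF.
rewrite qG mulmxA (unitary_adjK hU) mul1mx (sqn_unitary v hU).
rewrite qformZ; exact: scale_window.
Qed.

Variables (A : 'M[Cx]_n) (j q : nat) (dlt l b Lam tr : R).
Hypotheses (pA : psdmx A) (jK : (j < K)%N) (jN : (j < N)%N) (q0 : (0 < q)%N).
Hypotheses (dlt0 : 0 < dlt) (dct : dlt < ct) (l0 : 0 < l) (b0 : 0 < b) (Lam0 : 0 <= Lam).
Hypothesis eigA : forall k : nat, (K <= k < n)%N -> eigval k.+1 A <= Lam.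
Hypotheses (trA : \sum_(k < n) eigval k.+1 A <= tr) (trl : tr <= N%:R * l / 2).
Hypothesis Lamb : Lam + q%:R * l <= b.

(** The three terms bound the failure of [gram_off_rare] on the first [K] eigenvectors of [A]
    and, for the remaining ones, the failures of the matrix Chernoff bound and of the
    truncation. Off these events the variational comparisons apply, and the part of [A]
    beyond its [K]-th eigenvalue adds at most [M * (2 * b)]. *)
Lemma eigval_sample_cov_off_rare : off_rare P
  (fun w => (ct - dlt) * eigval j.+1 A <= eigval j.+1 (sample_cov C (Z w) A)
     <= (ct + dlt) * eigval j.+1 A + M * (2 * b))
  ((3 * K ^ 2)%:R * ((kron_const kappa * (N%:R * M ^+ 2 * 16)) ^+ p / (dlt * N%:R / (3 * K%:R)) ^+ p.*2)
   + (n%:R / 2 ^+ q + N%:R * ((kron_const kappa * (Lam * tr)) ^+ p / (N%:R * l / 2) ^+ p.*2))).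
Proof.
have n0 : (0 < n)%N by exact: leq_trans Kn.
have [U hU AU] := sorted_spectral pA.1.
pose lam (k : 'I_n) : R := if (k < K)%N then 0 else eigval k.+1 A.
have lam0 k : 0 <= lam k <= Lam.
  rewrite /lam; case: ltnP => [_|Kk]; first by rewrite lexx.
  by rewrite eigval_ge0 // eigA // Kk ltn_ord.
pose D : 'M[Cx]_n := diag_mx (\row_k (Num.sqrt (lam k))%:C).
have hD : D ^t* = D.
  apply/matrixP => a b'; rewrite adjmxE !mxE eq_sym; case: eqP => [->|_].
    by rewrite !mulr1n; apply/eqP; rewrite eq_complex /= oppr0 !eqxx.
  by rewrite !mulr0n rmorph0.
have DD : D *m D = diag_mx (\row_k (lam k)%:C).
  rewrite mulmx_diag; congr diag_mx; apply/rowP => k; rewrite !mxE -realcM -expr2 sqr_sqrtr //.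
  by have /andP[] := lam0 k.
pose W := D *m U.
have WW : W *m W ^t* = diag_mx (\row_k (lam k)%:C).
  rewrite /W adjmxM hD mulmxA -[D *m U *m _]mulmxA.
  by have /unitarymxP -> := hU; rewrite mulmx1 DD.
have W2 : W ^t* *m W = U ^t* *m diag_mx (\row_k (if (k < K)%N then 0 else (eigval k.+1 A)%:C)) *m U.
  rewrite /W adjmxM hD mulmxA -[U ^t* *m D *m D]mulmxA DD; congr (_ *m diag_mx _ *m _).
  by apply/rowP => k; rewrite !mxE /lam; case: ifP.
have trW : \sum_k lam k <= tr.
  apply: le_trans trA; apply: ler_sum => k _; rewrite /lam; case: ifP => // _.
  exact: eigval_ge0.
have fW : frob (W ^t* *m W) <= Lam * tr.
  have -> : W ^t* *m W = U ^t* *m diag_mx (\row_k (lam k)%:C) *m U.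
    rewrite W2; congr (_ *m diag_mx _ *m _); apply/rowP => k; rewrite !mxE /lam; case: ifP => //.
  rewrite frob_spectral //; apply: le_trans (ler_wpM2l Lam0 trW); rewrite mulr_sumr.
  apply: ler_sum => k _; rewrite expr2; have /andP[h1 h2] := lam0 k; exact: ler_wpM2r.
have tail := tail_off_rare mX indX p12 Re0 Im0 Sq0 mRe mIm mSq kappa0 WW lam0 N0 n0 l0 q0 b0 (le_trans trW trl) Lamb.
have {}tail := off_rare_le _ tail.
have gram := gram_off_rare hU dlt0.
apply: off_rare_imp (off_rare_and gram (tail _ _)) _.
  rewrite lerD2l ler_wpM2l // ler_wpM2r //.
    by rewrite invr_ge0 exprn_ge0 // divr_ge0 // mulr_ge0 // ltW.
  have gen (a x z : R) : 0 <= a -> 0 <= x -> x <= z -> (a * x) ^+ p <= (a * z) ^+ p.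
    move=> a0 x0 xz; have z0 := le_trans x0 xz.
    by rewrite lerXn2r ?nnegrE ?mulr_ge0 // ler_wpM2l.
  exact: gen (kron_const_ge0 kappa0) (frob_ge0 _) fW.
move=> w [h1 h2]; have ctd : 0 < ct - dlt by rewrite subr_gt0.
have ctd' : 0 < ct + dlt by rewrite addr_gt0 // (lt_trans dlt0).
apply/andP; split.
  apply: (eigval_sample_cov_ge pC pA hU AU jK Kn jN ctd) => v hv.
  by have /andP[] := h1 v hv.
apply: (eigval_sample_cov_le pC pA hU AU jK Kn jN ctd' (tau := 2 * b)) => [|v hv|x|x].
- by rewrite mulr_ge0 // ltW.
- by have /andP[] := h1 v hv.
- exact: qform_le_bound.
- by rewrite -W2; exact: h2.
Qed.

End FixedSize.

(** * Rates and modes of convergence *)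

Section Rates.
Variable R : realType.

(** For [k = 0] this tends to zero; for [k = 1] it is also summable, as the Borel-Cantelli
    lemma requires. *)
Definition rate (e : R) (k n : nat) : R := n%:R `^ (- e) / n%:R ^+ k.

Lemma rate_ge0 e k n : 0 <= rate e k n.
Proof. by rewrite divr_ge0 ?powR_ge0 // exprn_ge0. Qed.

Lemma rate_bounds (D nr v : R) k : 0 <= D -> 1 <= nr -> nr^-1 <= v -> v <= 1 ->
  (D / nr) ^+ k.+1 <= D ^+ k.+1 * (v / nr ^+ k) /\
  nr * (D * v / nr) ^+ k.+1 <= D ^+ k.+1 * (v / nr ^+ k).
Proof.
move=> D0 nr1 nrv v1; have nr0 : 0 < nr := lt_le_trans ltr01 nr1.
have v0 : 0 <= v by rewrite (le_trans _ nrv) // invr_ge0 ltW.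
split.
  rewrite exprMn ler_wpM2l ?exprn_ge0 // exprVn exprS invfM.
  by rewrite ler_wpM2r // invr_ge0 exprn_ge0 // ltW.
have -> : nr * (D * v / nr) ^+ k.+1 = D ^+ k.+1 * (v ^+ k.+1 / nr ^+ k).
  by rewrite !exprMn exprVn ![nr ^+ k.+1]exprS; field; rewrite ?expf_neq0 ?gt_eqF.
rewrite ler_wpM2l ?exprn_ge0 // ler_wpM2r ?invr_ge0 ?exprn_ge0 ?(ltW nr0) //.
by rewrite exprS ler_piMr // exprn_ile1.
Qed.

Lemma pow_ge_linear (x : R) t : 0 <= x -> 1 + t%:R * x <= (1 + x) ^+ t.
Proof.
move=> x0; elim: t => [|t IH]; first by rewrite mul0r addr0 expr0.
rewrite exprS; apply: le_trans (ler_wpM2l _ IH); last by rewrite addr_ge0.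
rewrite -natr1; have : 0 <= t%:R * (x * x) by rewrite !mulr_ge0.
by lra.
Qed.

(** Through [n ^ (a / 2)], which exceeds a multiple of [trunc_log 2 n] by the Bernoulli
    inequality. *)
Lemma log_small (a b : R) : 0 < a -> 0 < b ->
  \forall n \near \oo, (4 * (trunc_log 2 n).+1)%:R <= b * n%:R `^ a.
Proof.
move=> a0 b0; have a20 : 0 < a / 2 by rewrite divr_gt0.
pose x : R := 2 `^ (a / 2) - 1.
have x0 : 0 < x.
  have := gt0_ltr_powR a20 (_ : 1 \in Num.nneg) (_ : 2 \in Num.nneg) (_ : 1 < 2 :> R).
  by rewrite powR1 !nnegrE ltr1n subr_gt0; apply.
near=> n; have n0 : (0 < n)%N by near: n; exists 1%N.
have nR : 0 < n%:R :> R by rewrite ltr0n.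
set t := trunc_log 2 n; have tn : (2 ^ t <= n)%N by exact: trunc_logP.
have [u uE] : exists u : R, u = n%:R `^ (a / 2) by eexists.
have uu : n%:R `^ a = u * u.
  by rewrite uE -powRD ?(gt_eqF nR) ?implybT //; congr (_ `^ _); field.
have h1 : 1 + t%:R * x <= u.
  apply: le_trans (pow_ge_linear t (ltW x0)) _.
  rewrite /x addrCA subrr addr0 -powR_expn // uE.
  apply: ge0_ler_powR; rewrite ?nnegrE ?exprn_ge0 //; first exact: ltW.
  by rewrite -natrX ler_nat.
have h2 : 4 * (x^-1 + 1) / b <= u by rewrite uE; near: n; exact: powR_natr_unbounded.
have u0 : 0 < u by rewrite uE powR_gt0.
have u1 : 1 <= u by apply: le_trans h1; rewrite lerDl mulr_ge0 // ltW.
rewrite uu natrM -[t.+1]addn1 natrD; have tu : t%:R <= x^-1 * u.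
  by rewrite ler_pdivlMl // mulrC; move: h1; lra.
rewrite ler_pdivrMr // in h2.
apply: (@le_trans _ _ (4 * (x^-1 + 1) * u)).
  have -> : 4 * (x^-1 + 1) * u = 4 * (x^-1 * u) + 4 * u by ring.
  by move: (x^-1 * u) tu => z tu; lra.
have h3 : 4 * (x^-1 + 1) <= b * u by rewrite [b * u]mulrC.
by rewrite mulrA; apply: ler_wpM2r h3; exact: ltW.
Unshelve. all: by end_near.
Qed.

(** Telescoping: each term is at most an increment of [- n ^ (- e)], up to the factor [e^-1]. *)
Lemma sum_rate (e : R) m : 0 < e -> \sum_(n < m) rate e 1 n <= 1 + e^-1.
Proof.
move=> e0; have ei : 0 < e^-1 by rewrite invr_gt0.
have tele (k : nat) : (0 < k)%N -> rate e 1 k.+1 <= e^-1 * (k%:R `^ (- e) - k.+1%:R `^ (- e)).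
  move=> k0; have kR : 0 < k%:R :> R by rewrite ltr0n.
  have k1 : 0 < k.+1%:R :> R by rewrite ltr0n.
  pose y : R := k%:R / k.+1%:R; have y0 : 0 < y by rewrite divr_gt0.
  have -> : k%:R `^ (- e) = y `^ (- e) * k.+1%:R `^ (- e).
    by rewrite -powRM ?(ltW y0) // divfK // gt_eqF.
  have h : 1 + e / k.+1%:R <= y `^ (- e).
    rewrite /powR gt_eqF //; apply: le_trans (expR_ge1Dx _).
    rewrite lerD2l mulNr -mulrN ler_wpM2l ?(ltW e0) //.
    have lny : ln y <= y - 1.
      by have := expR_ge1Dx (ln y); rewrite lnK ?posrE //; lra.
    have -> : k.+1%:R^-1 = 1 - y.
      by rewrite /y -[k.+1]addn1 natrD; field; rewrite -natr1 in k1; rewrite gt_eqF.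
    lra.
  set z := k.+1%:R `^ (- e); have z0 : 0 <= z by exact: powR_ge0.
  rewrite /rate expr1 -/z; have -> : y `^ (- e) * z - z = (y `^ (- e) - 1) * z by ring.
  have h2 : e / k.+1%:R <= y `^ (- e) - 1 by rewrite lerBrDl.
  rewrite mulrA; apply: (@le_trans _ _ (e^-1 * (e / k.+1%:R) * z)).
    by rewrite mulKf ?gt_eqF // mulrC.
  by rewrite ler_wpM2r // ler_wpM2l // ltW.
have main k : \sum_(n < k.+2) rate e 1 n <= 1 + e^-1 * (1 - k.+1%:R `^ (- e)).
  elim: k => [|k IH].
    rewrite !big_ord_recr big_ord0 /= /rate invr0 mulr0 !add0r powR1 expr1 divr1.
    by rewrite subrr mulr0 addr0.
  rewrite big_ord_recr /=; apply: le_trans (lerD IH (tele _ (ltn0Sn k))) _.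
  by rewrite -addrA -mulrDr addrA subrK.
apply: (@le_trans _ _ (\sum_(n < m.+2) rate e 1 n)).
  by rewrite !big_ord_recr /= -addrA lerDl addr_ge0 // rate_ge0.
by apply: le_trans (main m) _; rewrite lerD2l ler_piMr ?(ltW ei) // lerBlDr lerDl powR_ge0.
Qed.

End Rates.

Section Convergence.
Variables (R : realType) (d : measure_display) (T : measurableType d) (P : probability T R).

Lemma off_rare_prob (Q : T -> Prop) (E : set T) x : measurable E -> off_rare P Q x ->
  (forall w, Q w -> ~ E w) -> (P E <= x%:E)%E.
Proof.
move=> mE [B mB [PB hB]] QE; apply: le_trans PB; apply: le_measure; rewrite ?inE // => w Ew.
by apply: contrapT => /hB /QE.
Qed.

Lemma ereal_cvg0 (u : nat -> \bar R) : (forall n, (0 <= u n)%E) ->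
  (forall e : R, 0 < e -> \forall n \near \oo, (u n <= e%:E)%E) -> u n @[n --> \oo] --> 0%E.
Proof.
move=> u0 hu; apply/fine_cvgP; split.
  apply: filterS (hu 1 ltr01) => n un; rewrite ge0_fin_numE //; exact: le_lt_trans un (ltry _).
apply/cvgrPdist_le => e e0; apply: filterS (hu e e0) => n un.
rewrite /= sub0r normrN ger0_norm; last exact: fine_ge0.
rewrite -lee_fin fineK // ge0_fin_numE //; exact: le_lt_trans un (ltry _).
Qed.

Lemma borel_cantelli (E : nat -> set T) (u : nat -> R) B : (forall n, measurable (E n)) ->
  (forall n, 0 <= u n) -> (forall m, \sum_(n < m) u n <= B) ->
  (\forall n \near \oo, (P (E n) <= (u n)%:E)%E) ->
  {ae P, forall w, \forall n \near \oo, ~ E n w}.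
Proof.
move=> mE u0 uB [n0 _ hn0]; pose F n := if (n < n0)%N then set0 else E n.
have mF n : measurable (F n) by rewrite /F; case: ifP.
have PF n : (P (F n) <= (u n)%:E)%E.
  by rewrite /F; case: ltnP => [_|h]; [rewrite measure0 lee_fin|exact: hn0].
have hF : P (lim_sup_set F) = 0%E.
  apply: lim_sup_set_cvg0 => //; apply: (@le_lt_trans _ _ B%:E); last exact: ltry.
  apply: lime_le; first by apply: is_cvg_nneseries => n _ _; exact: measure_ge0.
  apply: nearW => m; apply: (@le_trans _ _ (\sum_(0 <= n < m) (u n)%:E)%E).
    by apply: lee_sum => n _; exact: PF.
  by rewrite sumEFin lee_fin big_mkord.
have mL : measurable (lim_sup_set F).
  by apply: bigcap_measurableType => k _; apply: bigcup_measurable => n _.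
exists (lim_sup_set F); split=> // w /= hw; apply: contrapT => nL; apply: hw.
have [k hk] : exists k, ~ (\bigcup_(n >= k) F n) w.
  by apply: contrapT => /forallNP h; apply: nL => k _; apply: contrapT; exact: h.
exists (maxn k n0) => // n /=; rewrite geq_max => /andP[kn n0n] En.
by apply: hk; exists n => //; rewrite /F ltnNge n0n.
Qed.

Lemma cvg_in_prob_off_rare (X : nat -> T -> R) c : (forall n, measurable_fun setT (X n)) ->
  (forall e, 0 < e -> exists a D : R, 0 < a /\
     \forall n \near \oo, off_rare P (fun w => `|X n w - c| < e) (D * rate a 0 n)) ->
  cvg_in_prob P X c.
Proof.
move=> mX hX e e0; have [a [D [a0 h]]] := hX e e0.
apply: ereal_cvg0 => [n|e' e'0]; first exact: measure_ge0.
near=> n; have n0 : 0 < n%:R :> R by rewrite ltr0n; near: n; exists 1%N.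
have hr : off_rare P (fun w => `|X n w - c| < e) (D * rate a 0 n) by near: n.
apply: (@le_trans _ _ (D * rate a 0 n)%:E).
  apply: off_rare_prob hr _ => [|w /= lt le]; last by rewrite leNgt lt in le.
  rewrite -[X in measurable X]setTI; apply: measurable_fun_le => //.
  by apply: measurableT_comp => //; exact: measurable_funB.
rewrite lee_fin /rate expr0 divr1 powRN ler_pdivrMr ?powR_gt0 // mulrC -ler_pdivrMr //.
by near: n; exact: powR_natr_unbounded.
Unshelve. all: by end_near.
Qed.

Lemma cvg_as_off_rare (X : nat -> T -> R) c : (forall n, measurable_fun setT (X n)) ->
  (forall e, 0 < e -> exists a D : R, 0 < a /\
     \forall n \near \oo, off_rare P (fun w => `|X n w - c| < e) (D * rate a 1 n)) ->
  cvg_as P X c.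
Proof.
move=> mX hX.
have h k : {ae P, forall w, \forall n \near \oo, ~ (k.+1%:R^-1 <= `|X n w - c|)}.
  have k0 : 0 < k.+1%:R^-1 :> R by rewrite invr_gt0.
  have [a [D [a0 hr]]] := hX _ k0.
  have D0 : 0 <= Num.max D 0 by rewrite le_max lexx orbT.
  have mE n : measurable [set w | k.+1%:R^-1 <= `|X n w - c|].
    rewrite -[X in measurable X]setTI; apply: measurable_fun_le => //.
    by apply: measurableT_comp => //; exact: measurable_funB.
  apply: (borel_cantelli (E := fun n => [set w | k.+1%:R^-1 <= `|X n w - c|])
    (u := fun n => Num.max D 0 * rate a 1 n) (B := Num.max D 0 * (1 + a^-1))) => //.
  - by move=> n; rewrite mulr_ge0 ?rate_ge0.
  - by move=> m; rewrite -mulr_sumr ler_wpM2l // sum_rate.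
  apply: filterS hr => n hn; apply: (@le_trans _ _ (D * rate a 1 n)%:E).
    by apply: off_rare_prob (mE n) hn _ => w /= lt le; rewrite leNgt lt in le.
  by rewrite lee_fin ler_wpM2r ?rate_ge0 // le_max lexx.
have := ae_foralln h; apply: filterS => w hw.
apply/cvgrPdist_le => e e0; have [k hk] : exists k : nat, e^-1 < k.+1%:R by eexists; exact: truncnS_gt.
apply: filterS (hw k) => n /negP; rewrite -ltNge distrC => /ltW hlt.
apply: le_trans hlt _; rewrite -[leRHS]invrK lef_pV2 ?posrE ?invr_gt0 //; exact: ltW.
Qed.

End Convergence.

Section EntryMoments.
Variables (R : realType) (d : measure_display) (T : measurableType d) (P : probability T R).
Local Notation Re := complex.Re.
Local Notation Im := complex.Im.

(** The three centred variables are dominated, to the power [2 p], by [|X| ^ (4 p)] up to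
    constants: this is where four moments give [p = 1] and eight moments give [p = 2]. *)
Lemma entry_moments (X : T -> R[i]) p m : complex_rv X -> (0 < p)%N -> cexp_eq0 P X ->
  abs_moment P 2 X = 1%E -> abs_moment P (2 * p.*2) X = m%:E ->
  [/\ \int[P]_w Re (X w) = 0, \int[P]_w Im (X w) = 0,
      \int[P]_w (Re (X w) ^+ 2 + Im (X w) ^+ 2 - 1) = 0 &
  [/\ moment_le P p (fun w => Re (X w)) (4 ^+ p * (m + 1)),
      moment_le P p (fun w => Im (X w)) (4 ^+ p * (m + 1)) &
      moment_le P p (fun w => Re (X w) ^+ 2 + Im (X w) ^+ 2 - 1) (4 ^+ p * (m + 1))]].
Proof.
move=> mX p0 [E1 E2] A2 Ap; have [mr mi] := complex_rv_cmeasurable mX.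
pose Q w := Re (X w) ^+ 2 + Im (X w) ^+ 2.
have Q0 w : 0 <= Q w by rewrite addr_ge0 // sqr_ge0.
have mQ : measurable_fun setT Q by apply: measurable_funD; exact: measurable_funX.
have QE w : cabs (X w) ^+ 2 = Q w by exact: cabs_sqr.
have I2 : (\int[P]_w (Q w)%:E = 1)%E.
  by rewrite -A2 /abs_moment unlock; apply: eq_integral => w _; rewrite -QE.
have Ip : (\int[P]_w (Q w ^+ p.*2)%:E = m%:E)%E.
  by rewrite -Ap /abs_moment unlock; apply: eq_integral => w _; rewrite -QE -exprM.
have iQp : Pint P (fun w => Q w ^+ p.*2).
  apply/integrableP; split; first by apply/measurable_EFinP; exact: measurable_funX.
  rewrite (_ : (\int[P]_w _ = m%:E)%E) ?ltry // -Ip; apply: eq_integral => w _.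
  by rewrite /= ger0_norm // exprn_ge0.
have iQ : Pint P Q.
  apply/integrableP; split; first exact/measurable_EFinP.
  rewrite (_ : (\int[P]_w _ = 1%:E)%E) ?ltry // -I2; apply: eq_integral => w _.
  by rewrite /= ger0_norm.
have Qm : \int[P]_w (Q w ^+ p.*2) = m by rewrite /Rintegral Ip.
have m0 : 0 <= m by rewrite -Qm; apply: Rintegral_ge0 => w _; rewrite exprn_ge0.
have cst1 (a : R) : \int[P]_w a = a.
  have -> : \int[P]_w a = a * fine (P setT) by exact: Rintegral_cst.
  by rewrite probability_setT mulr1.
pose kap := 4 ^+ p * (m + 1).
have kap1 : 1 <= kap.
  by rewrite -[1]mulr1; apply: ler_pM => //; [rewrite exprn_ege1 // ler1n|rewrite lerDr].
have kapp : kap <= kap ^+ p.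
  case: (p) p0 => // p' _; rewrite exprS ler_peMr ?(le_trans ler01) // exprn_ege1 //.
have Qle w : Q w ^+ p <= Q w ^+ p.*2 + 1.
  rewrite -muln2 exprM; have := sqr_ge0 (Q w ^+ p - 1); have : 0 <= Q w ^+ p by rewrite exprn_ge0.
  by nra.
have dom (f : T -> R) : measurable_fun setT f -> (forall w, f w ^+ p.*2 <= 4 ^+ p * (Q w ^+ p.*2 + 1)) ->
    moment_le P p f kap.
  move=> mf hf; have i1 : Pint P (fun w => 4 ^+ p * (Q w ^+ p.*2 + 1)).
    by apply: PintZ; apply: PintD => //; exact: Pint_cst.
  have f0 w : 0 <= f w ^+ p.*2 by rewrite -mul2n exprM exprn_ge0 // sqr_ge0.
  have i2 : Pint P (fun w => f w ^+ p.*2).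
    by apply: Pint_le i1 => [|w]; [exact: measurable_funX|rewrite ger0_norm].
  split=> //; first exact: le_trans ler01 kap1.
  apply: le_trans kapp; apply: le_trans (le_Rintegral measurableT i2 i1 (fun w _ => hf w)) _.
  have i3 := Pint_cst P 1; rewrite RintegralZl //; last by apply: PintD.
  by rewrite RintegralD // Qm cst1.
have small w (x : R) : x ^+ 2 <= Q w -> x ^+ p.*2 <= 4 ^+ p * (Q w ^+ p.*2 + 1).
  move=> xQ; rewrite -{1}mul2n exprM; apply: (@le_trans _ _ (Q w ^+ p)).
    by rewrite lerXn2r ?nnegrE ?sqr_ge0.
  apply: le_trans (Qle w) _; rewrite ler_peMl ?addr_ge0 ?exprn_ge0 //.
  by rewrite exprn_ege1 // ler1n.
split.
- by rewrite /Rintegral; move: E1; rewrite unlock => ->.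
- by rewrite /Rintegral; move: E2; rewrite unlock => ->.
- have i1 := Pint_cst P 1; rewrite RintegralB // cst1; apply/eqP; rewrite subr_eq0; apply/eqP.
  by rewrite /Rintegral I2.
split.
- by apply: dom => // w; apply: small; rewrite lerDl sqr_ge0.
- by apply: dom => // w; apply: small; rewrite lerDr sqr_ge0.
apply: dom => [|w]; first exact: measurable_funB.
have -> : Re (X w) ^+ 2 + Im (X w) ^+ 2 - 1 = Q w - 1 by [].
have [Q1|/ltW Q1] := leP (Q w) 1.
  have h : (Q w - 1) ^+ 2 <= 1 by have := Q0 w; nra.
  rewrite -{1}mul2n exprM; apply: (@le_trans _ _ 1); first by rewrite exprn_ile1 // sqr_ge0.
  rewrite -[leLHS]mulr1; apply: ler_pM => //; first by rewrite exprn_ege1 // ler1n.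
  by rewrite lerDr exprn_ge0.
apply: (@le_trans _ _ (Q w ^+ p.*2)).
  by rewrite lerXn2r ?nnegrE ?subr_ge0 // lerBlDr lerDl.
apply: (@le_trans _ _ (Q w ^+ p.*2 + 1)); first by rewrite lerDl.
by rewrite ler_peMl ?addr_ge0 ?exprn_ge0 // exprn_ege1 // ler1n.
Qed.

End EntryMoments.

(** * Passage to the limit *)

Lemma trace_toeplitz (R : realType) (gamma : int -> R[i]) n : psdmx (toeplitz gamma n) ->
  \sum_(k < n) eigval k.+1 (toeplitz gamma n) = n%:R * complex.Re (gamma 0).
Proof.
move=> pT; have := congr1 (@complex.Re R) (trace_pow 1 pT.1).
have -> : \tr (toeplitz gamma n ^+ 1) = gamma 0 *+ n.
  by rewrite expr1 /mxtrace (eq_bigr (fun=> gamma 0)) ?sumr_const ?card_ord // => i _; rewrite mxE subrr.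
rewrite raddfMn /= => h; rewrite mulr_natl h; by apply: eq_bigr => i _; rewrite expr1.
Qed.

Section Limit.
Variable R : realType.

Let window_close (c ct dlt eps y : R) : 0 < dlt -> dlt <= eps / 8 -> - dlt <= c - ct -> c - ct <= dlt ->
  ct - dlt <= y -> y <= ct + dlt + dlt -> `|y - c| < eps.
Proof. by move=> h1 h2 h3 h4 h5 h6; rewrite ltr_norml; apply/andP; split; lra. Qed.

(** Here [Nr] and [nr] stand for the two dimensions, [s] is the scale of the spikes and [s / x] the
    truncation level of the rows. The first term is a power of [1 / n]; the third is,
    up to the factor [Nr], a power of [x ^ 2 / (nr s)], which is at most [1 / (nr x ^ 2)]
    since [x ^ 4 <= s]. *)
Lemma tail_rate k K (kc M dlt beta g0 r : R) : (k <= 1)%N -> 0 <= kc -> 0 < dlt -> 0 < beta ->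
  0 <= g0 -> 0 < r -> (0 < K)%N ->
  exists D : R, forall (nr Nr s x : R) q, 1 <= nr -> 1 <= x -> x ^+ 2 <= nr -> x ^+ 4 <= s ->
    r / 2 * nr <= Nr -> Nr <= 2 * r * nr -> nr ^+ 4 <= 2 ^+ q ->
  (3 * K ^ 2)%:R * ((kc * (Nr * M ^+ 2 * 16)) ^+ k.+1 / (dlt * Nr / (3 * K%:R)) ^+ k.+1.*2)
   + (nr / 2 ^+ q + Nr * ((kc * (beta * s * (nr * g0))) ^+ k.+1 / (Nr * (s / x) / 2) ^+ k.+1.*2))
  <= D * ((x ^+ 2)^-1 / nr ^+ k).
Proof.
move=> k1 kc0 dlt0 beta0 g00 r0 K0; have KR : 0 < K%:R :> R by rewrite ltr0n.
pose D1 := kc * M ^+ 2 * 16 * (3 * K%:R / dlt) ^+ 2 * (2 / r).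
pose D3 := kc * beta * g0 * 16 / r ^+ 2.
exists ((3 * K ^ 2)%:R * D1 ^+ k.+1 + (1 + 2 * r * D3 ^+ k.+1)).
move=> nr Nr s x q n1 x1 x2 x4 N1 N2 nq.
have x0 : 0 < x := lt_le_trans ltr01 x1; have n0 : 0 < nr := lt_le_trans ltr01 n1.
have N0 : 0 < Nr by apply: lt_le_trans N1; rewrite mulr_gt0 // divr_gt0.
have s0 : 0 < s by apply: lt_le_trans x4; rewrite exprn_gt0.
have pw (u y : R) : u ^+ k.+1 / y ^+ k.+1.*2 = (u / y ^+ 2) ^+ k.+1.
  by rewrite expr_div_n -exprM mul2n.
have [v vE] : exists v, v = (x ^+ 2)^-1 by eexists.
rewrite -vE; have v0 : 0 < v by rewrite vE invr_gt0 exprn_gt0.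
have v1 : v <= 1 by rewrite vE invf_le1 ?exprn_gt0 // exprn_ege1.
have nv : nr^-1 <= v by rewrite vE lef_pV2 ?posrE ?exprn_gt0.
have iN : Nr^-1 <= 2 / r / nr.
  have -> : 2 / r / nr = (r / 2 * nr)^-1 by field; rewrite !gt_eqF.
  by rewrite lef_pV2 ?posrE // mulr_gt0 // divr_gt0.
have i2 : 0 <= 2 / r / nr by rewrite !divr_ge0 // ltW.
have M2 : 0 <= M ^+ 2 by exact: sqr_ge0.
have E10 : 0 <= kc * M ^+ 2 * 16 * (3 * K%:R / dlt) ^+ 2.
  by apply: mulr_ge0 (sqr_ge0 _); apply: mulr_ge0 => //; exact: mulr_ge0.
have D10 : 0 <= D1 by rewrite /D1 mulr_ge0 // divr_ge0 // ltW.
have D30 : 0 <= D3 by rewrite /D3 divr_ge0 ?exprn_ge0 ?(ltW r0) // !mulr_ge0 // ltW.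
have [B1 _] := rate_bounds k D10 n1 nv v1; have [_ B3] := rate_bounds k D30 n1 nv v1.
rewrite [leRHS]mulrDl; apply: lerD.
  rewrite pw -[leRHS]mulrA; apply: ler_wpM2l => //; apply: le_trans B1.
  have -> : kc * (Nr * M ^+ 2 * 16) / (dlt * Nr / (3 * K%:R)) ^+ 2 =
      kc * M ^+ 2 * 16 * (3 * K%:R / dlt) ^+ 2 * Nr^-1 by field; rewrite !gt_eqF.
  have -> : D1 / nr = kc * M ^+ 2 * 16 * (3 * K%:R / dlt) ^+ 2 * (2 / r / nr) by rewrite /D1 !mulrA.
  move: (kc * M ^+ 2 * 16 * _) E10 => E E0.
  by apply: lerXn2r; rewrite ?nnegrE;
    [apply: mulr_ge0 => //; rewrite invr_ge0 ltW|exact: mulr_ge0|exact: ler_wpM2l].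
rewrite [leRHS]mulrDl mul1r; apply: lerD.
  have i1 : nr^-1 <= 1 by rewrite invf_le1.
  have i0 : 0 <= nr^-1 by rewrite invr_ge0 ltW.
  have hk : nr^-1 * nr^-1 <= (nr ^+ k)^-1.
    case: (k) k1 => [|[|]] // _; first by rewrite expr0 invr1 mulr_ile1.
    by rewrite expr1 ler_piMr.
  apply: (@le_trans _ _ (nr / nr ^+ 4)).
    by rewrite ler_wpM2l ?(ltW n0) // lef_pV2 ?posrE ?exprn_gt0.
  have -> : nr / nr ^+ 4 = nr^-1 * (nr^-1 * nr^-1) by field; rewrite gt_eqF.
  by apply: ler_pM => //; exact: mulr_ge0.
apply: (@le_trans _ _ (2 * r * (nr * (D3 * v / nr) ^+ k.+1))); last first.
  by rewrite -(mulrA (2 * r)); apply: ler_wpM2l B3; rewrite mulr_ge0 // ltW.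
rewrite pw (mulrA (2 * r)).
have A0 : 0 <= 4 * kc * beta * g0 * nr by rewrite !mulr_ge0 // ltW.
have xs0 : 0 <= x ^+ 2 / s by rewrite divr_ge0 ?sqr_ge0 // ltW.
have xs : x ^+ 2 / s <= v.
  rewrite ler_pdivrMr //; apply: le_trans (ler_wpM2l (ltW v0) x4).
  by rewrite vE (exprD x 2 2) mulKf // gt_eqF // exprn_gt0.
have L : kc * (beta * s * (nr * g0)) / (Nr * (s / x) / 2) ^+ 2 =
    4 * kc * beta * g0 * nr * (Nr^-1 ^+ 2 * (x ^+ 2 / s)) by field; rewrite !gt_eqF.
have Rr : D3 * v / nr = 4 * kc * beta * g0 * nr * ((2 / r / nr) ^+ 2 * v).
  by rewrite /D3; field; rewrite !gt_eqF.
have N20 : 0 <= Nr^-1 ^+ 2 by exact: sqr_ge0.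
have iN0 : 0 <= Nr^-1 by rewrite invr_ge0 ltW.
rewrite L Rr; apply: ler_pM => //; first exact: ltW.
  by rewrite exprn_ge0 // mulr_ge0 // mulr_ge0.
apply: lerXn2r; rewrite ?nnegrE; first by rewrite mulr_ge0 // mulr_ge0.
  by rewrite mulr_ge0 // mulr_ge0 ?sqr_ge0 // ltW.
apply: ler_wpM2l => //; apply: ler_pM => //.
by apply: lerXn2r; rewrite ?nnegrE.
Qed.

Variables (d : measure_display) (T : measurableType d) (P : probability T R).
Variables (gamma : int -> R[i]) (N : nat -> nat) (r : R) (C : forall n, 'M[R[i]]_(N n)).
Variables (nu : probability (measurableTypeR R) R) (Z : forall n, T -> 'M[R[i]]_(N n, n)).
Variables (k : nat) (kap : R).
Hypothesis pT : forall n, psdmx (toeplitz gamma n).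
Hypothesis spk : spiked gamma.
Hypothesis r0 : 0 < r.
Hypothesis hN : (N n)%:R / n%:R @[n --> \oo] --> r.
Hypothesis pC : forall n, psdmx (C n).
Hypothesis bC : exists M : R, forall n, spectral_norm (C n) <= M.
Hypothesis hnu : weak_cvg (fun n => esd (C n)) nu.
Hypothesis hnu0 : ~ (forall A : set (measurableTypeR R), measurable A -> nu A = dirac (0 : R) A).
Hypothesis mZ : forall n i j, complex_rv (fun w => Z n w i j).
Hypothesis indZ : forall n, mutually_independent P (fun (ij : 'I_(N n) * 'I_n) w => Z n w ij.1 ij.2).
Hypothesis k1 : (k <= 1)%N.
Hypothesis kap0 : 0 <= kap.
Hypothesis mom : forall n i j,
  [/\ \int[P]_w complex.Re (Z n w i j) = 0, \int[P]_w complex.Im (Z n w i j) = 0,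
      \int[P]_w (complex.Re (Z n w i j) ^+ 2 + complex.Im (Z n w i j) ^+ 2 - 1) = 0 &
  [/\ moment_le P k.+1 (fun w => complex.Re (Z n w i j)) kap,
      moment_le P k.+1 (fun w => complex.Im (Z n w i j)) kap &
      moment_le P k.+1 (fun w => complex.Re (Z n w i j) ^+ 2 + complex.Im (Z n w i j) ^+ 2 - 1) kap]].

(** Taking [K] large makes the eigenvalues beyond [K] negligible on the scale of the [j]-th
    one, and the truncation level a small negative power of [n] times that scale leaves
    room for a logarithmic number of factors in the Chernoff bound. *)
Lemma ratio_off_rare j eps : 0 < eps -> exists a D : R, 0 < a /\
  \forall n \near \oo, off_rare P
    (fun w => `|eigval j.+1 (sample_cov (C n) (Z n w) (toeplitz gamma n))
                / eigval j.+1 (toeplitz gamma n) - \int[nu]_x x| < eps) (D * rate a k n).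
Proof.
move=> eps0; have [s [e [e0 sA sB sC]]] := spk.
have [M [M0 eigM]] : exists M : R, 0 < M /\ forall n l, (l < N n)%N -> eigval l.+1 (C n) <= M.
  have [B hB] := bC; exists (Num.max B 1); split; first by rewrite lt_max ltr01 orbT.
  by move=> n l ln; rewrite le_max (le_trans (eigval_le_spectral_norm (pC n) ln)).
have eC n l : 0 <= eigval l (C n) by exact: eigval_ge0.
have ctc := mean_eigval_cvg (ltW M0) eC eigM hnu.
have c0 := limit_mean_gt0 (ltW M0) eC eigM hnu hnu0.
move: (\int[nu]_x x) c0 ctc => c c0 ctc.
have [cj cj0 hcj] := sA j.
have [dlt [dlt0 dlt1 dlt2]] : exists dlt : R, [/\ 0 < dlt, dlt <= eps / 8 & dlt <= c / 4].
  exists (Num.min (eps / 8) (c / 4)); split; last 2 first.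
  - by rewrite ge_min lexx.
  - by rewrite ge_min lexx orbT.
  by rewrite lt_min !divr_gt0.
(* The part of the Toeplitz matrix beyond [K] then costs at most [dlt] times the [j]-th eigenvalue. *)
have [beta [beta0 betaE]] : exists beta : R, 0 < beta /\ M * (4 * beta) = dlt * cj.
  exists (dlt * cj / (4 * M)); split; first by rewrite divr_gt0 ?mulr_gt0.
  by field; rewrite gt_eqF.
have [q0 hq0] := sB beta beta0; pose K := (maxn q0 j).+1.
(* With [x = n ^ a] these give [x ^ 4 <= n ^ e] and [x ^ 2 <= n]. *)
have [a [a0 a4e a41]] : exists a : R, [/\ 0 < a, a * 4 <= e & a * 2 <= 1].
  exists (Num.min e 1 / 4); have h : 0 < Num.min e 1 by rewrite lt_min e0 ltr01.
  have h1 : Num.min e 1 <= e by rewrite ge_min lexx.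
  have h2 : Num.min e 1 <= 1 by rewrite ge_min lexx orbT.
  by move: (Num.min e 1) h h1 h2 => z h h1 h2; split; lra.
have [g0 g0E] : exists g, g = complex.Re (gamma 0) by eexists.
have g00 : 0 <= g0.
  have := trace_toeplitz (pT 1); rewrite -g0E mul1r => <-.
  by apply: sumr_ge0 => i _; exact: eigval_ge0.
have [D hD] := tail_rate M k1 (kron_const_ge0 kap0) dlt0 beta0 g00 r0 (ltn0Sn (maxn q0 j)).
exists (2 * a), D; split; first by rewrite mulr_gt0.
have NN : \forall n \near \oo, r / 2 * n%:R <= (N n)%:R /\ (N n)%:R <= 2 * r * n%:R.
  have r20 : 0 < r / 2 by rewrite divr_gt0.
  near=> n; have n0 : 0 < n%:R :> R by rewrite ltr0n; near: n; exists 1%N.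
  have [y yE] : exists y, y = (N n)%:R / n%:R :> R by eexists.
  have : `|r - y| <= r / 2 by rewrite yE; near: n; move/cvgrPdist_le: hN; exact.
  have -> : (N n)%:R = y * n%:R :> R by rewrite yE divfK // gt_eqF.
  rewrite ler_norml => /andP[h1 h2].
  by split; rewrite ler_wpM2r ?(ltW n0) //; lra.
near=> n; have n0 : (0 < n)%N by near: n; exists 1%N.
have nR : 1 <= n%:R :> R by rewrite ler1n.
have n0R : 0 < n%:R :> R by rewrite ltr0n.
have [x xE] : exists x, x = n%:R `^ a by eexists.
have x1 : 1 <= x by rewrite xE -[leLHS](powRr0 n%:R) ler_powR // ltW.
have x0 : 0 < x := lt_le_trans ltr01 x1.
have xm m : x ^+ m = n%:R `^ (a * m%:R) by rewrite xE -powR_mulrn ?powR_ge0 // -powRrM.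
have x2 : x ^+ 2 <= n%:R by rewrite xm -[leRHS]powRr1 ?ler_powR // ltW.
have hs : n%:R `^ e <= s n by near: n.
have x4 : x ^+ 4 <= s n by apply: le_trans hs; rewrite xm ler_powR.
have s0 : 0 < s n by apply: lt_le_trans hs; exact: powR_gt0.
have hc : cj * s n <= eigval j.+1 (toeplitz gamma n) by near: n.
have hq : eigval q0.+1 (toeplitz gamma n) <= beta * s n by near: n.
have [N1 N2] : r / 2 * n%:R <= (N n)%:R /\ (N n)%:R <= 2 * r * n%:R by near: n.
have hct : `|c - (N n)%:R^-1 * \sum_(l < N n) eigval l.+1 (C n)| <= dlt.
  by near: n; move/cvgrPdist_le: ctc; exact.
have hlog : (4 * (trunc_log 2 n).+1)%:R <= beta * x by rewrite xE; near: n; exact: log_small.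
have hx : 4 * g0 / r <= x by rewrite xE; near: n; exact: powR_natr_unbounded.
have Kn : (K <= n)%N by near: n; exists K.
have jN : (j < N n)%N.
  have h : j.+1%:R * 2 / r <= n%:R `^ 1 by near: n; exact: powR_natr_unbounded.
  rewrite powRr1 ?(ltW n0R) // ler_pdivrMr // in h.
  by rewrite -(ler_nat R); apply: le_trans N1; move: h; lra.
have N0 : (0 < N n)%N by exact: leq_ltn_trans jN.
have jK : (j < K)%N by rewrite ltnS leq_maxr.
(* Four logarithms, so that [2 ^ q] beats [n ^ 4]. *)
pose q := (4 * (trunc_log 2 n).+1)%N.
have l0 : 0 < s n / x by exact: divr_gt0.
have [t tE] : exists t, t = s n by eexists.
have Lam0 : 0 <= beta * s n by rewrite mulr_ge0 // ltW.
have b0 : 0 < 2 * beta * s n by rewrite !mulr_gt0.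
have eigA l : (K <= l < n)%N -> eigval l.+1 (toeplitz gamma n) <= beta * s n.
  move=> /andP[Kl ln]; apply: le_trans hq; apply: eigval_noninc; rewrite ln andbT.
  by apply: leq_trans Kl; rewrite leqW // leq_maxl.
have trA : \sum_(l < n) eigval l.+1 (toeplitz gamma n) <= n%:R * g0 by rewrite trace_toeplitz // g0E.
have sx : x <= s n / x.
  rewrite ler_pdivlMr //; apply: le_trans x4; rewrite -expr2 -[4%N]/(2 + 2)%N exprD.
  by rewrite ler_peMr ?sqr_ge0 // exprn_ege1.
have trl : n%:R * g0 <= (N n)%:R * (s n / x) / 2.
  apply: (@le_trans _ _ (r / 2 * n%:R * x / 2)).
    have -> : r / 2 * n%:R * x / 2 = n%:R * (x * r / 4) by field.
    by rewrite ler_wpM2l ?(ltW n0R) //; move: hx; rewrite ler_pdivrMr //; lra.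
  rewrite ler_wpM2r ?invr_ge0 //; apply: ler_pM => //; last exact: ltW.
  by rewrite mulr_ge0 ?(ltW n0R) // divr_ge0 // ltW.
have Lamb : beta * s n + q%:R * (s n / x) <= 2 * beta * s n.
  have h : q%:R * (s n / x) <= beta * x * (s n / x) by rewrite ler_wpM2r // ltW.
  have h' : beta * x * (s n / x) = beta * s n by field; rewrite gt_eqF.
  by move: h; rewrite h'; move: (q%:R * (s n / x)) (s n) => y z; lra.
have nq : n%:R ^+ 4 <= 2 ^+ q :> R.
  by rewrite -!natrX ler_nat /q mulnC expnM leq_exp2r // ltnW // trunc_log_ltn.
have p12 : k.+1 = 1%N \/ k.+1 = 2%N by case: (k) k1 => [|[|]] // _; [left|right].
have dct : dlt < (N n)%:R^-1 * \sum_(l < N n) eigval l.+1 (C n).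
  by move: hct; rewrite ler_norml => /andP[h1 h2]; move: h1 h2; set ct := _^-1 * _; lra.
have R0 (ij : 'I_(N n) * 'I_n) : \int[P]_w complex.Re (Z n w ij.1 ij.2) = 0.
  by have [] := mom ij.1 ij.2.
have I0 (ij : 'I_(N n) * 'I_n) : \int[P]_w complex.Im (Z n w ij.1 ij.2) = 0.
  by have [] := mom ij.1 ij.2.
have S0 (ij : 'I_(N n) * 'I_n) :
    \int[P]_w (complex.Re (Z n w ij.1 ij.2) ^+ 2 + complex.Im (Z n w ij.1 ij.2) ^+ 2 - 1) = 0.
  by have [] := mom ij.1 ij.2.
have mR (ij : 'I_(N n) * 'I_n) : moment_le P k.+1 (fun w => complex.Re (Z n w ij.1 ij.2)) kap.
  by have [_ _ _ []] := mom ij.1 ij.2.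
have mI (ij : 'I_(N n) * 'I_n) : moment_le P k.+1 (fun w => complex.Im (Z n w ij.1 ij.2)) kap.
  by have [_ _ _ []] := mom ij.1 ij.2.
have mS (ij : 'I_(N n) * 'I_n) : moment_le P k.+1
    (fun w => complex.Re (Z n w ij.1 ij.2) ^+ 2 + complex.Im (Z n w ij.1 ij.2) ^+ 2 - 1) kap.
  by have [_ _ _ []] := mom ij.1 ij.2.
have main := @eigval_sample_cov_off_rare R d T P (N n) n (Z n) k.+1 kap
  (fun ij => mZ ij.1 ij.2) (@indZ n) p12 R0 I0 S0 mR mI mS kap0 (C n) M K (pC n) (eigM n) (ltW M0)
  N0 (ltn0Sn _) Kn (toeplitz gamma n) j q dlt (s n / x) (2 * beta * s n) (beta * s n) (n%:R * g0)
  (pT n) jK jN (ltn0Sn _) dlt0 dct l0 b0 Lam0 eigA trA trl Lamb.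
have rateE : rate (2 * a) k n = (x ^+ 2)^-1 / n%:R ^+ k by rewrite /rate powRN xm [2 * a]mulrC.
rewrite rateE; apply: off_rare_imp (off_rare_le (hD _ _ _ _ q nR x1 x2 x4 N1 N2 nq) main) _.
move=> w /andP[]; set mu := eigval _ (sample_cov _ _ _).
move: (eigval _ (toeplitz _ _)) hc => lam hc.
have lam0 : 0 < lam by apply: lt_le_trans hc; exact: mulr_gt0.
have -> : M * (2 * (2 * beta * s n)) = dlt * (cj * s n).
  by rewrite [RHS]mulrA -betaE; move: (s n) => z; ring.
move: (_^-1 * _) hct => ct; rewrite ler_norml => /andP[c1 c2] h1 h2.
have u1 : ct - dlt <= mu / lam by rewrite ler_pdivlMr.
have u2 : mu / lam <= ct + dlt + dlt.
  rewrite ler_pdivrMr //; apply: le_trans h2 _.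
  by rewrite [leRHS]mulrDl lerD2l ler_wpM2l // ltW.
exact: window_close dlt0 dlt1 c1 c2 u1 u2.
Unshelve. all: by end_near.
Qed.

End Limit.

(** * The theorem *)

Theorem corollary2p6 (R : realType)
  (d : measure_display) (Omega : measurableType d) (P : probability Omega R)
  (rho : R) (hrho : 0 < rho < 1)
  (gamma : int -> R[i])
  (hpsd : forall n, psdmx (toeplitz gamma n))
  (hgamma :
    (exists L1 : R -> R, [/\ locally_bounded L1, slowly_varying L1
       & long_memory_autocov rho gamma L1]) \/
    (exists L2 : R -> R, [/\ locally_bounded L2, slowly_varying L2
       & has_spectral_density gamma (long_memory_density rho L2)]))
  (N : nat -> nat) (r : R) (hr : 0 < r)
  (hN : (N n)%:R / n%:R @[n --> \oo] --> r)
  (C : forall n, 'M[R[i]]_(N n))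
  (hC : forall n, psdmx (C n))
  (hCbnd : exists M : R, forall n, spectral_norm (C n) <= M)
  (nuC : probability (measurableTypeR R) R)
  (hnuC : weak_cvg (fun n => esd (C n)) nuC)
  (hnuC0 : ~ (forall A : set (measurableTypeR R), measurable A ->
                nuC A = dirac (0 : R) A))
  (Z : forall n, Omega -> 'M[R[i]]_(N n, n))
  (hZrv : forall n i j, complex_rv (fun w => Z n w i j))
  (hZindep : forall n, mutually_independent P
     (fun (ij : 'I_(N n) * 'I_n) w => Z n w ij.1 ij.2))
  (hZlaw : forall n i j n' i' j',
     same_law P (fun w => Z n w i j) (fun w => Z n' w i' j'))
  (hZ1 : forall n i j, cexp_eq0 P (fun w => Z n w i j))
  (hZ2 : forall n i j, abs_moment P 2 (fun w => Z n w i j) = 1%E)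
  (hZ4 : forall n i j, (abs_moment P 4 (fun w => Z n w i j) < +oo)%E) :
  let ratio (j n : nat) (w : Omega) : R :=
    eigval j (sample_cov (C n) (Z n w) (toeplitz gamma n))
      / eigval j (toeplitz gamma n) in
  (forall j : nat, (1 <= j)%N -> cvg_in_prob P (ratio j) (\int[nuC]_x x)) /\
  ((forall n i k, std_real_gaussian P (fun w => Z n w i k)) \/
   (forall n i k, std_complex_gaussian P (fun w => Z n w i k)) ->
   forall j : nat, (1 <= j)%N -> cvg_as P (ratio j) (\int[nuC]_x x)).
Proof.
move=> ratio.
have spk : spiked gamma.
  case: hgamma => [[L [_ sL hL]]|[L [bL sL hL]]].
    exact: spiked_long_memory_autocov hL.
  exact: spiked_long_memory_density hL.
have mr j n : measurable_fun setT (ratio j.+1 n).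
  apply: measurable_funM; last exact: measurable_cst.
  by apply: measurable_eigval_sample_cov => // i l; exact: complex_rv_cmeasurable.
have main k : (k <= 1)%N ->
    (forall n i j, (abs_moment P (2 * k.+1.*2) (fun w => Z n w i j) < +oo)%E) ->
    forall j e, 0 < e -> exists a D : R, 0 < a /\ \forall n \near \oo, off_rare P
      (fun w => `|ratio j.+1 n w - \int[nuC]_x x| < e) (D * rate a k n).
  move=> k1 fin j e e0.
  have A0 n i l : (0 <= abs_moment P (2 * k.+1.*2) (fun w => Z n w i l))%E.
    rewrite /abs_moment unlock; apply: integral_ge0 => w _.
    rewrite lee_fin exprn_ge0 //; exact: cabs_ge0.
  (* One entry determines the moments of all; without any entry there is nothing to bound. *)
  have [m m0 hm] : exists2 m : R, 0 <= m &
      forall n i l, abs_moment P (2 * k.+1.*2) (fun w => Z n w i l) = m%:E.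
    have [[n0 [i0 [j0 _]]]|none] := pselect (exists n0 (i0 : 'I_(N n0)) (j0 : 'I_n0), True).
      exists (fine (abs_moment P (2 * k.+1.*2) (fun w => Z n0 w i0 j0))); first exact: fine_ge0.
      move=> n i l; rewrite fineK; first exact: same_law_abs_moment.
      by rewrite ge0_fin_numE.
    exists 0 => // n i l; exfalso; apply: none; by exists n, i, l.
  have kap0 : 0 <= 4 ^+ k.+1 * (m + 1) by rewrite mulr_ge0 ?exprn_ge0 // addr_ge0.
  apply: (ratio_off_rare hpsd spk hr hN hC hCbnd hnuC hnuC0 hZrv hZindep k1 kap0) => // n i l.
  exact: entry_moments.
split=> [|gauss] [//|j] _.
  apply: cvg_in_prob_off_rare => [n|e e0]; first exact: mr.
  by apply: main => // n i l; exact: hZ4.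
apply: cvg_as_off_rare => [n|e e0]; first exact: mr.
apply: main => // n i l; apply: gaussian_abs_moment8 => //.
by case: gauss => h; [left|right]; exact: h.
Qed.
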